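(* Let $n\ge 1$, let $L$ be an oriented link with $n$ components numbered $L_1,\dots,L_n$, and let $S=(s_{ij})$ and $T=(t_{ij})$ be symmetric $n\times n$ matrices with all entries in $\{-1,0,+1\}$ such that $t_{ij}=0$ if and only if $s_{ij}=0$. Let $\epsilon,\delta\in\{+1,-1\}$. (1) On diagrams of $L$, the link diagram invariant ${}_{\epsilon,+1}iu_{S,T}$ (resp. ${}_{\epsilon,-1}iu_{S,T}$) increases by $2\epsilon$ under an RI move creating a positive (resp. negative) crossing, and decreases by $\epsilon$ under an RI move creating a negative (resp. positive) crossing. Moreover ${}_{\epsilon,\delta}iu_{S,T}$ changes at most by $2$ under an RII or RIII move. (2) Let $D_1$ and $D_2$ be link diagrams of the same oriented link $L$. Then at least $\lceil |{}_{\epsilon,\delta}iu_{S,T}(D_1)-{}_{\epsilon,\delta}iu_{S,T}(D_2)|/2\rceil$ Reidemeister moves are needed to deform $D_1$ to $D_2$. In particular, when $D_2$ is a link diagram with $\mathcal{C}(D_2)\cup\check{\mathcal{C}}(D_2)=\emptyset$, at least $\lceil |{}_{\epsilon,\delta}iu_{S,T}(D_1)|/2\rceil$ Reidemeister moves are needed.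
   Context: A knot is regarded as a link with one component. Link diagrams lie in the $2$-sphere; links and diagrams are oriented unless otherwise specified. RI, RII, RIII denote the Reidemeister moves of types I, II, III: an RI (resp. RII) move creates or deletes a monogon (resp. bigon) face, and an RIII move is performed on a $3$-gon face, deleting it and creating a new one. $\lceil x\rceil$ is the smallest integer larger than or equal to $x$. Smoothings: at a crossing $x$ of an oriented diagram $D$, cut the link at the two preimage points of $x$, and paste the four short subarcs near the resulting endpoints in a way other than the original one. If the pasting connects orientations consistently this is the (regular) smoothing, and $D_x$ denotes the link represented by the resulting diagram. If the pasting connects orientations inconsistently this is the irregular smoothing, and $\check{D_x}$ denotes the unoriented link represented by the resulting diagram. Unknotting number: for an $m$-component link $K$, $u(K)$ is the minimum number of crossing changes in a sequence of Reidemeister moves and crossing changes (allowed at any crossing, between the same or distinct components) deforming a diagram of $K$ into a (possibly non-trivial) diagram of the trivial $m$-component link (the $m$-component link bounding a disjoint union of $m$ disks). Invariant $iu_{S,T}$: for $L$, $S$, $T$ as in the claim and $D$ a diagram of $L$, let $\mathcal{C}(D)$ (resp. $\check{\mathcal{C}}(D)$) be the set of all crossings of $D$ between subarcs of components $L_i$ and $L_j$ (possibly $i=j$) with $s_{ij}=+1$ (resp. $s_{ij}=-1$). For a crossing $x$ between a subarc of $L_i$ and a subarc of $L_j$ put $t(x)=t_{ij}$, and let $\mathrm{sign}(x)\in\{\pm1\}$ be the usual sign of the crossing. Then $$iu_{S,T}(D)=\sum_{x\in\mathcal{C}(D)}t(x)\,\mathrm{sign}(x)\,|u(D_x)-u(L)|+\sum_{x\in\check{\mathcal{C}}(D)}t(x)\,\mathrm{sign}(x)\,|u(\check{D_x})-u(L)|,$$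 with value $0$ for a diagram with no crossings. Modified invariant: for $\epsilon,\delta\in\{\pm1\}$, $${}_{\epsilon,\delta}iu_{S,T}(D)=iu_{S,T}(D)+\epsilon\left(\tfrac12 c(D)+\delta\,\tfrac32 w(D)\right),$$ where $c(D)$ is the number of crossings of $D$ and $w(D)$ is the writhe, i.e. the sum of the signs of all crossings of $D$.
   Formalization: The last sentence of (2) is stated with the extra assumption c(D_2)/2 + δ(3/2)w(D_2) = 0 (automatic if no s_ij is 0); without it the sentence fails, e.g. for n=1, S=T=(0), D_1=D_2 a one-crossing unknot diagram whose crossing has sign δ. *)

(* Defs.v *)
From Stdlib Require Import Relations.
From mathcomp Require Import all_boot all_order all_algebra all_fingroup boolp.

Set Implicit Arguments.
Unset Strict Implicit.
Unset Printing Implicit Defensive.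

Import Order.TTheory GRing.Theory Num.Theory.

(* Link diagrams on the oriented 2-sphere are encoded as combinatorial maps.
   The diagram is cut into edges by its crossings (4-valent vertices) and by
   auxiliary 2-valent vertices, which carry no information: they may be added
   to or removed from any arc (see [subdivides]), and they make it possible to
   represent crossingless circles.  A dart is an edge with a chosen end, seen
   as leaving the vertex at that end.
   - [edge d] is the same edge seen from its other end;
   - [turn d] is the next dart counterclockwise around the vertex of d;
   - [over d] says whether d lies on the over strand; it is only meaningful
     when d is at a crossing;
   - [region d e] says that the regions of the sphere on the left of d and on
     the left of e coincide.  This is data, not a consequence of the rest:
     when the diagram is disconnected a region has several boundary walks. *)
Record udiagram := UDiagram {
  dart : finType;
  edge : {perm dart};
  turn : {perm dart};
  over : dart -> bool;
  region : rel dart }.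

Arguments edge : clear implicits.
Arguments turn : clear implicits.
Arguments over : clear implicits.
Arguments region : clear implicits.

Section Maps.
Variable D : udiagram.
Implicit Types d e a : dart D.

Definition crossing d : bool := turn D (turn D d) != d.

(* Going straight ahead through the vertex of d. *)
Definition across d : dart D :=
  if crossing d then turn D (turn D d) else turn D d.

(* Walk along d, then along the next edge of the same boundary walk, keeping
   the region on the left. *)
Definition face : {perm dart D} := (edge D * (turn D)^-1)%g.

Definition n_map_components : nat :=
  n_comp [rel d e | (e == edge D d) || (e == turn D d)] (dart D).

Definition n_regions : nat := n_comp (region D) (dart D).

(* The first condition is Euler's formula V - E + B = 2C, where B is the number
   of boundary walks: every connected component of the map has genus 0.  The
   last two say that the graph whose vertices are the components and the
   regions, with an edge for each boundary walk, is a tree, i.e., that gluing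
   the components along the regions gives a sphere. *)
Definition spherical : Prop :=
  [/\ (#|porbits (turn D)| + #|porbits face|
         = #|porbits (edge D)| + n_map_components.*2)%N,
      (#|porbits face| + 1 = n_map_components + n_regions)%N
    & forall d e,
        connect [rel x y | [|| y == edge D x, y == turn D x | region D x y]]
          d e].

Definition udiagram_axiom : Prop :=
  [/\ forall d, edge D (edge D d) = d /\ edge D d != d,
      forall d, turn D (turn D (turn D (turn D d))) = d /\ turn D d != d,
      forall d, crossing d -> over D (turn D d) = ~~ over D d,
      equivalence_rel (region D) /\ (forall d, region D d (face d))
    & spherical].

(* Cut the vertex of a and paste a to [turn a], and the other two darts to one
   another.  The regions in the two corners next to the corner (a, turn a) get
   connected. *)
Definition smooth a : udiagram :=
  let b := turn D a in
  let c := turn D (turn D (turn D a)) in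
  {| dart := dart D;
     edge := edge D;
     turn := (turn D * tperm a (turn D (turn D a)))%g;
     over := over D;
     region := fun d e => [|| region D d e,
                              region D d b && region D c e
                            | region D d c && region D b e] |}.

Definition change_crossing a : udiagram :=
  {| dart := dart D;
     edge := edge D;
     turn := turn D;
     over := fun d => (d \in porbit (turn D) a) (+) over D d;
     region := region D |}.

(* The boundary walk of a is the whole boundary of its region. *)
Definition disk_face a : Prop := forall d, region D a d -> d \in porbit face a.

Definition monogon a : Prop :=
  [/\ crossing a, face a = a & disk_face a].

(* A bigon between two distinct crossings, with one side over at both ends. *)
Definition bigon a : Prop :=
  [/\ crossing a /\ crossing (face a),
      face a \notin porbit (turn D) a,
      face (face a) = a,
      over D a = over D (edge D a)
    & disk_face a].

(* A 3-gon between three distinct crossings, with a top, a middle and a bottom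
   side: the excluded case is the one in which each side is over at exactly
   one end. *)
Definition triangle a : Prop :=
  let b := face a in let c := face b in
  [/\ [/\ crossing a, crossing b & crossing c],
      [/\ b \notin porbit (turn D) a, c \notin porbit (turn D) b
        & a \notin porbit (turn D) c],
      face c = a,
      ~~ ((over D a == over D b) && (over D b == over D c))
    & disk_face a].

(* Exchange the two crossings met by the strand through the edge of a, while
   the edges of that strand stay in place. *)
Definition swap_ends a : {perm dart D} :=
  (tperm (across a) (edge D a) * tperm a (across (edge D a)))%g.

(* The result of an RIII move on the 3-gon of a.  The new 3-gon lies on the
   other side of the same three edges, and the old side of each of these edges
   now faces the region that was in the corner opposite to the 3-gon at the
   crossing not on that edge; [old d] is a dart of D on the left of which one
   finds the region which is on the left of d after the move. *)
Definition slide_triangle a : udiagram :=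
  let t := (swap_ends a * swap_ends (face a) * swap_ends (face (face a)))%g in
  let old d :=
    if d \in porbit face a then across (face (face d))
    else if edge D d \in porbit face a then edge D d
    else d in
  {| dart := dart D;
     edge := edge D;
     turn := (turn D ^ t)%g;
     over := fun d => over D (t d);
     region := fun d e => region D (old d) (old e) |}.

End Maps.

(* Orientation-preserving homeomorphisms of the sphere. *)
Definition isomorphism (D E : udiagram) (f : dart D -> dart E) : Prop :=
  [/\ bijective f,
      forall d, f (edge D d) = edge E (f d),
      forall d, f (turn D d) = turn E (f d),
      forall d, crossing d -> over E (f d) = over D d
    & forall d e, region E (f d) (f e) = region D d e].

(* E is obtained from D by adding a single 2-valent vertex, with darts a and
   [turn a], in the interior of an edge of D. *)
Definition subdivides (D E : udiagram) (f : dart D -> dart E) : Prop :=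
  exists a : dart E,
  let b := turn E a in
  [/\ [/\ ~~ crossing a, edge E a != b, injective f
        & forall x, (x \in codom f) = (x \notin [:: a; b])],
      forall d, f (edge D d) =
        (let x := edge E (f d) in
         if x == a then edge E b else if x == b then edge E a else x),
      forall d, f (turn D d) = turn E (f d),
      forall d, crossing d -> over E (f d) = over D d
    & forall d e, region E (f d) (f e) = region D d e].

(* A Reidemeister move read in the direction in which it deletes the given
   face; the face is given by a dart having it on its left.  Deleting a kink
   (resp. separating the two sides of a bigon) yields the same curve as pasting
   across the crossing(s) so as to connect the face with the opposite
   corner(s), except that the edges of the face may be traversed in the other
   direction (resp. belong to the other strand). *)
Inductive site (D : udiagram) : Type :=
  | Monogon of dart D
  | Bigon of dart D
  | Triangle of dart D.

Inductive move_type := RI | RII | RIII.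

Definition site_type (D : udiagram) (s : site D) : move_type :=
  match s with Monogon _ => RI | Bigon _ => RII | Triangle _ => RIII end.

Definition site_axiom (D : udiagram) (s : site D) : Prop :=
  match s with
  | Monogon a => monogon a
  | Bigon a => bigon a
  | Triangle a => triangle a
  end.

Definition delete_site (D : udiagram) (s : site D) : udiagram :=
  match s with
  | Monogon a => smooth (turn D a)
  | Bigon a => @smooth (smooth (turn D a)) (turn D (face D a))
  | Triangle a => slide_triangle a
  end.

Definition delete_site_dart (D : udiagram) (s : site D) :
    dart D -> dart (delete_site s) :=
  match s with Monogon _ => id | Bigon _ => id | Triangle _ => id end.

(* The darts whose orientation and component may be altered by the move. *)
Definition site_edges (D : udiagram) (s : site D) : {set dart D} :=
  match s with
  | Monogon a => [set a; edge D a]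
  | Bigon a => [set a; edge D a; face D a; edge D (face D a)]
  | Triangle _ => set0
  end.

(* [steps free paid k x y]: one can go from x to y by a sequence of steps of
   which exactly k are paid. *)
Inductive steps (X : Type) (free paid : X -> X -> Prop) : nat -> X -> X -> Prop :=
  | steps_nil x : steps free paid 0 x x
  | steps_free k x y z :
      steps free paid k x y -> free y z -> steps free paid k x z
  | steps_paid k x y z :
      steps free paid k x y -> paid y z -> steps free paid k.+1 x z.

(* The unknotting number does not depend on orientations. *)
Section UnknottingNumber.
Implicit Types D E : udiagram.

Definition u_isotopy1 D E : Prop :=
  [/\ udiagram_axiom D, udiagram_axiom E
    & exists f : dart D -> dart E, isomorphism f \/ subdivides f].

Definition u_delete1 D E : Prop :=
  [/\ udiagram_axiom D, udiagram_axiom E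
    & exists2 s : site D, site_axiom s
        & exists f : dart (delete_site s) -> dart E, isomorphism f].

(* Isotopies of the sphere and Reidemeister moves. *)
Definition u_deform1 D E : Prop :=
  (u_isotopy1 D E \/ u_isotopy1 E D) \/ (u_delete1 D E \/ u_delete1 E D).

Definition u_crossing_change D E : Prop :=
  [/\ udiagram_axiom D, udiagram_axiom E
    & exists2 a : dart D, crossing a
        & exists f : dart (change_crossing a) -> dart E, isomorphism f].

Definition crossingless D : Prop := forall d : dart D, ~~ crossing d.

(* A diagram, possibly with crossings, of a trivial link. *)
Definition trivial_link D : Prop :=
  exists E, [/\ udiagram_axiom E, crossingless E
              & clos_refl_trans _ u_deform1 D E].

(* Neither Reidemeister moves nor crossing changes alter the number m of
   components, so that E below is a diagram of the trivial m-component link. *)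
Definition unlinkable (k : nat) D : Prop :=
  exists2 E, steps u_deform1 u_crossing_change k D E & trivial_link E.

(* The minimal k such that [unlinkable k D]. *)
Definition unknotting_number D : nat :=
  if pselect (exists k, `[< unlinkable k D >]) is left h then ex_minn h else 0.

End UnknottingNumber.

(* Oriented diagrams with components numbered by 'I_n: [outgoing d] says that
   the orientation leaves the vertex of d along d. *)
Record ldiagram (n : nat) := LDiagram {
  shape :> udiagram;
  outgoing : dart shape -> bool;
  label : dart shape -> 'I_n }.

Definition link_diagram (n : nat) (D : ldiagram n) : Prop :=
  [/\ udiagram_axiom D,
      forall d : dart D, outgoing (edge D d) = ~~ outgoing d
                      /\ outgoing (across d) = ~~ outgoing d,
      forall d e : dart D, (label d == label e) =
        connect [rel x y | (y == edge D x) || (y == across x)] d e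
    & forall i : 'I_n, exists d : dart D, label d = i].

Definition preserves_labels_off (n : nat) (D E : ldiagram n)
    (A : {set dart D}) (f : dart D -> dart E) : Prop :=
  forall d, d \notin A -> outgoing (f d) = outgoing d /\ label (f d) = label d.

Section Moves.
Variable n : nat.
Implicit Types D E : ldiagram n.

Definition isotopy1 D E : Prop :=
  [/\ link_diagram D, link_diagram E
    & exists2 f : dart D -> dart E, isomorphism f \/ subdivides f
        & preserves_labels_off set0 f].

Definition isotopic : ldiagram n -> ldiagram n -> Prop :=
  clos_refl_sym_trans _ isotopy1.

Definition deletes D (s : site D) E : Prop :=
  [/\ link_diagram D, link_diagram E, site_axiom s
    & exists2 f : dart (delete_site s) -> dart E, isomorphism f
        & preserves_labels_off (site_edges s) (f \o @delete_site_dart D s)].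

Definition move (m : move_type) D E : Prop :=
  exists D0 E0, [/\ isotopic D D0, isotopic E E0
    & (exists2 s : site D0, site_type s = m & deletes s E0)
      \/ (exists2 s : site E0, site_type s = m & deletes s D0)].

(* Sign of the crossing of d.  If d is the outgoing over dart, the crossing is
   positive when the next dart counterclockwise is outgoing; the formula is
   invariant under [turn]. *)
Definition positive D (d : dart D) : bool :=
  over D d == (outgoing d == outgoing (turn D d)).

Definition RI_creating (pos : bool) D E : Prop :=
  exists D0 E0, [/\ isotopic D D0, isotopic E E0
    & exists2 a : dart E0, positive a = pos & deletes (Monogon a) D0].

(* E is obtained from D by k Reidemeister moves. *)
Definition deform (k : nat) D E : Prop :=
  steps isotopic (fun D E => exists m, move m D E) k D E.

(* An oriented link with n numbered components is given by any one of its
   diagrams: two diagrams represent the same link if and only if they are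
   related by Reidemeister moves. *)
Definition diagram_of (L D : ldiagram n) : Prop := exists k, deform k L D.

End Moves.

Section Invariant.
Local Open Scope ring_scope.
Variable n : nat.
Implicit Types (D L : ldiagram n) (S T : 'M[int]_n).

(* Each crossing is represented by its outgoing over dart. *)
Definition crossings D : {set dart D} :=
  [set d | [&& crossing d, over D d & outgoing d]].

Definition sign D (d : dart D) : int := if positive d then 1 else -1.

(* The entry of a symmetric matrix at the two components crossing at d. *)
Definition entry D S (d : dart D) : int := S (label d) (label (turn D d)).

Definition regular_crossings S D : {set dart D} :=
  [set d in crossings D | entry S d == 1].

Definition irregular_crossings S D : {set dart D} :=
  [set d in crossings D | entry S d == -1].

(* [smooth a] pastes a to [turn a]; it is consistent with the orientation when
   exactly one of these darts is outgoing. *)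
Definition regular_smoothing D (d : dart D) : udiagram :=
  if outgoing d == outgoing (turn D d) then smooth (turn D d) else smooth d.

Definition irregular_smoothing D (d : dart D) : udiagram :=
  if outgoing d == outgoing (turn D d) then smooth d else smooth (turn D d).

Definition u_dist (E1 E2 : udiagram) : int :=
  `|(unknotting_number E1)%:Z - (unknotting_number E2)%:Z|.

Definition iu L S T D : int :=
  \sum_(d in regular_crossings S D)
     entry T d * sign d * u_dist (regular_smoothing d) L
  + \sum_(d in irregular_crossings S D)
     entry T d * sign d * u_dist (irregular_smoothing d) L.

Definition crossing_number D : nat := #|crossings D|.

Definition writhe D : int := \sum_(d in crossings D) sign d.

Definition correction (delta : int) D : rat :=
  1 / 2 * (crossing_number D)%:R + delta%:~R * (3 / 2) * (writhe D)%:~R.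

Definition modified_iu (eps delta : int) L S T D : rat :=
  (iu L S T D)%:~R + eps%:~R * correction delta D.

End Invariant.

(* Main.v *)
(* Write the modified invariant as a sum over the crossings.  Under
   an RII or RIII move the crossings away from the site keep their smoothings,
   up to Reidemeister moves, and the two crossings of an RII bigon contribute
   terms of opposite signs, whose smoothings differ by at most one crossing
   change; their corrections add up to eps.  In an RIII move, exactly one of the
   three crossings has a smoothing that changes by something other than
   Reidemeister moves, namely by at most two crossing changes.  The smoothings at
   a kink are the original link and its union with a split circle, so the kink
   itself only contributes its correction, provided that adding a split circle does not
   change the unknotting number.  To prove this, we show that a sequence of moves
   and crossing changes can be followed on a diagram from which some components
   are deleted, and on a diagram to which a small circle is added; the circle can
   be carried to another region of the diagram when its own region is needed.

   Sphericity is used in the following form: the antisymmetric functions on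
   darts that sum up to 0 around each vertex are the differences of the values of
   a function on regions across the edges.  Unlike Euler's formula, this is
   directly inherited by smoothings, deletions and additions of components. *)
Require Import Defs.
From mathcomp Require Import all_boot all_order all_algebra.
From mathcomp Require Import perm fingraph boolp zify ring lra.
Import Defs.

Set Implicit Arguments.
Unset Strict Implicit.
Unset Printing Implicit Defensive.

Import Order.TTheory GRing.Theory Num.Theory.
Local Open Scope ring_scope.

(** The obstacle is the region data. A disconnected diagram has regions with several boundary walks,
    and following Euler's formula through a local change would require knowing how many components,
    walks and regions are merged. The same argument shows that a bijection of darts compatible with
    edges and turns that maps regions into regions separates them too, so one inclusion between
    region relations suffices. Smoothings and deletions leave 2-valent vertices behind, so diagrams
    are compared only up to [near k]; a comparison amounts to matching finitely many darts at the
    site, which is tested by evaluating tables. Origin of the bound 2 for RIII: when one crossing of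
    the triangle is opened, the slide makes the other two trade places along the opposite side.
    Their over and under data match exactly when that side is the top or the bottom one; for the
    middle side both crossings must be changed. With the other smoothing, that side has to be pulled
    off the smoothed crossing before and after the slide, at one change each. *)

Section InvariantFunctions.
Variable T : finType.
Implicit Types (r : rel T).

Definition row_of (f : T -> rat) : 'rV[rat]_#|T| := \row_i f (enum_val i).

(** Each row is the indicator function of a component of [r], so the row space consists of the
    functions that are constant on components. *)
Definition class_mx r : 'M[rat]_#|T| :=
  \matrix_(i, j) (connect r (enum_val i) (enum_val j))%:R.

Lemma connect_invariant (S : Type) r (f : T -> S) :
  (forall x y, r x y -> f x = f y) -> forall x y, connect r x y -> f x = f y.
Proof.
move=> fr x y /connectP[p]; elim: p x => [|z p IH] x /=; first by move=> _ ->.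
by case/andP=> rxz pz ey; rewrite (fr _ _ rxz) (IH z).
Qed.

Lemma row_of_class_mxP r (f : T -> rat) : connect_sym r ->
  (row_of f <= class_mx r)%MS <-> (forall x y, r x y -> f x = f y).
Proof.
move=> symr; split=> [/submxP[w ew] x y rxy | fr].
  have eval z : f z = (w *m class_mx r) 0 (enum_rank z).
    by rewrite -ew mxE enum_rankK.
  rewrite !eval !mxE; apply: eq_bigr => k _; rewrite !mxE !enum_rankK.
  by rewrite (same_connect_r symr (connect1 rxy)).
(* Each component is counted once, through its root, with the value of [f] there. *)
apply/submxP; exists (\row_i if roots r (enum_val i) then f (enum_val i) else 0).
apply/rowP=> j; rewrite !mxE; set y := enum_val j.
rewrite (bigD1 (enum_rank (root r y))) //= !mxE enum_rankK roots_root //.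
rewrite symr connect_root mulr1 big1 ?addr0 => [|i ne_i].
  exact: connect_invariant (connect_root r y).
rewrite !mxE; case: ifP => [ri|_]; last by rewrite mul0r.
case: connectP => [/connectP c|_]; last by rewrite mulr0.
case/negP: ne_i; rewrite -(can_eq enum_valK) enum_rankK -(eqP ri).
by rewrite (rootP symr c).
Qed.

(** The rows at the roots are free, since two distinct roots are never connected, and every other
    row repeats that of its root. *)
Lemma rank_class_mx r : connect_sym r -> \rank (class_mx r) = n_comp r T.
Proof.
move=> symr.
pose g (i : 'I_#|predI (roots r) (mem T)|) := enum_rank (enum_val i).
have rootg i : roots r (enum_val (g i)).
  by rewrite /g enum_rankK; have := enum_valP i; rewrite inE => /andP[].
have inj_g : injective g by move=> i j /enum_rank_inj/enum_val_inj.
have free : row_free (rowsub g (class_mx r)).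
  apply/row_freeP; exists (\matrix_(i, j) (i == g j)%:R).
  apply/matrixP=> i j; rewrite !mxE (bigD1 (g j)) //= !mxE eqxx mulr1.
  rewrite big1 ?addr0 => [|k /negbTE nk]; last by rewrite !mxE nk mulr0.
  rewrite -(root_connect symr) (eqP (rootg i)) (eqP (rootg j)).
  by rewrite (can_eq enum_valK) (inj_eq inj_g).
have -> : \rank (class_mx r) = \rank (rowsub g (class_mx r)).
  apply/eqP; rewrite eqn_leq; apply/andP; split; apply: mxrankS; last first.
    by apply/row_subP => i; rewrite row_rowsub row_sub.
  apply/row_subP=> i; set x := enum_val i.
  have rx : root r x \in predI (roots r) (mem T) by rewrite inE /= roots_root.
  have <- : row (enum_rank_in rx (root r x)) (rowsub g (class_mx r))
             = row i (class_mx r).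
    apply/rowP=> j; rewrite !mxE /g enum_rankK enum_rankK_in //.
    by rewrite -(same_connect symr (connect_root r x)).
  exact: row_sub.
by rewrite (eqP free) /n_comp_mem.
Qed.

End InvariantFunctions.

(** * Euler's formula as exactness *)

Section EulerFormula.
Variables (T : finType) (e t : {perm T}).
Hypotheses (eK : forall x, e (e x) = x) (e_neq : forall x, e x != x).
Hypothesis t4 : forall x, t (t (t (t x))) = x.
Implicit Types (f : T -> rat) (r : rel T).

Definition pull_mx (g : T -> T) : 'M[rat]_#|T| :=
  \matrix_(i, j) (enum_val i == g (enum_val j))%:R.

Lemma row_of_pull g f : row_of f *m pull_mx g = row_of (f \o g).
Proof.
apply/rowP=> j; rewrite !mxE (bigD1 (enum_rank (g (enum_val j)))) //=.
rewrite !mxE enum_rankK eqxx mulr1 big1 ?addr0 // => i ne_i.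
rewrite !mxE -(can_eq enum_rankK) enum_valK (negbTE ne_i) mulr0 //.
Qed.

Lemma row_ofE (v : 'rV[rat]_#|T|) : v = row_of (fun x => v 0 (enum_rank x)).
Proof. by apply/rowP=> j; rewrite mxE enum_valK. Qed.

Lemma row_of_eq0 f : row_of f = 0 <-> (forall x, f x = 0).
Proof.
split=> [f0 x | f0]; last by apply/rowP=> j; rewrite !mxE.
by move/rowP/(_ (enum_rank x)): f0; rewrite !mxE enum_rankK.
Qed.

(** [bd_mx] antisymmetrizes along edges and [star_mx] sums over four successive turns. At a 2-valent
    vertex each dart is thus counted twice, which over the rationals changes neither the kernel nor
    the image. *)
Definition bd_mx := pull_mx id - pull_mx e.
Definition star_mx :=
  pull_mx id + pull_mx t + pull_mx (t \o t) + pull_mx (t \o t \o t).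

Lemma row_of_bd f : row_of f *m bd_mx = row_of (fun x => f x - f (e x)).
Proof. by rewrite mulmxBr !row_of_pull; apply/rowP=> j; rewrite !mxE. Qed.

Lemma row_of_star f : row_of f *m star_mx =
  row_of (fun x => f x + f (t x) + f (t (t x)) + f (t (t (t x)))).
Proof. by rewrite !mulmxDr !row_of_pull; apply/rowP=> j; rewrite !mxE. Qed.

Lemma trmx_pull g g' : cancel g g' -> cancel g' g -> (pull_mx g)^T = pull_mx g'.
Proof.
move=> gK g'K; apply/matrixP=> i j; rewrite !mxE.
by rewrite eq_sym (can2_eq gK g'K).
Qed.

Lemma trmx_bd : bd_mx^T = bd_mx.
Proof. by rewrite linearB /= (@trmx_pull id id) // (trmx_pull eK eK). Qed.

Lemma trmx_star : star_mx^T = star_mx.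
Proof.
rewrite !linearD /= (@trmx_pull id id) // (@trmx_pull t (t \o t \o t)) //=;
  try by move=> x /=; rewrite t4.
rewrite (@trmx_pull (t \o t) (t \o t)) //=; try by move=> x /=; rewrite t4.
rewrite (@trmx_pull (t \o t \o t) t) //=; try by move=> x /=; rewrite t4.
by rewrite -2![LHS]addrA -2![RHS]addrA; congr (pull_mx id + _); rewrite addrC -addrA addrCA.
Qed.

Definition orbit_rel (s : {perm T}) := [rel x y | y == s x].
Definition join_rel r r' := [rel x y | r x y || r' x y].

Lemma connect_sym_perm (s : {perm T}) : connect_sym (orbit_rel s).
Proof.
have inj_s : injective s by exact: perm_inj.
have eqs : connect (orbit_rel s) =2 fconnect s.
  by apply: eq_connect => x y /=; rewrite eq_sym.
by move=> x y; rewrite !eqs fconnect_sym.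
Qed.

Lemma connect_sym_join r r' :
  connect_sym r -> connect_sym r' -> connect_sym (join_rel r r').
Proof.
move=> sr sr'.
suff imp x y : connect (join_rel r r') x y -> connect (join_rel r r') y x.
  by move=> x y; apply/idP/idP; apply: imp.
case/connectP=> p; elim: p x => [|z p IH] x /=; first by move=> _ ->.
case/andP=> rxz pz ey; apply: connect_trans (IH z pz ey) _.
case/orP: rxz => rxz.
  have: connect r z x by rewrite sr connect1.
  by apply: connect_sub => u v ruv; rewrite connect1 //= ruv.
have: connect r' z x by rewrite sr' connect1.
by apply: connect_sub => u v ruv; rewrite connect1 //= ruv orbT.
Qed.

Lemma card_porbits (s : {perm T}) : #|porbits s| = n_comp (orbit_rel s) T.
Proof.
have symr := connect_sym_perm s.
have porbitE x y : (porbit s x == porbit s y) = connect (orbit_rel s) x y.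
  rewrite eq_porbit_mem porbit_sym; apply/porbitP/idP=> [[i ->]|].
    elim: i => [|i IH]; first by rewrite expg0 perm1.
    by rewrite expgSr permM (connect_trans IH) // connect1 /=.
  case/connectP=> p; elim: p x => [|z p IH] x /=; first by exists 0%N; rewrite expg0 perm1.
  case/andP=> /eqP-> pz ey; case: (IH _ pz ey) => i ->.
  by exists i.+1; rewrite expgS permM.
rewrite /n_comp_mem -(card_in_imset (f := porbit s)); last first.
  move=> x y; rewrite !inE /= !andbT => /eqP rx /eqP ry /eqP.
  by rewrite porbitE => /(rootP symr); rewrite rx ry.
apply: eq_card => X; apply/imsetP/imsetP=> -[x _ ->]; last by exists x.
exists (root (orbit_rel s) x); first by rewrite !inE /= roots_root.
by apply/eqP; rewrite porbitE connect_root.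
Qed.

Lemma card_edges : #|T| = (#|porbits e|).*2.
Proof.
rewrite -cardsT -muln2; apply: card_uniform_partition; last first.
  suff -> : porbits e = preim_partition (porbit e) setT by apply: preim_partitionP.
  rewrite /porbits /preim_partition /equivalence_partition.
  have eqc : porbit e =1 fun x => [set y in [set: T] | porbit e x == porbit e y].
    by move=> x; apply/setP=> y; rewrite !inE eq_porbit_mem porbit_sym.
  rewrite (eq_imset _ eqc); apply/setP=> X.
  by apply/imsetP/imsetP=> -[x _ ->]; exists x.
move=> _ /imsetP[x _ ->].
suff -> : porbit e x = [set x; e x] by rewrite cards2 eq_sym e_neq.
apply/setP=> y; rewrite !inE; apply/porbitP/orP => [[i ->]|[]/eqP->].
- elim: i => [|i [/eqP IH|/eqP IH]]; first by left; rewrite expg0 perm1.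
  + by right; rewrite expgSr permM IH.
  + by left; rewrite expgSr permM IH eK.
- by exists 0%N; rewrite expg0 perm1.
- by exists 1%N; rewrite expg1.
Qed.

Lemma row_of_sub_orbits (s : {perm T}) f :
  (row_of f <= class_mx (orbit_rel s))%MS <-> (forall x, f (s x) = f x).
Proof.
rewrite row_of_class_mxP; last exact: connect_sym_perm.
by split=> fs x => [|y /= /eqP ->]; rewrite ?(fs x (s x)) /=.
Qed.

Lemma eqmx_row_of n1 n2 (M1 : 'M[rat]_(n1, #|T|)) (M2 : 'M[rat]_(n2, #|T|)) :
  (forall f, (row_of f <= M1)%MS <-> (row_of f <= M2)%MS) -> (M1 :=: M2)%MS.
Proof.
move=> eM; apply/eqmxP/andP; split; apply/row_subP=> i; rewrite (row_ofE (row i _)).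
  by apply/eM; rewrite -row_ofE row_sub.
by apply/eM; rewrite -row_ofE row_sub.
Qed.

Lemma star_orbits : (star_mx :=: class_mx (orbit_rel t))%MS.
Proof.
apply: eqmx_row_of => f; rewrite row_of_sub_orbits; split.
  case/submxP=> w; rewrite [w]row_ofE row_of_star => /rowP ef x.
  have evf z := ef (enum_rank z).
  move: (evf x) (evf (t x)); rewrite !mxE !enum_rankK t4 => -> ->; ring.
(* A function constant on orbits is the star of its quarter. *)
move=> ft; have -> : row_of f = row_of (fun x => f x / 4) *m star_mx.
  rewrite row_of_star; apply/rowP=> i; rewrite !mxE !ft; lra.
exact: submxMl.
Qed.

Lemma row_of_kermx_bd f :
  (row_of f <= kermx bd_mx)%MS <-> (forall x, f (e x) = f x).
Proof.
rewrite (sameP sub_kermxP eqP) row_of_bd; split=> [/eqP/row_of_eq0 fe x|fe].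
  by apply/esym/eqP; rewrite -subr_eq0 fe.
by apply/eqP/row_of_eq0=> x; rewrite fe subrr.
Qed.

(** The kernel is the space of functions constant on edges. An edge has exactly two darts, so kernel
    and image share the dimension equally. *)
Lemma rank_bd : \rank bd_mx = #|porbits e|.
Proof.
have := mxrank_ker bd_mx.
have -> : \rank (kermx bd_mx) = #|porbits e|; last first.
  by have := rank_leq_row bd_mx; have := card_edges; lia.
rewrite card_porbits -rank_class_mx; last exact: connect_sym_perm.
apply: eqmx_rank; apply/eqmxP/eqmx_row_of => f.
by rewrite row_of_kermx_bd row_of_sub_orbits.
Qed.

Lemma class_mx_cap_bd r : connect_sym r ->
  (class_mx r :&: kermx bd_mx :=: class_mx (join_rel (orbit_rel e) r))%MS.
Proof.
move=> sr; apply: eqmx_row_of => f; rewrite sub_capmx.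
rewrite row_of_class_mxP; last exact/connect_sym_join/sr/connect_sym_perm.
split=> [/andP[/row_of_class_mxP fr /row_of_kermx_bd fe] x y /=|fer].
  by case/orP=> [/eqP->|/fr->//].
apply/andP; split; last first.
  by apply/row_of_kermx_bd=> x; rewrite (fer x (e x)) //= eqxx.
by apply/row_of_class_mxP=> // x y rxy; apply: fer; rewrite /= rxy orbT.
Qed.

(** Rational 1-chains: the value at a dart is the amount leaving along it. A closed flow is a cycle,
    and [cycle_mx] spans the space of cycles. *)
Definition flow f := forall x, f (e x) = - f x.
Definition closed_flow f :=
  flow f /\ forall x, f x + f (t x) + f (t (t x)) + f (t (t (t x))) = 0.
Definition cycle_mx := (bd_mx :&: kermx star_mx)%MS.

Lemma cycle_mxP f : (row_of f <= cycle_mx)%MS <-> closed_flow f.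
Proof.
rewrite sub_capmx; split=> [/andP[/submxP[w ew] /sub_kermxP]|[fl st]].
  rewrite row_of_star => /row_of_eq0 st; split=> // x.
  rewrite [w]row_ofE row_of_bd in ew.
  have evf z := congr1 (fun m : 'rV_#|T| => m 0 (enum_rank z)) ew.
  by move: (evf x) (evf (e x)); rewrite !mxE !enum_rankK eK => -> ->; ring.
apply/andP; split; last by apply/sub_kermxP; rewrite row_of_star; apply/row_of_eq0.
have -> : row_of f = row_of (fun x => f x / 2) *m bd_mx.
  by rewrite row_of_bd; apply/rowP=> i; rewrite !mxE fl; lra.
exact: submxMl.
Qed.

Definition map_rel := join_rel (orbit_rel e) (orbit_rel t).

(** The dimension E - V + C of the cycle space. Both matrices are symmetric, so their products in
    the two orders are transposes of each other and have the same rank. Comparing the kernels gives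
    the formula, because a function constant on edges and on vertices is constant on components. *)
Lemma rank_cycle_mx :
  (\rank cycle_mx + #|porbits t| = #|porbits e| + n_comp map_rel T)%N.
Proof.
have rk_st : \rank star_mx = #|porbits t|.
  by rewrite star_orbits rank_class_mx -?card_porbits //;
     exact: connect_sym_perm.
have := mxrank_mul_ker bd_mx star_mx; rewrite rank_bd -/cycle_mx.
rewrite -(mxrank_tr (bd_mx *m star_mx)) trmx_mul trmx_bd trmx_star.
have := mxrank_mul_ker star_mx bd_mx; rewrite rk_st.
have -> : \rank (star_mx :&: kermx bd_mx) = n_comp map_rel T.
  rewrite -rank_class_mx; last exact/connect_sym_join/connect_sym_perm/connect_sym_perm.
  rewrite -class_mx_cap_bd; last exact: connect_sym_perm.
  by have [-> _] := cap_eqmx star_orbits (eqmx_refl (kermx bd_mx)).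
by move=> <- <-; rewrite addnA (addnC (\rank cycle_mx)).
Qed.

Section Regions.
Variable r : rel T.
Hypothesis sr : connect_sym r.
Hypothesis r_face : forall x, connect r (e x) ((t^-1)%g x).

Definition boundary_mx := class_mx r *m bd_mx.

Lemma rank_boundary :
  (\rank boundary_mx + n_comp (join_rel (orbit_rel e) r) T = n_comp r T)%N.
Proof.
have := mxrank_mul_ker (class_mx r) bd_mx.
rewrite (class_mx_cap_bd sr) !rank_class_mx //.
exact/connect_sym_join/sr/connect_sym_perm.
Qed.

(** The boundary of a 2-chain, in which [h] is the coefficient of the region on the left of a
    dart. *)
Definition region_boundary f :=
  exists2 h, forall x y, r x y -> h x = h y & forall x, f x = h x - h (e x).

Lemma boundary_mxP f : (row_of f <= boundary_mx)%MS <-> region_boundary f.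
Proof.
split=> [/submxP[w ew]|[h hr hf]].
  have: (w *m class_mx r <= class_mx r)%MS by apply: submxMl.
  rewrite mulmxA [w *m _]row_ofE in ew *.
  move/(row_of_class_mxP _ sr) => hr; eexists; first exact: hr.
  move: ew; rewrite row_of_bd => ew x.
  by have := congr1 (fun m : 'rV_#|T| => m 0 (enum_rank x)) ew; rewrite !mxE !enum_rankK.
have /submxP[w ew] : (row_of h <= class_mx r)%MS by apply/row_of_class_mxP.
have -> : row_of f = row_of h *m bd_mx.
  by rewrite row_of_bd; apply/rowP=> i; rewrite !mxE hf.
by rewrite ew -mulmxA submxMl.
Qed.

(** The region on the right of a dart is the one on the left of the preceding dart at the vertex, so
    the sum around the vertex telescopes. *)
Lemma boundary_closed f : region_boundary f -> closed_flow f.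
Proof.
case=> h hr hf; split=> [x|x]; first by rewrite !hf eK; ring.
have he z : h (e (t z)) = h z.
  rewrite (connect_invariant hr (r_face (t z))); congr h.
  by rewrite permK.
by have := he (t (t (t x))); rewrite t4 !hf !he => ->; ring.
Qed.

Lemma boundary_sub : (boundary_mx <= cycle_mx)%MS.
Proof.
apply/row_subP=> i; rewrite [row i _]row_ofE; apply/cycle_mxP/boundary_closed.
by apply/boundary_mxP; rewrite -row_ofE row_sub.
Qed.

Lemma euler_leq : (n_comp r T + #|porbits t| <=
  #|porbits e| + n_comp map_rel T + n_comp (join_rel (orbit_rel e) r) T)%N.
Proof.
by have := mxrankS boundary_sub; have := rank_cycle_mx; have := rank_boundary; lia.
Qed.

(** Boundaries are cycles; the gap between the two dimensions is the first Betti number, and Euler's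
    formula is its vanishing. *)
Lemma euler_exact :
  (n_comp r T + #|porbits t| = #|porbits e| + n_comp map_rel T +
     n_comp (join_rel (orbit_rel e) r) T)%N
  <-> (forall f, closed_flow f -> region_boundary f).
Proof.
have rkc := rank_cycle_mx; have rkb := rank_boundary; split=> [eul f cf | ex].
  apply/boundary_mxP; apply: submx_trans (_ : (cycle_mx <= _)%MS).
    exact/cycle_mxP.
  by rewrite -(geq_leqif (mxrank_leqif_sup boundary_sub)); lia.
suff rb : \rank boundary_mx = \rank cycle_mx by lia.
suff: (cycle_mx <= boundary_mx)%MS.
  by move=> cb; apply/eqP; rewrite eqn_leq !mxrankS // boundary_sub.
apply/row_subP=> i; rewrite [row i _]row_ofE; apply/boundary_mxP/ex.
by apply/cycle_mxP; rewrite -row_ofE row_sub.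
Qed.

End Regions.
End EulerFormula.

(** * Spherical diagrams in homological form *)

Section Equivalences.
Variables (T : Type) (r : rel T).
Hypothesis eqr : equivalence_rel r.

Lemma eqrel_refl x : r x x. Proof. exact: (eqr x x x).1. Qed.
Lemma eqrel_sym x y : r x y -> r y x.
Proof. by move=> rxy; rewrite -((eqr x y x).2 rxy) eqrel_refl. Qed.
Lemma eqrel_trans x y z : r x y -> r y z -> r x z.
Proof. by move=> rxy; rewrite ((eqr x y z).2 rxy). Qed.
End Equivalences.

Section FinEquivalences.
Variables (T : finType) (r : rel T).
Hypothesis eqr : equivalence_rel r.

Lemma eqrel_connect x y : connect r x y = r x y.
Proof.
apply/idP/idP=> [/connectP[p]|]; last exact: connect1.
elim: p x => [|z p IH] x /=; first by move=> _ ->; apply: eqrel_refl.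
by case/andP=> rxz pz ey; apply: (eqrel_trans eqr rxz (IH _ pz ey)).
Qed.
Lemma eqrel_connect_sym : connect_sym r.
Proof. by move=> x y; rewrite !eqrel_connect; apply/idP/idP; apply: eqrel_sym. Qed.
End FinEquivalences.

Lemma mk_equivalence (T : Type) (r : rel T) :
  reflexive r -> symmetric r -> transitive r -> equivalence_rel r.
Proof.
move=> rr rs rt x y z; split=> // rxy; apply/idP/idP => [rxz|]; last exact: rt.
by apply: rt rxz; rewrite rs.
Qed.

Lemma eq_n_comp_connect (T : finType) (r r' : rel T) :
  connect r =2 connect r' -> n_comp r T = n_comp r' T.
Proof. by move=> er; apply: eq_n_comp. Qed.

Lemma n_comp_connected (T : finType) (r : rel T) (x : T) :
  connect_sym r -> (forall x y, connect r x y) <-> n_comp r T = 1%N.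
Proof.
move=> sr; split=> [cr|n1 y z].
  rewrite -(n_comp_connect sr x); apply: eq_n_comp_r => y.
  by rewrite !inE cr.
have /card_le1_eqP eq_r : (#|predI (roots r) (mem T)| <= 1)%N by rewrite /n_comp_mem in n1; rewrite n1.
by apply/(rootP sr)/eq_r; rewrite inE /= roots_root.
Qed.

(** The working form of [udiagram_axiom]. Connectedness and exactness quantify over predicates and
    rational functions on darts, which can be pulled back or extended when the diagram is modified.
    [region_corner] expresses the condition on [face] without the inverse of [turn]. *)
Record good (D : udiagram) : Prop := Good {
  edgeK : forall d, edge D (edge D d) = d;
  edge_neq : forall d, edge D d != d;
  turn4 : forall d, turn D (turn D (turn D (turn D d))) = d;
  turn_neq : forall d, turn D d != d;
  over_turn : forall d, crossing d -> over D (turn D d) = ~~ over D d;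
  region_equiv : equivalence_rel (region D);
  region_corner : forall d, region D (edge D (turn D d)) d;
  good_inhabited : exists d : dart D, True;
  good_connected : forall P : pred (dart D), (forall d, P (edge D d) = P d) ->
    (forall d e, region D d e -> P d = P e) -> forall d e, P d = P e;
  good_exact : forall f : dart D -> rat, closed_flow (edge D) (turn D) f ->
    exists2 h, forall d e, region D d e -> h d = h e
             & forall d, f d = h d - h (edge D d) }.

Section GoodP.
Variable D : udiagram.
Let T := dart D.
Let e := edge D.
Let t := turn D.
Let r := region D.
Hypotheses (eK : forall x, e (e x) = x) (e_neq : forall x, e x != x).
Hypothesis t4 : forall x, t (t (t (t x))) = x.
Hypothesis eqr : equivalence_rel r.
Hypothesis rc : forall d, r (e (t d)) d.

Let sr : connect_sym r. Proof. exact: eqrel_connect_sym. Qed.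
Let r_face x : connect r (e x) ((t^-1)%g x).
Proof. by rewrite -{1}[x](permKV t) connect1 // rc. Qed.
Let se : connect_sym (orbit_rel e). Proof. exact: connect_sym_perm. Qed.
Let st : connect_sym (orbit_rel t). Proof. exact: connect_sym_perm. Qed.
Let global := join_rel (orbit_rel e) r.
Let sg : connect_sym global. Proof. exact: connect_sym_join. Qed.

Let turn_global x : connect global x (t x).
Proof.
apply: (@connect_trans _ _ (e (t x))); first by rewrite sg connect1 //= rc orbT.
by rewrite connect1 //= eK eqxx.
Qed.

Let globalE : connect [rel x y | [|| y == e x, y == t x | r x y]] =2 connect global.
Proof.
move=> x y; apply/idP/idP.
  apply: connect_sub => u v /= /or3P[/eqP->|/eqP->|ruv].
  - by rewrite connect1 //= eqxx.
  - exact: turn_global.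
  - by rewrite connect1 //= ruv orbT.
by apply: connect_sub => u v /= /orP[uv|uv]; rewrite connect1 //= uv ?orbT.
Qed.

Let face_rel := orbit_rel (face D).
Let sf : connect_sym face_rel. Proof. exact: connect_sym_perm. Qed.
Let faceE x : face D x = (t^-1)%g (e x). Proof. by rewrite permM. Qed.

(** The boundary walks are taken as regions: the gap in this inequality is twice the total genus of
    the map components. *)
Let euler_face : (#|porbits (face D)| + #|porbits t| <=
   #|porbits e| + (n_map_components D).*2)%N.
Proof.
have fc x : connect face_rel (e x) ((t^-1)%g x).
  by rewrite connect1 //= faceE eK.
have := euler_leq eK e_neq t4 sf fc; rewrite -card_porbits.
suff -> : n_comp (join_rel (orbit_rel e) face_rel) T = n_map_components D.
  by rewrite -addnn addnA.
apply: eq_n_comp_connect => x y; apply/idP/idP.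
  apply: connect_sub => u v /= /orP[/eqP->|/eqP->].
    by rewrite connect1 //= eqxx.
  apply: (@connect_trans _ _ (e u)); first by rewrite connect1 //= eqxx.
  rewrite (connect_sym_join se st) connect1 //=.
  by rewrite faceE permKV eqxx orbT.
apply: connect_sub => u v /= /orP[/eqP->|/eqP->].
  by rewrite connect1 //= eqxx.
apply: (@connect_trans _ _ (e (t u))); last by rewrite connect1 //= eK eqxx.
rewrite (connect_sym_join se sf) connect1 //=.
by rewrite faceE eK permK eqxx orbT.
Qed.

(** A graph has at least as many edges as a spanning forest, here with components and regions as
    vertices and boundary walks as edges. Linearly: functions constant on components and functions
    constant on regions are both constant along boundary walks, and their common part is made of the
    functions constant on connected pieces. *)
Let tree_leq : (n_map_components D + n_regions D <=
   #|porbits (face D)| + n_comp global T)%N.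
Proof.
have sm : connect_sym (map_rel e t) by apply: connect_sym_join.
have := mxrank_sum_cap (class_mx (map_rel e t)) (class_mx r).
rewrite !rank_class_mx // -/(n_regions D).
have -> : (\rank (class_mx (map_rel e t) :&: class_mx r)%MS = n_comp global T)%N.
  rewrite -rank_class_mx //; apply/eqmx_rank/eqmxP/eqmx_row_of => f.
  rewrite sub_capmx row_of_class_mxP //; split=> [/andP[]|fg].
    move=> /(row_of_class_mxP _ sm) fm /(row_of_class_mxP _ sr) fr x y /=.
    by case/orP=> [xy|/fr//]; apply: fm; rewrite /= xy.
  apply/andP; split; apply/row_of_class_mxP => // x y; last first.
    by move=> rxy; apply: fg; rewrite /= rxy orbT.
  by case/orP=> [/eqP->|/eqP->]; apply: (connect_invariant fg);
     [rewrite connect1 //= eqxx | exact: turn_global].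
suff: (class_mx (map_rel e t) + class_mx r <= class_mx face_rel)%MS.
  move/mxrankS; rewrite rank_class_mx // -card_porbits => le1 eq1.
  by apply: leq_trans (leq_add le1 (leqnn _)); rewrite eq1.
rewrite addsmx_sub; apply/andP; split; apply/row_subP=> i;
  rewrite [row i _]row_ofE; set f := (fun _ => _); apply/row_of_class_mxP=> // x y /eqP->.
  have /(row_of_class_mxP _ sm) fm : (row_of f <= class_mx (map_rel e t))%MS.
    by rewrite -row_ofE row_sub.
  rewrite faceE (fm x (e x)) /= ?eqxx //; apply/esym/fm.
  by rewrite /= permKV eqxx orbT.
have /(row_of_class_mxP _ sr) fm : (row_of f <= class_mx r)%MS.
  by rewrite -row_ofE row_sub.
by have := connect_invariant fm (r_face (e x)); rewrite eK faceE.
Qed.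

(** The two equalities of [spherical] add up to the equality in [euler_exact]. Each of them holds in
    advance as an inequality, by [euler_face] and [tree_leq], so equality of the sum forces both. *)
Lemma spherical_exact :
  spherical D <-> [/\ exists d : dart D, True,
   forall P : pred (dart D), (forall d, P (e d) = P d) ->
    (forall d e, r d e -> P d = P e) -> forall d e, P d = P e &
   forall f : dart D -> rat, closed_flow e t f -> region_boundary e r f].
Proof.
have ee := euler_exact eK e_neq t4 sr r_face.
rewrite -/(n_regions D) in ee.
have eC : n_comp (map_rel e t) T = n_map_components D by [].
have ef := euler_face; have tl := tree_leq; split.
  case; rewrite -/e -/t => eul tree conn.
  have inh : exists d : dart D, True.
    case: (pickP T) => [d _|T0]; first by exists d.
    have n0 (q : rel T) : n_comp q T = 0%N.
      by apply: eq_card0 => x; have := T0 x.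
    move: tree; rewrite /n_map_components /n_regions !n0 addn0.
    by rewrite (@eq_card0 _ (porbits _)) // => X; apply/imsetP=> -[x]; have := T0 x.
  have [d0 _] := inh.
  have g1 : n_comp global T = 1%N.
    by apply/(n_comp_connected d0 sg) => x y; rewrite -globalE conn.
  split=> // [P Pe Pr x y|].
    have: connect global x y by rewrite -globalE conn.
    by apply: connect_invariant => u v /= /orP[/eqP->|/Pr].
  by apply/ee; rewrite -/global g1 eC; lia.
case=> -[d0 _] conn /ee; rewrite -/global eC => eul.
have c x y : connect global x y.
  rewrite -(conn (connect global x) _ _ x) ?connect0 // => u.
    by rewrite -(same_connect1r sg (x := u)) //= eqxx.
  by move=> v uv; apply: (same_connect1r sg); rewrite /= uv orbT.
have g1 : n_comp global T = 1%N by apply/(n_comp_connected d0 sg).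
rewrite g1 in eul tl; split; rewrite -/e -/t; last first.
  by move=> x y; have := c x y; rewrite -globalE.
  by lia.
by lia.
Qed.
End GoodP.

Lemma goodP D : udiagram_axiom D <-> good D.
Proof.
split.
  case=> [edgeP turnP ov [eqr rf] sph].
  have eK d : edge D (edge D d) = d by case: (edgeP d).
  have t4 d : turn D (turn D (turn D (turn D d))) = d by case: (turnP d).
  have rc d : region D (edge D (turn D d)) d.
    by have := rf (edge D (turn D d)); rewrite permM eK permK.
  have [|inh conn ex] := (spherical_exact eK _ t4 eqr rc).1 sph.
    by move=> d; case: (edgeP d).
  by split=> // d; [case: (edgeP d) | case: (turnP d)].
case=> eK en t4 tn ov eqr rc inh conn ex; split=> //.
- split=> // d; have := rc ((turn D)^-1%g (edge D d)).
  by rewrite permM permKV eK.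
- exact/spherical_exact.
Qed.

Section GoodFacts.
Variables (D : udiagram) (g : good D).
Implicit Types d e a : dart D.

Lemma regxx d : region D d d. Proof. exact: (eqrel_refl (region_equiv g)). Qed.
Lemma regS d e : region D d e -> region D e d.
Proof. exact: (eqrel_sym (region_equiv g)). Qed.
Lemma regT e d c : region D d e -> region D e c -> region D d c.
Proof. exact: (eqrel_trans (region_equiv g)). Qed.

Lemma turn_inj : injective (turn D). Proof. exact: perm_inj. Qed.
Lemma edge_inj : injective (edge D). Proof. exact: perm_inj. Qed.

Lemma crossing_turn d : crossing (turn D d) = crossing d.
Proof. by rewrite /crossing (inj_eq turn_inj). Qed.

Lemma crossingN d : crossing d = false -> turn D (turn D d) = d.
Proof. by move/negbFE/eqP. Qed.

Lemma turnV d : (turn D)^-1%g d = turn D (turn D (turn D d)).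
Proof. by apply: turn_inj; rewrite permKV (turn4 g). Qed.

Lemma faceE d : face D d = turn D (turn D (turn D (edge D d))).
Proof. by rewrite permM turnV. Qed.

Lemma reg_corner d : region D (edge D d) (turn D (turn D (turn D d))).
Proof. by have := region_corner g (turn D (turn D (turn D d))); rewrite (turn4 g). Qed.

Lemma reg_face d : region D d (face D d).
Proof. by rewrite faceE; have := reg_corner (edge D d); rewrite (edgeK g). Qed.

Lemma boundary_closed_flow (h : dart D -> rat) :
  (forall d e, region D d e -> h d = h e) ->
  closed_flow (edge D) (turn D) (fun d => h d - h (edge D d)).
Proof.
move=> hr; have r_face x : connect (region D) (edge D x) ((turn D)^-1%g x).
  by rewrite connect1 // turnV reg_corner.
by apply: (boundary_closed (edgeK g) (turn4 g) r_face); exists h.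
Qed.

End GoodFacts.

(* A class of regions of D whose image in E is larger would have, as indicator
   function, the same boundary as an invariant function of E. *)
Lemma isomorphism_hom D E (f : dart D -> dart E) :
    good D -> good E -> bijective f ->
    (forall d, f (edge D d) = edge E (f d)) ->
    (forall d, f (turn D d) = turn E (f d)) ->
    (forall d, crossing d -> over E (f d) = over D d) ->
    (forall d e, region D d e -> region E (f d) (f e)) ->
  isomorphism f.
Proof.
move=> gD gE bij_f fe ft fo fr; split=> // d e; apply/idP/idP; last exact: fr.
have [f' fK f'K] := bij_f; move=> rde.
pose ind x : rat := (region D d x)%:R.
have indr x y : region D x y -> ind x = ind y.
  move=> rxy; congr (nat_of_bool _)%:R.
  by apply/idP/idP=> [/(regT gD)|/(regT gD)]; apply=> //; apply: regS.
have [fl st] := boundary_closed_flow gD indr.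
have f't x : f' (turn E x) = turn D (f' x) by rewrite -{1}[x]f'K -ft fK.
have f'e x : f' (edge E x) = edge D (f' x) by rewrite -{1}[x]f'K -fe fK.
have [|h hr hb] := good_exact gE (f := fun x => ind (f' x) - ind (edge D (f' x))).
  by split=> x; rewrite ?f'e ?f't ?fl ?st.
(* [k] is unchanged across edges and within regions, hence constant. The indicator [ind] therefore
   differs by a constant from the pullback of a function on the regions of [E]. *)
pose k x := ind x - h (f x).
have kc x : k x = k d.
  apply/eqP; suff ->: (k x == k d) = (k d == k d) by [].
  apply: (good_connected gD (P := fun x => k x == k d)).
    move=> y; congr (_ == _); rewrite /k fe.
    by have := hb (f y); rewrite fK; lra.
  by move=> y z ryz; rewrite /k (indr _ _ ryz) (hr _ _ (fr _ _ ryz)).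
have := kc e; rewrite /k (hr _ _ rde) => /addIr.
rewrite /ind (regxx gD); case: (region D d e) => // /eqP.
Qed.

Lemma isomorphism_inv D E (f : dart D -> dart E) : isomorphism f ->
  exists2 f' : dart E -> dart D, isomorphism f' & cancel f f' /\ cancel f' f.
Proof.
case=> [[f' fK f'K]] fe ft fo fr; exists f' => //.
have f't x : f' (turn E x) = turn D (f' x) by rewrite -{1}[x]f'K -ft fK.
split=> //.
- by exists f.
- by move=> x; rewrite -{1}[x]f'K -fe fK.
- move=> x; rewrite -{1 3}[x]f'K => cx; rewrite fo //.
  by move: cx; rewrite /crossing -!ft (can_eq fK).
- by move=> x y; rewrite -{2}[x]f'K -{2}[y]f'K fr.
Qed.

(** * Sequences of moves and the unknotting number *)

Section Steps.
Variables (X : Type) (free paid : X -> X -> Prop).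

Lemma steps_trans j k x y z :
  steps free paid j x y -> steps free paid k y z -> steps free paid (j + k) x z.
Proof.
move=> xy yz; elim: yz xy => [w|i u v w _ IH vw|i u v w _ IH vw] xu.
- by rewrite addn0.
- exact: steps_free (IH xu) vw.
- by rewrite addnS; apply: steps_paid (IH xu) vw.
Qed.

Lemma steps_sym k x y :
  (forall u v, free u v -> free v u) -> (forall u v, paid u v -> paid v u) ->
  steps free paid k x y -> steps free paid k y x.
Proof.
move=> fs ps; elim=> [w|i u v w _ IH vw|i u v w _ IH vw]; first exact: steps_nil.
  exact: steps_trans (steps_free (steps_nil _ _ _) (fs _ _ vw)) IH.
exact: steps_trans (steps_paid (steps_nil _ _ _) (ps _ _ vw)) IH.
Qed.

End Steps.

Definition near := steps u_deform1 u_crossing_change.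

Lemma near_trans j k D E F : near j D E -> near k E F -> near (j + k) D F.
Proof. exact: steps_trans. Qed.

Lemma near0_trans D E F : near 0 D E -> near 0 E F -> near 0 D F.
Proof. exact: near_trans. Qed.

Lemma u_deform1_sym D E : u_deform1 D E -> u_deform1 E D.
Proof. by rewrite /u_deform1; tauto. Qed.

Lemma crossing_iso D E (f : dart D -> dart E) d : isomorphism f ->
  crossing (f d) = crossing d.
Proof. by case=> bf _ ft _ _; rewrite /crossing -!ft (bij_eq bf). Qed.

Lemma porbit_iso D E (f : dart D -> dart E) d e : bijective f ->
  (forall d, f (turn D d) = turn E (f d)) ->
  (f d \in porbit (turn E) (f e)) = (d \in porbit (turn D) e).
Proof.
move=> bf ft; have fti i x : f ((turn D ^+ i)%g x) = (turn E ^+ i)%g (f x).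
  by elim: i => [|i IH]; rewrite ?expg0 ?perm1 // !expgSr !permM ft IH.
apply/porbitP/porbitP=> -[i ed]; exists i.
  by apply: (bij_inj bf); rewrite fti.
by rewrite ed fti.
Qed.

Lemma u_crossing_change_sym D E : u_crossing_change D E -> u_crossing_change E D.
Proof.
case=> gD gE [a ca [f iso_f]]; have [bf fe ft fo fr] := iso_f.
split=> //; exists (f a).
  by have := crossing_iso (a : dart (change_crossing a)) iso_f => ->.
have [f' iso' [fK f'K]] := isomorphism_inv iso_f; exists f'.
have [bf' fe' ft' fo' fr'] := iso'.
split=> //= d cd; have /= <- := fo' d cd.
have /= := porbit_iso (D := change_crossing a) (f' d) a bf ft.
by rewrite f'K => ->; rewrite addbA addbb.
Qed.

Lemma near_sym k D E : near k D E -> near k E D.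
Proof. exact/steps_sym/u_crossing_change_sym/u_deform1_sym. Qed.

Lemma near_deform D E : u_deform1 D E -> near 0 D E.
Proof. exact/steps_free/steps_nil. Qed.

Lemma near_change D E : u_crossing_change D E -> near 1 D E.
Proof. exact/steps_paid/steps_nil. Qed.

Lemma near_iso D E (f : dart D -> dart E) :
  good D -> good E -> isomorphism f -> near 0 D E.
Proof.
move=> /goodP gD /goodP gE iso_f; apply: near_deform; left; left.
by split=> //; exists f; left.
Qed.

Lemma near_unlinkable j k D E : near j D E -> unlinkable k E -> unlinkable (j + k) D.
Proof. by move=> DE [F EF tF]; exists F => //; apply: near_trans EF. Qed.

Lemma unlinkable_leq k D : unlinkable k D -> (unknotting_number D <= k)%N.
Proof.
move=> uk; rewrite /unknotting_number; case: pselect => [h|//].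
by case: ex_minnP => m _; apply; apply/asboolP.
Qed.

Lemma unlinkable_min k D : unlinkable k D -> unlinkable (unknotting_number D) D.
Proof.
move=> uk; rewrite /unknotting_number; case: pselect => [h|[]]; last first.
  by exists k; apply/asboolP.
by case: ex_minnP => m /asboolP.
Qed.

Lemma near_unknotting k D E : near k D E ->
  (unknotting_number D <= unknotting_number E + k)%N.
Proof.
move=> DE; case: (pselect (exists j, unlinkable j D)) => [[j uD]|nD]; last first.
  (* If [D] cannot be unlinked, its unknotting number is the default value 0. *)
  rewrite {1}/unknotting_number; case: pselect => // h.
  by have [j /asboolP uj] := h; case: nD; exists j.
have uE := unlinkable_min (near_unlinkable (near_sym DE) uD).
by rewrite addnC; apply: unlinkable_leq; apply: near_unlinkable uE.
Qed.

Lemma near0_unknotting D E : near 0 D E -> unknotting_number D = unknotting_number E.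
Proof.
move=> DE; apply/eqP; rewrite eqn_leq.
by have := near_unknotting DE; have := near_unknotting (near_sym DE); rewrite !addn0 => -> ->.
Qed.

Lemma near_u_dist k D E L : near k D E ->
  `|u_dist D L - u_dist E L| <= k%:Z.
Proof.
move=> DE; have := near_unknotting DE; have := near_unknotting (near_sym DE).
rewrite /u_dist; move: (unknotting_number D) (unknotting_number E) (unknotting_number L).
by move=> x y z; lia.
Qed.

(** * Smoothings and subdivisions *)

Section Merge.
Variables (T : Type) (r : rel T) (b c : T).
Hypothesis eqr : equivalence_rel r.

(** Gluing of the classes of [b] and [c]. The region relation of a smoothing has this form by
    conversion, and [merge_hom] is the universal property. *)
Definition merge : rel T :=
  fun x y => [|| r x y, r x b && r c y | r x c && r b y].

Lemma merge_sub x y : r x y -> merge x y.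
Proof. by rewrite /merge => ->. Qed.

Lemma merge_pair : merge b c.
Proof. by rewrite /merge !(eqrel_refl eqr) orbT. Qed.

Lemma merge_hom (U : Type) (R : rel U) (F : T -> U) : equivalence_rel R ->
  (forall x y, r x y -> R (F x) (F y)) -> R (F b) (F c) ->
  forall x y, merge x y -> R (F x) (F y).
Proof.
move=> eqR FR Fbc x y /or3P[/FR//|/andP[/FR xb /FR cy]|/andP[/FR xc /FR b_y]].
  exact: (eqrel_trans eqR xb (eqrel_trans eqR Fbc cy)).
exact: (eqrel_trans eqR xc (eqrel_trans eqR (eqrel_sym eqR Fbc) b_y)).
Qed.

Lemma merge_equiv : equivalence_rel merge.
Proof.
have rs : symmetric r by move=> x y; apply/idP/idP; apply: eqrel_sym.
have ms : symmetric merge.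
  move=> x y; rewrite /merge (rs x y) (rs x b) (rs c y) (rs x c) (rs b y).
  by rewrite (andbC (r b x)) (andbC (r c x)) (orbC (_ && _)).
have mt x y z : r x y -> merge y z -> merge x z.
  rewrite /merge => rxy.
  by rewrite ((eqr x y z).2 rxy) ((eqr x y b).2 rxy) ((eqr x y c).2 rxy).
apply: mk_equivalence => // [x|y x z].
  by rewrite /merge (eqrel_refl eqr).
case/or3P=> [/mt|/andP[xb cy]|/andP[xc b_y]]; first exact.
  move=> yz; have: merge c z by apply: mt yz.
  case/or3P=> [cz|/andP[cb cz]|/andP[_ bz]].
  - by rewrite /merge xb cz orbT.
  - by apply: merge_sub; apply: eqrel_trans xb _ => //; apply: eqrel_trans (eqrel_sym eqr cb) cz.
  - by apply: merge_sub; apply: eqrel_trans xb bz.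
move=> yz; have: merge b z by apply: mt yz.
case/or3P=> [bz|/andP[_ cz]|/andP[bc bz]].
- by rewrite /merge xc bz !orbT.
- by apply: merge_sub; apply: eqrel_trans xc cz.
- by apply: merge_sub; apply: eqrel_trans xc _ => //; apply: eqrel_trans (eqrel_sym eqr bc) bz.
Qed.

End Merge.

Definition vertex (D : udiagram) (a : dart D) : seq (dart D) :=
  [:: a; turn D a; turn D (turn D a); turn D (turn D (turn D a))].

Section Vertex.
Variables (D : udiagram) (g : good D).
Implicit Types a x : dart D.

Lemma vertex_turn a x : (turn D x \in vertex a) = (x \in vertex a).
Proof.
rewrite !inE -{1}[a](turn4 g) !(inj_eq (@turn_inj D)).
by case: (x == a); case: (x == turn D a); case: (_ == _); case: (_ == _).
Qed.

Lemma porbit_vertex a x : (x \in porbit (turn D) a) = (x \in vertex a).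
Proof.
apply/porbitP/idP=> [[i ->]|].
  elim: i => [|i IH]; first by rewrite expg0 perm1 inE eqxx.
  by rewrite expgSr permM vertex_turn.
rewrite !inE => /or4P[]/eqP->.
- by exists 0%N; rewrite expg0 perm1.
- by exists 1%N; rewrite expg1.
- by exists 2%N; rewrite expgS expg1 permM.
- by exists 3%N; rewrite !expgS expg0 mulg1 !permM.
Qed.

Lemma vertex_sym a x : (x \in vertex a) = (a \in vertex x).
Proof. by rewrite -!porbit_vertex porbit_sym. Qed.

Lemma vertex_eq a b : a \in vertex b -> vertex a =i vertex b.
Proof.
rewrite -porbit_vertex => ab x; rewrite -!porbit_vertex.
by move: ab; rewrite -eq_porbit_mem => /eqP->.
Qed.

Lemma vertex_uniq a : crossing a -> uniq (vertex a).
Proof.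
move=> ca; have n1 x : (x == turn D x) = false.
  by rewrite eq_sym (negbTE (turn_neq g x)).
have n2 : (a == turn D (turn D a)) = false by rewrite eq_sym; apply: negbTE.
have n3 : (a == turn D (turn D (turn D a))) = false.
  by rewrite -[LHS](inj_eq (@turn_inj D)) (turn4 g) eq_sym.
by rewrite /= !inE n1 n2 n3 !n1 (inj_eq (@turn_inj D)) n2.
Qed.

Lemma turn_iter_eq a i j : crossing a -> (i < 4)%N -> (j < 4)%N ->
  (iter i (turn D) a == iter j (turn D) a) = (i == j).
Proof.
move=> /vertex_uniq u; have nthE k : (k < 4)%N -> iter k (turn D) a = nth a (vertex a) k.
  by case: k => [|[|[|[|]]]].
by move=> i4 j4; rewrite !nthE // nth_uniq.
Qed.

End Vertex.

Section Smooth.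
Variables (D : udiagram) (g : good D) (a : dart D).
Hypothesis ca : crossing a.
Local Notation t := (turn D).
Local Notation S := (smooth a).
Implicit Types x y : dart D.

Let u := vertex_uniq g ca.

Lemma smooth_turn x : turn S x =
  if x == t a then a else if x == t (t (t a)) then t (t a) else t x.
Proof.
rewrite /= permM -(inj_eq (@turn_inj D) x (t (t (t a)))) (turn4 g).
rewrite -(inj_eq (@turn_inj D) x (t a)) /= -/(edge D).
have aN : (a == t (t a)) = false by move: (ca); rewrite /crossing eq_sym => /negbTE.
case: tpermP => [->|->|/eqP/negbTE-> /eqP/negbTE->] //; rewrite ?eqxx ?aN //.
Qed.

Lemma smooth_turn0 : turn S a = t a.
Proof. by rewrite smooth_turn !(turn_iter_eq g (i := 0) (j := 1)) //= !(turn_iter_eq g (i := 0) (j := 3)). Qed.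
Lemma smooth_turn1 : turn S (t a) = a.
Proof. by rewrite smooth_turn eqxx. Qed.
Lemma smooth_turn2 : turn S (t (t a)) = t (t (t a)).
Proof. by rewrite smooth_turn !(turn_iter_eq g (i := 2) (j := 1)) //= !(turn_iter_eq g (i := 2) (j := 3)). Qed.
Lemma smooth_turn3 : turn S (t (t (t a))) = t (t a).
Proof. by rewrite smooth_turn !(turn_iter_eq g (i := 3) (j := 1)) //= eqxx. Qed.
Lemma smooth_turn_off x : x \notin vertex a -> turn S x = t x.
Proof.
by rewrite !inE !negb_or smooth_turn => /and4P[_ /negbTE-> _ /negbTE->].
Qed.

Lemma smooth_turn2_vertex x : x \in vertex a -> turn S (turn S x) = x.
Proof.
by rewrite !inE => /or4P[]/eqP->;
  rewrite ?(smooth_turn0, smooth_turn1, smooth_turn2, smooth_turn3).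
Qed.

Lemma crossing_smooth x : @crossing S x = crossing x && (x \notin vertex a).
Proof.
rewrite /crossing; have [xa|xa] := boolP (x \in vertex a).
  by rewrite (smooth_turn2_vertex xa) eqxx andbF.
by rewrite andbT (smooth_turn_off xa) smooth_turn_off ?(vertex_turn g).
Qed.

Lemma region_smoothE :
  region S = merge (region D) (t a) (t (t (t a))).
Proof. by []. Qed.

Lemma good_smooth : good S.
Proof.
split; rewrite ?region_smoothE.
- exact: edgeK g.
- exact: edge_neq g.
- move=> x; have [xa|xa] := boolP (x \in vertex a).
    by rewrite !smooth_turn2_vertex.
  by rewrite !smooth_turn_off ?(vertex_turn g) // (turn4 g).
- move=> x; rewrite smooth_turn; case: ifP => [/eqP->|_].
    by rewrite eq_sym (turn_neq g).
  by case: ifP => [/eqP->|_]; [rewrite eq_sym|]; rewrite (turn_neq g).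
- move=> x; rewrite crossing_smooth => /andP[cx xa].
  by rewrite smooth_turn_off //= (over_turn g).
- exact: (merge_equiv _ _ (region_equiv g)).
- move=> x; have [|xa] := boolP (x \in vertex a); last first.
    by rewrite smooth_turn_off //; apply/merge_sub/(region_corner g).
  have e0 := merge_equiv (t a) (t (t (t a))) (region_equiv g).
  have rs y : merge (region D) (t a) (t (t (t a))) (edge D (t y)) y.
    by apply/merge_sub/(region_corner g).
  have r4 : merge (region D) (t a) (t (t (t a))) (edge D a) (t (t (t a))).
    by have := rs (t (t (t a))); rewrite (turn4 g).
  have mp := merge_pair (t a) (t (t (t a))) (region_equiv g).
  rewrite !inE => /or4P[]/eqP->;
    rewrite ?(smooth_turn0, smooth_turn1, smooth_turn2, smooth_turn3) //=.
  + exact: (eqrel_trans e0 r4 (eqrel_sym e0 mp)).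
  + exact: (eqrel_trans e0 (rs (t a)) mp).
- exact: good_inhabited g.
- move=> P Pe Pr; apply: (good_connected g) => // x y rxy.
  by apply: Pr; apply: merge_sub.
(* In the smoothing each pasted pair has total flow 0, hence so does the whole crossing of [D], and
   the flow has a potential there. *)
- move=> f [fl st]; have vs y : f y + f (turn S y) + f (turn S (turn S y))
     + f (turn S (turn S (turn S y))) = 0 by apply: st.
  have s0 := vs a; have s2 := vs (t (t a)).
  rewrite !(smooth_turn0, smooth_turn1) in s0.
  rewrite !(smooth_turn2, smooth_turn3) in s2.
  have [|h hr hf] := good_exact g (f := f).
    split=> // x; have [|xa] := boolP (x \in vertex a); last first.
      by have := vs x; rewrite !smooth_turn_off ?(vertex_turn g).
    by rewrite !inE => /or4P[]/eqP->; rewrite ?(turn4 g); lra.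
  exists h => // x y xy; apply/eqP; move: x y xy.
  apply: (@merge_hom _ _ _ _ _ (fun x y => h x == h y) id) => //.
  - by apply: mk_equivalence => [x|x y|y x z /eqP-> //]; rewrite ?eqxx // eq_sym.
  - by move=> x y /hr ->.
  (* The total flow of a pasted pair is the difference of potential between the two corners that the
     smoothing merges. *)
  move: s0; rewrite !hf (hr _ _ (region_corner g a)).
  have -> : h (edge D a) = h (t (t (t a))).
    by rewrite -(hr _ _ (region_corner g (t (t (t a))))) (turn4 g).
  by move=> s0; apply/eqP; lra.
Qed.
End Smooth.

Section SmoothTwice.
Variables (D : udiagram) (g : good D).
Implicit Types a b : dart D.

Lemma smooth_turn2_iso a : crossing a ->
  @isomorphism (smooth a) (smooth (turn D (turn D a))) id.
Proof.
move=> ca; have c2 : crossing (turn D (turn D a)) by rewrite !crossing_turn.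
apply: isomorphism_hom => //; try exact: good_smooth; first by exists id.
  move=> x; rewrite (smooth_turn g ca) (smooth_turn g c2) !(turn4 g).
  case: ifP => [/eqP->|_]; last by case: ifP.
  by rewrite (turn_iter_eq g (i := 1) (j := 3)) // eqxx.
rewrite !region_smoothE !(turn4 g); apply: merge_hom.
- exact: (merge_equiv _ _ (region_equiv g)).
- by move=> x y; apply: merge_sub.
- exact: (eqrel_sym (merge_equiv _ _ (region_equiv g)) (merge_pair _ _ (region_equiv g))).
Qed.

Lemma smooth_off_crossing a b : crossing a -> crossing b -> b \notin vertex a ->
  @crossing (smooth a) b.
Proof. by move=> ca cb ba; rewrite crossing_smooth // cb. Qed.

Lemma smooth_off_turn a b : crossing a -> b \notin vertex a ->
  ((turn (smooth a) b = turn D b) *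
   (turn (smooth a) (turn D b) = turn D (turn D b)) *
   (turn (smooth a) (turn D (turn D b)) = turn D (turn D (turn D b))) *
   (turn (smooth a) (turn D (turn D (turn D b))) = b))%type.
Proof. by move=> ca ba; rewrite !smooth_turn_off ?(vertex_turn g) ?(turn4 g). Qed.

Lemma smooth_off_vertex a b : crossing a -> b \notin vertex a ->
  @vertex (smooth a) b = vertex b.
Proof. by move=> ca ba; rewrite /vertex !(smooth_off_turn ca ba). Qed.

Lemma smoothC_iso a b : crossing a -> crossing b -> b \notin vertex a ->
  @isomorphism (@smooth (smooth a) b) (@smooth (smooth b) a) id.
Proof.
move=> ca cb ba; have ab : a \notin vertex b by rewrite vertex_sym.
have ga := good_smooth g ca; have gb := good_smooth g cb.
have cab := smooth_off_crossing ca cb ba; have cba := smooth_off_crossing cb ca ab.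
apply: isomorphism_hom => //; try exact: good_smooth; first by exists id.
  move=> x; have [xb|xb] := boolP (x \in vertex b).
    have xa : x \notin vertex a by rewrite (vertex_sym g) (vertex_eq g xb) -vertex_sym.
    rewrite (@smooth_turn_off _ gb _ cba) ?smooth_off_vertex //.
    rewrite (smooth_turn ga cab) !(smooth_off_turn ca ba) (smooth_turn g cb).
    by rewrite (smooth_turn_off g ca xa).
  rewrite (@smooth_turn_off _ ga _ cab) ?smooth_off_vertex //.
  rewrite (smooth_turn gb cba) !(smooth_off_turn cb ab) (smooth_turn g ca).
  by rewrite (smooth_turn_off g cb xb).
have eD := region_equiv g; have eb := merge_equiv (turn D b) (turn D (turn D (turn D b))) eD.
rewrite !region_smoothE !(smooth_off_turn ca ba) !(smooth_off_turn cb ab).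
set R := merge (merge (region D) (turn D b) _) _ _.
have eR : equivalence_rel R by apply: merge_equiv.
apply: merge_hom => //; last by apply/merge_sub/merge_pair.
apply: merge_hom => //; last exact: merge_pair.
by move=> x y xy; apply/merge_sub/merge_sub.
Qed.
End SmoothTwice.

(* The dart reached by walking along a strand, starting with the dart x towards
   which one goes, until the first dart in K. *)
Inductive res (D : udiagram) (K : pred (dart D)) : dart D -> dart D -> Prop :=
  | res_here x : K x -> res K x x
  | res_skip x y : ~~ K x -> res K (edge D (turn D x)) y -> res K x y.

Lemma res_fun D (K : pred (dart D)) x y z : res K x y -> res K x z -> y = z.
Proof.
elim=> {x y} [x Kx|x y nKx _ IH] xz.
  by case: xz Kx => // u v nKu _ Ku; rewrite Ku in nKu.
by case: xz nKx IH => [u Ku|u v _ uv _ IH]; [rewrite Ku | apply: IH].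
Qed.

Lemma res_in D (K : pred (dart D)) x y : res K x y -> K y.
Proof. by elim. Qed.

Lemma eq_res D (K L : pred (dart D)) x y : K =1 L -> res K x y -> res L x y.
Proof.
move=> KL; elim=> {x y} [x Kx|x y nKx _ IH]; first by apply: res_here; rewrite -KL.
by apply: res_skip IH; rewrite -KL.
Qed.

Definition img (S : Type) (T : finType) (f : S -> T) : pred T :=
  fun x => `[< exists d, f d = x >].

Lemma imgP (S : Type) (T : finType) (f : S -> T) x : reflect (exists d, f d = x) (img f x).
Proof. exact: asboolP. Qed.

Lemma img_f (S : Type) (T : finType) (f : S -> T) d : img f (f d).
Proof. by apply/imgP; exists d. Qed.

(* E is obtained from D by subdividing edges, up to isomorphism. *)
Record refines (D E : udiagram) (f : dart D -> dart E) : Prop := Refines {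
  ref_inj : injective f;
  ref_turn : forall d, f (turn D d) = turn E (f d);
  ref_over : forall d, crossing d -> over E (f d) = over D d;
  ref_region : forall d e, region E (f d) (f e) = region D d e;
  ref_off : forall x, ~~ img f x -> ~~ crossing x;
  ref_edge : forall d, res (img f) (edge E (f d)) (f (edge D d));
  ref_res : forall x, exists y, res (img f) x y }.

Lemma iso_refines D E (f : dart D -> dart E) : isomorphism f -> refines f.
Proof.
case=> [[f' fK f'K]] fe ft fo fr; have imf x : img f x by rewrite -[x]f'K img_f.
split=> // [|x|d|x]; first exact: can_inj fK.
- by rewrite imf.
- by rewrite -fe; apply/res_here/img_f.
- by exists x; apply: res_here.
Qed.

Lemma subdivides_refines D E (f : dart D -> dart E) : good E ->
  subdivides f -> refines f.
Proof.
move=> gE [a [[ca ea inj_f cod] fe ft fo fr]].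
set b := turn E a in ea cod fe *.
have tb : turn E b = a by apply/eqP; apply: negbNE.
have imf x : img f x = (x \notin [:: a; b]).
  by rewrite -cod; apply/imgP/codomP=> -[d e]; exists d.
have eb : edge E b != a by apply: contra ea => /eqP <-; rewrite (edgeK gE).
have ia : ~~ img f a by rewrite imf !inE eqxx.
have ib : ~~ img f b by rewrite imf !inE eqxx orbT.
have iea : img f (edge E a) by rewrite imf !inE negb_or (edge_neq gE).
have ieb : img f (edge E b) by rewrite imf !inE negb_or (edge_neq gE) eb.
split=> // [x|d|x].
- rewrite imf negbK !inE => /orP[]/eqP->//.
  by rewrite /crossing tb eqxx.
- rewrite fe /=; case: eqP => [->|/eqP na]; last case: eqP => [->|/eqP nb].
  + by apply: res_skip => //; rewrite -/b; apply: res_here.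
  + by apply: res_skip => //; rewrite tb; apply: res_here.
  + by apply: res_here; rewrite imf !inE negb_or na.
- case: (eqVneq x a) => [->|na]; last case: (eqVneq x b) => [->|nb].
  + by exists (edge E b); apply: res_skip => //; apply: res_here.
  + by exists (edge E a); apply: res_skip => //; rewrite tb; apply: res_here.
  + by exists x; apply: res_here; rewrite imf !inE negb_or na.
Qed.

Section Contract.
Variables (D : udiagram) (g : good D) (z : dart D).
Local Notation z' := (turn D z).
Hypotheses (cz : ~~ crossing z) (ez : edge D z != z').

Let tz' : turn D z' = z. Proof. by apply/eqP; apply: negbNE. Qed.
Let ez' : edge D z' != z.
Proof. by apply: contra ez => /eqP {1}<-; rewrite (edgeK g). Qed.

(** The inverse of a subdivision at the vertex of [z]. The hypothesis [ez] excludes a circle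
    carrying this single vertex, which would be left without darts. *)
Definition contract_dart : finType := {x : dart D | x \notin [:: z; z']}.

(** An edge that arrives at the removed vertex is continued by the edge on its other side. *)
Definition skip (x : dart D) : dart D :=
  if x == z then edge D z' else if x == z' then edge D z else x.

Let ez_off : edge D z \notin [:: z; z'].
Proof. by rewrite !inE negb_or ez (edge_neq g). Qed.
Let ez'_off : edge D z' \notin [:: z; z'].
Proof. by rewrite !inE negb_or ez' (edge_neq g). Qed.

Lemma skip_z : skip z = edge D z'. Proof. by rewrite /skip eqxx. Qed.
Lemma skip_z' : skip z' = edge D z.
Proof. by rewrite /skip (negbTE (turn_neq g z)) eqxx. Qed.
Lemma skip_id x : x \notin [:: z; z'] -> skip x = x.
Proof. by rewrite !inE negb_or /skip => /andP[/negbTE-> /negbTE->]. Qed.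

Lemma skip_off x : skip x \notin [:: z; z'].
Proof.
have [->|xz] := eqVneq x z; first by rewrite skip_z.
have [->|xz'] := eqVneq x z'; first by rewrite skip_z'.
by rewrite skip_id ?inE ?negb_or ?xz.
Qed.

Definition kept (x : dart D) : contract_dart := Sub (skip x) (skip_off x).

Lemma val_kept x : x \notin [:: z; z'] -> val (kept x) = x.
Proof. exact: skip_id. Qed.

Lemma keptK (x : contract_dart) : kept (val x) = x.
Proof. by apply: val_inj; apply: val_kept; case: x. Qed.

Lemma kept_skip x : kept (skip x) = kept x.
Proof. by apply: val_inj; rewrite val_kept ?skip_off. Qed.

Let edge' (x : contract_dart) := kept (edge D (val x)).

Let kept_edge x : kept (edge D x) = edge' (kept x).
Proof.
apply: val_inj; rewrite /edge' /=.
have [->|xz] := eqVneq x z.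
  by rewrite skip_z (edgeK g) skip_z' skip_id ?ez_off.
have [->|xz'] := eqVneq x z'; last by rewrite (@skip_id x) // !inE negb_or xz.
by rewrite skip_z' (edgeK g) skip_z skip_id ?ez'_off.
Qed.

Let edge'K : involutive edge'.
Proof. by move=> x; rewrite {2}/edge' -kept_edge (edgeK g) keptK. Qed.

Let turn' (x : contract_dart) := kept (turn D (val x)).

Let off_turn x : (turn D x \notin [:: z; z']) = (x \notin [:: z; z']).
Proof. by rewrite !inE -{1}tz' !(inj_eq (@turn_inj D)) orbC. Qed.

Let val_turn' x : val (turn' x) = turn D (val x).
Proof. by apply: val_kept; rewrite off_turn (valP x). Qed.

Let turn'_inj : injective turn'.
Proof. by move=> x y /(congr1 val); rewrite !val_turn' => /turn_inj/val_inj. Qed.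

Definition contract : udiagram := {|
  dart := contract_dart;
  edge := perm (can_inj edge'K);
  turn := perm turn'_inj;
  over := fun x => over D (val x);
  region := fun x y => region D (val x) (val y) |}.

Let edgeE (x : contract_dart) : edge contract x = kept (edge D (val x)).
Proof. by rewrite permE. Qed.

Let val_turn (x : contract_dart) : val (turn contract x) = turn D (val x).
Proof. by rewrite permE val_turn'. Qed.

Let crossingE (x : contract_dart) : @crossing contract x = crossing (val x).
Proof. by rewrite /crossing -!val_turn (inj_eq val_inj). Qed.

Let region_kept x : region D x (val (kept x)).
Proof.
rewrite /= /skip; case: eqP => [->|_].
  by apply: (regS g); have := region_corner g z.
case: eqP => [->|_]; last exact: regxx.
by apply: (regS g); have := region_corner g z'; rewrite tz'.
Qed.

Lemma good_contract : good contract.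
Proof.
split.
- by move=> x; rewrite !edgeE -[RHS]edge'K.
- move=> x; rewrite edgeE; apply/eqP=> /(congr1 val) /=.
  have [ex|xz] := eqVneq (edge D (val x)) z.
    rewrite ex skip_z -[sval x](edgeK g) ex => /edge_inj/eqP.
    by rewrite (negbTE (turn_neq g z)).
  have [ex|xz'] := eqVneq (edge D (val x)) z'.
    rewrite ex skip_z' -[sval x](edgeK g) ex => /edge_inj/eqP.
    by rewrite eq_sym (negbTE (turn_neq g z)).
  by rewrite skip_id ?inE ?negb_or ?xz // => /eqP; rewrite (negbTE (edge_neq g _)).
- by move=> x; apply: val_inj; rewrite !val_turn (turn4 g).
- by move=> x; rewrite -(inj_eq val_inj) val_turn (turn_neq g).
- by move=> x; rewrite crossingE /= val_turn; apply: over_turn.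
- move=> x y w; have [rx rr] := region_equiv g (val x) (val y) (val w).
  by split.
- move=> x; rewrite edgeE /= -/(val (kept _)) val_turn.
  apply: regT (region_corner g (val x)) => //; apply: (regS g).
  exact: region_kept.
- by exists (kept z).
- move=> P Pe Pr x y; rewrite -[x]keptK -[y]keptK.
  apply: (good_connected g (P := fun u => P (kept u))).
    by move=> u; rewrite kept_edge -[RHS]Pe edgeE.
  move=> u v uv; apply: Pr => /=.
  apply: regT (regS g (region_kept u)) _ => //.
  exact: (regT g uv (region_kept v)).
- move=> f [fl st].
  have flk u : f (kept (edge D u)) = - f (kept u).
    by rewrite kept_edge -fl edgeE.
  have [|h hr hf] := good_exact g (f := fun u => f (kept u)).
    split=> // u; have [|uk] := boolP (u \in [:: z; z']); last first.
      have kt v : v \notin [:: z; z'] -> kept (turn D v) = turn contract (kept v).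
        by move=> vk; apply: val_inj; rewrite val_turn !val_kept // off_turn.
      by rewrite !kt ?off_turn.
    (* What arrives on one side of the removed vertex leaves on the other, so extending the flow
       over that vertex keeps it closed. *)
    have fz : f (kept z) + f (kept z') = 0.
      have -> : kept z = kept (edge D z').
        by apply: val_inj; rewrite /= skip_z skip_id.
      by rewrite flk addNr.
    by rewrite !inE => /orP[]/eqP->; rewrite !tz'; lra.
  exists (fun x => h (val x)) => [x y|x]; first exact: hr.
  by rewrite -{1}[x]keptK hf edgeE (hr _ _ (region_kept (edge D (val x)))).
Qed.

Lemma contract_edge x : edge contract (kept x) = kept (edge D x).
Proof. by rewrite edgeE -/(edge' (kept x)) -kept_edge. Qed.

Lemma contract_turn x : x \notin [:: z; z'] -> turn contract (kept x) = kept (turn D x).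
Proof. by move=> xk; apply: val_inj; rewrite val_turn !val_kept // off_turn. Qed.

Lemma contract_subdivides : @subdivides contract D val.
Proof.
exists z; split=> //.
- split=> //; first exact: val_inj.
  move=> x; apply/codomP/idP=> [[y ->]|xk]; first by case: y.
  by exists (kept x); rewrite val_kept.
- by move=> x; rewrite edgeE.
Qed.

Lemma near_contract : near 0 contract D.
Proof.
apply: near_deform; left; left; split; try exact/goodP.
  exact/goodP/good_contract.
by exists val; right; apply: contract_subdivides.
Qed.

Lemma val_edge_contract (x : contract_dart) :
  val (edge contract x) = skip (edge D (val x)).
Proof. by rewrite edgeE. Qed.

End Contract.

Lemma res_refine D E (f : dart D -> dart E) (K : pred (dart D)) (L : pred (dart E)) x y :
    refines f -> (forall d, L (f d) = K d) -> (forall e, L e -> img f e) ->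
  res K x y -> res L (f x) (f y).
Proof.
move=> rf LK Lf; have cat u v w : res (img f) u v -> res L v w -> res L u w.
  elim=> {u v} // u v nfu _ IH vw; apply: res_skip (IH vw).
  by apply: contra nfu; apply: Lf.
elim=> {x y} [x Kx|x y nKx _ IH]; first by apply: res_here; rewrite LK.
apply: res_skip; first by rewrite LK.
by rewrite -(ref_turn rf); apply: cat IH; apply: ref_edge.
Qed.

Lemma res_refine_cat D E (f : dart D -> dart E) (L : pred (dart E)) u v w :
    (forall e, L e -> img f e) -> res (img f) u v -> res L v w -> res L u w.
Proof.
move=> Lf; elim=> {u v} // u v nfu _ IH vw; apply: res_skip (IH vw).
by apply: contra nfu; apply: Lf.
Qed.

Lemma refines_comp D E F (f : dart D -> dart E) (h : dart E -> dart F) :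
  good F -> refines f -> refines h -> refines (h \o f).
Proof.
move=> gF rf rh; have Lf e : img (h \o f) e -> img h e.
  by case/imgP=> d <-; apply: img_f.
have LK e : img (h \o f) (h e) = img f e.
  apply/imgP/imgP=> -[d ed]; exists d; last by rewrite /= ed.
  exact: (ref_inj rh).
split=> [|d|d cd|d e|x|d|x] /=.
- exact: inj_comp (ref_inj rh) (ref_inj rf).
- by rewrite (ref_turn rf) (ref_turn rh).
- rewrite (ref_over rh) ?(ref_over rf) //.
  by rewrite /crossing -!(ref_turn rf) (inj_eq (ref_inj rf)).
- by rewrite (ref_region rh) (ref_region rf).
- case: (boolP (img h x)) => [/imgP[e <-]|nx _]; last exact: (ref_off rh).
  rewrite LK => /(ref_off rf); rewrite /crossing -!(ref_turn rh).
  by rewrite (inj_eq (ref_inj rh)).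
- apply: (res_refine_cat Lf (ref_edge rh (f d))).
  by apply: (res_refine rh LK Lf); apply: ref_edge.
- have [y xy] := ref_res rh x; have /imgP[e ey] := res_in xy.
  have [w ew] := ref_res rf e; exists (h w).
  by apply: (res_refine_cat Lf xy); rewrite -ey; apply: (res_refine rh LK Lf).
Qed.

(** Induction on the number of darts outside [K], with one contraction at a time. Since [K] is
    reached from everywhere, no closed curve avoids it, which is what makes each contraction
    possible. *)
Lemma contraction D (K : pred (dart D)) : good D ->
    (forall d, K (turn D d) = K d) -> (forall d, crossing d -> K d) ->
    (forall x, exists y, res K x y) ->
  exists D', exists i : dart D' -> dart D,
    [/\ good D', near 0 D' D, refines i & img i =1 K].
Proof.
have [n] := ubnP #|[pred x | ~~ K x]|; elim: n => // n IH in D K *.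
rewrite ltnS => leK g Kt Kc Kres.
case: (pickP [pred x | ~~ K x]) => [z /= nKz|allK]; last first.
  have Kx x : K x by apply/negbFE/(allK x).
  exists D, id; split=> //; first exact: steps_nil.
    by apply: iso_refines; split=> //; exists id.
  by move=> x; rewrite Kx -[x]/(id x) img_f.
have cz : ~~ crossing z by apply: contra nKz; apply: Kc.
have ez : edge D z != turn D z.
  apply/eqP=> e; have [y zy] := Kres z.
  have: edge D (turn D z) = z by rewrite -e (edgeK g).
  move: nKz; elim: zy => [x ->//|x w nKx _ IHx _ ex].
  by apply: IHx; rewrite ex.
pose g1 := good_contract g cz ez; pose D1 := contract g cz ez.
pose K1 : pred (dart D1) := fun x => K (val x).
have offK x : K x -> x \notin [:: z; turn D z].
  move=> Kx; rewrite !inE negb_or; apply/andP; split; apply: contraNneq nKz => e; first by rewrite -e.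
  by rewrite -(Kt z) -e.
have keptK1 x y : res K x y -> res K1 (kept g ez x) (kept g ez y).
  elim=> {x y} [x Kx|x y nKx _ IHx].
    by apply: res_here; rewrite /K1 val_kept // offK.
  have [xz|xo] := boolP (x \in [:: z; turn D z]).
    suff -> : kept g ez x = kept g ez (edge D (turn D x)) by [].
    rewrite -(kept_skip g ez x).
    move: xz; rewrite !inE => /orP[]/eqP->; first by rewrite skip_z.
    rewrite skip_z' //; congr (kept g ez (edge D _)); exact: esym (crossingN (negbTE cz)).
  apply: res_skip; first by rewrite /K1 val_kept.
  by rewrite contract_turn // contract_edge.
have [|x|x|x|D2 [i2 [g2 n2 r2 im2]]] := IH D1 K1 _ g1.
- apply: leq_trans leK; rewrite -(card_image val_inj).
  apply: proper_card; apply/properP; split; last first.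
    exists z => //; apply/negP=> /imageP[[x xo] _ /= e].
    by move: xo; rewrite -e !inE eqxx.
  by apply/subsetP=> x /imageP[y ny ->].
- by rewrite /K1 -(Kt (val x)); congr K; rewrite (ref_turn (subdivides_refines g (contract_subdivides g cz ez))).
- move=> cx; apply: Kc; move: cx; have r1 := subdivides_refines g (contract_subdivides g cz ez).
  by rewrite /crossing -!(ref_turn r1) (inj_eq val_inj).
- by have [y /keptK1] := Kres (val x); rewrite keptK; exists (kept g ez y).
exists D2, (val \o i2); have r1 := subdivides_refines g (contract_subdivides g cz ez).
split=> //.
- exact: near0_trans n2 (near_contract g cz ez).
- exact: refines_comp r2 r1.
- move=> x; apply/imgP/idP=> [[d <-]|Kx].
    by have := im2 (i2 d); rewrite img_f.
  have: K1 (kept g ez x) by rewrite /K1 val_kept ?offK.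
  by rewrite -im2 => /imgP[d ed]; exists d; rewrite /= ed val_kept ?offK.
Qed.

Section WeakIsomorphism.
Variables (D E : udiagram) (gD : good D) (gE : good E).
Variables (K : pred (dart D)) (L : pred (dart E)) (f : dart D -> dart E).
Hypotheses (Kt : forall d, K (turn D d) = K d) (Kc : forall d, crossing d -> K d).
Hypotheses (Lt : forall d, L (turn E d) = L d) (Lc : forall d, crossing d -> L d).
Hypotheses (Kres : forall x, exists y, res K x y) (Lres : forall x, exists y, res L x y).
Hypothesis f_inj : forall d e, K d -> K e -> f d = f e -> d = e.
Hypotheses (f_in : forall d, K d -> L (f d)) (f_onto : forall e, L e -> exists2 d, K d & f d = e).
Hypothesis ft : forall d, K d -> f (turn D d) = turn E (f d).
Hypothesis fo : forall d, K d -> crossing d -> over E (f d) = over D d.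
Hypothesis fr : forall d e, K d -> K e -> region D d e -> region E (f d) (f e).
Hypothesis fe : forall d, K d -> exists2 e, res K (edge D d) e & res L (edge E (f d)) (f e).

(* Vertices of valence 2 outside K and L are contracted, after which f becomes
   an isomorphism. *)
Lemma weak_iso : near 0 D E.
Proof.
have [D' [i [gD' nD ri imi]]] := contraction gD Kt Kc Kres.
have [E' [j [gE' nE rj imj]]] := contraction gE Lt Lc Lres.
have Ki d : K (i d) by rewrite -imi img_f.
have ex d : exists e, j e = f (i d) by apply/imgP; rewrite imj f_in.
pose h d := sval (cid (ex d)); have jh d : j (h d) = f (i d) := svalP (cid (ex d)).
have h_inj : injective h.
  by move=> d e /(congr1 j); rewrite !jh => /f_inj e'; apply: (ref_inj ri); apply: e'.
have ex' e : exists d, h d = e.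
  have /f_onto[d Kd fd] : L (j e) by rewrite -imj img_f.
  move: Kd; rewrite -imi => /imgP[d' ed]; exists d'.
  by apply: (ref_inj rj); rewrite jh ed.
have bij_h : bijective h.
  by exists (fun e => sval (cid (ex' e))) => [d|e]; [apply: h_inj|]; apply: svalP (cid (ex' _)).
apply: near0_trans (near_sym nD) _; apply: near0_trans nE.
apply: (@near_iso _ _ h) => //; apply: isomorphism_hom => // [d|d|d cd|d e de].
- apply: (ref_inj rj); rewrite jh; have [e e1 e2] := fe (Ki d).
  have := eq_res imi (ref_edge ri d) => /(res_fun e1) <-.
  have := eq_res imj (ref_edge rj (h d)); rewrite jh; exact: res_fun.
- by apply: (ref_inj rj); rewrite (ref_turn rj) !jh (ref_turn ri) ft.
- have ci : crossing (i d) by rewrite /crossing -!(ref_turn ri) (inj_eq (ref_inj ri)).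
  rewrite -(ref_over ri cd) -fo // -jh (ref_over rj) //.
  apply: contra ci => /eqP e2; apply/eqP.
  apply: f_inj; rewrite ?Kt //.
  by rewrite !ft ?Kt // -jh -!(ref_turn rj) e2.
- by rewrite -(ref_region rj) !jh fr // (ref_region ri).
Qed.
End WeakIsomorphism.

Lemma near_refines D E (f : dart D -> dart E) : good D -> good E ->
  refines f -> near 0 D E.
Proof.
move=> gD gE rf; have imt x : img f (turn E x) = img f x.
  apply/imgP/imgP=> -[d]; last by move=> <-; exists (turn D d); rewrite (ref_turn rf).
  move=> ed; exists (turn D (turn D (turn D d))).
  by rewrite !(ref_turn rf) ed (turn4 gE).
apply: (@weak_iso _ _ gD gE xpredT (img f) f) => //.
- by move=> d cd; apply: contraLR cd; apply: (ref_off rf).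
- by move=> x; exists x; apply: res_here.
- exact: ref_res rf.
- by move=> d e _ _; apply: (ref_inj rf).
- by move=> d _; apply: img_f.
- by move=> e /imgP[d ed]; exists d.
- by move=> d _; rewrite (ref_turn rf).
- by move=> d _; apply: (ref_over rf).
- by move=> d e _ _; rewrite (ref_region rf).
- by move=> d _; exists (edge D d); [apply: res_here | apply: ref_edge].
Qed.

Lemma res_smooth D (a : dart D) (K : pred (dart D)) x y : good D -> crossing a ->
  {in vertex a, forall x, K x} -> res K x y -> @res (smooth a) K x y.
Proof.
move=> gD ca Ka; elim=> {x y} [x Kx|x y nKx _ IH]; first exact: res_here.
apply: res_skip => //; rewrite smooth_turn_off //.
by apply: contra nKx; apply: Ka.
Qed.

Lemma ref_crossing D E (f : dart D -> dart E) d : refines f ->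
  crossing (f d) = crossing d.
Proof. by move=> rf; rewrite /crossing -!(ref_turn rf) (inj_eq (ref_inj rf)). Qed.

Lemma smooth_refines D E (f : dart D -> dart E) (a : dart D) :
  good D -> good E -> crossing a -> refines f ->
  @refines (smooth a) (smooth (f a)) f.
Proof.
move=> gD gE ca rf; have cfa : crossing (f a) by rewrite ref_crossing.
have imv x : x \in vertex (f a) -> img f x.
  rewrite !inE => /or4P[]/eqP->; rewrite -?(ref_turn rf); exact: img_f.
split; first exact: ref_inj rf.
- move=> x; rewrite !smooth_turn // -!(ref_turn rf) !(inj_eq (ref_inj rf)).
  by case: ifP => // _; case: ifP.
- by move=> x; rewrite crossing_smooth // => /andP[cx _]; apply: (ref_over rf).
- by move=> x y /=; rewrite -!(ref_turn rf) !(ref_region rf).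
- move=> x /(ref_off rf) cx; rewrite crossing_smooth //; by apply: contra cx => /andP[].
- by move=> x; exact: (res_smooth gE cfa imv (ref_edge rf x)).
- by move=> x; have [y xy] := ref_res rf x; exists y; exact: (res_smooth gE cfa imv xy).
Qed.

Lemma good_iso D E (f : dart D -> dart E) : isomorphism f -> good E -> good D.
Proof.
move=> iso_f g; have [bf fe ft fo fr] := iso_f; have fi := bij_inj bf.
have cf d : crossing (f d) = crossing d by apply: crossing_iso.
have [f' fK f'K] := bf.
have f't x : f' (turn E x) = turn D (f' x) by rewrite -{1}[x]f'K -ft fK.
have f'e x : f' (edge E x) = edge D (f' x) by rewrite -{1}[x]f'K -fe fK.
split.
- by move=> d; apply: fi; rewrite !fe (edgeK g).
- by move=> d; rewrite -(inj_eq fi) fe (edge_neq g).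
- by move=> d; apply: fi; rewrite !ft (turn4 g).
- by move=> d; rewrite -(inj_eq fi) ft (turn_neq g).
- by move=> d cd; rewrite -!fo ?crossing_turn // ft (over_turn g) ?cf.
- by move=> x y z; rewrite -!fr; apply: region_equiv g _ _ _.
- by move=> d; rewrite -fr fe ft (region_corner g).
- by have [x _] := good_inhabited g; exists (f' x).
- move=> P Pe Pr x y; rewrite -[x]fK -[y]fK.
  apply: (good_connected g (P := P \o f')) => [d|d e de] /=; first by rewrite f'e Pe.
  by apply: Pr; rewrite -fr !f'K.
- move=> p [fl st]; have [|h hr hf] := good_exact g (f := p \o f').
    by split=> x /=; rewrite ?f'e ?f't ?fl ?st.
  exists (h \o f) => [d e de|d] /=; first by apply: hr; rewrite fr.
  by have := hf (f d); rewrite /= fK fe.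
Qed.

Ltac near_id :=
  lazymatch goal with |- near _ ?E1 ?E2 => refine (@near_iso E1 E2 (fun x => x) _ _ _) end.

Lemma iso_id D : @isomorphism D D id.
Proof. by split=> //; exists id. Qed.

Lemma good_change D (a : dart D) : good D -> good (change_crossing a).
Proof.
move=> g; case: (g) => eK en t4 tn ov eqr rc inh conn ex; split=> //= d cd.
by rewrite !(porbit_vertex g) (vertex_turn g) ov // addbN.
Qed.

Lemma near_change_crossing D (a : dart D) : good D -> crossing a ->
  near 1 D (change_crossing a).
Proof.
move=> g ca; apply: near_change; split; try exact/goodP.
  exact/goodP/good_change.
by exists a => //; exists id; apply: iso_id.
Qed.

Lemma near_site D (s : site D) : good D -> good (delete_site s) -> site_axiom s ->
  near 0 D (delete_site s).
Proof.
move=> /goodP g /goodP g' ax; apply: near_deform; right; left; split=> //.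
by exists s => //; exists id; apply: iso_id.
Qed.

Lemma val_turn_contract D (g : good D) (z : dart D) (cz : ~~ crossing z)
  (ez : edge D z != turn D z) (x : dart (contract g cz ez)) :
  val (turn (contract g cz ez) x) = turn D (val x).
Proof. by rewrite (ref_turn (subdivides_refines g (contract_subdivides g cz ez))). Qed.

Lemma val_face_contract D (g : good D) (z : dart D) (cz : ~~ crossing z)
  (ez : edge D z != turn D z) (x : dart (contract g cz ez)) :
  val (face (contract g cz ez) x) =
  turn D (turn D (turn D (skip z (edge D (val x))))).
Proof. by rewrite (faceE (good_contract g cz ez)) !val_turn_contract val_edge_contract. Qed.

(* A monogon whose loop carries a vertex of valence 2. *)
Lemma near_weak_monogon D (a z : dart D) : good D -> crossing a -> ~~ crossing z ->
    edge D a = turn D z -> edge D z = turn D a ->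
    (forall x, region D a x -> x = a \/ x = z) ->
  near 0 D (smooth (turn D a)).
Proof.
move=> g ca cz ea ez disk.
have nez : edge D z != turn D z.
  apply/eqP=> e; have : crossing (turn D a) by rewrite crossing_turn.
  by rewrite -ez e crossing_turn (negbTE cz).
pose C := contract g cz nez; have gC : good C := good_contract g cz nez.
have rC := subdivides_refines g (contract_subdivides g cz nez).
have az : a \notin [:: z; turn D z].
  rewrite !inE negb_or; apply/andP; split; apply: contraTneq ca => ->; first by [].
  by rewrite crossing_turn.
pose a' : dart C := kept g nez a; have va : val a' = a by apply: val_kept.
have ca' : crossing a' by rewrite -(ref_crossing _ rC) va.
have cta : crossing (turn C a') by rewrite crossing_turn.
have mono : monogon a'.
  split=> //.
    apply: val_inj; rewrite val_face_contract va ea skip_z' // ez.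
    by rewrite (turn4 g).
  move=> x; rewrite -[region C a' x]/(region D (val a') (val x)) va => /disk[e|e].
    suff -> : x = a' by apply: porbit_id.
    by apply: val_inj; rewrite va.
  by have := valP x; rewrite /= e !inE eqxx.
apply: near0_trans (near_sym (near_contract g cz nez)) _.
have gS := good_smooth gC cta.
have /= n := near_site (s := Monogon a') gC gS mono.
apply: near0_trans n _; have rS := smooth_refines gC g cta rC.
rewrite val_turn_contract va in rS.
apply: near_refines rS => //; apply: good_smooth => //; by rewrite crossing_turn.
Qed.

Section WeakBigon.
Variables (D : udiagram) (g : good D) (a b z : dart D).
Hypotheses (ca : crossing a) (cb : crossing b) (cz : ~~ crossing z).
Hypothesis ba : b \notin vertex a.
Hypotheses (ea : edge D a = turn D b) (eb : edge D b = turn D z).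
Hypothesis ez : edge D z = turn D a.
Hypothesis disk : forall x, region D a x -> [\/ x = a, x = b | x = z].

Let cta : crossing (turn D a). Proof. by rewrite crossing_turn. Qed.
Let ctb : crossing (turn D b). Proof. by rewrite crossing_turn. Qed.
Let tba : turn D b \notin vertex (turn D a).
Proof. by rewrite (vertex_turn g) vertex_sym // (vertex_turn g) vertex_sym. Qed.

Lemma good_smooth2 : good (@smooth (smooth (turn D a)) (turn D b)).
Proof. by apply: good_smooth; [apply: good_smooth | apply: smooth_off_crossing]. Qed.

(** The 2-valent vertex [z] lies on the side from [b] to [a]; contracting it leaves a genuine
    bigon. *)
Lemma near_weak_bigon0 : over D a = over D (edge D a) ->
  near 0 D (@smooth (smooth (turn D a)) (turn D b)).
Proof.
move=> ov.
have nez : edge D z != turn D z.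
  by apply/eqP=> e; move: cta; rewrite -ez e crossing_turn (negbTE cz).
pose C := contract g cz nez; have gC : good C := good_contract g cz nez.
have rC := subdivides_refines g (contract_subdivides g cz nez).
have off x : crossing x -> x \notin [:: z; turn D z].
  move=> cx; rewrite !inE negb_or; apply/andP.
  by split; apply: contraTneq cx => ->; rewrite ?crossing_turn.
pose a' : dart C := kept g nez a; have va : val a' = a by apply/val_kept/off.
pose b' : dart C := kept g nez b; have vb : val b' = b by apply/val_kept/off.
have ca' : crossing a' by rewrite -(ref_crossing _ rC) va.
have cb' : crossing b' by rewrite -(ref_crossing _ rC) vb.
have cta' : crossing (turn C a') by rewrite crossing_turn.
have vin x y : (x \in @vertex C y) = (val x \in vertex (val y)).
  by rewrite !inE -!(inj_eq val_inj) !val_turn_contract.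
have fa : face C a' = b'.
  apply: val_inj; rewrite val_face_contract va vb ea skip_id ?off //.
  by rewrite (turn4 g).
have fb : face C b' = a'.
  apply: val_inj; rewrite val_face_contract va vb eb skip_z' // ez.
  by rewrite (turn4 g).
have big : bigon a'.
  split.
  - by rewrite fa.
  - by rewrite fa (porbit_vertex gC) vin va vb.
  - by rewrite fa fb.
  - rewrite -[over C a']/(over D (val a')) va ov.
    rewrite -[over C _]/(over D (val (edge C a'))) val_edge_contract va.
    by rewrite skip_id // ea off // crossing_turn.
  - move=> x; rewrite -[region C a' x]/(region D (val a') (val x)) va => /disk[e|e|e].
    + have -> : x = a' by apply: val_inj; rewrite va.
      exact: porbit_id.
    + have -> : x = face C a' by apply: val_inj; rewrite fa vb.
      by have := mem_porbit (face C) 1 a'; rewrite expg1.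
    + by have := valP x; rewrite /= e !inE eqxx.
apply: near0_trans (near_sym (near_contract g cz nez)) _.
have gS := good_smooth gC cta'.
have ctb' : @crossing (smooth (turn C a')) (turn C (face C a')).
  apply: smooth_off_crossing; rewrite ?crossing_turn ?fa //.
  by rewrite vin !val_turn_contract va vb.
have gS2 : good (delete_site (Bigon a')) by apply: good_smooth.
have n := near_site gC gS2 big.
apply: near0_trans n _; have rS := smooth_refines gC g cta' rC.
rewrite val_turn_contract va in rS.
have gSD : good (smooth (turn D a)) by apply: good_smooth.
have rS2 := smooth_refines gS gSD ctb' rS.
rewrite [val _](_ : _ = turn D b) in rS2; last by rewrite val_turn_contract fa vb.
by apply: near_refines rS2 => //; apply: good_smooth2.
Qed.
End WeakBigon.

(** If neither side is over at both ends, changing the crossing of [a] makes the RII move possible.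
    That crossing is smoothed in the result, where the change leaves no trace. *)
Lemma near_weak_bigon D (a b z : dart D) : good D ->
    crossing a -> crossing b -> ~~ crossing z -> b \notin vertex a ->
    edge D a = turn D b -> edge D b = turn D z -> edge D z = turn D a ->
    (forall x, region D a x -> [\/ x = a, x = b | x = z]) ->
  near (over D a != over D (edge D a)) D (@smooth (smooth (turn D a)) (turn D b)).
Proof.
move=> g ca cb cz ba ea eb ez disk.
have [ov|ov] := eqVneq (over D a) (over D (edge D a)).
  exact: near_weak_bigon0 disk ov.
pose D1 := change_crossing a; have g1 : good D1 by apply: good_change.
apply: (near_trans (j := 1) (k := 0)) (near_change_crossing g ca) _.
have ba' : b \notin @vertex D1 a by [].
have ov1 : over D1 a = over D1 (edge D1 a).
  rewrite /= porbit_id (porbit_vertex g) ea vertex_turn // (negbTE ba) /=.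
  by move: ov; rewrite ea; case: (over D a); case: (over D _).
apply: near0_trans (near_weak_bigon0 g1 (a := a) (b := b) (z := z) _ _ _ _ _ _ _ _ _) _ => //.
have cta : crossing (turn D a) by rewrite crossing_turn.
have ctb : crossing (turn D b) by rewrite crossing_turn.
have tba : turn D b \notin vertex (turn D a).
  by rewrite (vertex_turn g) vertex_sym // (vertex_turn g) vertex_sym.
have gS := good_smooth g cta.
near_id; [exact: (@good_smooth2 D1 g1 a b ca cb ba) | exact: good_smooth2 |].
split=> //; first by exists id.
move=> d cd; have : @crossing (smooth (turn D a)) d.
  by move: cd; rewrite (@crossing_smooth (smooth (turn D1 a)) (good_smooth g1 cta)) => [/andP[]//|];
     apply: (@smooth_off_crossing D1).
rewrite crossing_smooth // => /andP[_ da] /=.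
suff -> : (d \in porbit (turn D) a) = false by [].
have ta : turn D a \in vertex a by rewrite !inE eqxx orbT.
by rewrite (porbit_vertex g) -(vertex_eq g ta) (negbTE da).
Qed.

(* A tangle is a part of a diagram with n numbered darts.  The list e gives the
   edges joining two of them (i is an end of the tangle when e_i = n), t gives
   the turns, and N lists the darts at vertices which are to be forgotten.
   [walk] enters the tangle towards the dart j, and either meets a dart which is
   not in N, or leaves the tangle through the edge of some dart. *)
Section TangleWalk.
Variables (n : nat) (t e N : seq nat).

Fixpoint walk (fuel j : nat) : option (bool * nat) :=
  if fuel is m.+1 then
    if j \notin N then Some (true, j)
    else let k := nth 0%N t j in
      if (nth 0 e k < n)%N then walk m (nth 0 e k)%N else Some (false, k)
  else None.

Definition depart (i : nat) :=
  if (nth 0 e i < n)%N then walk n.+1 (nth 0 e i)%N else Some (false, i).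

Variables (E : udiagram) (x0 : dart E) (loc : seq (dart E)).
Hypotheses (uloc : uniq loc) (sloc : size loc = n).
Local Notation d := (nth x0 loc).
Hypothesis tn : forall i, (i < n)%N -> (nth 0 t i < n)%N /\ turn E (d i) = d (nth 0 t i)%N.
Hypothesis en : forall i, (i < n)%N -> (nth 0 e i < n)%N -> edge E (d i) = d (nth 0 e i)%N.

Definition keep : pred (dart E) := fun x => index x loc \notin N.

(** The fuel only makes the recursion structural: tables on which it runs out are rejected by
    [tangle_ok]. *)
Lemma walkP fuel j : (j < n)%N ->
  match walk fuel j with
  | Some (true, p) => [/\ (p < n)%N, p \notin N & res keep (d j) (d p)]
  | Some (false, k) => (k < n)%N /\ (n <= nth 0 e k)%N /\
      forall x, res keep (edge E (d k)) x -> res keep (d j) x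
  | None => True
  end.
Proof.
elim: fuel j => //= m IH j jn; have kj : keep (d j) = (j \notin N).
  by rewrite /keep index_uniq ?sloc.
case: ifP => [jN|jN]; first by split=> //; apply: res_here; rewrite kj.
have [kn tj] := tn jn; have skip x : res keep (edge E (d (nth 0 t j)%N)) x -> res keep (d j) x.
  by move=> kx; apply: res_skip; rewrite ?kj ?jN // tj.
case: ifP => [ekn|ekn]; last by split=> //; rewrite leqNgt ekn.
have := IH _ ekn; case: walk => // -[[] p]; rewrite -en //.
  by case=> pn pN rp; split=> //; apply: skip.
by case=> pn [ep rp]; do 2?split=> //; move=> x /rp/skip.
Qed.

Lemma departP i : (i < n)%N -> 
  match depart i with
  | Some (true, p) => [/\ (p < n)%N, p \notin N & res keep (edge E (d i)) (d p)]
  | Some (false, k) => (k < n)%N /\ (n <= nth 0 e k)%N /\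
      forall x, res keep (edge E (d k)) x -> res keep (edge E (d i)) x
  | None => True
  end.
Proof.
move=> i_n; rewrite /depart; case: ifP => [ein|ein]; last by split=> //; rewrite leqNgt ein.
by have := walkP n.+1 ein; rewrite en.
Qed.
End TangleWalk.

Section TangleCheck.
Variables (n : nat) (t1 t2 e N1 N2 phi : seq nat).
Local Notation "s # i" := (nth 0%N s i) (at level 9, i at level 1, format "s # i").

(** A test, run by evaluation, that two tangles with the same ends agree up to 2-valent vertices.
    [phi] matches the positions outside [N1] with those outside [N2]. Walks entering at the same end
    must meet matched darts, and walks leaving matched darts must meet matched darts or exit through
    the same end. The entries of [phi] at positions in [N1] are placeholders. *)
Definition tangle_ok : bool :=
  [&& all (fun i => i < n)%N N1, all (fun i => i < n)%N N2 &
  all (fun i =>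
    [&& [&& (t1#i < n)%N, (t2#i < n)%N & (e#i < n)%N ==> (e#(e#i) == i)],
        [&& (t1#i \in N1) == (i \in N1), (t2#i \in N2) == (i \in N2),
            (i \in N1) ==> (t1#(t1#i) == i) & (i \in N2) ==> (t2#(t2#i) == i)],
        (i \notin N1) ==> [&& (phi#i < n)%N, phi#i \notin N2, phi#(t1#i) == t2#(phi#i)
          & all (fun j => (j \notin N1) ==> (phi#i == phi#j) ==> (i == j)) (iota 0 n)],
        (i \notin N2) ==> has (fun j => (j \notin N1) && (phi#j == i)) (iota 0 n) &
      [&&
        (n <= e#i)%N ==>
          match walk n t1 e N1 n.+1 i, walk n t2 e N2 n.+1 i with
          | Some (true, p), Some (true, q) => q == phi#p
          | _, _ => false end,
        (i \notin N1) ==>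
          match depart n t1 e N1 i, depart n t2 e N2 (phi#i) with
          | Some (true, p), Some (true, q) => q == phi#p
          | Some (false, p), Some (false, q) => p == q
          | _, _ => false end &
        (walk n t1 e N1 n.+1 i != None) && (walk n t2 e N2 n.+1 i != None)]])
    (iota 0 n)].

Record tangle_facts (i : nat) : Prop := TangleFacts {
  tf_t1 : (t1#i < n)%N;
  tf_t2 : (t2#i < n)%N;
  tf_e : (e#i < n)%N -> e#(e#i) = i;
  tf_N1 : (t1#i \in N1) = (i \in N1);
  tf_N2 : (t2#i \in N2) = (i \in N2);
  tf_t11 : i \in N1 -> t1#(t1#i) = i;
  tf_t22 : i \in N2 -> t2#(t2#i) = i;
  tf_phi : i \notin N1 -> [/\ (phi#i < n)%N, phi#i \notin N2 & phi#(t1#i) = t2#(phi#i)];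
  tf_inj : i \notin N1 -> forall j, (j < n)%N -> j \notin N1 -> phi#i = phi#j -> i = j;
  tf_onto : i \notin N2 -> exists j, [/\ (j < n)%N, j \notin N1 & phi#j = i];
  tf_arr : (n <= e#i)%N ->
          match walk n t1 e N1 n.+1 i, walk n t2 e N2 n.+1 i with
          | Some (true, p), Some (true, q) => q == phi#p
          | _, _ => false end;
  tf_dep : i \notin N1 ->
          match depart n t1 e N1 i, depart n t2 e N2 (phi#i) with
          | Some (true, p), Some (true, q) => q == phi#p
          | Some (false, p), Some (false, q) => p == q
          | _, _ => false end;
  tf_walk1 : walk n t1 e N1 n.+1 i != None;
  tf_walk2 : walk n t2 e N2 n.+1 i != None }.

Lemma tangle_okP : tangle_ok -> [/\ n \notin N1, n \notin N2 &
  forall i, (i < n)%N -> tangle_facts i].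
Proof.
case/and3P=> /allP N1n /allP N2n /allP all_ok; split.
- by apply/negP=> /N1n; rewrite ltnn.
- by apply/negP=> /N2n; rewrite ltnn.
move=> i i_n; have := all_ok i; rewrite mem_iota /= add0n => /(_ i_n).
case/and5P=> /and3P[a1 a2 /implyP a3] /and4P[/eqP a4 /eqP a5 /implyP a6 /implyP a7].
move=> /implyP a8 /implyP a9 /and3P[/implyP a10 /implyP a11 /andP[a12 a13]].
split=> //.
- by move/a3/eqP.
- by move/a6/eqP.
- by move/a7/eqP.
- by case/a8/and4P=> ? ? /eqP.
- case/a8/and4P=> _ _ _ /allP inj j jn jN fij; apply/eqP.
  by have := inj j; rewrite mem_iota /= add0n jn jN fij eqxx; apply.
- case/a9/hasP=> j; rewrite mem_iota /= add0n => jn /andP[jN /eqP fj].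
  by exists j.
Qed.
End TangleCheck.

Section Tangle.
Variables (E1 E2 : udiagram) (g1 : good E1) (g2 : good E2).
Variables (io : dart E1 -> dart E2) (x0 : dart E1) (loc : seq (dart E1)).
Hypotheses (bij_io : bijective io) (io_edge : forall x, io (edge E1 x) = edge E2 (io x)).
Hypothesis io_turn : forall x, x \notin loc -> io (turn E1 x) = turn E2 (io x).
Variables (n : nat) (t1 t2 e N1 N2 phi : seq nat).
Hypotheses (uloc : uniq loc) (sloc : size loc = n).
Local Notation d := (nth x0 loc).
Hypothesis t1E : forall i, (i < n)%N -> turn E1 (d i) = d (nth 0 t1 i)%N.
Hypothesis t2E : forall i, (i < n)%N -> turn E2 (io (d i)) = io (d (nth 0 t2 i)%N).
Hypothesis eE : forall i, (i < n)%N -> (nth 0 e i < n)%N -> edge E1 (d i) = d (nth 0 e i)%N.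
Hypothesis ok : tangle_ok n t1 t2 e N1 N2 phi.

Definition relabel (x : dart E1) : dart E2 :=
  if (index x loc < n)%N then io (d (nth 0 phi (index x loc))%N) else io x.

Hypothesis o_off : forall x, x \notin loc -> crossing x -> over E2 (io x) = over E1 x.
Hypothesis o_loc : forall i, (i < n)%N -> i \notin N1 -> crossing (d i) ->
  over E2 (io (d (nth 0 phi i)%N)) = over E1 (d i).
Hypothesis r_hom : forall x y, index x loc \notin N1 -> index y loc \notin N1 ->
  region E1 x y -> region E2 (relabel x) (relabel y).

(** [phi] inside the tangle and [io] outside it form [relabel], to which [weak_iso] applies. A walk
    that leaves the tangle arrives at a dart outside it or at another of its ends, and in the latter
    case meets a kept dart inside by the test, so walks never have to be followed further. *)
Lemma tangle_near : near 0 E1 E2.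
Proof.
have [N1off N2off okP] := tangle_okP ok.
pose loc2 := map io loc; pose d2 := nth (io x0) loc2.
have io_inj := bij_inj bij_io.
have uloc2 : uniq loc2 by rewrite map_inj_uniq.
have sloc2 : size loc2 = n by rewrite size_map.
have d2E i : (i < n)%N -> d2 i = io (d i) by move=> i_n; rewrite /d2 (nth_map x0) ?sloc.
have ix2 x : index (io x) loc2 = index x loc by rewrite index_map.
pose K := keep N1 loc; pose L := keep N2 loc2.
have ixd i : (i < n)%N -> index (d i) loc = i by move=> i_n; rewrite index_uniq ?sloc.
have offn x : x \notin loc -> index x loc = n by move=> /memNindex; rewrite sloc.
have ncase x : (exists2 i, (i < n)%N & x = d i) \/ (x \notin loc).
  have [xl|] := boolP (x \in loc); [left | by right].
  by exists (index x loc); rewrite ?nth_index // -sloc index_mem.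
have Kd i : (i < n)%N -> K (d i) = (i \notin N1) by move=> i_n; rewrite /K /keep ixd.
have Ld i : (i < n)%N -> L (io (d i)) = (i \notin N2) by move=> i_n; rewrite /L /keep ix2 ixd.
have Koff x : x \notin loc -> K x by move=> xo; rewrite /K /keep offn.
have Loff x : x \notin loc -> L (io x) by move=> xo; rewrite /L /keep ix2 offn.
have fd i : (i < n)%N -> relabel (d i) = io (d (nth 0 phi i)%N).
  by move=> i_n; rewrite /relabel ixd ?i_n.
have foff x : x \notin loc -> relabel x = io x by move=> xo; rewrite /relabel offn ?ltnn.
have T1 i : (i < n)%N -> (nth 0 t1 i < n)%N /\ turn E1 (d i) = d (nth 0 t1 i)%N.
  by move=> i_n; rewrite t1E //; split=> //; apply: tf_t1 (okP i i_n).
have T2 i : (i < n)%N -> (nth 0 t2 i < n)%N /\ turn E2 (d2 i) = d2 (nth 0 t2 i)%N.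
  by move=> i_n; have t2n := tf_t2 (okP i i_n); rewrite !d2E // t2E.
have e2E i : (i < n)%N -> (nth 0 e i < n)%N -> edge E2 (d2 i) = d2 (nth 0 e i)%N.
  by move=> i_n ein; rewrite !d2E // -io_edge eE.
have io_onto y : exists x, io x = y by have [h _ hK] := bij_io; exists (h y).
have turn_off x : (turn E1 x \in loc) = (x \in loc).
  have imp y : y \in loc -> turn E1 y \in loc.
    move=> yl; have i_n : (index y loc < n)%N by rewrite -sloc index_mem.
    have [tn ty] := T1 _ i_n; rewrite -(nth_index x0 yl) ty mem_nth ?sloc //.
  apply/idP/idP=> [/imp/imp/imp|/imp//]; by rewrite (turn4 g1).
(* The darts at which a walk may arrive through an edge outside the tangle: those off the tangle,
   and its ends. *)
pose Y x := (x \notin loc) \/ (exists2 i, x = d i & (i < n)%N && (n <= nth 0 e i)%N).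
have arr x : Y x -> exists2 y, res K x y & res L (io x) (relabel y).
  case=> [xo|[i -> /andP[i_n ein]]].
    by exists x; [apply/res_here/Koff | rewrite foff //; apply/res_here/Loff].
  have := tf_arr (okP i i_n) ein.
  have := walkP N1 uloc sloc T1 eE n.+1 i_n; case: walk => [[[] p]|] //.
  have := walkP N2 uloc2 sloc2 T2 e2E n.+1 i_n; case: walk => [[[] q]|] //.
  case=> qn qN rq [pn pN rp] /eqP eq_q; exists (d p) => //.
  by rewrite fd // -eq_q -!d2E.
have Yedge x : Y x -> Y (edge E1 x).
  move=> Yx; case: (ncase (edge E1 x)) => [[i i_n ex]|]; last by left.
  right; exists i => //; rewrite i_n leqNgt /=; apply/negP=> ein.
  have ex2 : x = d (nth 0 e i)%N by rewrite -eE // -ex (edgeK g1).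
  case: Yx => [|[j ej /andP[jn]]]; first by rewrite ex2 mem_nth ?sloc.
  have ij : nth 0%N e i = j by rewrite -(ixd _ ein) -(ixd _ jn) -ej ex2.
  by rewrite -ij (tf_e (okP i i_n) ein) leqNgt i_n.
have Yd k : (k < n)%N -> (n <= nth 0 e k)%N -> Y (d k).
  by move=> kn ek; right; exists k; rewrite ?kn.
have part1 x : exists y, res K x y.
  case: (ncase x) => [[i i_n ->]|xo]; last by exists x; apply/res_here/Koff.
  have := tf_walk1 (okP i i_n).
  have := walkP N1 uloc sloc T1 eE n.+1 i_n; case: walk => [[[] p]|] //.
    by case=> _ _ rp _; exists (d p).
  by case=> kn [ek rk] _; have [y ky _] := arr _ (Yedge _ (Yd _ kn ek)); exists y; apply: rk.
apply: (@weak_iso _ _ g1 g2 K L relabel) => //.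
- move=> x; case: (ncase x) => [[i i_n ->]|xo]; last by rewrite !Koff ?turn_off.
  have [tn ->] := T1 _ i_n; rewrite !Kd //.
  by rewrite (tf_N1 (okP i i_n)).
- move=> x cx; case: (ncase x) cx => [[i i_n ->]|xo]; last by rewrite Koff.
  have [tn ti] := T1 _ i_n; have [_ tti] := T1 _ tn.
  rewrite Kd // /crossing ti tti; apply: contra => iN.
  by rewrite (tf_t11 (okP i i_n)).
- move=> y; have [x <-] := io_onto y.
  case: (ncase x) => [[i i_n ->]|xo]; last by rewrite -io_turn // !Loff ?turn_off.
  have [tn ti] := T2 _ i_n; rewrite -d2E // ti !d2E // !Ld //.
  by rewrite (tf_N2 (okP i i_n)).
- move=> y; have [x <-] := io_onto y.
  case: (ncase x) => [[i i_n ->]|xo]; last by rewrite Loff.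
  have [tn ti] := T2 _ i_n; have [_ tti] := T2 _ tn.
  rewrite Ld // /crossing -d2E // ti tti; apply: contra => iN.
  by rewrite (tf_t22 (okP i i_n)).
- move=> y; have [x <-] := io_onto y.
  case: (ncase x) => [[i i_n ->]|xo]; last by exists (io x); apply/res_here/Loff.
  have := tf_walk2 (okP i i_n).
  have := walkP N2 uloc2 sloc2 T2 e2E n.+1 i_n; rewrite -d2E //; case: walk => [[[] p]|] //.
    by case=> _ _ rp _; exists (d2 p).
  case=> kn [ek rk] _; have [y' _ ly] := arr _ (Yedge _ (Yd _ kn ek)).
  by exists (relabel y'); apply: rk; rewrite -[nth _ loc2 p]/(d2 p) d2E // -io_edge.
- move=> x y Kx Ky.
  case: (ncase x) Kx => [[i i_n ->]|xo]; case: (ncase y) Ky => [[j jn ->]|yo].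
  + rewrite !Kd // !fd // => jN iN /io_inj/(congr1 (index^~ loc)).
    have [fin _ _] := tf_phi (okP i i_n) iN; have [fjn _ _] := tf_phi (okP j jn) jN.
    by rewrite !ixd // => /(tf_inj (okP i i_n) iN jn jN) ->.
  + rewrite Kd // fd // foff // => _ iN /io_inj e1.
    have [fin _ _] := tf_phi (okP i i_n) iN.
    by case/negP: yo; rewrite -e1 mem_nth ?sloc.
  + rewrite Kd // fd // foff // => jN _ /io_inj e1.
    have [fjn _ _] := tf_phi (okP j jn) jN.
    by case/negP: xo; rewrite e1 mem_nth ?sloc.
  + by rewrite !foff // => _ _ /io_inj.
- move=> x; case: (ncase x) => [[i i_n ->]|xo]; last by rewrite foff // => _; apply: Loff.
  rewrite Kd // fd // => iN.
  by have [fin fN _] := tf_phi (okP i i_n) iN; rewrite Ld.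
- move=> y; have [x <-] := io_onto y.
  case: (ncase x) => [[i i_n ->]|xo]; last by move=> _; exists x; [apply: Koff | rewrite foff].
  rewrite Ld // => /(tf_onto (okP i i_n))[j [jn jN ej]].
  by exists (d j); rewrite ?Kd // fd // ej.
- move=> x; case: (ncase x) => [[i i_n ->]|xo]; last by rewrite !foff ?turn_off // => _; apply: io_turn.
  rewrite Kd // => iN; have [tn ti] := T1 _ i_n; rewrite ti !fd //.
  by have [fin _ ->] := tf_phi (okP i i_n) iN; rewrite t2E.
- move=> x; case: (ncase x) => [[i i_n ->]|xo] Kx cx; last by rewrite foff // o_off.
  by rewrite fd // o_loc // -Kd.
- move=> x; case: (ncase x) => [[i i_n ->]|xo]; last first.
    by move=> _; rewrite foff // -io_edge; apply/arr/Yedge; left.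
  rewrite Kd // => iN; have [fin fN _] := tf_phi (okP i i_n) iN.
  have := tf_dep (okP i i_n) iN.
  have := departP N1 uloc sloc T1 eE i_n; have := departP N2 uloc2 sloc2 T2 e2E fin.
  rewrite fd // -d2E //.
  case: depart => [[[] q]|]; case: depart => [[[] p]|] //.
    move=> [qn qN rq] [pn pN rp] /eqP eq_q; exists (d p) => //.
    by rewrite fd // -eq_q -d2E.
  move=> [qn [eq rq]] [pn [ep rp]] /eqP epq; rewrite -epq in qn eq rq.
  have [y ky ly] := arr _ (Yedge _ (Yd _ pn ep)); exists y; first exact: rp.
  by apply: rq; rewrite -[nth _ loc2 p]/(d2 p) d2E // -io_edge.
Qed.
End Tangle.

Section TangleRegions.
Variables (E1 E2 : udiagram) (g1 : good E1) (g2 : good E2).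
Variables (io : dart E1 -> dart E2) (x0 : dart E1) (loc : seq (dart E1)).
Variables (n : nat) (t1 t2 e N1 N2 phi : seq nat) (F : dart E1 -> dart E2).
Local Notation d := (nth x0 loc).

(** [F] transports regions and need not agree with the matching of darts; it is chosen so as to
    respect gluings easily, and compared with [phi] only at the kept positions of the tangle. *)
Lemma tangle_near_regions :
    bijective io -> (forall x, io (edge E1 x) = edge E2 (io x)) ->
    (forall x, x \notin loc -> io (turn E1 x) = turn E2 (io x)) ->
    uniq loc -> size loc = n ->
    (forall i, (i < n)%N -> turn E1 (d i) = d (nth 0 t1 i)%N) ->
    (forall i, (i < n)%N -> turn E2 (io (d i)) = io (d (nth 0 t2 i)%N)) ->
    (forall i, (i < n)%N -> (nth 0 e i < n)%N -> edge E1 (d i) = d (nth 0 e i)%N) ->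
    tangle_ok n t1 t2 e N1 N2 phi ->
    (forall x, x \notin loc -> crossing x -> over E2 (io x) = over E1 x) ->
    (forall i, (i < n)%N -> i \notin N1 -> crossing (d i) ->
       over E2 (io (d (nth 0 phi i)%N)) = over E1 (d i)) ->
    (forall x y, region E1 x y -> region E2 (F x) (F y)) ->
    (forall i, (i < n)%N -> i \notin N1 -> region E2 (F (d i)) (io (d (nth 0 phi i)%N))) ->
    (forall x, x \notin loc -> region E2 (F x) (io x)) ->
  near 0 E1 E2.
Proof.
move=> bij_io io_e io_t uloc sloc t1E t2E eE ok o_off o_loc F_hom F_loc F_off.
apply: (tangle_near g1 g2 bij_io io_e io_t uloc sloc t1E t2E eE ok o_off o_loc).
have F_relabel x : index x loc \notin N1 -> region E2 (F x) (relabel io x0 loc n phi x).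
  rewrite /relabel; case: ifP => ix iN; last by apply: F_off; rewrite -index_mem sloc ix.
  have xl : x \in loc by rewrite -index_mem sloc.
  by rewrite -{1}(nth_index x0 xl); apply: F_loc.
move=> x y /F_relabel fx /F_relabel fy /F_hom fxy.
exact: (regT g2 (regS g2 fx) (regT g2 fxy fy)).
Qed.
End TangleRegions.

(** [C] is a union of classes, in practice the face that vanishes. It has no counterpart in the
    target and may be sent to any chosen [p]. *)
Lemma collapse_hom (T U : Type) (r : rel T) (R : rel U) (C : pred T) (f : T -> U) (p : U) :
    equivalence_rel R -> (forall x y, r x y -> C x = C y) ->
    (forall x y, r x y -> R (f x) (f y)) ->
  forall x y, r x y -> R (if C x then p else f x) (if C y then p else f y).
Proof.
move=> eqR Cr rR x y rxy; rewrite (Cr _ _ rxy); case: ifP => _; last exact: rR.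
exact: eqrel_refl.
Qed.

(** * Deletion of components *)

Section Deletion.
Variables (D : udiagram) (g : good D) (A : pred (dart D)).

(** A union of components. The third clause handles 2-valent vertices, where going straight ahead is
    a single turn. *)
Definition sublink : Prop :=
  [/\ forall d, A (edge D d) = A d, forall d, A (turn D (turn D d)) = A d
    & forall d, ~~ crossing d -> A (turn D d) = A d].

Hypothesis subA : sublink.
Let Ae d : A (edge D d) = A d. Proof. by case: subA. Qed.
Let A2 d : A (turn D (turn D d)) = A d. Proof. by case: subA. Qed.
Let Anc d : ~~ crossing d -> A (turn D d) = A d. Proof. by case: subA => _ _; apply. Qed.

Definition del_dart : finType := {x : dart D | ~~ A x}.

Lemma del_edge_off (x : del_dart) : ~~ A (edge D (val x)).
Proof. by rewrite Ae (valP x). Qed.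

(** A crossing that loses one of its strands becomes a 2-valent vertex of the other. *)
Definition del_turn_fun x := if A (turn D x) then turn D (turn D x) else turn D x.

Lemma del_turn_off (x : del_dart) : ~~ A (del_turn_fun (val x)).
Proof.
rewrite /del_turn_fun; case: ifPn => // _; by rewrite A2 (valP x).
Qed.

Let fe (x : del_dart) : del_dart := Sub (edge D (val x)) (del_edge_off x).
Let ft (x : del_dart) : del_dart := Sub (del_turn_fun (val x)) (del_turn_off x).

Let feK : involutive fe. Proof. by move=> x; apply: val_inj; rewrite /= (edgeK g). Qed.
Let ft_inj : injective ft.
Proof.
move=> x y /(congr1 val) /=; rewrite /del_turn_fun => e; apply: val_inj; move: e.
case: ifPn => Ax; case: ifPn => Ay; [by do 2!move/turn_inj | | | exact: turn_inj].
  by move/turn_inj=> e; move: (valP y); rewrite /= -e Ax.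
by move/turn_inj=> e; move: (valP x); rewrite /= e Ay.
Qed.

(** Removing an edge joins the regions on its two sides. Any number of regions can be joined in this
    way, hence the closure by [connect]. *)
Definition del_rel := [rel x y | region D x y || (A x && (y == edge D x))].
Definition del_region := connect del_rel.

Lemma del_region_equiv : equivalence_rel del_region.
Proof.
have sc : connect_sym del_rel.
  apply: sym_connect_sym => x y /=; congr (_ || _).
    by apply/idP/idP; apply: regS.
  apply/andP/andP=> -[Ax /eqP e]; first by rewrite e Ae Ax (edgeK g).
  by rewrite e Ae Ax (edgeK g).
apply: mk_equivalence => // [x|y x z]; first exact: connect0.
exact: connect_trans.
Qed.

Lemma del_region_sub x y : region D x y -> del_region x y.
Proof. by move=> xy; apply: connect1; rewrite /= xy. Qed.

Lemma del_region_edge x : A x -> del_region x (edge D x).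
Proof. by move=> Ax; apply: connect1; rewrite /= Ax eqxx orbT. Qed.

Lemma del_region_hom (U : Type) (R : rel U) (F : dart D -> U) : equivalence_rel R ->
  (forall x y, region D x y -> R (F x) (F y)) ->
  (forall x, A x -> R (F x) (F (edge D x))) ->
  forall x y, del_region x y -> R (F x) (F y).
Proof.
move=> eR FR FA x y /connectP[p]; elim: p x => [|z p IH] x /=.
  by move=> _ ->; apply: eqrel_refl.
case/andP=> xz pz ey; apply: (eqrel_trans eR _ (IH _ pz ey)).
by case/orP: xz => [/FR//|/andP[Ax /eqP->]]; apply: FA.
Qed.

Definition del : udiagram := {|
  dart := del_dart;
  edge := perm (can_inj feK);
  turn := perm ft_inj;
  over := fun x => over D (val x);
  region := fun x y => del_region (val x) (val y) |}.

Lemma val_del_edge (x : dart del) : val (edge del x) = edge D (val x).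
Proof. by rewrite permE. Qed.

Lemma val_del_turn (x : dart del) : val (turn del x) = del_turn_fun (val x).
Proof. by rewrite permE. Qed.

Lemma del_turn_in x : A (turn D x) -> del_turn_fun x = turn D (turn D x).
Proof. by rewrite /del_turn_fun => ->. Qed.

Lemma del_turn_out x : ~~ A (turn D x) -> del_turn_fun x = turn D x.
Proof. by rewrite /del_turn_fun => /negbTE->. Qed.

Lemma del_turn2 x : ~~ A x -> A (turn D x) -> del_turn_fun (del_turn_fun x) = x.
Proof. by move=> Ax Atx; rewrite (del_turn_in Atx) del_turn_in ?A2 // (turn4 g). Qed.

Lemma crossing_del (x : dart del) :
  crossing x = crossing (val x) && ~~ A (turn D (val x)).
Proof.
have Ax := valP x; rewrite /crossing -(inj_eq val_inj) !val_del_turn.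
have [At|At] := boolP (A _); first by rewrite del_turn2 // eqxx andbF.
by rewrite andbT (del_turn_out At) del_turn_out // A2.
Qed.

Lemma good_del : (exists x, ~~ A x) -> good del.
Proof.
move=> [x0 Ax0]; have eR := del_region_equiv; split.
- by move=> x; apply: val_inj; rewrite !val_del_edge (edgeK g).
- by move=> x; rewrite -(inj_eq val_inj) val_del_edge (edge_neq g).
- move=> x; apply: val_inj; rewrite !val_del_turn; have Ax := valP x.
  have [At|At] := boolP (A (turn D (val x))).
    by rewrite (del_turn2 Ax At) del_turn2.
  rewrite (del_turn_out At) (@del_turn_out (turn D _)) ?A2 //.
  by rewrite !del_turn_out ?A2 // (turn4 g).
- move=> x; rewrite -(inj_eq val_inj) val_del_turn /del_turn_fun.
  case: ifPn => [At|_]; last exact: turn_neq g _.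
  by apply: contraL At => /eqP e; rewrite Anc ?(valP x) // negbK e.
- by move=> x; rewrite crossing_del => /andP[cx At] /=; rewrite val_del_turn del_turn_out // (over_turn g).
- by move=> x y z; apply: eR.
- move=> x /=; rewrite val_del_edge val_del_turn /del_turn_fun.
  have cor d : del_region (edge D (turn D d)) d by apply/del_region_sub/region_corner.
  case: ifP => [At|_]; last exact: cor.
  apply: (eqrel_trans eR (cor _)); apply: (eqrel_trans eR (del_region_edge At)).
  exact: cor.
- by exists (Sub x0 Ax0 : del_dart).
- move=> P Pe Pr x y.
  (* The predicate is extended to the deleted darts through the regions of the remaining diagram. *)
  pose Q u := [exists z : del_dart, del_region u (val z) && P z].
  have QP (z : del_dart) : Q (val z) = P z.
    apply/existsP/idP => [[w /andP[zw Pw]]|Pz]; first by rewrite (Pr z w).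
    by exists z; rewrite Pz (eqrel_refl eR).
  have Qr u v : del_region u v -> Q u = Q v.
    have imp u' v' : del_region u' v' -> Q u' -> Q v'.
      move=> uv /existsP[w /andP[uw Pw]]; apply/existsP; exists w.
      by rewrite Pw (eqrel_trans eR (eqrel_sym eR uv) uw).
    by move=> uv; apply/idP/idP; apply: imp => //; apply: (eqrel_sym eR).
  rewrite -!QP; apply: (good_connected g (P := Q)) => [u|u v uv].
    have [Au|Au] := boolP (A u); first by apply/esym/Qr/del_region_edge.
    have := Pe (Sub u Au : del_dart); rewrite -!QP; by rewrite val_del_edge.
  exact/Qr/del_region_sub.
- move=> f [fl st].
  (* Extended by 0, the flow stays closed, and its potential takes the same value on both sides of
     every deleted edge. *)
  pose fx u := if insub u is Some z then f (z : del_dart) else 0.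
  have fxv (z : del_dart) : fx (val z) = f z by rewrite /fx valK.
  have fx0 u : A u -> fx u = 0 by move=> Au; rewrite /fx insubF // Au.
  have [|h hr hf] := good_exact g (f := fx).
    split=> u.
      have [Au|Au] := boolP (A u); first by rewrite !fx0 ?Ae // oppr0.
      have := fl (Sub u Au : del_dart); rewrite -!fxv; by rewrite val_del_edge.
    have main w : ~~ A w -> fx w + fx (turn D w) + fx (turn D (turn D w)) +
        fx (turn D (turn D (turn D w))) = 0.
      move=> Aw; have := st (Sub w Aw : del_dart); rewrite -!fxv !val_del_turn /=.
      have [At|At] := boolP (A (turn D w)).
        rewrite (del_turn2 Aw At) (del_turn_in At) (fx0 _ At) (fx0 (turn D (turn D (turn D w)))) ?A2 //.
        by move=> e; lra.
      by rewrite (del_turn_out At) !del_turn_out ?A2.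
    have [Au|Au] := boolP (A u); last exact: main.
    have [At|At] := boolP (A (turn D u)); first by rewrite !fx0 ?A2 // !addr0.
    by have := main _ At; rewrite (turn4 g) => e; lra.
  have hd u v : del_region u v -> h u = h v.
    move=> uv; apply/eqP; move: u v uv.
    apply: (@del_region_hom _ (fun x y => h x == h y) id) => //.
    - by apply: mk_equivalence => [x|x y|y x z /eqP-> //]; rewrite ?eqxx // eq_sym.
    - by move=> x y /hr ->.
    - by move=> x Ax; rewrite -subr_eq0 -hf fx0.
  exists (fun x => h (val x)) => [x y|x]; first exact: hd.
  by rewrite -fxv hf val_del_edge.
Qed.

End Deletion.

(** Both maps are total, so that they can be defined by cases on positions; their values at deleted
    darts are arbitrary. *)
Lemma val_del_iso (D E : udiagram) (A : pred (dart D)) (B : pred (dart E))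
    (gD : good D) (gE : good E) (sA : sublink A) (sB : sublink B)
    (f : dart D -> dart E) (f' : dart E -> dart D) :
    (exists x, ~~ A x) ->
    (forall x, ~~ A x -> ~~ B (f x)) -> (forall x, ~~ B x -> ~~ A (f' x)) ->
    (forall x, ~~ A x -> f' (f x) = x) -> (forall x, ~~ B x -> f (f' x) = x) ->
    (forall x, ~~ A x -> f (edge D x) = edge E (f x)) ->
    (forall x, ~~ A x -> f (del_turn_fun A x) = del_turn_fun B (f x)) ->
    (forall x, ~~ A x -> ~~ A (turn D x) -> crossing x -> over E (f x) = over D x) ->
    (forall x y, ~~ A x -> ~~ A y -> del_region A x y -> del_region B (f x) (f y)) ->
  near 0 (del gD sA) (del gE sB).
Proof.
move=> exA fAB fBA fK f'K fe ft fo fr; have [x0 Ax0] := exA.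
have gdA : good (del gD sA) by apply: good_del.
have gdB : good (del gE sB) by apply: good_del; exists (f x0); apply: fAB.
pose h (x : dart (del gD sA)) : dart (del gE sB) := Sub (f (val x)) (fAB _ (valP x)).
pose h' (x : dart (del gE sB)) : dart (del gD sA) := Sub (f' (val x)) (fBA _ (valP x)).
apply: (@near_iso _ _ h) => //; apply: isomorphism_hom => //.
- exists h' => x.
    by apply: (@val_inj _ _ (del_dart A)); rewrite /= fK ?(valP x).
  by apply: (@val_inj _ _ (del_dart B)); rewrite /= f'K ?(valP x).
- move=> x; apply: (@val_inj _ _ (del_dart B)).
  by rewrite val_del_edge /= -fe ?(valP x) // -(val_del_edge x).
- move=> x; apply: (@val_inj _ _ (del_dart B)).
  by rewrite val_del_turn /= -ft ?(valP x) // -(val_del_turn x).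
- by move=> x; rewrite crossing_del => /andP[cx At] /=; rewrite fo ?(valP x).
- by move=> x y; apply: (fr _ _ (valP x) (valP y)).
Qed.

Lemma res_region D (g : good D) (K : pred (dart D)) x y : res K x y -> region D x y.
Proof.
elim=> {x y} [x _|x y _ _ xy]; first exact: regxx.
by apply: (regT g _ xy); apply/(regS g)/region_corner.
Qed.

Lemma res_sublink D (A : pred (dart D)) (K : pred (dart D)) x y : sublink A ->
  (forall x, ~~ K x -> ~~ crossing x) -> res K x y -> A x = A y.
Proof.
case=> Ae _ An Kc; elim=> {x y} // x y nKx _ <-.
by rewrite Ae An // Kc.
Qed.

Lemma res_del D (g : good D) (A : pred (dart D)) (sA : sublink A) (K : pred (dart D))
    (y : dart (del g sA)) w : (forall x, ~~ K x -> ~~ crossing x) ->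
  res K (val y) w -> exists2 w', val w' = w & @res (del g sA) (fun x => K (val x)) y w'.
Proof.
move=> Kc; move: (erefl (val y)); move: {1 3}(val y) => v ev yw.
elim: yw y ev => {v w} [v Kv|v w nKv _ IH] y /esym ev.
  by exists y => //; apply: res_here; rewrite ev.
have [_ _ An] := sA; have nA : ~~ A (turn D v) by rewrite An ?Kc // -ev (valP y).
have [|w' ew yw] := IH (edge (del g sA) (turn (del g sA) y)).
  by rewrite val_del_edge val_del_turn ev del_turn_out.
by exists w' => //; apply: res_skip => //; rewrite ev.
Qed.

Section RefineSublink.
Variables (D E : udiagram) (gD : good D) (gE : good E) (f : dart D -> dart E).
Hypothesis rf : refines f.

Let off x : ~~ img f x -> ~~ crossing x. Proof. exact: ref_off rf x. Qed.

Lemma sublink_comp (B : pred (dart E)) : sublink B -> sublink (B \o f).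
Proof.
move=> sB; have [Be B2 Bn] := sB; split=> d /=.
- by rewrite -(res_sublink sB off (ref_edge rf d)) Be.
- by rewrite !(ref_turn rf) B2.
- by move=> cd; rewrite (ref_turn rf) Bn // ref_crossing.
Qed.

(** A dart of [E] is put in [B] when the walk towards it first meets the image of a dart of [A]. *)
Lemma refines_sublink (A : pred (dart D)) : sublink A ->
  exists2 B : pred (dart E), sublink B & forall x, B (f x) = A x.
Proof.
case=> Ae A2 An; pose B y := `[< exists2 x, A x & res (img f) y (f x) >].
have Bf y x : res (img f) y (f x) -> B y = A x.
  move=> yx; apply/asboolP/idP=> [[x' Ax' yx']|Ax]; last by exists x.
  by rewrite (ref_inj rf (res_fun yx yx')).
have resE y : exists x, res (img f) y (f x).
  by have [w yw] := ref_res rf y; have /imgP[x ex] := res_in yw; exists x; rewrite ex.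
have imt y : img f (turn E y) = img f y.
  apply/imgP/imgP=> -[x ex]; last by exists (turn D x); rewrite (ref_turn rf) ex.
  by exists (turn D (turn D (turn D x))); rewrite !(ref_turn rf) ex (turn4 gE).
have tt y : ~~ img f y -> turn E (turn E y) = y.
  by move/off; rewrite /crossing negbK => /eqP.
(* A walk through 2-valent vertices can be retraced from its end. *)
have rev y z : res (img f) y z -> forall w, res (img f) (edge E y) w -> res (img f) (edge E z) w.
  elim=> {y z} // y z ny _ IH w yw; apply: IH; rewrite (edgeK gE).
  by apply: res_skip; rewrite ?imt // tt.
have Be y : B (edge E y) = B y.
  have [x yx] := resE y; have [w ew] := resE (edge E y).
  rewrite (Bf _ _ yx) (Bf _ _ ew) -(Ae x); congr A; apply: (ref_inj rf).
  exact: res_fun (rev _ _ yx _ ew) (ref_edge rf x).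
have Bfx x : B (f x) = A x by apply: Bf; apply/res_here/img_f.
exists B => //; split=> // y; have [/imgP[x <-]|ny] := boolP (img f y).
- by rewrite -!(ref_turn rf) !Bfx A2.
- by rewrite tt.
- by rewrite ref_crossing // => cx; rewrite -(ref_turn rf) !Bfx An.
move=> _; rewrite -Be; have [x xy] := resE (edge E y).
rewrite -[RHS]Be; apply: etrans (Be _) _.
by rewrite (Bf _ _ xy); apply: Bf; apply: res_skip; rewrite ?imt // tt.
Qed.

Lemma del_refines (A : pred (dart D)) (B : pred (dart E)) (sA : sublink A) (sB : sublink B) :
  (exists x, ~~ A x) -> (forall x, B (f x) = A x) -> near 0 (del gD sA) (del gE sB).
Proof.
move=> exA BA; have [x0 Ax0] := exA.
have gdA : good (del gD sA) by apply: good_del.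
have gdB : good (del gE sB) by apply: good_del; exists (f x0); rewrite BA.
have fB (x : dart (del gD sA)) : ~~ B (f (val x)) by rewrite BA (valP x).
pose h x : dart (del gE sB) := Sub (f (val x)) (fB x).
have hB x y : val x = f (val y) -> x = h y by move=> e; apply: (@val_inj _ _ (del_dart B)).
have eR := del_region_equiv gE sB.
have imt y : img f (turn E y) = img f y.
  apply/imgP/imgP=> -[x ex]; last by exists (turn D x); rewrite (ref_turn rf) ex.
  by exists (turn D (turn D (turn D x))); rewrite !(ref_turn rf) ex (turn4 gE).
have kept (y : dart (del gE sB)) d : val y = f d -> exists2 x, val x = d & h x = y.
  move=> ey; have Ad : ~~ A d by rewrite -BA -ey (valP y).
  by exists (Sub d Ad : dart (del gD sA)) => //; apply/esym/hB.
apply: (@weak_iso _ _ gdA gdB xpredT (fun y => img f (val y)) h) => //.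
- move=> y; rewrite val_del_turn /del_turn_fun; case: ifP => _; by rewrite !imt.
- by move=> y; rewrite crossing_del => /andP[cy _]; apply: contraLR cy; apply: off.
- by move=> x; exists x; apply: res_here.
- move=> y; have [w yw] := ref_res rf (val y).
  by have [w' _ yw'] := res_del off yw; exists w'.
- move=> x y _ _ /(congr1 val)/= /(ref_inj rf) e; exact: (@val_inj _ _ (del_dart A)).
- by move=> x _; apply: img_f.
- by move=> y /imgP[d ed]; have [x _ hx] := kept y d (esym ed); exists x.
- move=> x _; apply: (@val_inj _ _ (del_dart B)); rewrite val_del_turn /= val_del_turn.
  by rewrite /del_turn_fun -(ref_turn rf) BA; case: ifP => _; rewrite !(ref_turn rf).
- by move=> x _; rewrite crossing_del => /andP[cx _]; apply: (ref_over rf).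
- move=> x y _ _; apply: (del_region_hom (F := f) eR) => [u v uv|u Au].
    by apply: del_region_sub; rewrite (ref_region rf).
  have := res_region gE (ref_edge rf u) => /(del_region_sub B).
  by apply: (eqrel_trans eR); apply: del_region_edge; rewrite BA.
- move=> x _; exists (edge (del gD sA) x); first exact: res_here.
  have yw : res (img f) (val (edge (del gE sB) (h x))) (f (edge D (val x))).
    by rewrite val_del_edge; apply: ref_edge.
  have [w' ew yw'] := res_del off yw.
  by rewrite -(hB w' (edge (del gD sA) x)) // ew val_del_edge.
Qed.
End RefineSublink.

Section DelSmooth.
Variables (D : udiagram) (g : good D) (A : pred (dart D)) (sA : sublink A).
Hypothesis exA : exists x, ~~ A x.
Variables (a : dart D) (ca : crossing a).
Let gS : good (smooth a) := good_smooth g ca.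
Let A2 d : A (turn D (turn D d)) = A d. Proof. by case: sA. Qed.

Lemma sublink_smooth : A (turn D a) = A a -> @sublink (smooth a) A.
Proof.
move=> Ata; case: (sA) => Ae _ An.
have Av x : x \in vertex a -> A x = A a by rewrite !inE => /or4P[]/eqP->; rewrite ?A2 ?Ata.
have tv x : x \in vertex a -> turn (smooth a) x \in vertex a.
  by rewrite !inE => /or4P[]/eqP->; rewrite ?(smooth_turn0, smooth_turn1, smooth_turn2, smooth_turn3) // eqxx ?orbT.
split=> // x; have [xa|xa] := boolP (x \in vertex a).
- by rewrite smooth_turn2_vertex.
- by rewrite !smooth_turn_off ?(vertex_turn g).
- by rewrite (Av _ (tv _ xa)) Av.
- by rewrite crossing_smooth // xa andbT smooth_turn_off // => /An.
Qed.

Lemma del_smooth_in (sS : @sublink (smooth a) A) : A a -> A (turn D a) ->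
  near 0 (del g sA) (del gS sS).
Proof.
move=> Aa Ata; have Av x : x \in vertex a -> A x.
  by rewrite !inE => /or4P[]/eqP->; rewrite ?A2 ?Ata.
apply: (@val_del_iso D (smooth a) A A g gS sA sS (fun x => x) (fun x => x)) => //.
  move=> x nA; rewrite /del_turn_fun -?[turn (smooth a) _]/(turn (smooth a) _).
  have xv : x \notin vertex a by apply: contra nA; apply: Av.
  by rewrite !smooth_turn_off ?(vertex_turn g).
move=> x y _ _; have eR := del_region_equiv gS sS.
move: x y; apply: (@del_region_hom D A _ (@del_region (smooth a) A) (fun x => x) eR) => [u v uv|u].
  by apply/del_region_sub/merge_sub.
exact: del_region_edge.
Qed.

Lemma del_smooth_out_iso (sS : @sublink (smooth a) A) (nA : ~~ A a) : ~~ A (turn D a) ->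
  @isomorphism (@smooth (del g sA) (Sub a nA)) (del gS sS) (fun x => x).
Proof.
move=> nAt; have gd : good (del g sA) by apply: good_del.
pose a' : dart (del g sA) := Sub a nA.
have ca' : crossing a' by rewrite crossing_del ca.
have v1 : val (turn (del g sA) a') = turn D a by rewrite val_del_turn del_turn_out.
have v2 : val (turn (del g sA) (turn (del g sA) a')) = turn D (turn D a).
  by rewrite val_del_turn v1 del_turn_out // A2.
have v3 : val (turn (del g sA) (turn (del g sA) (turn (del g sA) a'))) = turn D (turn D (turn D a)).
  by rewrite val_del_turn v2 del_turn_out // A2.
have Av x : x \in vertex a -> ~~ A x.
  by rewrite !inE => /or4P[]/eqP->; rewrite ?A2.
have eR := del_region_equiv gS sS.
have hom u v : @del_region D A u v -> @del_region (smooth a) A u v.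
  apply: (@del_region_hom D A _ (@del_region (smooth a) A) (fun x => x) eR) => [u' v' uv|u'].
    by apply/del_region_sub/merge_sub.
  exact: del_region_edge.
apply: isomorphism_hom.
- exact: good_smooth.
- exact: good_del.
- by exists id.
- move=> x; apply: (@val_inj _ _ (del_dart A)).
  by rewrite (@val_del_edge _ gS A sS) (@val_del_edge _ g A sA).
- move=> x; apply: (@val_inj _ _ (del_dart A)).
  rewrite (@val_del_turn _ gS A sS) (smooth_turn gd ca').
  rewrite -!(inj_eq val_inj) v1 v3 !(fun_if val) v2 val_del_turn /del_turn_fun.
  rewrite [LHS]/=.
  have [xv|xv] := boolP (val x \in vertex a); last first.
    move: (xv); rewrite !inE !negb_or => /and4P[_ /negbTE-> _ /negbTE->].
    by rewrite !smooth_turn_off ?(vertex_turn g).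
  have nAS : ~~ A (turn (smooth a) (val x)).
    apply: Av; move: xv; rewrite !inE => /or4P[]/eqP->;
    by rewrite ?(smooth_turn0, smooth_turn1, smooth_turn2, smooth_turn3) // eqxx ?orbT.
  rewrite (negbTE nAS) smooth_turn //; case: ifP => // _; case: ifP => // _.
  by rewrite ifN // Av // (vertex_turn g).
- by move=> x _.
- move=> x y; rewrite (@region_smoothE (del g sA)).
  apply: (@merge_hom (del_dart A) (region (del g sA)) _ _ (del_dart A)
    (fun u v => @del_region (smooth a) A (val u) (val v)) (fun x => x)).
  + by move=> ? ? ?; apply: eR.
  + by move=> u v; apply: hom.
  + by rewrite /= v1 v3; apply/del_region_sub/merge_pair/region_equiv.
Qed.
Lemma crossing_Sub (nA : ~~ A a) : ~~ A (turn D a) -> @crossing (del g sA) (Sub a nA).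
Proof. by move=> nAt; rewrite crossing_del ca. Qed.

Lemma del_smooth_out (sS : @sublink (smooth a) A) (nA : ~~ A a) : ~~ A (turn D a) ->
  near 0 (@smooth (del g sA) (Sub a nA)) (del gS sS).
Proof.
move=> nAt; apply: near_iso (del_smooth_out_iso sS nA nAt); last exact: good_del.
by apply: good_smooth; [exact: good_del | exact: crossing_Sub].
Qed.
End DelSmooth.

Section DelMoves.
Variables (D : udiagram) (g : good D) (A : pred (dart D)) (sA : sublink A).
Hypothesis exA : exists x, ~~ A x.
Let Ae d : A (edge D d) = A d. Proof. by case: sA. Qed.
Let A2 d : A (turn D (turn D d)) = A d. Proof. by case: sA. Qed.

Lemma sublink_vertex a x : x \in vertex a -> A x = A a \/ A x = A (turn D a).
Proof. by rewrite !inE => /or4P[]/eqP->; rewrite ?A2; auto. Qed.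

(** A crossing with a deleted strand is no longer a crossing, so changing it costs nothing. *)
Lemma del_change (a : dart D) : crossing a ->
  near (~~ A a && ~~ A (turn D a)) (del g sA)
    (del (good_change a g) (sA : @sublink (change_crossing a) A)).
Proof.
move=> ca; have gc := good_change a g.
have [/andP[nAa nAt]|out] := boolP (_ && _); last first.
  apply: (@val_del_iso D (change_crossing a) A A g (good_change a g) sA sA (fun x => x) (fun x => x)) => //.
  move=> x nAx nAt _ /=; suff -> : (x \in porbit (turn D) a) = false by [].
  apply: contraNF out; rewrite (porbit_vertex g) (vertex_sym g) => ax.
  have tax : turn D a \in vertex x by rewrite (vertex_turn g).
  by case: (sublink_vertex ax) => ->; case: (sublink_vertex tax) => ->; apply/andP.
have gd : good (del g sA) by apply: good_del.
pose a' : dart (del g sA) := Sub a nAa.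
have ca' : crossing a' by rewrite crossing_del ca.
apply: (near_trans (j := 1) (k := 0) (near_change_crossing gd ca')).
have gdc : good (del (good_change a g) (sA : @sublink (change_crossing a) A)) by apply: good_del.
have v1 : val (turn (del g sA) a') = turn D a by rewrite val_del_turn del_turn_out.
have v2 : val (turn (del g sA) (turn (del g sA) a')) = turn D (turn D a).
  by rewrite val_del_turn v1 del_turn_out // A2.
have v3 : val (turn (del g sA) (turn (del g sA) (turn (del g sA) a'))) = turn D (turn D (turn D a)).
  by rewrite val_del_turn v2 del_turn_out // A2.
near_id; [exact: good_change | exact: gdc | split] => //.
- by exists id.
- move=> x; apply: (@val_inj _ _ (del_dart A)).
  by rewrite (@val_del_edge _ (good_change a g) A sA) (@val_del_edge _ g A sA).
- move=> x; apply: (@val_inj _ _ (del_dart A)).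
  by rewrite (@val_del_turn _ (good_change a g) A sA) (@val_del_turn _ g A sA).
- move=> x _; rewrite -[LHS]/((val x \in porbit (turn D) a) (+) over D (val x)).
  rewrite -[RHS]/((x \in porbit (turn (del g sA)) a') (+) over D (val x)).
  rewrite (porbit_vertex g) (porbit_vertex gd); congr (_ (+) _).
  by rewrite [RHS]inE !in_cons !in_nil -!(inj_eq val_inj) v1 v2 v3.
Qed.

(** The loop joins the two strands at the crossing, so they are deleted together or kept together.
    In the first case the smoothing is invisible; in the second the monogon survives. *)
Lemma del_monogon (a : dart D) (gS : good (smooth (turn D a))) : monogon a ->
  exists sS : @sublink (smooth (turn D a)) A, near 0 (del g sA) (del gS sS).
Proof.
case=> ca fa disk; have ct : crossing (turn D a) by rewrite crossing_turn.
have ea : edge D a = turn D a by rewrite -{2}fa (faceE g) (turn4 g).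
have At : A (turn D a) = A a by rewrite -ea Ae.
have sS : @sublink (smooth (turn D a)) A by apply: sublink_smooth; rewrite ?A2 ?At.
exists sS; rewrite (Prop_irrelevance gS (good_smooth g ct)).
have [Aa|nAa] := boolP (A a).
  by apply: del_smooth_in; rewrite ?A2 ?At.
have nAt : ~~ A (turn D a) by rewrite At.
have gd : good (del g sA) by apply: good_del.
pose a' : dart (del g sA) := Sub a nAa.
have v1 : val (turn (del g sA) a') = turn D a by rewrite val_del_turn del_turn_out.
have ca' : crossing a' by rewrite crossing_del ca.
have ct' : crossing (turn (del g sA) a') by rewrite crossing_turn.
have mono : monogon a'.
  split=> //.
    rewrite (faceE gd); have -> : edge (del g sA) a' = turn (del g sA) a'.
      by apply: (@val_inj _ _ (del_dart A)); rewrite val_del_edge v1.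
    by rewrite (turn4 gd).
  move=> x ax; suff -> : x = a' by apply: porbit_id.
  apply: (@val_inj _ _ (del_dart A)); apply/eqP.
  suff <- : (a == a) = (val x == a) by rewrite eqxx.
  apply: (connect_invariant (r := del_rel A) (f := fun y => y == a)) ax.
  have only u v : region D u v -> u == a -> v == a.
    by move=> uv /eqP eu; rewrite eu in uv; have /porbitP[i ->] := disk _ uv;
       apply/eqP; elim: i => [|i IH]; rewrite ?expg0 ?perm1 // expgSr permM IH.
  move=> u v /= /orP[uv|/andP[Au /eqP->]].
    by apply/idP/idP; apply: only => //; apply: regS.
  apply/eqP/eqP=> e; first by rewrite e (negbTE nAa) in Au.
  by rewrite -Ae e (negbTE nAa) in Au.
apply: near0_trans (near_site (s := Monogon a') gd (good_smooth gd ct') mono) _ => /=.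
have := del_smooth_out g sA exA ct sS nAt; rewrite A2 nAa => /(_ isT) n.
suff <- : Sub (turn D a) nAt = turn (del g sA) a' by [].
by apply: (@val_inj _ _ (del_dart A)); rewrite v1.
Qed.
End DelMoves.

(** * Smoothings read off from tables *)

Section Tables.
Variables (D : udiagram) (x0 : dart D) (loc : seq (dart D)) (n : nat).
Hypotheses (uloc : uniq loc) (sloc : size loc = n).
Local Notation d := (nth x0 loc).

Definition turn_table (t : seq nat) : Prop :=
  forall i, (i < n)%N -> turn D (d i) = d (nth 0 t i)%N.

Lemma table_crossing t i : turn_table t -> (i < n)%N -> (nth 0 t i < n)%N ->
  (nth 0 t (nth 0 t i) < n)%N ->
  crossing (d i) = (nth 0 t (nth 0 t i) != i)%N.
Proof.
by move=> tE i0 i1 i2; rewrite /crossing !tE // nth_uniq ?sloc.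
Qed.

Lemma off_nth x i : x \notin loc -> (i < n)%N -> (x == d i) = false.
Proof. by move=> xo i_n; apply: contraNF xo => /eqP->; rewrite mem_nth ?sloc. Qed.
End Tables.

(** [t'] is the table of turns obtained from [t] by pasting position [j] to the next one at its
    vertex; the disequality says that this vertex is a crossing. *)
Definition smooth_check (n : nat) (t t' : seq nat) (j : nat) : bool :=
  [&& (j < n)%N, all (fun i => nth 0 t i < n)%N (iota 0 n),
      nth 0%N t (nth 0%N t j) != j &
   all (fun i => nth 0%N t' i ==
     if i == nth 0%N t j then j
     else if i == nth 0%N t (nth 0%N t (nth 0%N t j)) then nth 0%N t (nth 0%N t j)
     else nth 0%N t i) (iota 0 n)].

Section SmoothTable.
Variables (D : udiagram) (g : good D) (x0 : dart D) (loc : seq (dart D)) (n : nat).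
Hypotheses (uloc : uniq loc) (sloc : size loc = n).
Local Notation d := (nth x0 loc).
Variables (t t' : seq nat) (j : nat).
Hypotheses (tE : turn_table x0 loc n t) (ok : smooth_check n t t' j).

Let tn i : (i < n)%N -> (nth 0 t i < n)%N.
Proof.
by have /and4P[_ /allP tn _ _] := ok; move=> i_n; apply: tn; rewrite mem_iota.
Qed.
Let jn : (j < n)%N. Proof. by case/and4P: ok. Qed.

Lemma smooth_crossing : crossing (d j).
Proof. by rewrite (table_crossing uloc sloc tE) ?tn //; case/and4P: ok. Qed.

Lemma smooth_good : good (smooth (d j)).
Proof. exact: good_smooth smooth_crossing. Qed.

Lemma smooth_table : @turn_table (smooth (d j)) x0 loc n t'.
Proof.
move=> i i_n; rewrite smooth_turn ?smooth_crossing // !tE ?tn // !nth_uniq ?sloc ?tn //.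
have /and4P[_ _ _ /allP/(_ i)] := ok; rewrite mem_iota => /(_ i_n)/eqP->.
by case: ifP => // _; case: ifP.
Qed.

Lemma smooth_table_off x : x \notin loc -> turn (smooth (d j)) x = turn D x.
Proof.
by move=> xo; rewrite smooth_turn ?smooth_crossing // !tE ?tn // !(off_nth x0 sloc xo) ?tn.
Qed.

Lemma smooth_table_region :
  region (smooth (d j)) = merge (region D) (d (nth 0 t j)%N) (d (nth 0 t (nth 0 t (nth 0 t j)))%N).
Proof. by rewrite region_smoothE !tE ?tn. Qed.
End SmoothTable.

(** * Bigons and triangles *)

Lemma smooth_nth D (g : good D) (x0 : dart D) (loc : seq (dart D)) n (t : seq nat) j :
    uniq loc -> size loc = n -> crossing (nth x0 loc j) ->
    (forall i, (i < n)%N -> (nth 0 t i < n)%N && (turn D (nth x0 loc i) == nth x0 loc (nth 0 t i)%N)) ->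
    (j < n)%N -> forall i, (i < n)%N ->
  turn (smooth (nth x0 loc j)) (nth x0 loc i) = nth x0 loc
    (if i == nth 0 t j then j
     else if i == nth 0 t (nth 0 t (nth 0 t j)) then nth 0 t (nth 0 t j) else nth 0 t i)%N.
Proof.
move=> uloc sloc cj tE jn i i_n; rewrite smooth_turn //.
have [/andP[j1 /eqP->] /andP[i1 /eqP->]] := (tE j jn, tE i i_n).
have /andP[j2 /eqP->] := tE _ j1; have /andP[j3 /eqP->] := tE _ j2.
by rewrite !nth_uniq ?sloc //; do 2?case: ifP.
Qed.

Section Bigon.
Variables (D : udiagram) (g : good D) (a : dart D).
Local Notation b := (face D a).
Hypotheses (ca : crossing a) (cb : crossing b) (ba : b \notin vertex a).
Hypothesis fb : face D b = a.
Hypothesis disk : forall x, region D a x -> x = a \/ x = b.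

(** Positions 0 to 3 are the darts at the crossing of [a], counterclockwise from [a], and 4 to 7
    those at the other crossing, from [b]. In the list [e] of edges, 8 marks an edge that leaves the
    site. *)
Let loc := vertex a ++ vertex b.
Let d := nth a loc.
Local Notation t := [:: 1; 2; 3; 0; 5; 6; 7; 4]%N.
Local Notation e := [:: 5; 4; 8; 8; 1; 0; 8; 8]%N.

Let uloc : uniq loc.
Proof.
rewrite cat_uniq !vertex_uniq // andbT; apply/hasPn=> x xb.
by apply: contra ba => xa; rewrite -(vertex_eq g xa) vertex_sym.
Qed.
Let sloc : size loc = 8%N. Proof. by []. Qed.
Let dE i j : (i < 8)%N -> (j < 8)%N -> (d i == d j) = (i == j).
Proof. by move=> i8 j8; rewrite nth_uniq. Qed.

Let tE i : (i < 8)%N -> turn D (d i) = d (nth 0 t i)%N.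
Proof. by case: i => [|[|[|[|[|[|[|[|i]]]]]]]] //= _; rewrite (turn4 g). Qed.
Let tn i : (i < 8)%N -> (nth 0 t i < 8)%N.
Proof. by case: i => [|[|[|[|[|[|[|[|i]]]]]]]]. Qed.
Let tE' i : (i < 8)%N -> (nth 0 t i < 8)%N && (turn D (d i) == d (nth 0 t i)%N).
Proof. by move=> i8; rewrite tE // eqxx andbT tn. Qed.

Let ea : edge D a = turn D b. Proof. by rewrite (faceE g) (turn4 g). Qed.
Let eb : edge D b = turn D a.
Proof. by rewrite -{2}fb (faceE g b) (turn4 g). Qed.

Let eE i : (i < 8)%N -> (nth 0 e i < 8)%N -> edge D (d i) = d (nth 0 e i)%N.
Proof.
case: i => [|[|[|[|[|[|[|[|i]]]]]]]] //= _ _.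
- by rewrite -[d 1]eb (edgeK g).
- by rewrite -[d 5]ea (edgeK g).
Qed.

Let cd i : (i < 8)%N -> crossing (d i).
Proof. by case: i => [|[|[|[|[|[|[|[|i]]]]]]]] //= _; rewrite !crossing_turn. Qed.

Let inside : pred (dart D) := fun x => (x == a) || (x == b).
Let inside_region x y : region D x y -> inside x = inside y.
Proof.
suff imp u v : region D u v -> inside u -> inside v.
  by move=> rxy; apply/idP/idP; apply: imp => //; apply: regS.
move=> ruv /orP iu; have {ruv}: region D a v.
  by apply: (regT g _ ruv); case: iu => /eqP->; [apply: regxx | apply: reg_face].
by case/disk=> ->; rewrite /inside eqxx ?orbT.
Qed.
Let insideE i : (i < 8)%N -> inside (d i) = (i \in [:: 0; 4]%N).
Proof.
by move=> i8; rewrite /inside -[a]/(d 0) -[face D _]/(d 4) !dE // !inE.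
Qed.
Let inside_off x : x \notin loc -> inside x = false.
Proof.
move=> xo; apply/negP=> /orP[]/eqP ex; case/negP: xo; rewrite ex.
  exact: (mem_nth a (n := 0) (s := loc)).
exact: (mem_nth a (n := 4) (s := loc)).
Qed.

Let corner i : (i < 8)%N -> region D (edge D (d i)) (turn D (turn D (turn D (d i)))).
Proof. by move=> _; apply: reg_corner. Qed.
Let r53 : region D (d 5) (d 3). Proof. by rewrite -[d 5]ea; apply: (corner (i := 0)). Qed.
Let r71 : region D (d 7) (d 1). Proof. by apply/(regS g); rewrite -[d 1]eb; apply: (corner (i := 4)). Qed.
Let r04 : region D (d 0) (d 4). Proof. exact: reg_face. Qed.

Let sE j i : (j < 8)%N -> (i < 8)%N -> turn (smooth (d j)) (d i) = d
  (if i == nth 0 t j then j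
   else if i == nth 0 t (nth 0 t (nth 0 t j)) then nth 0 t (nth 0 t j) else nth 0 t i)%N.
Proof. by move=> j8 i8; rewrite (smooth_nth g uloc sloc (cd j8) tE' j8 i8). Qed.

Let off_d x i : x \notin loc -> (i < 8)%N -> (x == d i) = false.
Proof. by move=> xo i8; apply: contraNF xo => /eqP->; apply: mem_nth. Qed.

Let sOff j x : (j < 8)%N -> x \notin loc -> turn (smooth (d j)) x = turn D x.
Proof.
by move=> j8 xo; rewrite smooth_turn ?cd // !tE ?tn // !off_d ?tn.
Qed.

Let oE i : (i < 8)%N -> over D (d (nth 0 t i)%N) = ~~ over D (d i).
Proof. by move=> i8; rewrite -tE // (over_turn g) ?cd. Qed.

(* Opening the bigon at one crossing leaves the other one, with its strands
   exchanged with respect to over and under. *)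
Lemma bigon_open : over D a = over D (edge D a) ->
  near 1 (smooth (turn D a)) (smooth (turn D b)).
Proof.
move=> ov; have g1 : good (smooth (d 1)) by apply/good_smooth/cd.
have g2 : good (smooth (d 5)) by apply/good_smooth/cd.
have vd4 : @vertex (smooth (d 1)) (d 4) = [:: d 4; d 5; d 6; d 7].
  by rewrite /vertex !sE.
have vd1 : vertex (d 1) = [:: d 1; d 2; d 3; d 0] by rewrite /vertex !tE.
have c4 : @crossing (smooth (d 1)) (d 4).
  by rewrite crossing_smooth ?cd // vd1 !inE !dE.
apply: (near_trans (j := 1) (k := 0)) (near_change_crossing g1 c4) _.
(* Smoothing at [d 1] glues the bigon to the corner of [d 2], so its darts can be sent there. *)
pose F x := if inside x then d 2 else x.
have eR := region_equiv g2.
have oc x : over (@change_crossing (smooth (d 1)) (d 4)) x = (x \in [:: d 4; d 5; d 6; d 7]) (+) over D x.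
  by rewrite /= (porbit_vertex g1) vd4.
have p64 : region (smooth (d 5)) (d 6) (d 4).
  by rewrite region_smoothE !tE //; apply/merge_pair/region_equiv.
have sub x y : region D x y -> region (smooth (d 5)) x y by apply: merge_sub.
(* The surviving crossing, at positions 4 to 7 on the left, matches positions 2, 3, 0, 1 on the
   right. The over strand there is the opposite one, whence the crossing change made beforehand. *)
apply: (@tangle_near_regions _ _ (@good_change (smooth (d 1)) (d 4) g1) g2 (fun x : dart D => x) a loc 8
  [:: 3; 2; 1; 0; 5; 6; 7; 4]%N [:: 1; 2; 3; 0; 7; 6; 5; 4]%N e
  [:: 0; 1; 2; 3]%N [:: 4; 5; 6; 7]%N [:: 0; 0; 0; 0; 2; 3; 0; 1]%N F) => //.
- by exists id.
- by move=> x xo; rewrite (sOff (j := 1)) // (sOff (j := 5)).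
- by move=> i i8; rewrite (sE (j := 1)) //; case: i i8 => [|[|[|[|[|[|[|[|i]]]]]]]].
- by move=> i i8; rewrite (sE (j := 5)) //; case: i i8 => [|[|[|[|[|[|[|[|i]]]]]]]].
- by move=> x xo _; rewrite oc !inE !off_d.
- move=> i i8 iN _; rewrite oc !inE !dE //.
  have := oE (i := 0) isT; have := oE (i := 1) isT; have := oE (i := 2) isT.
  have := oE (i := 4) isT; have := oE (i := 5) isT; have := oE (i := 6) isT.
  move: ov; rewrite ea -[face D a]/(d 4) -[a]/(d 0) tE //=.
  by case: i i8 iN => [|[|[|[|[|[|[|[|i]]]]]]]] //= _ _;
  move: (over D (d 0)) (over D (d 1)) (over D (d 2)) (over D (d 3)) (over D (d 4))
    (over D (d 5)) (over D (d 6)) (over D (d 7)) => [] [] [] [] [] [] [] [].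
- move=> x y; rewrite -[region _ x y]/(region (smooth (d 1)) x y) region_smoothE !tE //=.
  apply: (merge_hom (F := F) eR).
    exact: (collapse_hom (d 2) eR inside_region sub).
  by rewrite /F !insideE // !inE /=; exact: (regxx g2).
- move=> i i8 iN; rewrite /F insideE //.
  case: i i8 iN => [|[|[|[|[|[|[|[|i]]]]]]]] //= _ _; try exact: (regxx g2).
  + exact: sub r53.
  + exact: (regT g2 p64 (sub _ _ (regS g r04))).
  + exact: sub r71.
- by move=> x xo; rewrite /F inside_off //; exact: (regxx g2).
Qed.

Let stable j i : (j < 8)%N -> (i < 8)%N -> (j %/ 4 != i %/ 4)%N ->
  d i \notin vertex (d j).
Proof.
move=> j8 i8 ji; rewrite /vertex !tE ?tn // !inE !dE ?tn //.
by case: j j8 ji => [|[|[|[|[|[|[|[|j]]]]]]]]; case: i i8 => [|[|[|[|[|[|[|[|i]]]]]]]].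
Qed.

(* Closing the bigon at one crossing turns the other one into a kink. *)
Let near_kink i j k l : (i < 8)%N -> (j < 8)%N -> nth 0%N t i = k -> nth 0%N t j = l ->
    (i %/ 4 != j %/ 4)%N -> edge D (d j) = d k -> edge D (d i) = d l ->
    (forall x, region D (d j) x -> x = d j \/ x = d i) ->
    inside (d j) -> ~~ inside (d k) -> ~~ inside (d (nth 0 t (nth 0 t k)))%N ->
  near 0 (smooth (d i)) (@smooth (smooth (d i)) (d l)).
Proof.
move=> i8 j8 tik tjl ij ej ei disk' inj nink ninc.
have gi : good (smooth (d i)) by apply/good_smooth/cd.
have ji : d j \notin vertex (d i) by apply: stable.
have cj : @crossing (smooth (d i)) (d j) by apply: smooth_off_crossing; rewrite ?cd.
have := @near_weak_monogon (smooth (d i)) (d j) (d i) gi cj.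
have -> : turn (smooth (d i)) (d j) = d l by rewrite smooth_turn_off ?cd // tE // tjl.
apply.
- by rewrite crossing_smooth ?cd // negb_and negbK !inE eqxx orbT.
- by rewrite smooth_turn0 ?cd // tE // tik.
- by [].
- move=> x; rewrite region_smoothE !tE ?tn // tik => /or3P[/disk'//||].
    case/andP=> /inside_region; rewrite inj => e; move: nink; by rewrite -e.
  case/andP=> /inside_region; rewrite inj => e; move: ninc; by rewrite -e.
Qed.

(** Once the kink is removed on either side, no crossing remains at the site, and the ends are
    joined in the same way. *)
Lemma bigon_close : near 0 (smooth a) (smooth b).
Proof.
have g0 : good (smooth (d 0)) by apply/good_smooth/cd.
have g4 : good (smooth (d 4)) by apply/good_smooth/cd.
have in0 : inside (d 0) by rewrite insideE.
have in4 : inside (d 4) by rewrite insideE.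
have n1 : near 0 (smooth (d 0)) (@smooth (smooth (d 0)) (d 5)).
  apply: (near_kink (j := 4)) => //; rewrite ?insideE //.
  by move=> x rx; apply/or_comm/disk; apply: (regT g (reg_face g a)).
have n2 : near 0 (smooth (d 4)) (@smooth (smooth (d 4)) (d 1)).
  by apply: (near_kink (j := 0)) => //; rewrite ?insideE.
apply: near0_trans n1 _; apply: near0_trans _ (near_sym n2).
have c05 : @crossing (smooth (d 0)) (d 5).
  by apply: smooth_off_crossing; rewrite ?cd // stable.
have c41 : @crossing (smooth (d 4)) (d 1).
  by apply: smooth_off_crossing; rewrite ?cd // stable.
have g05 : good (@smooth (smooth (d 0)) (d 5)) by apply: good_smooth.
have g41 : good (@smooth (smooth (d 4)) (d 1)) by apply: good_smooth.
pose R2 := region (@smooth (smooth (d 4)) (d 1)).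
have eR : equivalence_rel R2 by apply: region_equiv.
have sub x y : region D x y -> R2 x y by move=> xy; apply/merge_sub/merge_sub.
have p57 : R2 (d 5) (d 7).
  apply: merge_sub; rewrite region_smoothE !tE //.
  exact/merge_pair/region_equiv.
have p13 : R2 (d 1) (d 3).
  apply: (eqrel_trans eR (sub _ _ (regS g r71))).
  exact: (eqrel_trans eR (eqrel_sym eR p57) (sub _ _ r53)).
(* The two smoothings on the left glue the bigon to the corner of [d 6]. *)
pose F x := if inside x then d 6 else x.
have Fsub := collapse_hom (d 6) eR inside_region sub.
apply: (@tangle_near_regions _ _ g05 g41 (fun x : dart D => x) a loc 8
  [:: 1; 0; 3; 2; 7; 6; 5; 4]%N [:: 3; 2; 1; 0; 5; 4; 7; 6]%N e
  [:: 0; 1; 4; 7]%N [:: 0; 3; 4; 5]%N [:: 0; 0; 2; 1; 0; 7; 6; 0]%N F) => //.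
- by exists id.
- move=> x xo; rewrite !(@smooth_turn (smooth _)) // !(sE (j := 0)) // !(sE (j := 4)) //.
  by rewrite !off_d // !sOff.
- move=> i i8; rewrite (@smooth_turn (smooth _)) // !(sE (j := 0)) // !dE //.
  by case: i i8 => [|[|[|[|[|[|[|[|i]]]]]]]].
- move=> i i8; rewrite (@smooth_turn (smooth _)) // !(sE (j := 4)) // !dE //.
  by case: i i8 => [|[|[|[|[|[|[|[|i]]]]]]]].
- move=> i i8 iN; rewrite (@crossing_smooth (smooth (d 0))) // crossing_smooth ?cd //.
  rewrite /vertex !(sE (j := 0)) // !tE // !inE !dE //.
  by case: i i8 iN => [|[|[|[|[|[|[|[|i]]]]]]]].
- move=> x y; rewrite (@region_smoothE (smooth (d 0))) region_smoothE !(sE (j := 0)) // !tE //=.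
  apply: (merge_hom (F := F) eR).
    apply: (merge_hom (F := F) eR); first exact: Fsub.
    by rewrite /F !insideE.
  by rewrite /F !insideE //=; apply: eqrel_refl.
- move=> i i8 iN; rewrite /F insideE //.
  case: i i8 iN => [|[|[|[|[|[|[|[|i]]]]]]]] //= _ _; try exact: (regxx g41).
  exact: (eqrel_sym eR p13).
- by move=> x xo; rewrite /F inside_off //; exact: (regxx g41).
Qed.

Local Notation open2 := (@smooth (smooth (turn D a)) (turn D b)).

Let ok1 : smooth_check 8 t [:: 3; 2; 1; 0; 5; 6; 7; 4]%N 1. Proof. by []. Qed.
Let g1 := smooth_good g uloc sloc tE ok1.
Let t1E := smooth_table g uloc sloc tE ok1.
Let ok15 : smooth_check 8 [:: 3; 2; 1; 0; 5; 6; 7; 4]%N [:: 3; 2; 1; 0; 7; 6; 5; 4]%N 5.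
Proof. by []. Qed.
Let t15E i : (i < 8)%N -> turn open2 (d i) = d (nth 0 [:: 3; 2; 1; 0; 7; 6; 5; 4] i)%N.
Proof. exact: (smooth_table g1 uloc sloc t1E ok15). Qed.

Lemma good_open2 : good open2.
Proof. exact: (smooth_good g1 uloc sloc t1E ok15). Qed.

Let open2_off x : x \notin loc -> turn open2 x = turn D x.
Proof.
move=> xo; rewrite (smooth_table_off g1 uloc sloc t1E ok15 xo).
exact: (smooth_table_off g uloc sloc tE ok1 xo).
Qed.

Let ncase x : (exists2 i, (i < 8)%N & x = d i) \/ (x \notin loc).
Proof.
have [xl|] := boolP (x \in loc); [left | by right].
by exists (index x loc); [rewrite index_mem | rewrite /d nth_index].
Qed.

Let turn_off x : (turn D x \in loc) = (x \in loc).
Proof.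
have imp y : y \in loc -> turn D y \in loc.
  move/(nthP a)=> [i]; rewrite sloc => i8 <-; by rewrite -/(d i) tE // mem_nth ?tn.
by apply/idP/idP=> [/imp/imp/imp|/imp//]; rewrite (turn4 g).
Qed.

(** Each dart of the bigon is pasted by the move to a dart outside it, which determines whether it
    belongs to the sublink. *)
Let open2_ext (A B : pred (dart D)) : @sublink open2 A -> @sublink open2 B ->
  (forall y, y \notin [:: d 0; d 1; d 4; d 5] -> A y = B y) -> A =1 B.
Proof.
move=> [_ _ An] [_ _ Bn] AB y.
have E2 i : (i < 8)%N -> ~~ @crossing open2 (d i).
  by rewrite /crossing; case: i => [|[|[|[|[|[|[|[|i]]]]]]]] // _; rewrite !t15E // eqxx.
have step i j : (i < 8)%N -> (nth 0 [:: 3; 2; 1; 0; 7; 6; 5; 4] i)%N = j ->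
    d j \notin [:: d 0; d 1; d 4; d 5] -> A (d i) = B (d i).
  move=> i8 ij jo; have := AB _ jo.
  by rewrite -ij -t15E // An ?Bn ?E2.
have [yi|/AB//] := boolP (y \in [:: d 0; d 1; d 4; d 5]).
by move: yi; rewrite !inE => /or4P[]/eqP->; [apply: (step 0 3)%N | apply: (step 1 2)%N
  | apply: (step 4 7)%N | apply: (step 5 6)%N] => //; rewrite !inE !dE.
Qed.

(** The move makes the two edges of the bigon change strands; [sw] exchanges their darts at each
    crossing, so that pulling [B] back along it gives a sublink of [D]. The last clause is the
    uniqueness from [open2_ext]. *)
Lemma bigon_extend (B : pred (dart D)) : @sublink open2 B ->
  exists A (sA : @sublink D A), ((exists y, ~~ B y) -> exists x, ~~ A x) /\
  forall C, @sublink open2 C -> (forall y, y \notin [:: d 0; d 1; d 4; d 5] -> C y = A y) -> C =1 B.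
Proof.
move=> sB; pose sw x := if x == d 0 then d 1 else if x == d 1 then d 0
  else if x == d 4 then d 5 else if x == d 5 then d 4 else x.
have swd i : (i < 8)%N -> sw (d i) = d (nth 0 [:: 1; 0; 2; 3; 5; 4; 6; 7] i)%N.
  by move=> i8; rewrite /sw !dE //; case: i i8 => [|[|[|[|[|[|[|[|i]]]]]]]].
have swo x : x \notin loc -> sw x = x by move=> xo; rewrite /sw !off_d.
have swo' x : x \notin [:: d 0; d 1; d 4; d 5] -> sw x = x.
  by rewrite /sw !inE !negb_or => /and4P[/negbTE-> /negbTE-> /negbTE-> /negbTE->].
have swK x : sw (sw x) = x.
  have [|/swo' xo] := boolP (x \in [:: d 0; d 1; d 4; d 5]); last by rewrite !xo.
  by rewrite !inE => /or4P[]/eqP->; rewrite !swd.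
have e0 : edge D (d 0) = d 5 := ea; have e4 : edge D (d 4) = d 1 := eb.
have e5 : edge D (d 5) = d 0 by rewrite -e0 (edgeK g).
have e1 : edge D (d 1) = d 4 by rewrite -e4 (edgeK g).
have [Be B2 Bn] := sB.
have Bt i : (i < 8)%N -> B (d (nth 0 [:: 3; 2; 1; 0; 7; 6; 5; 4] i)%N) = B (d i).
  move=> i8; rewrite -t15E // Bn // /crossing.
  by case: i i8 => [|[|[|[|[|[|[|[|i]]]]]]]] // _; rewrite !t15E // eqxx.
exists (fun x => B (sw x)); unshelve eexists; last split.
- split=> x.
  + have [xi|xi] := boolP (x \in [:: d 0; d 1; d 4; d 5]).
      by move: xi; rewrite !inE => /or4P[]/eqP->; rewrite ?(e0, e1, e4, e5) !swd //;
        rewrite -[RHS]Be -[edge open2 _]/(edge D _) ?(e0, e1, e4, e5).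
    have xi' : edge D x \notin [:: d 0; d 1; d 4; d 5].
      apply: contra xi; rewrite !inE !(can2_eq (edgeK g) (edgeK g)) e0 e1 e4 e5.
      by case/or4P=> ->; rewrite ?orbT.
    by rewrite !swo' //; apply: Be.
  + case: (ncase x) => [[i i8 ->]|xo]; last first.
      by have := B2 x; rewrite !open2_off ?turn_off // !swo ?turn_off.
    case: i i8 => [|[|[|[|[|[|[|[|i]]]]]]]] // _; rewrite !tE // !swd //.
    - exact: (Bt 1%N). - exact: (Bt 0%N). - exact: (Bt 2%N). - exact: (Bt 3%N).
    - exact: (Bt 5%N). - exact: (Bt 4%N). - exact: (Bt 6%N). - exact: (Bt 7%N).
  + case: (ncase x) => [[i i8 ->]|xo]; first by rewrite cd.
    by have := Bn x; rewrite /crossing !open2_off ?turn_off // !swo ?turn_off.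
- by case=> y nBy; exists (sw y); rewrite swK.
- move=> C sC CA; apply: open2_ext => // y yo; rewrite CA //.
  by rewrite swo'.
Qed.

Section Deletion.
Variables (A : pred (dart D)) (sA : sublink A).
Hypothesis exA : exists x, ~~ A x.
Let Ae x : A (edge D x) = A x. Proof. by case: sA. Qed.
Let A2 x : A (turn D (turn D x)) = A x. Proof. by case: sA. Qed.

(* The bigon is bounded by one strand in A and one strand not in A; separating
   them exchanges the edges of the bigon. *)
Lemma del_bigon_mixed (gE : good open2) : ~~ A a -> A (turn D a) ->
  exists B (sB : @sublink open2 B), [/\ exists y, ~~ B y, near 0 (del g sA) (del gE sB) &
    forall y, y \notin [:: d 0; d 1; d 4; d 5] -> B y = A y].
Proof.
move=> nA0 A1; pose B x := if x \in [:: d 1; d 4] then false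
  else if x \in [:: d 0; d 5] then true else A x.
have Ad i : (i < 8)%N -> A (d i) = (i \in [:: 1; 3; 4; 6]%N).
  have a2 : A (d 2) = A (d 0) := A2 (d 0); have a3 : A (d 3) = A (d 1) := A2 (d 1).
  have a5 : A (d 5) = A (d 0) by rewrite -[d 5]ea Ae.
  have a4 : A (d 4) = A (d 1) by rewrite -[d 1]eb Ae.
  have a6 : A (d 6) = A (d 4) := A2 (d 4); have a7 : A (d 7) = A (d 5) := A2 (d 5).
  have a1 : A (d 1) = true := A1; have a0 : A (d 0) = false := negbTE nA0.
  by case: i => [|[|[|[|[|[|[|[|i]]]]]]]] // _;
    rewrite ?a7 ?a6 ?a5 ?a4 ?a3 ?a2 ?a1 ?a0.
have Bd i : (i < 8)%N -> B (d i) = (i \in [:: 0; 3; 5; 6]%N).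
  move=> i8; rewrite /B !inE !dE // Ad //.
  by case: i i8 => [|[|[|[|[|[|[|[|i]]]]]]]].
have Boff x : x \notin loc -> B x = A x by move=> xo; rewrite /B !inE !off_d.
have e0 : edge D (d 0) = d 5 := ea; have e4 : edge D (d 4) = d 1 := eb.
have e5 : edge D (d 5) = d 0 by rewrite -e0 (edgeK g).
have e1 : edge D (d 1) = d 4 by rewrite -e4 (edgeK g).
have inE' x : (edge D x \in [:: d 0; d 1; d 4; d 5]) = (x \in [:: d 0; d 1; d 4; d 5]).
  rewrite !inE !(can2_eq (edgeK g) (edgeK g)) e0 e1 e4 e5.
  by case: (x == d 0); case: (x == d 1); case: (x == d 4); case: (x == d 5).
have Bout x : x \notin [:: d 0; d 1; d 4; d 5] -> B x = A x.
  by rewrite /B !inE !negb_or => /and4P[/negbTE-> /negbTE-> /negbTE-> /negbTE->].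
have E2 i : (i < 8)%N -> turn open2 (turn open2 (d i)) = d i.
  by case: i => [|[|[|[|[|[|[|[|i]]]]]]]] // _; rewrite !t15E.
have sB : @sublink open2 B.
  split=> x; rewrite -?[edge open2 x]/(edge D x).
  - have [xi|xi] := boolP (x \in [:: d 0; d 1; d 4; d 5]); last first.
      by rewrite !Bout ?inE'.
    by move: xi; rewrite !inE => /or4P[]/eqP->; rewrite ?(e0, e1, e4, e5) !Bd.
  - case: (ncase x) => [[i i8 ->]|xo]; first by rewrite E2.
    by rewrite !open2_off ?turn_off // !Boff ?turn_off.
  - case: (ncase x) => [[i i8 ->]|xo].
      by move=> _; case: i i8 => [|[|[|[|[|[|[|[|i]]]]]]]] // _; rewrite t15E // !Bd.
    rewrite /crossing !open2_off ?turn_off // => cx; rewrite !Boff ?turn_off //.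
    by case: sA => _ _; apply.
exists B, sB; split=> //; first by exists (d 1); rewrite Bd.
pose f x := if x == d 0 then d 1 else if x == d 5 then d 4 else x.
pose f' x := if x == d 1 then d 0 else if x == d 4 then d 5 else x.
have fd i : (i < 8)%N -> f (d i) = d (nth 0 [:: 1; 1; 2; 3; 4; 4; 6; 7] i)%N.
  by move=> i8; rewrite /f !dE //; case: i i8 => [|[|[|[|[|[|[|[|i]]]]]]]].
have f'd i : (i < 8)%N -> f' (d i) = d (nth 0 [:: 0; 0; 2; 3; 5; 5; 6; 7] i)%N.
  by move=> i8; rewrite /f' !dE //; case: i i8 => [|[|[|[|[|[|[|[|i]]]]]]]].
have foff x : x \notin loc -> f x = x by move=> xo; rewrite /f !off_d.
have f'off x : x \notin loc -> f' x = x by move=> xo; rewrite /f' !off_d.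
have del_in i : (i < 8)%N -> ~~ A (d i) -> del_turn_fun A (d i) = d (nth 0 [:: 2; 1; 0; 3; 4; 7; 6; 5] i)%N.
  move=> i8; rewrite Ad // => iA; rewrite /del_turn_fun.
  by case: i i8 iA => [|[|[|[|[|[|[|[|i]]]]]]]] // _ _; rewrite !tE // Ad.
have del_in' i : (i < 8)%N -> ~~ B (d i) -> @del_turn_fun open2 B (d i) = d (nth 0 [:: 3; 2; 1; 0; 7; 6; 5; 4] i)%N.
  move=> i8; rewrite Bd // => iA; rewrite /del_turn_fun.
  by case: i i8 iA => [|[|[|[|[|[|[|[|i]]]]]]]] // _ _; rewrite !t15E // Bd.
have eR := del_region_equiv gE sB.
have sub x y : region D x y -> @del_region open2 B x y.
  by move=> xy; apply/del_region_sub/merge_sub/merge_sub.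
apply: (@val_del_iso D open2 A B g gE sA sB f f') => //.
- move=> x; case: (ncase x) => [[i i8 ->]|xo]; last by rewrite foff // Boff.
  rewrite Ad // fd // => iA; case: i i8 iA => [|[|[|[|[|[|[|[|i]]]]]]]] // _ _; by rewrite Bd.
- move=> x; case: (ncase x) => [[i i8 ->]|xo]; last by rewrite f'off // Boff.
  rewrite Bd // f'd // => iA; case: i i8 iA => [|[|[|[|[|[|[|[|i]]]]]]]] // _ _; by rewrite Ad.
- move=> x; case: (ncase x) => [[i i8 ->]|xo]; last by rewrite foff // f'off.
  rewrite Ad // => iA; case: i i8 iA => [|[|[|[|[|[|[|[|i]]]]]]]] // _ _; by rewrite fd // f'd.
- move=> x; case: (ncase x) => [[i i8 ->]|xo]; last by rewrite f'off // foff.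
  rewrite Bd // => iA; case: i i8 iA => [|[|[|[|[|[|[|[|i]]]]]]]] // _ _; by rewrite f'd // fd.
- move=> x nAx; rewrite -[edge open2 _]/(edge D (f x)).
  have [xi|xi] := boolP (x \in [:: d 0; d 1; d 4; d 5]); last first.
    have fout y : y \notin [:: d 0; d 1; d 4; d 5] -> f y = y.
      by rewrite /f !inE !negb_or => /and4P[/negbTE-> _ _ /negbTE->].
    by rewrite !fout ?inE'.
  by move: xi nAx; rewrite !inE => /or4P[]/eqP->; rewrite ?(e0, e1, e4, e5) ?Ad // => _;
    rewrite !fd // ?(e0, e1, e4, e5).
- move=> x; case: (ncase x) => [[i i8 ->]|xo nAx].
    move=> iA; rewrite del_in //; move: iA; rewrite Ad // => iA.
    rewrite fd //; case: i i8 iA => [|[|[|[|[|[|[|[|i]]]]]]]] // _ _; by rewrite fd // del_in' // Bd.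
  rewrite /del_turn_fun (foff x) // !open2_off ?turn_off // Boff ?turn_off //.
  by case: ifP => _; rewrite foff ?turn_off.
- move=> x; case: (ncase x) => [[i i8 ->]|xo]; last by rewrite foff.
  by rewrite tE // Ad // => iA; rewrite Ad ?tn // => tA; case: i i8 iA tA => [|[|[|[|[|[|[|[|i]]]]]]]].
have re x : B x -> @del_region open2 B x (edge D x) by move=> Bx; apply: (@del_region_edge open2).
pose F x := if inside x then d 1 else x.
have Fhom := collapse_hom (d 1) eR inside_region sub.
have Ff x : ~~ A x -> @del_region open2 B (F x) (f x).
  case: (ncase x) => [[i i8 ->]|xo]; last by rewrite /F inside_off // foff // => _; apply: (eqrel_refl eR).
  rewrite Ad // /F insideE // fd //.
  case: i i8 => [|[|[|[|[|[|[|[|i]]]]]]]] // _ _; try exact: (eqrel_refl eR).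
  apply: (eqrel_trans eR _ (sub _ _ r04)); rewrite -e0; apply: (eqrel_sym eR).
  by apply: re; rewrite Bd.
move=> x y nAx nAy xy.
apply: (eqrel_trans eR (eqrel_sym eR (Ff _ nAx))); apply: (eqrel_trans eR _ (Ff _ nAy)).
move: x y xy {nAx nAy}; apply: (@del_region_hom D A _ (@del_region open2 B) F eR Fhom) => x Ax.
have [xi|xi] := boolP (x \in [:: d 0; d 1; d 4; d 5]).
  move: xi Ax; rewrite !inE => /or4P[]/eqP->; rewrite Ad // => _; rewrite ?(e1, e4) /F !insideE //.
    exact: (eqrel_refl eR).
  exact: (eqrel_refl eR).
have Fout y : y \notin [:: d 0; d 1; d 4; d 5] -> F y = y.
  by rewrite /F /inside !inE !negb_or -[d 0]/a -[d 4]/b => /and4P[/negbTE-> _ /negbTE-> _].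
by rewrite !Fout ?inE' //; apply: re; rewrite Bout.
Qed.
(** When both strands are deleted the two smoothings are invisible; when both are kept the bigon
    survives the deletion, and the move is performed there. *)
Lemma del_bigon_same (gE : good open2) : over D a = over D (edge D a) -> A (turn D a) = A a ->
  exists sE : @sublink open2 A, near 0 (del g sA) (del gE sE).
Proof.
move=> ov Aeq; have c1 : crossing (d 1) by rewrite cd.
have c5 : @crossing (smooth (d 1)) (d 5) := @smooth_crossing (smooth (d 1)) a loc 8 uloc sloc _ _ 5 t1E ok15.
have a2 : A (d 2) = A (d 0) := A2 (d 0); have a1 : A (d 1) = A (d 0) := Aeq.
have a5 : A (d 5) = A (d 0) by rewrite -[d 5]ea Ae.
have a4 : A (d 4) = A (d 1) by rewrite -[d 4](edgeK g) Ae -[edge D (d 4)]/(edge D b) eb.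
have a6 : A (d 6) = A (d 4) := A2 (d 4).
have t1 : turn D (d 1) = d 2 by [].
have t5 : turn (smooth (d 1)) (d 5) = d 6 by exact: t1E.
have sS1 : @sublink (smooth (d 1)) A by apply: sublink_smooth; rewrite // t1 a2 a1.
have sS : @sublink open2 A by apply: (sublink_smooth g1 sS1 c5); rewrite t5 a6 a4 a1 a5.
exists sS; rewrite (Prop_irrelevance gE (good_smooth g1 c5)).
have [Aa|nAa] := boolP (A a).
  have Aa0 : A (d 0) by [].
  have n1 : near 0 (del g sA) (del (good_smooth g c1) sS1).
    by apply: del_smooth_in; rewrite ?t1 ?a2 ?a1.
  have n2 : near 0 (del g1 sS1) (del (good_smooth g1 c5) sS).
    by apply: del_smooth_in; rewrite ?t5 ?a6 ?a4 ?a5 ?a1.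
  by rewrite (Prop_irrelevance (good_smooth g c1) g1) in n1; apply: near0_trans n1 n2.
have na0 : ~~ A (d 0) by []. have na1 : ~~ A (d 1) by rewrite a1.
have na4 : ~~ A (d 4) by rewrite a4 a1. have na5 : ~~ A (d 5) by rewrite a5.
have na6 : ~~ A (d 6) by rewrite a6 a4 a1.
have na2 : ~~ A (d 2) by rewrite a2.
have gd : good (del g sA) by apply: good_del.
pose a' : dart (del g sA) := Sub (d 0) na0; pose b' : dart (del g sA) := Sub (d 4) na4.
have Ad i : (i < 8)%N -> ~~ A (d i).
  have a3 : A (d 3) = A (d 1) := A2 (d 1); have a7 : A (d 7) = A (d 5) := A2 (d 5).
  by case: i => [|[|[|[|[|[|[|[|i]]]]]]]] // _; rewrite ?a3 ?a7.
have vt (x : dart (del g sA)) i : (i < 8)%N -> val x = d i -> val (turn (del g sA) x) = d (nth 0%N t i).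
  by move=> i8 ex; rewrite val_del_turn ex del_turn_out tE // Ad // tn.
have vb' : val b' = d 4 by []. have va' : val a' = d 0 by [].
have fa : face (del g sA) a' = b'.
  apply: (@val_inj _ _ (del_dart A)); rewrite (faceE gd).
  have e0 : val (edge (del g sA) a') = d 5 by exact: (etrans (val_del_edge a') ea).
  exact: (vt _ 7%N isT (vt _ 6%N isT (vt _ 5%N isT e0))).
have fb' : face (del g sA) b' = a'.
  apply: (@val_inj _ _ (del_dart A)); rewrite (faceE gd).
  have e0 : val (edge (del g sA) b') = d 1 by exact: (etrans (val_del_edge b') eb).
  exact: (vt _ 3%N isT (vt _ 2%N isT (vt _ 1%N isT e0))).
have ca' : crossing a' by apply: crossing_Sub.
have cb' : crossing b' by apply: crossing_Sub; rewrite ?cd // tE // Ad.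
have cta : crossing (turn (del g sA) a') by rewrite crossing_turn.
have ctb : crossing (turn (del g sA) b') by rewrite crossing_turn.
have ba' : b' \notin vertex a'.
  rewrite !inE -!(inj_eq val_inj) (vt _ 0%N isT va') (vt _ 1%N isT (vt _ 0%N isT va')).
  by rewrite (vt _ 2%N isT (vt _ 1%N isT (vt _ 0%N isT va'))) va' vb' !dE.
have big : bigon a'.
  split; rewrite ?fa //.
  - by rewrite (porbit_vertex gd).
  - by rewrite -[LHS]/(over D (d 0)) -[RHS]/(over D (val (edge (del g sA) a'))) val_del_edge.
  - move=> x ax; have : inside (val x).
      have ia : inside (val a') by rewrite insideE.
      suff <- : inside (val a') = inside (val x) by [].
      apply: (connect_invariant (r := del_rel A) (f := inside)) ax.
      move=> u v /orP[/inside_region//|/andP[Au /eqP->]].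
      have nin w : A w -> inside w = false.
        by move=> Aw; apply/negP=> /orP[]/eqP e; move: Aw; rewrite e; apply/negP;
           [exact: na0 | exact: na4].
      by rewrite !nin ?Ae.
    case/orP=> /eqP ex.
      have -> : x = a' by apply: (@val_inj _ _ (del_dart A)).
      exact: porbit_id.
    have -> : x = b' by apply: (@val_inj _ _ (del_dart A)).
    by rewrite -fa; have := mem_porbit (face (del g sA)) 1 a'; rewrite expg1.
have gs1 : good (smooth (turn (del g sA) a')) by apply: good_smooth.
have tba : turn (del g sA) b' \notin vertex (turn (del g sA) a').
  by rewrite (vertex_turn gd) vertex_sym // (vertex_turn gd) vertex_sym.
have cs : @crossing (smooth (turn (del g sA) a')) (turn (del g sA) b').
  by apply: smooth_off_crossing.
have gs2 : good (delete_site (Bigon a')) by rewrite /delete_site fa; apply: good_smooth.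
apply: near0_trans (near_site gd gs2 big) _; rewrite /delete_site fa.
have e1 : turn (del g sA) a' = Sub (d 1) na1.
  by apply: (@val_inj _ _ (del_dart A)); rewrite (vt _ 0%N isT va').
have e5 : turn (del g sA) b' = Sub (d 5) na5.
  by apply: (@val_inj _ _ (del_dart A)); rewrite (vt _ 4%N isT vb').
rewrite e1 e5 in gs1 gs2 cs *.
have gS1 : good (del (good_smooth g c1) sS1) by apply: good_del.
have iso1 := del_smooth_out_iso g sA exA c1 sS1 na1.
have r1 := smooth_refines gs1 gS1 cs (iso_refines (iso1 na2)).
apply: near0_trans (near_refines _ _ r1) _.
- by rewrite /delete_site fa e1 e5 in gs2.
- refine (@good_smooth (del (good_smooth g c1) sS1) gS1 _ _).
  by refine (crossing_Sub (good_smooth g c1) sS1 c5 na5 _); rewrite t5.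
- rewrite -[in good_smooth g1 c5](Prop_irrelevance (good_smooth g c1) g1).
  by apply: del_smooth_out; rewrite ?t5.
Qed.
End Deletion.
End Bigon.

Lemma bigon_facts D (g : good D) (a : dart D) : bigon a ->
  [/\ crossing a, crossing (face D a), face D a \notin vertex a, face D (face D a) = a
    & over D a = over D (edge D a)] /\ (forall x, region D a x -> x = a \/ x = face D a).
Proof.
case=> [[ca cb] ba fb ov disk]; split; first by rewrite -(porbit_vertex g).
move=> x /disk/porbitP[i ->]; elim: i => [|i [e|e]]; first by rewrite expg0 perm1; left.
  by right; rewrite expgSr permM e.
by left; rewrite expgSr permM e.
Qed.

(** The mixed case is available when the strand along [a] is kept. Otherwise the roles of the two
    corners are exchanged, which performs the two smoothings in the other order; the sublink is
    carried back along [smoothC_iso]. *)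
Lemma del_bigon D (g : good D) (A : pred (dart D)) (sA : sublink A) (a : dart D)
    (gE : good (delete_site (Bigon a))) : (exists x, ~~ A x) -> bigon a ->
  exists B (sB : @sublink (delete_site (Bigon a)) B),
    [/\ exists y, ~~ B y, near 0 (del g sA) (del gE sB) &
    forall y, y \notin [:: a; turn D a; face D a; turn D (face D a)] -> B y = A y].
Proof.
move=> exA /(bigon_facts g)[[ca cb ba fb ov] disk]; have [Ae _ _] := sA.
have [Aeq|Aneq] := eqVneq (A (turn D a)) (A a).
  have [sE n] := del_bigon_same g ca cb ba fb disk sA exA gE ov Aeq.
  by exists A, sE.
have [Aa|nAa] := boolP (A a); last first.
  apply: (del_bigon_mixed g ca cb ba fb disk sA exA gE nAa).
  by move: Aneq; rewrite (negbTE nAa); case: (A _).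
have eb : edge D (face D a) = turn D a by rewrite -{2}fb (faceE g (face D a)) (turn4 g).
have ea : edge D a = turn D (face D a) by rewrite (faceE g) (turn4 g).
have ab : face D (face D a) \notin vertex (face D a) by rewrite fb vertex_sym.
have ffb : face D (face D (face D a)) = face D a by rewrite fb.
have disk' x : region D (face D a) x -> x = face D a \/ x = face D (face D a).
  by rewrite fb => bx; apply/or_comm/disk; apply: (regT g (reg_face g a) bx).
have cfb : crossing (face D (face D a)) by rewrite fb.
have ct : crossing (turn D a) by rewrite crossing_turn.
have ctb : crossing (turn D (face D a)) by rewrite crossing_turn.
have tba : turn D a \notin vertex (turn D (face D a)).
  by rewrite (vertex_turn g) vertex_sym // (vertex_turn g).
have iso := smoothC_iso g ctb ct tba.
have gE' : good (@smooth (smooth (turn D (face D a))) (turn D a)).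
  by have := good_open2 g cb cfb ab; rewrite fb.
have := del_bigon_mixed g cb cfb ab ffb disk' sA exA; rewrite fb => /(_ gE') [||B [sB [exB n Bo]]].
- by rewrite -Ae eb; move: Aneq; rewrite Aa; case: (A _).
- by rewrite -ea Ae.
have [B' sB' BB] := refines_sublink gE (iso_refines iso) sB.
exists B', sB'; split; first by have [y nBy] := exB; exists y; rewrite (BB y).
  exact: near0_trans n (del_refines gE' gE (iso_refines iso) sB sB' exB BB).
move=> y y4; rewrite (BB y) Bo //; move: y4; apply: contra; rewrite !inE.
by case/or4P=> ->; rewrite ?orbT.
Qed.

(** [bigon_extend] provides [A]. Following its deletion forwards with [del_bigon] yields a sublink
    equal to [A] off the bigon, which is [B] by uniqueness. *)
Lemma bigon_lift D (g : good D) (a : dart D) (gE : good (delete_site (Bigon a)))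
    (B : pred (dart D)) (sB : @sublink (delete_site (Bigon a)) B) : bigon a ->
    (exists y, ~~ B y) ->
  exists A (sA : @sublink D A), (exists y, ~~ A y) /\ near 0 (del g sA) (del gE sB).
Proof.
move=> big exB; have [[ca cb ba fb ov] disk] := bigon_facts g big.
have [A [sA [exA uA]]] := bigon_extend g ca cb ba fb sB.
exists A, sA; have xA := exA exB; split=> //.
have [C [sC [exC n CA]]] := del_bigon g sA gE xA big.
have CB : C = B by apply/funext/(uA C sC) => y; apply: CA.
by move: sC n {CA exC}; rewrite CB => sC; rewrite (Prop_irrelevance sC sB).
Qed.

(** Allows [triangle_open] to treat at once a smoothing and the same smoothing followed by two
    crossing changes. *)
Definition set_over (D : udiagram) (o : dart D -> bool) : udiagram :=
  {| dart := dart D; edge := edge D; turn := turn D; over := o; region := region D |}.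

(** * Sliding a strand across a triangle *)

Section Triangle.
Variables (D : udiagram) (g : good D) (a : dart D).
Local Notation b := (face D a).
Local Notation c := (face D b).
Hypothesis tri : triangle a.
Local Notation E := (slide_triangle a).
Hypothesis gE : good E.

Let cra : crossing a. Proof. by case: tri => -[]. Qed.
Let crb : crossing b. Proof. by case: tri => -[]. Qed.
Let crc : crossing c. Proof. by case: tri => -[]. Qed.
Let fc : face D c = a. Proof. by case: tri. Qed.

(** Four positions per crossing, from [a], from [b] and from [c]; in [e], 12 marks an edge that
    leaves the site. The list [tt] is the slide permutation on positions; conjugating [t] by it
    gives the table [te] of turns after the move. *)
Let loc := vertex a ++ vertex b ++ vertex c.
Local Notation d := (nth a loc).
Local Notation t := [:: 1; 2; 3; 0; 5; 6; 7; 4; 9; 10; 11; 8]%N.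
Local Notation e := [:: 5; 8; 12; 12; 9; 0; 12; 12; 1; 4; 12; 12]%N.
Local Notation tt := [:: 7; 10; 5; 8; 11; 2; 9; 0; 3; 6; 1; 4]%N.

Let uloc : uniq loc.
Proof.
case: tri => _ []; rewrite !(porbit_vertex g) => ba cb ac _ _ _.
have dis (x y : dart D) : y \notin vertex x -> ~~ has [in vertex x] (vertex y).
  move=> yx; apply/hasPn=> z zy; apply: contra yx => zx.
  by rewrite -(vertex_eq g zx) vertex_sym.
rewrite cat_uniq vertex_uniq // has_cat negb_or dis // dis; last by rewrite vertex_sym.
by rewrite cat_uniq !vertex_uniq // dis.
Qed.
Let sloc : size loc = 12%N. Proof. by []. Qed.
Let dE i j : (i < 12)%N -> (j < 12)%N -> (d i == d j) = (i == j).
Proof. by move=> i8 j8; rewrite nth_uniq. Qed.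
Let off_d x i : x \notin loc -> (i < 12)%N -> (x == d i) = false.
Proof. by move=> xo i8; apply: off_nth xo i8. Qed.

Let tE : turn_table a loc 12 t.
Proof. by case=> [|[|[|[|[|[|[|[|[|[|[|[|i]]]]]]]]]]]] //= _; rewrite (turn4 g). Qed.

Let e0 : edge D (d 0) = d 5. Proof. by rewrite -[d 0]/a -[d 5]/(turn D b) (faceE g) (turn4 g). Qed.
Let e4 : edge D (d 4) = d 9. Proof. by rewrite -[d 4]/b -[d 9]/(turn D c) (faceE g b) (turn4 g). Qed.
Let e8 : edge D (d 8) = d 1.
Proof. by rewrite -[d 8]/c -[d 1]/(turn D a) -{2}fc (faceE g c) (turn4 g). Qed.

Let eE i : (i < 12)%N -> (nth 0 e i < 12)%N -> edge D (d i) = d (nth 0 e i)%N.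
Proof.
case: i => [|[|[|[|[|[|[|[|[|[|[|[|i]]]]]]]]]]]] // _ _.
- by rewrite -e8 (edgeK g).
- by rewrite -e0 (edgeK g).
- by rewrite -e4 (edgeK g).
Qed.

Let cd i : (i < 12)%N -> crossing (d i).
Proof. by case: i => [|[|[|[|[|[|[|[|[|[|[|[|i]]]]]]]]]]]] //= _; rewrite !crossing_turn. Qed.

Let inside : pred (dart D) := fun x => x \in porbit (face D) a.
Let insideP x : inside x = (x \in [:: d 0; d 4; d 8]).
Proof.
apply/porbitP/idP => [[i ->]|].
  elim: i => [|i]; first by rewrite expg0 perm1 inE eqxx.
  by rewrite !inE expgSr permM => /or3P[]/eqP->; rewrite ?fc eqxx ?orbT.
rewrite !inE => /or3P[]/eqP->.
- by exists 0%N; rewrite expg0 perm1.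
- by exists 1%N; rewrite expg1.
- by exists 2%N; rewrite expgS expg1 permM.
Qed.
Let insideE i : (i < 12)%N -> inside (d i) = (i \in [:: 0; 4; 8]%N).
Proof. by move=> i12; rewrite insideP !inE !dE. Qed.
Let inside_off x : x \notin loc -> inside x = false.
Proof. by move=> xo; rewrite insideP !inE !off_d. Qed.

Let inside_region x y : region D x y -> inside x = inside y.
Proof.
suff imp u v : region D u v -> inside u -> inside v.
  by move=> rxy; apply/idP/idP; apply: imp => //; apply: regS.
have [_ _ _ _ disk] := tri; move=> ruv iu; apply: disk.
apply: (regT g _ ruv); move: iu; rewrite insideP !inE => /or3P[]/eqP->.
- exact: regxx.
- exact: reg_face.
- exact: (regT g (reg_face g a) (reg_face g b)).
Qed.

Let r_in i j : (i < 12)%N -> (j < 12)%N -> i \in [:: 0; 4; 8]%N -> j \in [:: 0; 4; 8]%N ->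
  region D (d i) (d j).
Proof.
have r0 k : k \in [:: 0; 4; 8]%N -> region D (d 0) (d k).
  rewrite !inE => /or3P[]/eqP->; first exact: regxx.
    exact: reg_face.
  exact: (regT g (reg_face g a) (reg_face g b)).
by move=> _ _ /r0 ri /r0; apply: (regT g (regS g ri)).
Qed.

Let r53 : region D (d 5) (d 3). Proof. by rewrite -e0; apply: reg_corner. Qed.
Let r97 : region D (d 9) (d 7). Proof. by rewrite -e4; apply: reg_corner. Qed.
Let r111 : region D (d 1) (d 11). Proof. by rewrite -e8; apply: reg_corner. Qed.
Definition slide_perm : {perm dart D} :=
  (swap_ends a * swap_ends b * swap_ends c)%g.

Let tperm_d i j k : (i < 12)%N -> (j < 12)%N -> (k < 12)%N ->
  tperm (d i) (d j) (d k) = d (if k == i then j else if k == j then i else k).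
Proof.
by move=> i12 j12 k12; rewrite permE /= !dE //; case: ifP => // _; case: ifP.
Qed.

Let acrossE i : (i < 12)%N -> across (d i) = turn D (turn D (d i)).
Proof. by move=> i12; rewrite /across cd. Qed.

Let slide_permE i : (i < 12)%N -> slide_perm (d i) = d (nth 0 tt i)%N.
Proof.
rewrite /slide_perm /swap_ends -[a]/(d 0) -[face D (d 0)]/(d 4) -[face D (d 4)]/(d 8).
rewrite e0 e4 e8 !acrossE // !tE // => i12; rewrite !permM.
by case: i i12 => [|[|[|[|[|[|[|[|[|[|[|[|i]]]]]]]]]]]] // _; rewrite !tperm_d.
Qed.

Let slide_perm_off x : x \notin loc -> slide_perm x = x.
Proof.
rewrite /slide_perm /swap_ends -[a]/(d 0) -[face D (d 0)]/(d 4) -[face D (d 4)]/(d 8).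
rewrite e0 e4 e8 !acrossE // !tE // => xo; rewrite !permM.
by do 6![rewrite (tpermD (z := x)); [|by rewrite eq_sym off_d|by rewrite eq_sym off_d]].
Qed.

Lemma slide_permK : involutive slide_perm.
Proof.
move=> x; have [xl|xo] := boolP (x \in loc); last by rewrite !slide_perm_off.
have i12 : (index x loc < 12)%N by rewrite index_mem.
rewrite -(nth_index a xl); case: (index x loc) i12 => [|[|[|[|[|[|[|[|[|[|[|[|i]]]]]]]]]]]] // _;
  by rewrite !slide_permE.
Qed.

Lemma slide_turn x : turn E (slide_perm x) = slide_perm (turn D x).
Proof. exact: permJ. Qed.

Lemma slide_over x : over E (slide_perm x) = over D x.
Proof. by rewrite -{2}[x]slide_permK. Qed.

Local Notation te := [:: 11; 4; 9; 6; 3; 8; 1; 10; 7; 0; 5; 2]%N.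

Let teE : @turn_table E a loc 12 te.
Proof.
move=> i i12; rewrite -[d i]slide_permK slide_turn slide_permE //.
by case: i i12 => [|[|[|[|[|[|[|[|[|[|[|[|i]]]]]]]]]]]] // _; rewrite tE // slide_permE.
Qed.

Let te_off x : x \notin loc -> turn E x = turn D x.
Proof.
move=> xo; rewrite -{1}[x]slide_perm_off // slide_turn slide_perm_off //.
apply: contra xo => /(nthP a)[i]; rewrite sloc => i12 e1.
have: turn D (turn D (turn D (turn D x))) \in loc; last by rewrite (turn4 g).
rewrite -e1 !tE //; by case: i i12 {e1} => [|[|[|[|[|[|[|[|[|[|[|[|i]]]]]]]]]]]] // _; apply: mem_nth.
Qed.

Let old x := if inside x then across (face D (face D x))
             else if inside (edge D x) then edge D x else x.

Lemma slide_region x y : region E x y = region D (old x) (old y).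
Proof. by []. Qed.

Let inside_edge x : inside (edge D x) = (x \in [:: d 5; d 9; d 1]).
Proof.
by rewrite insideP !inE !(can2_eq (edgeK g) (edgeK g)) e0 e4 e8.
Qed.

Let oldE i : (i < 12)%N ->
  old (d i) = d (nth 0 [:: 10; 8; 2; 3; 2; 0; 6; 7; 6; 4; 10; 11] i)%N.
Proof.
move=> i12; rewrite /old insideE // inside_edge !inE !dE //.
case: i i12 => [|[|[|[|[|[|[|[|[|[|[|[|i]]]]]]]]]]]] // _.
- by rewrite -[face D (face D _)]/(d 8) acrossE // !tE.
- by rewrite -e8 (edgeK g).
- by rewrite -[face D (d 4)]/(d 8) -[face D (d 8)]/(face D c) fc -[a]/(d 0) acrossE // !tE.
- by rewrite -e0 (edgeK g).
- by rewrite -[face D (d 8)]/(face D c) fc -[face D a]/(d 4) acrossE // !tE.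
- by rewrite -e4 (edgeK g).
Qed.

Let old_off x : x \notin loc -> old x = x.
Proof. by move=> xo; rewrite /old inside_off // inside_edge !inE !off_d. Qed.

Let ncase x : (exists2 i, (i < 12)%N & x = d i) \/ (x \notin loc).
Proof.
have [xl|] := boolP (x \in loc); [left | by right].
by exists (index x loc); rewrite ?nth_index // index_mem.
Qed.

(* A dart of E on the left of which one finds the region of x, for x outside of
   the vanishing triangle. *)
Let new x := if x == d 1 then d 11 else if x == d 5 then d 3
             else if x == d 9 then d 7 else x.

Let r_old_new x : ~~ inside x -> region D x (old (new x)).
Proof.
case: (ncase x) => [[i i12 ->]|xo _]; last first.
  by rewrite /new !off_d // old_off //; apply: regxx.
rewrite insideE // /new !dE //.
by case: i i12 => [|[|[|[|[|[|[|[|[|[|[|[|i]]]]]]]]]]]] // _ _; rewrite oldE //; apply: regxx.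
Qed.

(** The map of regions from [D] to the slid diagram. The triangle of [D] has no counterpart there,
    and [p] is chosen in each use according to the region to which a smoothing or a deletion joins
    it. *)
Let moved p x := if inside x then p else new x.

Let moved_hom (R : rel (dart D)) p : equivalence_rel R ->
  (forall x y, region D (old x) (old y) -> R x y) ->
  forall x y, region D x y -> R (moved p x) (moved p y).
Proof.
move=> eR sub x y rxy; rewrite /moved (inside_region rxy).
case: ifP => [_|iy]; first exact: eqrel_refl.
apply: sub; have ix : ~~ inside x by rewrite (inside_region rxy) iy.
apply: (regT g (regS g (r_old_new ix))); apply: (regT g rxy).
by apply: r_old_new; rewrite iy.
Qed.

Let movedE p i : (i < 12)%N -> moved (d p) (d i) =
  d (nth 0 [:: p; 11; 2; 3; p; 3; 6; 7; p; 7; 10; 11] i)%N.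
Proof.
move=> i12; rewrite /moved insideE // /new !dE //.
by case: i i12 => [|[|[|[|[|[|[|[|[|[|[|[|i]]]]]]]]]]]].
Qed.

Let moved_off p x : x \notin loc -> moved p x = x.
Proof. by move=> xo; rewrite /moved inside_off // /new !off_d. Qed.

Let ovE i : (i < 12)%N -> over D (d (nth 0 t i)%N) = ~~ over D (d i).
Proof. by move=> i12; rewrite -tE // (over_turn g) ?cd. Qed.

Let over_slide i : (i < 12)%N -> over E (d i) = over D (d (nth 0 tt i)%N).
Proof. by move=> i12; rewrite -slide_permE // -{1}[d i]slide_permK slide_over. Qed.

Let over_slide_off x : x \notin loc -> over E x = over D x.
Proof. by move=> xo; rewrite -{1}[x]slide_perm_off // slide_over. Qed.

Local Notation t1 := [:: 3; 2; 1; 0; 5; 6; 7; 4; 9; 10; 11; 8]%N.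
Local Notation te1 := [:: 11; 4; 9; 6; 3; 10; 1; 8; 7; 0; 5; 2]%N.
Local Notation phi1 := [:: 0; 0; 0; 0; 4; 3; 6; 1; 2; 9; 0; 11]%N.

(** With the crossing of [a] opened, the slid crossing of [c] takes the place of that of [b], and
    conversely; [phi1] records this exchange, and [o] the over and under data on the left. *)
Let open_set_over (o : dart D -> bool) :
    good (@set_over (smooth (d 1)) o) ->
    (forall x, x \notin loc -> o x = over D x) ->
    (forall i, (i < 12)%N -> i \notin [:: 0; 1; 2; 3]%N ->
       over E (d (nth 0 phi1 i)%N) = o (d i)) ->
  near 0 (@set_over (smooth (d 1)) o) (@smooth E (d 10)).
Proof.
move=> g1 o_off o_loc.
have ok : smooth_check 12 t t1 1 by [].
have oke : smooth_check 12 te te1 10 by [].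
have g2 : good (@smooth E (d 10)) := smooth_good gE uloc sloc teE oke.
have eR := region_equiv g2.
have sub x y : region D (old x) (old y) -> region (@smooth E (d 10)) x y.
  by move=> xy; apply: merge_sub.
have R2E : region (@smooth E (d 10)) = merge (region E) (d 5) (d 7).
  exact: (smooth_table_region teE oke).
have p57 : region (@smooth E (d 10)) (d 5) (d 7).
  by rewrite R2E; apply/merge_pair/region_equiv.
have same i j : (i < 12)%N -> (j < 12)%N -> region D (old (d i)) (old (d j)) ->
  region (@smooth E (d 10)) (d i) (d j) by move=> _ _; apply: sub.
apply: (@tangle_near_regions _ _ g1 g2 (fun x : dart D => x) a loc 12
  t1 te1 e [:: 0; 1; 2; 3]%N [:: 5; 7; 8; 10]%N phi1 (moved (d 2))) => //.
- by exists id.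
- move=> x xo; rewrite (smooth_table_off gE uloc sloc teE oke xo) te_off //.
  exact: (smooth_table_off g uloc sloc tE ok xo).
- exact: (smooth_table g uloc sloc tE ok).
- exact: (smooth_table gE uloc sloc teE oke).
- by move=> x xo _; rewrite [RHS]o_off // -over_slide_off.
- by move=> i i12 iN _; apply: o_loc.
- move=> x y; rewrite -[region _ x y]/(region (smooth (d 1)) x y).
  rewrite (smooth_table_region tE ok).
  apply: (merge_hom (F := moved (d 2)) eR); first exact: moved_hom.
  by rewrite !movedE //; apply: eqrel_refl.
- move=> i i12 iN; rewrite movedE //.
  case: i i12 iN => [|[|[|[|[|[|[|[|[|[|[|[|i]]]]]]]]]]]] // _ _;
    try by apply: same; rewrite ?oldE //; apply: regxx.
  + by apply: (eqrel_trans eR (eqrel_sym eR p57)); apply: same; rewrite ?oldE //; apply: r_in.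
  + by apply: (eqrel_trans eR (eqrel_sym eR p57)); apply: same; rewrite ?oldE //; apply: r_in.
- by move=> x xo; rewrite moved_off //; exact: (regxx g2).
Qed.

(** The crossings of [b] and [c] trade places along the side that joins them. The far end of this
    side is [turn D c], so [over D b != over D c] means that it is over at both ends or under at
    both, and the data match after the exchange. Otherwise both crossings are changed. *)
Lemma triangle_open :
  near (over D b == over D c).*2 (smooth (turn D a)) (@smooth E (slide_perm (turn D a))).
Proof.
rewrite -[turn D a]/(d 1) slide_permE // -[face D a]/(d 4) -[face D (d 4)]/(d 8).
have ok : smooth_check 12 t t1 1 by [].
have g1 := smooth_good g uloc sloc tE ok; have t1E := smooth_table g uloc sloc tE ok.
have o5 : over D (d 5) = ~~ over D (d 4) := ovE (i := 4) isT.
have o6 : over D (d 6) = ~~ over D (d 5) := ovE (i := 5) isT.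
have o7 : over D (d 7) = ~~ over D (d 6) := ovE (i := 6) isT.
have o9 : over D (d 9) = ~~ over D (d 8) := ovE (i := 8) isT.
have o10 : over D (d 10) = ~~ over D (d 9) := ovE (i := 9) isT.
have o11 : over D (d 11) = ~~ over D (d 10) := ovE (i := 10) isT.
case: eqVneq => [ov|ov]; last first.
  have ov' : over D (d 4) = ~~ over D (d 8) by case: (over D (d 4)) ov; case: (over D _).
  apply: (open_set_over (o := over D) g1) => // i i12 iN; rewrite over_slide //; last first.
    by case: i i12 iN => [|[|[|[|[|[|[|[|[|[|[|[|i]]]]]]]]]]]].
  case: i i12 iN => [|[|[|[|[|[|[|[|[|[|[|[|i]]]]]]]]]]]] // _ _;
    by rewrite [nth 0%N _ _]/= ?o11 ?o10 ?o9 ?o7 ?o6 ?o5 ?ov' ?negbK.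
have c4 : @crossing (smooth (d 1)) (d 4).
  by rewrite (@table_crossing (smooth (d 1)) a loc 12 uloc sloc t1 4 t1E).
have g2 := @good_change (smooth (d 1)) (d 4) g1.
apply: (near_trans (j := 1) (k := 1) (near_change_crossing g1 c4)).
have c8 : @crossing (@change_crossing (smooth (d 1)) (d 4)) (d 8).
  rewrite -[crossing _]/(@crossing (smooth (d 1)) (d 8)).
  by rewrite (@table_crossing (smooth (d 1)) a loc 12 uloc sloc t1 8 t1E).
apply: (near_trans (j := 1) (k := 0) (near_change_crossing g2 c8)).
pose o x := (x \in [:: d 8; d 9; d 10; d 11]) (+) ((x \in [:: d 4; d 5; d 6; d 7]) (+) over D x).
have v4 : @vertex (smooth (d 1)) (d 4) = [:: d 4; d 5; d 6; d 7].
  by rewrite /vertex !t1E.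
have v8 : @vertex (smooth (d 1)) (d 8) = [:: d 8; d 9; d 10; d 11].
  by rewrite /vertex !t1E.
have oE x : over (@change_crossing (@change_crossing (smooth (d 1)) (d 4)) (d 8)) x = o x.
  rewrite -[LHS]/((x \in porbit (turn (smooth (d 1))) (d 8)) (+)
    ((x \in porbit (turn (smooth (d 1))) (d 4)) (+) over D x)).
  by rewrite !(porbit_vertex g1) v4 v8.
have eD : @change_crossing (@change_crossing (smooth (d 1)) (d 4)) (d 8) = @set_over (smooth (d 1)) o.
  rewrite /set_over /change_crossing; congr UDiagram; apply: funext => x.
  exact: oE.
have g3 := @good_change (@change_crossing (smooth (d 1)) (d 4)) (d 8) g2.
rewrite eD in g3 *; apply: open_set_over => // [x xo|i i12 iN].
- by rewrite /o !inE !off_d.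
case: i i12 iN => [|[|[|[|[|[|[|[|[|[|[|[|i]]]]]]]]]]]] // _ _;
  rewrite over_slide // /o !inE !dE //=;
  by rewrite ?o11 ?o10 ?o9 ?o7 ?o6 ?o5 ?ov ?negbK.
Qed.

Let inside_old x : inside (old x) -> x \in [:: d 1; d 5; d 9].
Proof.
case: (ncase x) => [[i i12 ->]|xo]; last by rewrite old_off // inside_off.
by rewrite oldE // !inE !dE //; case: i i12 => [|[|[|[|[|[|[|[|[|[|[|[|i]]]]]]]]]]]] // _;
  rewrite insideE.
Qed.

Local Notation t0 := [:: 1; 0; 3; 2; 5; 6; 7; 4; 9; 10; 11; 8]%N.
Local Notation t05 := [:: 1; 0; 3; 2; 7; 6; 5; 4; 9; 10; 11; 8]%N.
Local Notation t059 := [:: 1; 0; 3; 2; 7; 6; 5; 4; 11; 10; 9; 8]%N.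
Local Notation te7 := [:: 11; 4; 9; 6; 3; 8; 1; 10; 5; 0; 7; 2]%N.
Local Notation te70 := [:: 11; 4; 9; 6; 3; 8; 1; 10; 5; 2; 7; 0]%N.
Local Notation te704 := [:: 11; 6; 9; 4; 3; 8; 1; 10; 5; 2; 7; 0]%N.
Local Notation phi0 := [:: 0; 0; 2; 9; 10; 1; 6; 7; 0; 0; 0; 0]%N.

(* Both sides are simplified by separating the third strand from the smoothed
   crossing. *)
Lemma triangle_close :
  near (over D b == over D c).*2 (smooth a) (@smooth E (slide_perm a)).
Proof.
rewrite -[near _ _ _]/(near (over D (d 4) == over D (d 8)).*2 (smooth (d 0))
  (@smooth E (slide_perm (d 0)))) slide_permE // -[nth 0%N tt 0]/7%N.
have ok0 : smooth_check 12 t t0 0 by [].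
have g0 := smooth_good g uloc sloc tE ok0; have t0E := smooth_table g uloc sloc tE ok0.
have ok05 : smooth_check 12 t0 t05 5 by [].
have g05 := smooth_good g0 uloc sloc t0E ok05; have t05E := smooth_table g0 uloc sloc t0E ok05.
have ok059 : smooth_check 12 t05 t059 9 by [].
have g059 := smooth_good g05 uloc sloc t05E ok059.
have t059E := smooth_table g05 uloc sloc t05E ok059.
have ok7 : smooth_check 12 te te7 7 by [].
have g7 := smooth_good gE uloc sloc teE ok7; have t7E := smooth_table gE uloc sloc teE ok7.
have ok70 : smooth_check 12 te7 te70 0 by [].
have g70 := smooth_good g7 uloc sloc t7E ok70; have t70E := smooth_table g7 uloc sloc t7E ok70.
have ok704 : smooth_check 12 te70 te704 4 by [].
have g704 := smooth_good g70 uloc sloc t70E ok704.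
have t704E := smooth_table g70 uloc sloc t70E ok704.
have o9 : over D (d 9) = ~~ over D (d 8) := ovE (i := 8) isT.
have o10 : over D (d 10) = ~~ over D (d 9) := ovE (i := 9) isT.
have o11 : over D (d 11) = ~~ over D (d 10) := ovE (i := 10) isT.
have o5 : over D (d 5) = ~~ over D (d 4) := ovE (i := 4) isT.
have o6 : over D (d 6) = ~~ over D (d 5) := ovE (i := 5) isT.
have c0 i : (i < 12)%N -> @crossing (smooth (d 0)) (d i) = (i \in iota 4 8).
  move=> i12; rewrite (@table_crossing (smooth (d 0)) a loc 12 uloc sloc t0 i t0E) //;
  by case: i i12 => [|[|[|[|[|[|[|[|[|[|[|[|i]]]]]]]]]]]].
have cE7 i : (i < 12)%N ->
    @crossing (@smooth E (d 7)) (d i) = (i \notin [:: 5; 7; 8; 10]%N).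
  move=> i12; rewrite (@table_crossing (@smooth E (d 7)) a loc 12 uloc sloc te7 i t7E) //;
  by case: i i12 => [|[|[|[|[|[|[|[|[|[|[|[|i]]]]]]]]]]]].
(* With the crossing of [a] smoothed, the triangle becomes a bigon with the 2-valent vertex of [d 0]
   on one side. Separating its sides takes a change only if the side from [b] to [c] is over at one
   end and under at the other. *)
have n1 : near (over D (d 4) == over D (d 8)) (smooth (d 0))
    (@smooth (@smooth (smooth (d 0)) (d 5)) (d 9)).
  have := @near_weak_bigon (smooth (d 0)) (d 4) (d 8) (d 0) g0.
  rewrite !c0 // /vertex !t0E // -[edge (smooth _)]/(edge D) !eE // -[over (smooth _)]/(over D).
  rewrite -[nth 0%N e 4]/9%N o9.
  have -> : (over D (d 4) != ~~ over D (d 8)) = (over D (d 4) == over D (d 8)).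
    by case: (over D (d 4)); case: (over D _).
  apply=> //; first by rewrite !inE !dE.
  move=> x; rewrite (smooth_table_region tE ok0).
  have disk4 y : region D (d 4) y -> [\/ y = d 4, y = d 8 | y = d 0].
    move/inside_region; rewrite insideE // => /esym; rewrite insideP !inE.
    by case/or3P=> /eqP->; [constructor 3 | constructor 1 | constructor 2].
  case/or3P=> [/disk4//|/andP[/inside_region]|/andP[/inside_region]];
    by rewrite !insideE.
(* The same separation in the slid diagram, where the new triangle lies on the left of [d 9], [d 1]
   and [d 5]. *)
have n2 : near (over D (d 4) == over D (d 8)) (@smooth E (d 7))
    (@smooth (@smooth (@smooth E (d 7)) (d 0)) (d 4)).
  have := @near_weak_bigon (@smooth E (d 7)) (d 9) (d 1) (d 5) g7.
  rewrite !cE7 // /vertex !t7E // -[edge (smooth _)]/(edge D) !eE // -[over (smooth _)]/(over E).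
  rewrite !over_slide // -[nth 0%N tt 9]/6%N -[nth 0%N tt (nth 0%N e 9)]/11%N.
  rewrite o11 o10 o9 o6 o5 !negbK.
  have -> : (over D (d 4) != ~~ over D (d 8)) = (over D (d 4) == over D (d 8)).
    by case: (over D (d 4)); case: (over D _).
  apply=> //; first by rewrite !inE !dE.
  move=> x; rewrite (smooth_table_region teE ok7).
  have disk9 y : region E (d 9) y -> [\/ y = d 9, y = d 1 | y = d 5].
    rewrite slide_region => /inside_region; rewrite oldE // insideE // => /esym/inside_old.
    by rewrite !inE => /or3P[]/eqP->; [constructor 2 | constructor 3 | constructor 1].
  case/or3P=> [/disk9//|/andP[]|/andP[]];
    by rewrite slide_region => /inside_region; rewrite !oldE // !insideE.
(* One possible change on each side accounts for the total of two. *)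
rewrite -addnn; apply: near_trans n1 _.
rewrite -[X in near X]add0n; apply: near_trans (near_sym n2).
have eR := region_equiv g704.
have R704 : region (@smooth (@smooth (@smooth E (d 7)) (d 0)) (d 4)) =
  merge (merge (merge (region E) (d 10) (d 8)) (d 11) (d 9)) (d 3) (d 1).
  by rewrite (smooth_table_region t70E ok704) (smooth_table_region t7E ok70) (smooth_table_region teE ok7).
set R := region (@smooth (@smooth (@smooth E (d 7)) (d 0)) (d 4)) in eR R704 *.
have sub x y : region D (old x) (old y) -> R x y.
  by move=> xy; rewrite R704; do 3!apply: merge_sub.
have m1 := merge_equiv (d 10) (d 8) (region_equiv gE).
have m2 := merge_equiv (d 11) (d 9) m1.
have p108 : R (d 10) (d 8).
  by rewrite R704; do 2!apply: merge_sub; apply/merge_pair/region_equiv.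
have p119 : R (d 11) (d 9) by rewrite R704; apply/merge_sub/merge_pair.
have p31 : R (d 3) (d 1) by rewrite R704; apply: merge_pair.
have p91 : R (d 9) (d 1) by apply: sub; rewrite !oldE //; apply: r_in.
have p86 : R (d 8) (d 6) by apply: sub; rewrite !oldE //; apply: regxx.
have p39 : R (d 3) (d 9) := eqrel_trans eR p31 (eqrel_sym eR p91).
have p106 : R (d 10) (d 6) := eqrel_trans eR p108 p86.
apply: (@tangle_near_regions _ _ g059 g704 (fun x : dart D => x) a loc 12
  t059 te704 e [:: 0; 1; 8; 9; 10; 11]%N [:: 0; 3; 4; 5; 8; 11]%N phi0 (moved (d 6))) => //.
- by exists id.
- move=> x xo.
  rewrite (smooth_table_off g05 uloc sloc t05E ok059 xo) (smooth_table_off g0 uloc sloc t0E ok05 xo).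
  rewrite (smooth_table_off g uloc sloc tE ok0 xo) (smooth_table_off g70 uloc sloc t70E ok704 xo).
  rewrite (smooth_table_off g7 uloc sloc t7E ok70 xo) (smooth_table_off gE uloc sloc teE ok7 xo).
  by rewrite te_off.
- by move=> x xo _; exact: over_slide_off.
- move=> i i12 iN; rewrite (@table_crossing (@smooth (@smooth (smooth (d 0)) (d 5)) (d 9)) a loc 12 uloc sloc t059 i t059E) //;
  by case: i i12 iN => [|[|[|[|[|[|[|[|[|[|[|[|i]]]]]]]]]]]].
- move=> x y; rewrite (smooth_table_region t05E ok059) (smooth_table_region t0E ok05) (smooth_table_region tE ok0).
  apply: (merge_hom (F := moved (d 6)) eR); last first.
    by rewrite !movedE //; apply: p106.
  apply: (merge_hom (F := moved (d 6)) eR); last first.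
    by rewrite !movedE //; apply: eqrel_refl.
  apply: (merge_hom (F := moved (d 6)) eR); first exact: moved_hom.
  rewrite !movedE //; apply: (eqrel_trans eR p119); exact: (eqrel_sym eR p39).
- move=> i i12 iN; rewrite movedE //.
  case: i i12 iN => [|[|[|[|[|[|[|[|[|[|[|[|i]]]]]]]]]]]] // _ _; try exact: (regxx g704).
    exact: (eqrel_sym eR p106).
- by move=> x xo; rewrite moved_off //; exact: (regxx g704).
Qed.

(** The slide does not depend on which side of the triangle comes first, so what is proved at the
    crossing of [a] transfers to the other two. *)
Lemma slide_perm_rot :
  (swap_ends b * swap_ends c * swap_ends (face D c))%g = slide_perm.
Proof.
rewrite fc; apply/permP=> x; have [xl|xo] := boolP (x \in loc); last first.
  rewrite slide_perm_off // /swap_ends -[a]/(d 0) -[face D (d 0)]/(d 4) -[face D (d 4)]/(d 8).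
  rewrite e0 e4 e8 !acrossE // !tE // !permM.
  by do 6![rewrite (tpermD (z := x)); [|by rewrite eq_sym off_d|by rewrite eq_sym off_d]].
have i12 : (index x loc < 12)%N by rewrite index_mem.
rewrite -(nth_index a xl) slide_permE // /swap_ends.
rewrite -[a]/(d 0) -[face D (d 0)]/(d 4) -[face D (d 4)]/(d 8).
rewrite e0 e4 e8 !acrossE // !tE // !permM.
by case: (index x loc) i12 => [|[|[|[|[|[|[|[|[|[|[|[|i]]]]]]]]]]]] // _; rewrite !tperm_d.
Qed.

Lemma triangle_rot : [/\ triangle b, slide_triangle b = E &
  forall y : dart D, @smooth (slide_triangle b) y = @smooth E y].
Proof.
have pf : porbit (face D) b = porbit (face D) a.
  by apply/eqP; rewrite eq_porbit_mem; have := mem_porbit (face D) 1 a; rewrite expg1.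
split; [|by rewrite /slide_triangle slide_perm_rot pf
  |by move=> y; rewrite /slide_triangle slide_perm_rot pf].
have [[ca cb cc] [ba cb' ac] _ ov disk] := tri; split; rewrite ?fc //.
- by apply: contra ov => /andP[/eqP-> /eqP->]; rewrite !eqxx.
- by move=> x rbx; rewrite pf -[_ \in _]/(inside x) -(inside_region rbx) insideP !inE eqxx orbT.
Qed.

Lemma triangle_rot_del (X : udiagram) (A : pred (dart D)) :
  (forall gE : good (slide_triangle b), exists sB : @sublink (slide_triangle b) A, near 0 X (del gE sB)) ->
  forall gE : good E, exists sB : @sublink E A, near 0 X (del gE sB).
Proof.
have pf : porbit (face D) b = porbit (face D) a.
  by apply/eqP; rewrite eq_porbit_mem; have := mem_porbit (face D) 1 a; rewrite expg1.
by rewrite /slide_triangle slide_perm_rot pf.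
Qed.

(** A smoothing elsewhere preserves the triangle, because neither of the corners that it merges lies
    in it. Sliding and smoothing then commute up to equality of diagrams, not only up to
    isomorphism. *)
Lemma triangle_smooth_off x : crossing x -> x \notin loc -> near 0 (smooth x) (@smooth E x).
Proof.
move=> cx xo; have gS := good_smooth g cx.
have loc_vertex y : y \in loc -> y \notin vertex x.
  move=> yl; apply: contra xo => yx.
  have {yx} : x \in vertex y by rewrite vertex_sym.
  have tl z : z \in loc -> turn D z \in loc.
    move/(nthP a)=> [i]; rewrite sloc => i12 <-; rewrite tE //.
    by case: i i12 => [|[|[|[|[|[|[|[|[|[|[|[|i]]]]]]]]]]]] // _; apply: mem_nth.
  rewrite -(porbit_vertex g) => /porbitP[i ->].
  by elim: i => [|i IH]; [rewrite expg0 perm1 | rewrite expgSr permM; apply: tl].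
have dl i : (i < 12)%N -> d i \in loc by move=> i12; rewrite mem_nth.
have turnS i : (i < 12)%N -> turn (smooth x) (d i) = turn D (d i).
  by move=> i12; rewrite smooth_turn_off // loc_vertex ?dl.
have crossS i : (i < 12)%N -> @crossing (smooth x) (d i).
  by move=> i12; rewrite crossing_smooth // cd // loc_vertex ?dl.
have tSE : @turn_table (smooth x) a loc 12 t by move=> i i12; rewrite turnS // tE.
have faceS i j k : (i < 12)%N -> (j < 12)%N -> edge D (d i) = d j ->
    nth 0%N t (nth 0%N t (nth 0%N t j)) = k -> face (smooth x) (d i) = d k.
  move=> i12 j12 ei <-; rewrite (faceE gS) -[edge (smooth x)]/(edge D) ei.
  by rewrite (tSE j) // tSE ?tSE //; case: j j12 {ei} => [|[|[|[|[|[|[|[|[|[|[|[|j]]]]]]]]]]]].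
have fS0 : face (smooth x) (d 0) = d 4 by apply: (faceS 0 5)%N.
have fS4 : face (smooth x) (d 4) = d 8 by apply: (faceS 4 9)%N.
have fS8 : face (smooth x) (d 8) = d 0 by apply: (faceS 8 1)%N.
have inS y : (y \in porbit (face (smooth x)) (d 0)) = inside y.
  rewrite insideP; apply/porbitP/idP => [[i ->]|].
    elim: i => [|i]; first by rewrite expg0 perm1 inE eqxx.
    by rewrite !inE expgSr permM => /or3P[]/eqP->; rewrite ?fS0 ?fS4 ?fS8 eqxx ?orbT.
  rewrite !inE => /or3P[]/eqP->.
  - by exists 0%N; rewrite expg0 perm1.
  - by exists 1%N; rewrite expg1.
  - by exists 2%N; rewrite expgS expg1 permM fS0.
have acrossS i : (i < 12)%N -> across (d i : dart (smooth x)) = across (d i).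
  by case: i => [|[|[|[|[|[|[|[|[|[|[|[|i]]]]]]]]]]]] // _;
    rewrite /across crossS // cd // !tSE // !tE.
have tS4 i : (i < 12)%N -> @vertex (smooth x) (d i) = vertex (d i).
  by case: i => [|[|[|[|[|[|[|[|[|[|[|[|i]]]]]]]]]]]] // _;
    rewrite /vertex !tSE // !tE.
have nx y : y \in [:: turn D x; turn D (turn D (turn D x))] -> ~~ inside y.
  have xx : x \in vertex x by rewrite inE eqxx.
  move=> yx; have : y \in vertex x.
    by move: yx; rewrite !inE => /orP[]/eqP->; rewrite eqxx !orbT.
  by apply: contraL => iy; apply: loc_vertex; apply: contraLR iy => /inside_off->.
have triS : @triangle (smooth x) (d 0).
  case: tri => [_ [ba cb ac] _ ov disk]; split; rewrite ?fS0 ?fS4 ?fS8 //.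
  - by split; apply: crossS.
  - rewrite !(porbit_vertex gS) !tS4 //; rewrite !(porbit_vertex g) in ba cb ac.
    by split.
  - move=> y; rewrite inS region_smoothE => /or3P[/disk//|/andP[r1]|/andP[r1]].
    + have := nx (turn D x); rewrite -(inside_region r1) inE eqxx => /(_ isT).
      by rewrite insideP inE eqxx.
    + have := nx (turn D (turn D (turn D x))); rewrite -(inside_region r1) !inE eqxx orbT => /(_ isT).
      by rewrite insideP inE eqxx.
have swapS i j : (i < 12)%N -> (j < 12)%N -> edge D (d i) = d j ->
    @swap_ends (smooth x) (d i) = swap_ends (d i).
  move=> i12 j12 ei; rewrite /swap_ends -[edge (smooth x)]/(edge D) ei.
  by rewrite !acrossS.
have permS : (@swap_ends (smooth x) (d 0) * @swap_ends (smooth x) (d 4) *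
    @swap_ends (smooth x) (d 8))%g = slide_perm.
  by rewrite (swapS 0 5)%N // (swapS 4 9)%N // (swapS 8 1)%N.
have xo2 : turn D (turn D x) \notin loc.
  apply: contra xo => /loc_vertex; rewrite !(vertex_turn g) inE eqxx //.
have xo1 : turn D x \notin loc.
  apply: contra xo => /loc_vertex; rewrite !(vertex_turn g) inE eqxx //.
have xo3 : turn D (turn D (turn D x)) \notin loc.
  apply: contra xo => /loc_vertex; rewrite !(vertex_turn g) inE eqxx //.
have cEx : @crossing E x by rewrite /crossing !te_off.
have eqS : @slide_triangle (smooth x) (d 0) = @smooth E x.
  rewrite /slide_triangle fS0 fS4 permS /smooth; congr UDiagram.
  - rewrite -[turn (smooth x)]/(turn D * tperm x (turn D (turn D x)))%g conjMg tpermJ.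
    by rewrite !slide_perm_off // !te_off.
  - apply: funext => u; apply: funext => v.
    have oldS y : (if y \in porbit (face (smooth x)) (d 0)
             then across (face (smooth x) (face (smooth x) y))
             else if edge (smooth x) y \in porbit (face (smooth x)) (d 0)
             then edge (smooth x) y else y) = old y.
      rewrite !inS /old; case: ifP => // iy; move: (iy); rewrite insideP !inE.
      case/or3P=> /eqP->.
      + by rewrite fS0 fS4 acrossS.
      + by rewrite fS4 fS8 -[face D (d 4)]/(d 8) -[face D (d 8)]/(face D c) fc acrossS.
      + by rewrite fS8 fS0 -[face D (d 8)]/(face D c) fc acrossS.
    rewrite !oldS -[LHS]/(merge (region D) (turn D x) (turn D (turn D (turn D x))) (old u) (old v)).
    rewrite -[RHS]/(merge (region E) (turn E x) (turn E (turn E (turn E x))) u v).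
    by rewrite !te_off // /merge !slide_region (old_off xo1) (old_off xo3).
have gSE : good (@delete_site (smooth x) (@Triangle (smooth x) (d 0))).
  by rewrite /delete_site eqS; apply: good_smooth.
have := near_site (s := @Triangle (smooth x) (d 0)) gS gSE triS.
by rewrite /delete_site eqS.
Qed.

Lemma slide_perm_vertices x : x \notin vertex a -> x \notin vertex b -> x \notin vertex c ->
  slide_perm x = x /\ x \notin loc.
Proof.
move=> xa xb xc; suff xo : x \notin loc by rewrite slide_perm_off.
by rewrite !mem_cat (negbTE xa) (negbTE xb) (negbTE xc).
Qed.

Lemma triangle_vertex x : x \in vertex a ->
  near (over D b == over D c).*2 (smooth x) (@smooth E (slide_perm x)).
Proof.
have cE y : crossing y -> @crossing E (slide_perm y).
  by move=> cy; rewrite /crossing !slide_turn (inj_eq (@perm_inj _ slide_perm)).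
have half y : crossing y ->
    near (over D b == over D c).*2 (smooth y) (@smooth E (slide_perm y)) ->
    near (over D b == over D c).*2 (smooth (turn D (turn D y)))
      (@smooth E (slide_perm (turn D (turn D y)))).
  move=> cy n; have cy2 : crossing (turn D (turn D y)) by rewrite !crossing_turn.
  have n1 : near 0 (smooth y) (smooth (turn D (turn D y))).
    by apply: near_iso (smooth_turn2_iso g cy); apply: good_smooth.
  have n2 : near 0 (@smooth E (slide_perm y)) (@smooth E (slide_perm (turn D (turn D y)))).
    have := near_iso _ _ (smooth_turn2_iso gE (cE _ cy)); rewrite !slide_turn; apply.
      exact: (good_smooth gE (cE _ cy)).
    exact: (good_smooth gE (cE _ cy2)).
  by rewrite -[_.*2]addn0; apply: near_trans n2; rewrite -[_.*2]add0n; apply: near_trans (near_sym n1) _.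
rewrite !inE => /or4P[]/eqP->.
- exact: triangle_close.
- exact: triangle_open.
- exact: half cra triangle_close.
- by apply: half triangle_open; rewrite crossing_turn.
Qed.

Let turn_loc x : (turn D x \in loc) = (x \in loc).
Proof.
have imp y : y \in loc -> turn D y \in loc.
  move/(nthP a)=> [i]; rewrite sloc => i12 <-; rewrite tE //.
  by case: i i12 => [|[|[|[|[|[|[|[|[|[|[|[|i]]]]]]]]]]]] // _; apply: mem_nth.
by apply/idP/idP=> [/imp/imp/imp|/imp//]; rewrite (turn4 g).
Qed.

(** Also in the slid diagram, the slide permutation moves each dart within its own strand. *)
Let te_edge (A : pred (dart D)) : @sublink E A -> forall i, (i < 12)%N ->
  A (d (nth 0 tt i)%N) = A (d i).
Proof.
move=> [Ae A2 _]; have T i : (i < 12)%N -> A (turn E (turn E (d i))) = A (d i) by rewrite A2.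
have a02 : A (d 2) = A (d 0) by rewrite -(T 0%N) // !teE.
have a57 : A (d 7) = A (d 5) by rewrite -(T 5%N) // !teE.
have a46 : A (d 6) = A (d 4) by rewrite -(T 4%N) // !teE.
have a911 : A (d 11) = A (d 9) by rewrite -(T 9%N) // !teE.
have a810 : A (d 10) = A (d 8) by rewrite -(T 8%N) // !teE.
have a13 : A (d 3) = A (d 1) by rewrite -(T 1%N) // !teE.
have := Ae (d 0); have := Ae (d 4); have := Ae (d 8).
rewrite -[edge E]/(edge D) e0 e4 e8 => b81 b49 b05.
have h0 : A (d 7) = A (d 0) by rewrite a57.
have h1 : A (d 10) = A (d 1) by rewrite a810.
have h2 : A (d 5) = A (d 2) by rewrite a02.
have h3 : A (d 8) = A (d 3) by rewrite a13.
have h4 : A (d 11) = A (d 4) by rewrite a911.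
have h6 : A (d 9) = A (d 6) by rewrite a46.
case=> [|[|[|[|[|[|[|[|[|[|[|[|i]]]]]]]]]]]] i12; last by [];
  [exact: h0 | exact: h1 | exact: h2 | exact: h3 | exact: h4 | exact: esym h2
  |exact: h6 | exact: esym h0 | exact: esym h3 | exact: esym h6 | exact: esym h1 | exact: esym h4].
Qed.

Lemma sublink_slide_inv (A : pred (dart D)) : @sublink E A -> sublink A.
Proof.
move=> sA; have [Ae A2 An] := sA.
have tDE x : turn D x = slide_perm (turn E (slide_perm x)) by rewrite slide_turn slide_permK.
have A_perm x : A (slide_perm x) = A x.
  by case: (ncase x) => [[i i12 ->]|xo]; [rewrite slide_permE // te_edge | rewrite slide_perm_off].
split=> x; first exact: Ae.
  by rewrite !tDE slide_permK A_perm A2 A_perm.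
move=> cx; rewrite tDE A_perm An ?A_perm //.
by rewrite /crossing !slide_turn (inj_eq (@perm_inj _ slide_perm)).
Qed.

Section Deletion.
Variables (A : pred (dart D)) (sA : sublink A).
Hypothesis exA : exists x, ~~ A x.
Let Ae x : A (edge D x) = A x. Proof. by case: sA. Qed.
Let A2 x : A (turn D (turn D x)) = A x. Proof. by case: sA. Qed.
(** Each strand of the site is named by the position of the dart of the triangle on it: 0, 4 or
    8. *)
Let strand i := nth 0%N [:: 0; 8; 0; 8; 4; 0; 4; 0; 8; 4; 8; 4]%N i.

Let Ad i : (i < 12)%N -> A (d i) = A (d (strand i)).
Proof.
have a2 : A (d 2) = A (d 0) := A2 (d 0); have a6 : A (d 6) = A (d 4) := A2 (d 4).
have a10 : A (d 10) = A (d 8) := A2 (d 8).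
have a5 : A (d 5) = A (d 0) by rewrite -e0 Ae.
have a9 : A (d 9) = A (d 4) by rewrite -e4 Ae.
have a1 : A (d 1) = A (d 8) by rewrite -e8 Ae.
have a3 : A (d 3) = A (d 1) := A2 (d 1).
have a7 : A (d 7) = A (d 5) := A2 (d 5).
have a11 : A (d 11) = A (d 9) := A2 (d 9).
by case: i => [|[|[|[|[|[|[|[|[|[|[|[|i]]]]]]]]]]]] // _; rewrite ?a7 ?a11 ?a3.
Qed.

Let A_perm x : A (slide_perm x) = A x.
Proof.
case: (ncase x) => [[i i12 ->]|xo]; last by rewrite slide_perm_off.
rewrite slide_permE // (Ad i12); case: i i12 => [|[|[|[|[|[|[|[|[|[|[|[|i]]]]]]]]]]]] // _; exact: Ad.
Qed.

Lemma sublink_slide : @sublink E A.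
Proof.
have tEE x : turn E x = slide_perm (turn D (slide_perm x)) by rewrite -{1}[x]slide_permK slide_turn.
split=> x; first exact: Ae.
  by rewrite !tEE slide_permK A_perm A2 A_perm.
rewrite -{1}[x]slide_permK /crossing !slide_turn (inj_eq (@perm_inj _ slide_perm)).
by rewrite tEE A_perm => c; have [_ _ An] := sA; rewrite An // A_perm.
Qed.

Variable sE : @sublink E A.
Let eR := del_region_equiv gE sE.

Let sub x y : region D (old x) (old y) -> @del_region E A x y.
Proof. by move=> xy; apply: del_region_sub. Qed.
Let same i j : (i < 12)%N -> (j < 12)%N -> region D (old (d i)) (old (d j)) ->
  @del_region E A (d i) (d j).
Proof. by move=> _ _; apply: sub. Qed.
Let re x : A x -> @del_region E A x (edge D x).
Proof. by move=> Ax; apply: (@del_region_edge E). Qed.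
(* Across an edge of A leaving the site, into the next corner of its other end. *)
Let cross i j : (i < 12)%N -> (j < 12)%N -> nth 0%N te j = i -> A (d i) ->
  @del_region E A (d i) (d j).
Proof.
move=> i12 j12 tij Ai; apply: (eqrel_trans eR (re Ai)); apply: del_region_sub.
by have := region_corner gE (d j); rewrite teE // tij.
Qed.

Let ext_edge x : x \notin [:: d 0; d 1; d 4; d 5; d 8; d 9] ->
  (edge D x \notin [:: d 0; d 1; d 4; d 5; d 8; d 9]) /\ forall p, moved p x = x.
Proof.
have e5 : edge D (d 5) = d 0 by rewrite -e0 (edgeK g).
have e1 : edge D (d 1) = d 8 by rewrite -e8 (edgeK g).
have e9 : edge D (d 9) = d 4 by rewrite -e4 (edgeK g).
move=> xo; split.
  apply: contra xo; rewrite !inE !(can2_eq (edgeK g) (edgeK g)) e0 e1 e4 e5 e8 e9.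
  by do 5?[case/orP]; move=> /eqP->; rewrite eqxx ?orbT.
move: xo; rewrite !inE !negb_or => /and5P[x0 x1 x4 x5 /andP[x8 x9]] p.
by rewrite /moved insideP !inE (negbTE x0) (negbTE x4) (negbTE x8) /new (negbTE x1) (negbTE x5) (negbTE x9).
Qed.

(** Deleting a side of the triangle joins the triangle to the region beyond that side; the three
    conditional hypotheses say that [p] lies in the resulting region. *)
Let moved_del p (R : rel (dart D)) : equivalence_rel R -> (p < 12)%N ->
    (forall x y, @del_region E A x y -> R x y) ->
    (A (d 0) -> R (d p) (d 3)) -> (A (d 4) -> R (d p) (d 7)) -> (A (d 8) -> R (d p) (d 11)) ->
  forall x y, @del_region D A x y -> R (moved (d p) x) (moved (d p) y).
Proof.
move=> eR' p12 subR R0 R4 R8; apply: del_region_hom => //.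
  by apply: moved_hom => // x y /sub/subR.
move=> x Ax; have [xi|xo] := boolP (x \in [:: d 0; d 1; d 4; d 5; d 8; d 9]); last first.
  by have [ex mx] := ext_edge xo; have [_ mex] := ext_edge ex; rewrite mx mex; apply/subR/re.
have e5 : edge D (d 5) = d 0 by rewrite -e0 (edgeK g).
have e1 : edge D (d 1) = d 8 by rewrite -e8 (edgeK g).
have e9 : edge D (d 9) = d 4 by rewrite -e4 (edgeK g).
move: xi Ax; rewrite !inE; do 5?[case/orP]; move=> /eqP->; rewrite Ad // => Ax;
  rewrite ?(e0, e1, e4, e5, e8, e9) !movedE //;
  by [apply: R0 | apply: R4 | apply: R8 | apply: (eqrel_sym eR'); apply: R0
     | apply: (eqrel_sym eR'); apply: R4 | apply: (eqrel_sym eR'); apply: R8].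
Qed.

(** No crossing of the site survives the deletion, and the identity on darts is the comparison. The
    triangle is sent to the region of [d 10], which [d 0] faces after the move. *)
Lemma del_triangle2 : A (d 4) -> A (d 8) -> near 0 (del g sA) (del gE sE).
Proof.
move=> A4 A8; have Ai i : (i < 12)%N -> strand i != 0%N -> A (d i).
  by move=> i12; rewrite Ad //; case: i i12 => [|[|[|[|[|[|[|[|[|[|[|[|i]]]]]]]]]]]].
have c109 : @del_region E A (d 10) (d 7) by apply: cross => //; apply: Ai.
have c110 : @del_region E A (d 11) (d 0) by apply: cross => //; apply: Ai.
have c34 : @del_region E A (d 3) (d 4) by apply: cross => //; apply: Ai.
have s010 : @del_region E A (d 0) (d 10) by apply: same; rewrite ?oldE //; apply: regxx.
have r49 : @del_region E A (d 4) (d 9) by have := re (Ai 4 isT isT); rewrite e4.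
have r95 : @del_region E A (d 9) (d 5) by apply: same; rewrite ?oldE //; apply: r_in.
have r35 := eqrel_trans eR c34 (eqrel_trans eR r49 r95).
have r103 : A (d 0) -> @del_region E A (d 10) (d 3).
  move=> A0; apply: (eqrel_trans eR (eqrel_sym eR s010)).
  by have := re A0; rewrite e0 => r05; apply: (eqrel_trans eR r05 (eqrel_sym eR r35)).
have r1011 : @del_region E A (d 10) (d 11).
  exact: (eqrel_trans eR (eqrel_sym eR s010) (eqrel_sym eR c110)).
apply: (@val_del_iso D E A A g gE sA sE (fun x => x) (fun x => x)) => //.
- move=> x; case: (ncase x) => [[i i12 ->]|xo _]; last by rewrite /del_turn_fun !te_off ?turn_loc.
  move=> nAi; have s0 : strand i == 0%N by apply/eqP; apply: contraNeq nAi => si; exact: Ai i12 si.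
  rewrite /del_turn_fun tE // teE //.
  case: i i12 nAi s0 => [|[|[|[|[|[|[|[|[|[|[|[|i]]]]]]]]]]]] // _ _ _;
    by rewrite !tE // !teE // ?Ai // ?(Ad (i := 2)) ?(Ad (i := 5)) ?(Ad (i := 7)) //.
- move=> x nAx nAt _; case: (ncase x) => [[i i12 ex]|xo]; last exact: over_slide_off.
  move: nAx nAt; rewrite ex tE // => nAi nAt.
  have s0 : strand i == 0%N by apply/eqP; apply: contraNeq nAi => si; exact: Ai i12 si.
  by case: i i12 ex nAi nAt s0 => [|[|[|[|[|[|[|[|[|[|[|[|i]]]]]]]]]]]] // _ _ _; rewrite Ai.
move=> x y nAx nAy xy.
have mid z : ~~ A z -> @del_region E A (moved (d 10) z) z.
  case: (ncase z) => [[i i12 ->]|zo]; last by rewrite moved_off // => _; apply: (eqrel_refl eR).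
  move=> nAi; have s0 : strand i == 0%N by apply/eqP; apply: contraNeq nAi => si; exact: Ai i12 si.
  rewrite movedE //; case: i i12 nAi s0 => [|[|[|[|[|[|[|[|[|[|[|[|i]]]]]]]]]]]] // _ _ _.
  - exact: (eqrel_sym eR s010).
  - exact: (eqrel_refl eR).
  - exact: (eqrel_refl eR).
apply: (eqrel_trans eR (eqrel_sym eR (mid _ nAx))); apply: (eqrel_trans eR _ (mid _ nAy)).
exact: (moved_del eR).
Qed.

(** All strands of the triangle remain, so that it is still a triangle after the deletion, and
    sliding commutes with deleting. *)
Lemma del_triangle0 : ~~ A (d 0) -> ~~ A (d 4) -> ~~ A (d 8) -> near 0 (del g sA) (del gE sE).
Proof.
move=> nA0 nA4 nA8.
have nAi i : (i < 12)%N -> ~~ A (d i).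
  by move=> i12; rewrite Ad //; case: i i12 => [|[|[|[|[|[|[|[|[|[|[|[|i]]]]]]]]]]]].
have Ao x : A x -> x \notin loc.
  move=> Ax; apply: contraL Ax => /(nthP a)[i]; rewrite sloc => i12 <-; exact: nAi.
have gd : good (del g sA) by apply: good_del.
have gdE : good (del gE sE) by apply: good_del.
pose d' i (i12 : (i < 12)%N) : dart (del g sA) := Sub (d i) (nAi i i12).
have vt (x : dart (del g sA)) : val x \in loc -> val (turn (del g sA) x) = turn D (val x).
  by move=> xl; rewrite val_del_turn del_turn_out //; apply: contraL xl => /Ao; rewrite turn_loc.
have dl i : (i < 12)%N -> d i \in loc by move=> i12; rewrite mem_nth.
have tl := turn_loc.
have vf (x : dart (del g sA)) : edge D (val x) \in loc -> val (face (del g sA) x) = face D (val x).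
  by move=> xl; rewrite (faceE gd) (faceE g) !vt ?val_del_edge ?tl.
have cr (x : dart (del g sA)) : val x \in loc -> crossing x = crossing (val x).
  by move=> xl; rewrite crossing_del andbC; have -> : ~~ A (turn D (val x)) by apply: contraL xl => /Ao; rewrite tl.
have ac (x : dart (del g sA)) : val x \in loc -> val (across x) = across (val x).
  by move=> xl; rewrite /across cr //; case: ifP => _; rewrite !vt ?tl.
pose a' := d' 0%N isT; pose b' := d' 4%N isT; pose c' := d' 8%N isT.
have fa' : face (del g sA) a' = b' by apply: val_inj; rewrite vf // e0 dl.
have fb' : face (del g sA) b' = c' by apply: val_inj; rewrite vf // e4 dl.
have fc' : face (del g sA) c' = a' by apply: val_inj; rewrite vf ?e8 ?dl //; exact: fc.
have inS y : (y \in porbit (face (del g sA)) a') = inside (val y).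
  rewrite insideP; apply/porbitP/idP => [[i ->]|].
    elim: i => [|i]; first by rewrite expg0 perm1 inE eqxx.
    rewrite !inE expgSr permM => /or3P[]/eqP h.
    - by rewrite [X in face _ X](_ : _ = a') ?fa' ?eqxx ?orbT //; apply: val_inj.
    - by rewrite [X in face _ X](_ : _ = b') ?fb' ?eqxx ?orbT //; apply: val_inj.
    - by rewrite [X in face _ X](_ : _ = c') ?fc' ?eqxx ?orbT //; apply: val_inj.
  rewrite !inE => /or3P[]/eqP h.
  - by exists 0%N; rewrite expg0 perm1; apply: val_inj.
  - by exists 1%N; rewrite expg1 fa'; apply: val_inj.
  - by exists 2%N; rewrite expgS expg1 permM fa' fb'; apply: val_inj.
have inside_del x y : del_region A x y -> inside x = inside y.
  move=> xy; apply/eqP; move: x y xy.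
  apply: (@del_region_hom D A bool (fun u v => u == v) inside).
  - by move=> [] [] [].
  - by move=> x y /inside_region->.
  - by move=> x Ax; rewrite !inside_off ?Ao ?Ae.
have v4 (x y : dart (del g sA)) : val y \in loc -> x \in vertex y -> val x \in vertex (val y).
  by move=> yl; rewrite !inE -!(inj_eq val_inj) !vt ?tl.
have tri' : triangle a'.
  case: tri => [_ [ba cb ac'] _ ov disk]; split; rewrite ?fa' ?fb' ?fc' //.
  - by split; rewrite cr ?cd ?dl.
  - rewrite !(porbit_vertex gd); rewrite !(porbit_vertex g) in ba cb ac'.
    by split; [apply: contra ba|apply: contra cb|apply: contra ac']; apply: v4; apply: dl.
  - by move=> y r; rewrite inS -(inside_del _ _ r) insideE.
have vtp (x y z : dart (del g sA)) : val (tperm x y z) = tperm (val x) (val y) (val z).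
  by rewrite !permE /= -!(inj_eq val_inj); do 2?case: ifP.
have swapS (x : dart (del g sA)) z : val x \in loc -> edge D (val x) \in loc ->
    val (swap_ends x z) = swap_ends (val x) (val z).
  by move=> xl el; rewrite !permM !vtp !ac ?val_del_edge.
have eqS (x : dart (del g sA)) :
    val ((swap_ends a' * swap_ends b' * swap_ends c')%g x) = slide_perm (val x).
  have mul3 (T : finType) (p q r : {perm T}) z : (p * q * r)%g z = r (q (p z)) by rewrite !permM.
  by rewrite /slide_perm !mul3 !swapS ?e0 ?e4 ?e8 ?dl.
have ginv : (swap_ends a' * swap_ends b' * swap_ends c' *
   (swap_ends a' * swap_ends b' * swap_ends c'))%g = 1%g.
  by apply/permP => x; apply: val_inj; rewrite permM !eqS slide_permK perm1.
have mo x : ~~ A x -> @del_region E A (moved (d 1) (old x)) x.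
  move=> _; apply: sub; case: (ncase x) => [[i i12 ->]|xo].
    case: i i12 => [|[|[|[|[|[|[|[|[|[|[|[|i]]]]]]]]]]]] // _;
      rewrite oldE // movedE // oldE //; try exact: regxx; exact: r_in.
  by rewrite (old_off xo) moved_off // old_off //; apply: regxx.
pose f (x : dart (slide_triangle a')) : dart (del gE sE) := x.
have in3 z : inside z -> [\/ z = d 0, z = d 4 | z = d 8].
  by rewrite insideP !inE => /or3P[]/eqP->; [constructor 1 | constructor 2 | constructor 3].
have iso : isomorphism f.
  split=> //.
  - by exists f.
  - move=> x; apply: val_inj; exact: etrans (val_del_edge (x : dart (del g sA))) (esym (val_del_edge (f x))).
  - move=> x; apply: val_inj; rewrite val_del_turn.
    have -> : turn (slide_triangle a') x = (swap_ends a' * swap_ends b' * swap_ends c')%g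
         (turn (del g sA) ((swap_ends a' * swap_ends b' * swap_ends c')%g x)).
      rewrite -fb' -fa' in ginv *.
      set t' := (_ * _ * _)%g; rewrite -[turn (slide_triangle a')]/(t'^-1 * (turn (del g sA) * t'))%g.
      rewrite 2!permM; congr (t' (turn _ _)).
      by apply: (@perm_inj _ t'); rewrite permKV -permM ginv perm1.
    rewrite eqS val_del_turn eqS /del_turn_fun.
    have tEE y : turn E y = slide_perm (turn D (slide_perm y)) by rewrite -{1}[y]slide_permK slide_turn.
    by rewrite !tEE slide_permK A_perm -[val x]/(val (f x)); case: ifP.
  - move=> x _; rewrite -[LHS]/(over D (slide_perm (val x))) -eqS -fb' -fa' //.
  move=> x y; have oldS z : val (if z \in porbit (face (del g sA)) a'
             then across (face (del g sA) (face (del g sA) z))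
             else if edge (del g sA) z \in porbit (face (del g sA)) a'
             then edge (del g sA) z else z) = old (val z).
    rewrite !inS /old val_del_edge; case: ifP => iz; last by case: ifP => _; rewrite ?val_del_edge.
    have zl : edge D (val z) \in loc.
      case/in3: iz => ->.
      - by rewrite [edge D _]e0; apply: (dl 5%N isT).
      - by rewrite [edge D _]e4; apply: (dl 9%N isT).
      - by rewrite [edge D _]e8; apply: (dl 1%N isT).
    have zl' : edge D (face D (val z)) \in loc.
      case/in3: iz => ->.
      - by rewrite [edge D _]e4; apply: (dl 9%N isT).
      - by rewrite [edge D _]e8; apply: (dl 1%N isT).
      - by rewrite [face D _]fc [edge D _]e0; apply: (dl 5%N isT).
    rewrite ac ?vf //.
    case/in3: iz => ->.
    - exact: (dl 8%N isT).
    - by rewrite [face D (face D _)]fc; apply: (dl 0%N isT).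
    - by rewrite [face D (d 8)]fc; apply: (dl 4%N isT).
  rewrite -[RHS]/(del_region A (val (if x \in porbit (face (del g sA)) a'
             then across (face (del g sA) (face (del g sA) x))
             else if edge (del g sA) x \in porbit (face (del g sA)) a'
             then edge (del g sA) x else x)) (val (if y \in porbit (face (del g sA)) a'
             then across (face (del g sA) (face (del g sA) y))
             else if edge (del g sA) y \in porbit (face (del g sA)) a'
             then edge (del g sA) y else y))) !oldS.
  rewrite -[LHS]/(@del_region E A (val x) (val y)).
  apply/idP/idP.
    apply: del_region_hom; first exact: del_region_equiv.
      by move=> u v; rewrite slide_region; apply: del_region_sub.
    by move=> u Au; rewrite !old_off ?Ao ?Ae //; apply: del_region_edge.
  move=> r; apply: (eqrel_trans eR (eqrel_sym eR (mo _ (valP x)))).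
  apply: (eqrel_trans eR _ (mo _ (valP y))).
  by apply: (moved_del eR) r => //; rewrite ?(negbTE nA0) ?(negbTE nA4) ?(negbTE nA8).
have gs : good (delete_site (Triangle a')).
  exact: good_iso iso gdE.
exact: near0_trans (near_site gd gs tri') (near_iso gs gdE iso).
Qed.

(** Only the crossing of [b] survives, and the slide moves it along its two strands past the other
    vertices, which have become 2-valent. *)
Lemma del_triangle1 : ~~ A (d 0) -> ~~ A (d 4) -> A (d 8) -> near 0 (del g sA) (del gE sE).
Proof.
move=> nA0 nA4 A8.
have nAi i : (i < 12)%N -> strand i != 8%N -> ~~ A (d i).
  by move=> i12; rewrite Ad //; case: i i12 => [|[|[|[|[|[|[|[|[|[|[|[|i]]]]]]]]]]]].
have Ai i : (i < 12)%N -> strand i = 8%N -> A (d i) by move=> i12 si; rewrite Ad // si.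
have gd : good (del g sA) by apply: good_del.
have gdE : good (del gE sE) by apply: good_del.
pose s i (i12 : (i < 12)%N) (si : strand i != 8%N) : dart (del g sA) := Sub (d i) (nAi i i12 si).
pose loc' := [:: s 0%N isT isT; s 2%N isT isT; s 4%N isT isT; s 5%N isT isT;
  s 6%N isT isT; s 7%N isT isT; s 9%N isT isT; s 11%N isT isT].
pose idx := [:: 0; 2; 4; 5; 6; 7; 9; 11]%N.
pose s0 := s 0%N isT isT; pose s11 := s 11%N isT isT.
have vs i : (i < 8)%N -> val (nth s0 loc' i) = d (nth 0 idx i)%N.
  by case: i => [|[|[|[|[|[|[|[|i]]]]]]]].
have idx12 i : (i < 8)%N -> (nth 0 idx i < 12)%N.
  by case: i => [|[|[|[|[|[|[|[|i]]]]]]]].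
have eqv i j : (i < 8)%N -> (j < 8)%N -> forall x : dart (del g sA), val x = d (nth 0 idx j)%N ->
  x = nth s0 loc' j by move=> _ j8 x e1; apply: val_inj; rewrite vs.
have off x : x \notin loc' -> val x \notin loc.
  move=> xo; apply/negP => /(nthP a)[i]; rewrite sloc => i12 ei.
  have nAx : ~~ A (val x) := valP x.
  have : strand i != 8%N by apply: contraNneq nAx => si; rewrite -ei; apply: Ai.
  have mm j : (j < 8)%N -> val x = d (nth 0 idx j)%N -> False.
    move=> j8 ej; move/negP: xo; apply.
    by rewrite (eqv j j j8 j8 x ej) mem_nth.
  move: ei; case: i i12 => [|[|[|[|[|[|[|[|[|[|[|[|i]]]]]]]]]]]] // _ ei _.
  - exact: (mm 0%N). - exact: (mm 1%N). - exact: (mm 2%N). - exact: (mm 3%N).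
  - exact: (mm 4%N). - exact: (mm 5%N). - exact: (mm 6%N). - exact: (mm 7%N).
have dt i : (i < 12)%N -> del_turn_fun A (d i) =
    d (let j := nth 0 t i in if strand j == 8 then nth 0 t j else j)%N.
  move=> i12; rewrite /del_turn_fun tE //.
  have j12 : (nth 0 t i < 12)%N by case: i i12 => [|[|[|[|[|[|[|[|[|[|[|[|i]]]]]]]]]]]].
  rewrite /=; case: eqP => [/(Ai _ j12)->|/eqP/(nAi _ j12)/negbTE->//]; rewrite tE //.
have dte i : (i < 12)%N -> @del_turn_fun E A (d i) =
    d (let j := nth 0 te i in if strand j == 8 then nth 0 te j else j)%N.
  move=> i12; rewrite /del_turn_fun teE //.
  have j12 : (nth 0 te i < 12)%N by case: i i12 => [|[|[|[|[|[|[|[|[|[|[|[|i]]]]]]]]]]]].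
  rewrite /=; case: eqP => [/(Ai _ j12)->|/eqP/(nAi _ j12)/negbTE->//]; rewrite teE //.
(* [moved] would send [d 5] to [d 3], a deleted dart; [d 4] lies in the same region once the strand
   between them is deleted. *)
pose Fv x := if x == d 5 then d 4 else moved (d 11) x.
have Fv_ok x : ~~ A x -> ~~ A (Fv x).
  rewrite /Fv; case: (ncase x) => [[i i12 ->]|xo]; last by rewrite off_d // moved_off.
  move=> nA; have : strand i != 8%N by apply: contraNneq nA => si; apply: Ai.
  rewrite dE // movedE //.
  by case: i i12 nA => [|[|[|[|[|[|[|[|[|[|[|[|i]]]]]]]]]]]] // _ _ _; rewrite nAi.
pose F (x : dart (del g sA)) : dart (del gE sE) := Sub (Fv (val x)) (Fv_ok _ (valP x)).
have mF x : ~~ A x -> @del_region E A (moved (d 11) x) (Fv x).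
  move=> nAx; rewrite /Fv; case: eqP => [->|_]; last exact: (eqrel_refl eR).
  by rewrite movedE //; apply: cross => //; apply: Ai.
have r69 : @del_region E A (d 6) (d 9).
  have r68 : @del_region E A (d 6) (d 8) by apply: same; rewrite ?oldE //; apply: regxx.
  have r19 : @del_region E A (d 1) (d 9) by apply: same; rewrite ?oldE //; apply: r_in.
  by have := re A8; rewrite e8 => r81; apply: (eqrel_trans eR r68 (eqrel_trans eR r81 r19)).
have r70 : @del_region E A (d 7) (d 0).
  have r107 : @del_region E A (d 10) (d 7) by apply: cross => //; apply: Ai.
  have r010 : @del_region E A (d 0) (d 10) by apply: same; rewrite ?oldE //; apply: regxx.
  exact: (eqrel_sym eR (eqrel_trans eR r010 r107)).
apply: (@tangle_near_regions _ _ gd gdE (fun x : dart (del g sA) => x) s0 loc' 8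
  [:: 1; 0; 3; 4; 5; 2; 7; 6]%N [:: 7; 6; 4; 5; 2; 3; 0; 1]%N [:: 3; 8; 6; 0; 8; 8; 2; 8]%N
  [:: 0; 1; 6; 7]%N [:: 2; 3; 4; 5]%N [:: 0; 0; 7; 1; 6; 0; 0; 0]%N F) => //.
- by exists id.
- by move=> x; apply: val_inj; exact: etrans (val_del_edge x) (esym (val_del_edge (x : dart (del gE sE)))).
- move=> x /off xo; apply: val_inj; rewrite [LHS]val_del_turn [RHS]val_del_turn /del_turn_fun.
  by rewrite !te_off ?turn_loc.
- apply: (map_uniq (f := val)).
  rewrite (_ : map _ _ = map (nth a loc) idx) // map_inj_in_uniq // => i j hi hj /eqP.
  have i12 := allP (isT : all (fun i => i < 12)%N idx).
  by rewrite dE ?(i12 _ hi) ?(i12 _ hj) // => /eqP.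
- move=> i i8; apply: val_inj; rewrite val_del_turn !vs //; last first.
    by case: i i8 => [|[|[|[|[|[|[|[|i]]]]]]]].
  rewrite dt ?idx12 //; by case: i i8 => [|[|[|[|[|[|[|[|i]]]]]]]].
- move=> i i8; apply: val_inj; rewrite val_del_turn !vs //; last first.
    by case: i i8 => [|[|[|[|[|[|[|[|i]]]]]]]].
  rewrite dte ?idx12 //; by case: i i8 => [|[|[|[|[|[|[|[|i]]]]]]]].
- move=> i i8 ei; apply: val_inj; rewrite val_del_edge !vs //.
  by case: i i8 ei => [|[|[|[|[|[|[|[|i]]]]]]]] // _ _; rewrite eE.
- by move=> x /off xo _; apply: over_slide_off.
- move=> i i8 iN _; rewrite -[LHS]/(over E (val (nth s0 loc' (nth 0 [:: 0; 0; 7; 1; 6; 0; 0; 0] i)%N))).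
  rewrite -[RHS]/(over D (val (nth s0 loc' i))) !vs //; last first.
    by case: i i8 {iN} => [|[|[|[|[|[|[|[|i]]]]]]]].
  by case: i i8 iN => [|[|[|[|[|[|[|[|i]]]]]]]] // _ _; rewrite over_slide.
- move=> x y xy; rewrite -[region _ _ _]/(@del_region E A (Fv (val x)) (Fv (val y))).
  apply: (eqrel_trans eR (eqrel_sym eR (mF _ (valP x)))); apply: (eqrel_trans eR _ (mF _ (valP y))).
  apply: (moved_del eR) xy => //; rewrite ?(negbTE nA0) ?(negbTE nA4) // => _.
  exact: (eqrel_refl eR).
- move=> i i8 iN; rewrite -[region _ _ _]/(@del_region E A (Fv (val (nth s0 loc' i)))
    (val (nth s0 loc' (nth 0 [:: 0; 0; 7; 1; 6; 0; 0; 0] i)%N))).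
  rewrite !vs //; last by case: i i8 {iN} => [|[|[|[|[|[|[|[|i]]]]]]]].
  case: i i8 iN => [|[|[|[|[|[|[|[|i]]]]]]]] // _ _; rewrite /Fv dE // ?movedE //.
  + exact: (eqrel_refl eR).
  + by apply: same; rewrite ?oldE //; apply: regxx.
- move=> x /off xo; rewrite -[region _ _ _]/(@del_region E A (Fv (val x)) (val x)).
  by rewrite /Fv off_d // moved_off //; apply: (eqrel_refl eR).
Qed.
End Deletion.
End Triangle.

(** Case analysis on the deleted sides. Rotating the triangle brings two deleted sides, or a single
    one, to the positions assumed above. *)
Lemma del_triangle D (g : good D) (A : pred (dart D)) (sA : sublink A) (a : dart D)
    (gE : good (delete_site (Triangle a))) : (exists x, ~~ A x) -> triangle a ->
  exists sB : @sublink (delete_site (Triangle a)) A, near 0 (del g sA) (del gE sB).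
Proof.
move=> exA tri; move: gE; rewrite /delete_site => gE.
have [trib eqb _] := triangle_rot g tri.
have [tric eqc _] := triangle_rot g trib.
have fc : face D (face D (face D a)) = a by case: tri.
pose goal (c : dart D) := forall gE : good (slide_triangle c),
  exists sB : @sublink (slide_triangle c) A, near 0 (del g sA) (del gE sB).
have two c : triangle c -> A (face D c) -> A (face D (face D c)) -> goal c.
  move=> tc A1 A2 gc; exists (sublink_slide g tc sA); exact: del_triangle2.
have one c : triangle c -> ~~ A c -> ~~ A (face D c) -> A (face D (face D c)) -> goal c.
  move=> tc A0 A1 A2 gc; exists (sublink_slide g tc sA); exact: del_triangle1.
have rb : goal (face D a) -> goal a by apply: triangle_rot_del.
have rc : goal (face D (face D a)) -> goal a by move=> h; apply/rb/(triangle_rot_del g trib)/h.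
suff : goal a by apply.
have [A0|A0] := boolP (A a); have [A1|A1] := boolP (A (face D a));
  have [A2|A2] := boolP (A (face D (face D a))).
- exact: two.
- by apply/rc/two; rewrite ?fc.
- by apply/rb/two; rewrite ?fc.
- by apply/rb/one; rewrite ?fc.
- exact: two.
- by apply/rc/one; rewrite ?fc.
- exact: one.
- move=> gc; exists (sublink_slide g tri sA); exact: del_triangle0.
Qed.

Lemma triangle_lift D (g : good D) (a : dart D) (gE : good (delete_site (Triangle a)))
    (B : pred (dart D)) (sB : @sublink (delete_site (Triangle a)) B) : triangle a ->
    (exists y, ~~ B y) ->
  exists sA : @sublink D B, near 0 (del g sA) (del gE sB).
Proof.
move=> tri exB; have sA := sublink_slide_inv g tri sB; exists sA.
have [sC n] := del_triangle g sA gE exB tri.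
by rewrite (Prop_irrelevance sB sC).
Qed.

(** For a crossing of the triangle, whether the opposite side is over at one end and under at the
    other. As the corner values are not all equal, this happens for exactly one crossing. *)
Definition triangle_cost (D : udiagram) (a x : dart D) : bool :=
  let b := face D a in let c := face D b in
  if x \in vertex a then over D b == over D c
  else if x \in vertex b then over D c == over D a
  else (x \in vertex c) && (over D a == over D b).

Lemma slide_smooth D (g : good D) (a x : dart D) : triangle a ->
    good (slide_triangle a) -> crossing x ->
  near (triangle_cost a x).*2 (smooth x) (@smooth (slide_triangle a) (slide_perm a x)).
Proof.
move=> tri gE cx; rewrite /triangle_cost.
have [trib eqb smb] := triangle_rot g tri.
have [tric eqc smc] := triangle_rot g trib.
have gEb : good (slide_triangle (face D a)) by rewrite eqb.
have gEc : good (slide_triangle (face D (face D a))) by rewrite eqc.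
have fc : face D (face D (face D a)) = a by case: tri.
have pb : slide_perm (face D a) = slide_perm a by apply: slide_perm_rot.
have pc : slide_perm (face D (face D a)) = slide_perm a.
  by rewrite -pb; apply: slide_perm_rot.
case: ifP => [xa|/negbT xa]; first exact: triangle_vertex.
case: ifP => [xb|/negbT xb].
  by have := triangle_vertex g trib gEb xb; rewrite smb pb fc.
case: (boolP (x \in vertex (face D (face D a)))) => [xc|xc] /=.
  by have := triangle_vertex g tric gEc xc; rewrite smc smb pc fc.
have [-> xo] := slide_perm_vertices g tri xa xb xc.
exact: triangle_smooth_off.
Qed.

(** * Moves after a deletion *)

Lemma unlinkableP k D : unlinkable k D <->
  exists F, [/\ good F, crossingless F & near k D F].
Proof.
split=> [[E DE [F [/goodP gF cF EF]]]|[F [gF cF DF]]].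
  exists F; split=> //; rewrite -[k]addn0; apply: near_trans DE _.
  elim: EF => [x y|x|x y z _ xy _ yz]; [exact: near_deform | exact: steps_nil | exact: near0_trans xy yz].
exists F => //; exists F; split; [exact/goodP | by [] | exact: Relation_Operators.rt_refl].
Qed.

(** The hypotheses also show that either both diagrams can be unlinked or neither can; in the second
    case both numbers are the default value 0. *)
Lemma unknotting_eq D E :
  (forall k, unlinkable k D -> exists2 j, (j <= k)%N & unlinkable j E) ->
  (forall k, unlinkable k E -> exists2 j, (j <= k)%N & unlinkable j D) ->
  unknotting_number D = unknotting_number E.
Proof.
move=> DE ED; have [[k uD]|nD] := pselect (exists k, unlinkable k D); last first.
  have nE : ~ exists k, unlinkable k E.
    by case=> k /ED[j _ uj]; apply: nD; exists j.
  rewrite /unknotting_number; case: pselect => [h|_].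
    by have [k /asboolP uk] := h; case: nD; exists k.
  by case: pselect => // h; have [k /asboolP uk] := h; case: nE; exists k.
have [i _ uE] := DE _ uD.
have [j jD /unlinkable_leq uj] := DE _ (unlinkable_min uD).
have [l lE /unlinkable_leq ul] := ED _ (unlinkable_min uE).
by apply/eqP; rewrite eqn_leq (leq_trans ul lE) (leq_trans uj jD).
Qed.

(** The sublink to delete depends on the diagram, since an RII move exchanges edges between strands.
    The number of changes may drop, because changes at crossings with a deleted strand disappear. *)
Definition del_sim k D E := forall (g : good D) (gE : good E) (A : pred (dart D)) (sA : sublink A),
  (exists x, ~~ A x) -> exists B (sB : @sublink E B), (exists y, ~~ B y) /\
    exists2 j, (j <= k)%N & near j (del g sA) (del gE sB).

Lemma del_sim_trans i j D E F : good E -> del_sim i D E -> del_sim j E F -> del_sim (i + j) D F.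
Proof.
move=> gE DE EF g gF A sA exA.
have [B [sB [exB [k ki n1]]]] := DE g gE A sA exA.
have [C [sC [exC [l lj n2]]]] := EF gE gF B sB exB.
by exists C, sC; split=> //; exists (k + l)%N; [exact: leq_add | exact: near_trans n2].
Qed.

Lemma refines_del_sim D E (f : dart D -> dart E) : refines f -> del_sim 0 D E.
Proof.
move=> rf g gE A sA [x nAx]; have [B sB BA] := refines_sublink gE rf sA.
exists B, sB; split; first by exists (f x); rewrite BA.
by exists 0%N => //; apply: (del_refines g gE rf sA sB _ BA); exists x.
Qed.

Lemma refines_del_sim_inv D E (f : dart D -> dart E) : refines f -> del_sim 0 E D.
Proof.
move=> rf gE g A sA [y nAy]; have sB := sublink_comp rf sA.
have exB : exists x, ~~ A (f x).
  have [w yw] := ref_res rf y; have /imgP[x ex] := res_in yw; exists x.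
  by rewrite ex -(res_sublink sA (ref_off rf) yw).
exists (A \o f), sB; split=> //; exists 0%N => //; apply: near_sym.
exact: (del_refines g gE rf sB sA exB).
Qed.

(** Pasting already puts the darts of each pair on the same side; the last hypothesis relates the
    two pairs. *)
Lemma sublink_unsmooth D (g : good D) (a : dart D) (A : pred (dart D)) : crossing a ->
  @sublink (smooth a) A -> A (turn D (turn D a)) = A a -> sublink A.
Proof.
move=> ca [Ae A2 An] A2a.
have nc x : x \in vertex a -> ~~ @crossing (smooth a) x by rewrite crossing_smooth // => ->; rewrite andbF.
have A1 : A (turn D a) = A a.
  by have := An a (nc _ _); rewrite smooth_turn0 // inE eqxx; apply.
have A3 : A (turn D (turn D (turn D a))) = A a.
  by have := An _ (nc (turn D (turn D a)) _); rewrite smooth_turn2 // A2a !inE eqxx !orbT; apply.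
have Av x : x \in vertex a -> A x = A a by rewrite !inE => /or4P[]/eqP->.
split=> [//|x|x]; have [xa|xa] := boolP (x \in vertex a).
- by rewrite !Av ?(vertex_turn g).
- by have := A2 x; rewrite !smooth_turn_off ?(vertex_turn g).
- by rewrite !Av ?(vertex_turn g).
- by move=> cx; have := An x; rewrite crossing_smooth // xa andbT smooth_turn_off // => ->.
Qed.

Lemma monogon_lift D (g : good D) (a : dart D) (B : pred (dart D)) : monogon a ->
  @sublink (smooth (turn D a)) B -> sublink B.
Proof.
case=> ca fa _ sB; have ct : crossing (turn D a) by rewrite crossing_turn.
have ea : edge D a = turn D a by rewrite -{2}fa (faceE g) (turn4 g).
apply: (sublink_unsmooth g ct sB); have [Be _ Bn] := sB.
have b1 : B (turn D a) = B a by rewrite -[in LHS]ea; apply: Be.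
by rewrite b1; have := Bn (turn D (turn D (turn D a))); rewrite smooth_turn2 // (turn4 g) => <- //;
  rewrite crossing_smooth // !(vertex_turn g) vertex_sym // !(vertex_turn g) inE eqxx andbF.
Qed.

Lemma site_del_sim D (s : site D) : site_axiom s -> del_sim 0 D (delete_site s).
Proof.
case: s => a ax g gE A sA exA.
- have [sS n] := del_monogon g sA exA gE ax.
  by exists A, sS; split=> //; exists 0%N.
- have [B [sB [exB n _]]] := del_bigon g sA gE exA ax.
  by exists B, sB; split=> //; exists 0%N.
have [sE n] := del_triangle g sA gE exA ax.
by exists A, sE; split=> //; exists 0%N.
Qed.

Lemma site_del_sim_inv D (s : site D) : site_axiom s -> del_sim 0 (delete_site s) D.
Proof.
case: s => a ax gE g B sB exB.
- have sA := monogon_lift g ax sB.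
  have [sS n] := del_monogon g sA exB gE ax.
  exists B, sA; split=> //; exists 0%N => //.
  by rewrite (Prop_irrelevance sB sS); apply: near_sym.
- have [A [sA [exA n]]] := bigon_lift g gE sB ax exB.
  by exists A, sA; split=> //; exists 0%N => //; apply: near_sym.
have [sA n] := triangle_lift g gE sB ax exB.
by exists B, sA; split=> //; exists 0%N => //; apply: near_sym.
Qed.

Lemma change_del_sim D (a : dart D) : crossing a -> del_sim 1 D (change_crossing a).
Proof.
move=> ca g gE A sA exA; have n := del_change g sA exA ca.
exists A, sA; split=> //; exists (~~ A a && ~~ A (turn D a) : nat); first by case: (_ && _).
by rewrite (Prop_irrelevance gE (good_change a g)).
Qed.

Lemma isotopy_refines D E : u_isotopy1 D E -> exists f : dart D -> dart E, refines f.
Proof.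
case=> _ /goodP gE [f iso]; exists f.
by case: iso => [/iso_refines|/(subdivides_refines gE)].
Qed.

Lemma deform_del_sim D E : u_deform1 D E -> del_sim 0 D E.
Proof.
case=> [[|]|[|]].
- by case/isotopy_refines => f; apply: refines_del_sim.
- by case/isotopy_refines => f; apply: refines_del_sim_inv.
- case=> /goodP g /goodP gE [s ax [f iso]]; have gs := good_iso iso gE.
  exact: (del_sim_trans gs (site_del_sim ax) (refines_del_sim (iso_refines iso))).
case=> /goodP g /goodP gE [s ax [f iso]]; have gs := good_iso iso gE.
exact: (del_sim_trans gs (refines_del_sim_inv (iso_refines iso)) (site_del_sim_inv ax)).
Qed.

Lemma near_del_sim k D E : near k D E -> del_sim k D E.
Proof.
elim=> {k D E} [D|k D E F _ IH EF|k D E F _ IH EF].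
- move=> g gE A sA exA; exists A, sA; split=> //; exists 0%N => //.
  by rewrite (Prop_irrelevance gE g); apply: steps_nil.
- have gE : good E by apply/goodP; case: EF => [[]|[]] [].
  by rewrite -[k]addn0; apply: del_sim_trans gE IH (deform_del_sim EF).
case: EF => /goodP gE /goodP gF [a ca [f iso]]; rewrite -addn1.
apply: (del_sim_trans gE IH); rewrite -[1%N]addn0.
exact: del_sim_trans (good_change a gE) (change_del_sim ca) (refines_del_sim (iso_refines iso)).
Qed.

Lemma unlinkable_del k D (g : good D) (A : pred (dart D)) (sA : sublink A) :
  (exists x, ~~ A x) -> unlinkable k D -> exists2 j, (j <= k)%N & unlinkable j (del g sA).
Proof.
move=> exA /unlinkableP[F [gF cF DF]].
have [B [sB [exB [j jk n]]]] := near_del_sim DF g gF sA exA.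
exists j => //; apply/unlinkableP; exists (del gF sB); split=> //; first exact: good_del.
by move=> x; rewrite crossing_del negb_and cF.
Qed.

(** * Addition of a circle *)

(** Names for the regions of an enlarged diagram: [inl x] is the region of [D] on the left of [x],
    and [inr] provides up to two new ones. *)
Definition key_rel (D : udiagram) : rel (dart D + bool) := fun u v =>
  match u, v with inl x, inl y => region D x y | inr i, inr j => i == j | _, _ => false end.

Lemma key_rel_equiv D (g : good D) : equivalence_rel (@key_rel D).
Proof.
apply: mk_equivalence => [[x|i]|[x|i] [y|j]|[y|j] [x|i] [z|k]] //=;
  by [apply: (regxx g) | apply/idP/idP; apply: (regS g) | apply: (regT g) | move/eqP->].
Qed.

Lemma pull_equiv (T U : Type) (R : rel U) (F : T -> U) : equivalence_rel R ->
  equivalence_rel (fun x y => R (F x) (F y)).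
Proof.
move=> eR; apply: mk_equivalence => [x|x y|y x z].
- exact: eqrel_refl.
- by apply/idP/idP; apply: eqrel_sym.
- exact: eqrel_trans.
Qed.

(* A small circle in the region on the left of r. *)
Section Circle.
Variables (D : udiagram) (r : dart D).
Let T := (dart D + bool)%type.
Let ef (u : T) : T := match u with inl x => inl (edge D x) | inr i => inr (~~ i) end.
Let tf (u : T) : T := match u with inl x => inl (turn D x) | inr i => inr (~~ i) end.
Hypothesis g : good D.
Let efK : involutive ef. Proof. by case=> [x|[]] //=; rewrite (edgeK g). Qed.
Let tf_inj : injective tf.
Proof. by case=> [x|i] [y|j] //= []; [move/turn_inj-> | case: i; case: j]. Qed.

(** The circle has one edge and one 2-valent vertex. Its dart [inr true] has the region of [r] on
    the left, and [inr false] the inside, named [inr true] as a region. *)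
Definition circ_key (u : T) : dart D + bool :=
  match u with inl x => inl x | inr i => if i then inl r else inr true end.

Definition circ : udiagram := {|
  dart := T;
  edge := perm (can_inj efK);
  turn := perm tf_inj;
  over := fun u => if u is inl x then over D x else true;
  region := fun u v => key_rel (circ_key u) (circ_key v) |}.

Lemma circ_edge (u : dart circ) : edge circ u = ef u. Proof. by rewrite permE. Qed.
Lemma circ_turn (u : dart circ) : turn circ u = tf u. Proof. by rewrite permE. Qed.

Lemma circ_crossing (u : dart circ) : crossing u = if u is inl x then crossing x else false.
Proof. by rewrite /crossing !circ_turn; case: u => [x|[]]. Qed.

Lemma circ_crossing_inl (x : dart D) : crossing (inl x : dart circ) = crossing x.
Proof. exact: circ_crossing. Qed.

Lemma good_circ : good circ.
Proof.
have eR := key_rel_equiv g; split.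
- by move=> u; rewrite !circ_edge efK.
- by move=> u; rewrite circ_edge; case: u => [x|[]] //=; apply: contra (edge_neq g x) => /eqP[->].
- by move=> u; rewrite !circ_turn; case: u => [x|[]] //=; rewrite (turn4 g).
- by move=> u; rewrite circ_turn; case: u => [x|[]] //=; apply: contra (turn_neq g x) => /eqP[->].
- by move=> u; rewrite circ_crossing circ_turn; case: u => [x|[]] //=; apply: over_turn.
- exact: pull_equiv.
- move=> u; rewrite circ_turn circ_edge; case: u => [x|i] /=; first exact: region_corner.
  by rewrite negbK; apply: (eqrel_refl eR).
- by exists (inl r).
- move=> P Pe Pr; have Pl x y : P (inl x) = P (inl y).
    apply: (good_connected g (P := fun x => P (inl x))) => [z|u v uv]; last exact: Pr.
    by have := Pe (inl z); rewrite circ_edge.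
  have P1 : P (inr true) = P (inl r) by apply: Pr => /=; apply: regxx.
  have P2 : P (inr false) = P (inl r) by have := Pe (inr true); rewrite circ_edge /= P1.
  have Pr' u : P u = P (inl r) by case: u => [x|[]] //; apply: Pl.
  by move=> u v; rewrite (Pr' u) (Pr' v).
move=> f [fe f4].
have [h hr hf] : exists2 h, forall d e, region D d e -> h d = h e
             & forall d, f (inl d) = h d - h (edge D d).
  apply: (good_exact g); split=> x.
    by have := fe (inl x); rewrite circ_edge.
  by have := f4 (inl x); rewrite !circ_turn.
(* The potential inside the circle is the outer potential minus the flow along the dart that has the
   outside on its left. *)
pose k (u : dart D + bool) := match u with inl x => h x | inr _ => h r - f (inr true) end.
exists (fun u => k (circ_key u)).
  by case=> [x|[]] [y|[]] //=; apply: hr.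
move=> u; rewrite circ_edge; case: u => [x|[]] /=; first exact: hf.
  by rewrite opprB addrC subrK.
by have := fe (inr true); rewrite circ_edge /= => ->; rewrite addrAC subrr add0r.
Qed.
End Circle.

(* A small circle passing over the middle of the edge of r.  The new darts are
   numbered 0..3 (west, south, east, north) at the crossing where r arrives, and
   4..7 at the other one. *)
Section Straddle.
Variables (D : udiagram) (r : dart D).
Let T := (dart D + 'I_8)%type.
Let n (i : nat) : T := inr (inord i).
Let ef (u : T) : T := match u with
  | inl x => if x == r then n 0 else if x == edge D r then n 6 else inl (edge D x)
  | inr i => nth (inl r) [:: inl r; n 5; n 4; n 7; n 2; n 1; inl (edge D r); n 3] i end.
Let tf (u : T) : T := match u with
  | inl x => inl (turn D x)
  | inr i => nth (inl r) [:: n 1; n 2; n 3; n 0; n 5; n 6; n 7; n 4] i end.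
Hypothesis g : good D.
Let nE i : (i < 8)%N -> nat_of_ord (inord i : 'I_8) = i. Proof. exact: inordK. Qed.
Let case8 (P : T -> Prop) : (forall x, P (inl x)) -> (forall i, (i < 8)%N -> P (n i)) -> forall u, P u.
Proof. by move=> Pl Pn [x//|i]; rewrite -[i]inord_val; apply: Pn. Qed.
Let er : edge D r != r := edge_neq g r.
Let efK : involutive ef.
Proof.
apply: case8 => [x|i].
  rewrite /=; case: eqP => [->|xr]; first by rewrite /= nE.
  case: eqP => [->|xe]; first by rewrite /= nE.
  rewrite /= (can2_eq (edgeK g) (edgeK g)) (negbTE (introN eqP xe)).
  by rewrite (inj_eq (@perm_inj _ (edge D))) (negbTE (introN eqP xr)) (edgeK g).
by case: i => [|[|[|[|[|[|[|[|i]]]]]]]] // _; rewrite /= !nE //= ?nE //= ?eqxx ?(negbTE er).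
Qed.
Let tn i : (i < 8)%N -> tf (n i) = n (nth 0 [:: 1; 2; 3; 0; 5; 6; 7; 4] i)%N.
Proof. by case: i => [|[|[|[|[|[|[|[|i]]]]]]]] // _; rewrite /= nE. Qed.
Let tf4 u : tf (tf (tf (tf u))) = u.
Proof.
elim/case8: u => [x|i]; first by rewrite /= (turn4 g).
by case: i => [|[|[|[|[|[|[|[|i]]]]]]]] // _; rewrite !tn.
Qed.
Let tf_inj : injective tf.
Proof. by apply: (can_inj (g := tf \o tf \o tf)) => u; apply: tf4. Qed.

Let key (u : T) : dart D + bool := match u with
  | inl x => inl x
  | inr i => nth (inl r) [:: inl (edge D r); inr false; inr true; inl r;
                             inr false; inl (edge D r); inl r; inr true] i end.

Definition straddle : udiagram := {|
  dart := T;
  edge := perm (can_inj efK);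
  turn := perm tf_inj;
  over := fun u => match u with inl x => over D x
    | inr i => nth true [:: false; true; false; true; false; true; false; true] i end;
  region := fun u v => key_rel (key u) (key v) |}.

Let seE (u : dart straddle) : edge straddle u = ef u. Proof. by rewrite permE. Qed.
Let stE (u : dart straddle) : turn straddle u = tf u. Proof. by rewrite permE. Qed.

Let en i : (i < 8)%N -> ef (n i) = nth (inl r) [:: inl r; n 5; n 4; n 7; n 2; n 1; inl (edge D r); n 3] i.
Proof. by case: i => [|[|[|[|[|[|[|[|i]]]]]]]] // _; rewrite /= nE. Qed.
Let n_eq i j : (i < 8)%N -> (j < 8)%N -> (n i == n j) = (i == j).
Proof. by move=> i8 j8; rewrite -[LHS]/(inord i == inord j) -val_eqE /= !nE. Qed.

Lemma good_straddle : good straddle.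
Proof.
have eR := key_rel_equiv g; split.
- by move=> u; rewrite !seE efK.
- move=> u; rewrite seE; elim/case8: u => [x|i i8] /=.
    by case: ifP => // _; case: ifP => // _; apply: contra (edge_neq g x) => /eqP[e]; apply/eqP.
  by rewrite -[X in X != _]/(ef (n i)) en //; case: i i8 => [|[|[|[|[|[|[|[|i]]]]]]]] // _; rewrite n_eq.
- by move=> u; rewrite !stE tf4.
- move=> u; rewrite stE; elim/case8: u => [x|i i8].
    by apply: contra (turn_neq g x) => /eqP[->].
  by rewrite tn //; case: i i8 => [|[|[|[|[|[|[|[|i]]]]]]]] // _; rewrite n_eq.
- move=> u; rewrite /crossing !stE; elim/case8: u => [x|i i8].
    by move=> cx; apply: (over_turn g); apply: contra cx => /eqP /= ->.
  by rewrite tn //; case: i i8 => [|[|[|[|[|[|[|[|i]]]]]]]] // _; rewrite /= !nE.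
- exact: pull_equiv.
- move=> u; rewrite stE seE; elim/case8: u => [x|i i8]; last first.
    rewrite tn //; case: i i8 => [|[|[|[|[|[|[|[|i]]]]]]]] // _; rewrite en //= ?nE //=; exact: regxx.
  have := region_corner g x; rewrite /=; case: eqP => [->|_]; first by rewrite /= nE.
  by case: eqP => [->|_]; rewrite //= nE //= (edgeK g).
- by exists (inl r).
- move=> P Pe Pr.
  have P0 : P (n 0) = P (inl r) by rewrite -[in RHS](Pe (inl r)) seE /= eqxx.
  have P3 : P (n 3) = P (inl r) by apply: Pr; rewrite /= nE //=; apply: regxx.
  have P6 : P (n 6) = P (inl r) by apply: Pr; rewrite /= nE //=; apply: regxx.
  have Per : P (inl (edge D r)) = P (inl r) by rewrite -P0; apply: Pr; rewrite /= nE //=; apply: regxx.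
  have P7 : P (n 7) = P (inl r) by rewrite -(Pe (n 7)) seE en.
  have P5 : P (n 5) = P (inl r) by rewrite -Per; apply: Pr; rewrite /= nE //=; apply: regxx.
  have P1 : P (n 1) = P (inl r) by rewrite -(Pe (n 1)) seE en.
  have P2 : P (n 2) = P (inl r) by rewrite -P7; apply: Pr; rewrite /= !nE.
  have P4 : P (n 4) = P (inl r) by rewrite -(Pe (n 4)) seE en.
  have Pl x y : P (inl x) = P (inl y).
    apply: (good_connected g (P := fun x => P (inl x))) => [z|u v uv]; last exact: Pr.
    have [->|zr] := eqVneq z r; first by rewrite Per.
    have [->|ze] := eqVneq z (edge D r); first by rewrite (edgeK g) Per.
    by have := Pe (inl z); rewrite seE /= (negbTE zr) (negbTE ze).
  have Pr' : forall u, P u = P (inl r).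
    by apply: case8 => [x|[|[|[|[|[|[|[|[|i]]]]]]]]] //; apply: Pl.
  by move=> u v; rewrite (Pr' u) (Pr' v).
move=> f [fe f4].
have fn i j : (i < 8)%N -> (j < 8)%N -> ef (n i) = n j -> f (n j) = - f (n i).
  by move=> i8 j8 e; have := fe (n i); rewrite seE e.
have f42 : f (n 4) = - f (n 2) by apply: fn; rewrite ?en.
have f51 : f (n 5) = - f (n 1) by apply: fn; rewrite ?en.
have f73 : f (n 7) = - f (n 3) by apply: fn; rewrite ?en.
have s0 : f (n 0) + f (n 1) + f (n 2) + f (n 3) = 0.
  by have := f4 (n 0); rewrite !stE !tn.
have s4 : f (n 4) + f (n 5) + f (n 6) + f (n 7) = 0.
  by have := f4 (n 4); rewrite !stE !tn.
have f0 : f (n 0) = - f (inl r) by have := fe (inl r); rewrite seE /= eqxx.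
have f6 : f (n 6) = - f (inl (edge D r)).
  by have := fe (inl (edge D r)); rewrite seE /= (negbTE er) eqxx.
(* The flow along the circle cancels between the two crossings, so what enters along one half of the
   cut edge leaves along the other. *)
have fer : f (inl (edge D r)) = - f (inl r) by lra.
have [h hr hf] : exists2 h, forall d e, region D d e -> h d = h e
             & forall d, f (inl d) = h d - h (edge D d).
  apply: (good_exact g); split=> x; last by have := f4 (inl x); rewrite !stE.
  have [->|zr] := eqVneq x r; first by rewrite fer.
  have [->|ze] := eqVneq x (edge D r); first by rewrite (edgeK g) fer opprK.
  by have := fe (inl x); rewrite seE /= (negbTE zr) (negbTE ze).
pose k (u : dart D + bool) := match u with inl x => h x
  | inr true => h r - f (n 3) | inr false => h (edge D r) + f (n 1) end.
exists (fun u => k (key u)).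
  move=> u v; rewrite -[region _ _ _]/(key_rel (key u) (key v)).
  by case: (key u) (key v) => [x|[]] [y|[]] //=; apply: hr.
have hr' := hf r; have hk i : (i < 8)%N -> k (key (n i)) =
  nth 0 [:: h (edge D r); h (edge D r) + f (n 1); h r - f (n 3); h r;
        h (edge D r) + f (n 1); h (edge D r); h r; h r - f (n 3)] i.
  by case: i => [|[|[|[|[|[|[|[|i]]]]]]]] // _; rewrite /= nE.
move=> u; rewrite seE; elim/case8: u => [x|i i8].
  rewrite -[ef (inl x)]/(if x == r then n 0 else if x == edge D r then n 6 else inl (edge D x)).
  rewrite -[k (key (inl x))]/(h x); case: eqP => [->|_]; first by rewrite hk // hf.
  by case: eqP => [->|_]; rewrite ?hk //= hf ?(edgeK g).
rewrite en // hk //; case: i i8 => [|[|[|[|[|[|[|[|i]]]]]]]] // _; rewrite [nth _ _ _]/= ?hk //= ; try lra.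
Qed.

Definition straddle_new (i : nat) : dart straddle := n i.
Definition straddle_key := key.
Lemma straddle_case (P : dart straddle -> Prop) : (forall x, P (inl x)) ->
  (forall i, (i < 8)%N -> P (straddle_new i)) -> forall u, P u.
Proof. exact: case8. Qed.
Lemma straddle_new_eq i j : (i < 8)%N -> (j < 8)%N -> (straddle_new i == straddle_new j) = (i == j).
Proof. exact: n_eq. Qed.
Lemma straddle_turn i : (i < 8)%N ->
  turn straddle (straddle_new i) = straddle_new (nth 0 [:: 1; 2; 3; 0; 5; 6; 7; 4] i)%N.
Proof. by move=> i8; apply: etrans (stE _) (tn i8). Qed.
Lemma straddle_turn_inl x : turn straddle (inl x) = inl (turn D x).
Proof. exact: stE. Qed.
Lemma straddle_edge i : (i < 8)%N -> edge straddle (straddle_new i) =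
  nth (inl r) [:: inl r; straddle_new 5; straddle_new 4; straddle_new 7;
    straddle_new 2; straddle_new 1; inl (edge D r); straddle_new 3] i.
Proof. by move=> i8; apply: etrans (seE _) (en i8). Qed.
Lemma straddle_edge_inl x : edge straddle (inl x) =
  if x == r then straddle_new 0 else if x == edge D r then straddle_new 6 else inl (edge D x).
Proof. exact: seE. Qed.
Lemma straddle_over i : (i < 8)%N -> over straddle (straddle_new i) =
  nth true [:: false; true; false; true; false; true; false; true] i.
Proof. by move=> i8; rewrite /= nE. Qed.
Lemma straddle_key_new i : (i < 8)%N -> straddle_key (straddle_new i) =
  nth (inl r) [:: inl (edge D r); inr false; inr true; inl r;
                  inr false; inl (edge D r); inl r; inr true] i.
Proof. by move=> i8; rewrite /straddle_key /straddle_new /= nE. Qed.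
Lemma straddle_region u v : region straddle u v = key_rel (straddle_key u) (straddle_key v).
Proof. by []. Qed.
End Straddle.

Section NearStraddle.
Variables (D : udiagram) (g : good D) (r : dart D).
Local Notation M := (straddle r g).
Local Notation C := (circ (edge D r) g).
Local Notation n := (straddle_new r g).

Let loc := [:: n 0; n 1; n 2; n 3; n 4; n 5; n 6; n 7].
Let loc_n i : (i < 8)%N -> nth (n 0) loc i = n i.
Proof. by case: i => [|[|[|[|[|[|[|[|i]]]]]]]]. Qed.
Let sloc : size loc = 8%N. Proof. by []. Qed.
Let uloc : uniq loc.
Proof.
apply/(uniqP (n 0)) => i j; rewrite !inE sloc => i8 j8; rewrite !loc_n // => /eqP.
by rewrite straddle_new_eq // => /eqP.
Qed.
Local Notation t := [:: 1; 2; 3; 0; 5; 6; 7; 4]%N.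
Local Notation t1 := [:: 3; 2; 1; 0; 5; 6; 7; 4]%N.
Local Notation t2 := [:: 3; 2; 1; 0; 5; 4; 7; 6]%N.
Let gM := good_straddle r g.
Let ok1 : smooth_check 8 t t1 3. Proof. by []. Qed.
Let ok2 : smooth_check 8 t1 t2 4. Proof. by []. Qed.
Let tE : @turn_table M (n 0) loc 8 t.
Proof.
move=> i i8; rewrite !loc_n ?straddle_turn //.
by case: i i8 => [|[|[|[|[|[|[|[|i]]]]]]]].
Qed.
Let d i := nth (n 0) loc i.
Let M1 := @smooth M (d 3).
Let M2 := @smooth M1 (d 4).
Let t1E := smooth_table gM uloc sloc tE ok1.
Let g1 := smooth_good gM uloc sloc tE ok1.
Let t2E := smooth_table g1 uloc sloc t1E ok2.
Let g2 := smooth_good g1 uloc sloc t1E ok2.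
Let off x : (inl x : dart M) \notin loc. Proof. by rewrite !inE. Qed.
Let t2_inl x : turn M2 (inl x) = inl (turn D x).
Proof.
rewrite (smooth_table_off g1 uloc sloc t1E ok2 (off x)).
by rewrite (smooth_table_off gM uloc sloc tE ok1 (off x)) straddle_turn_inl.
Qed.
Let t2_new i : (i < 8)%N -> turn M2 (n i) = n (nth 0 t2 i)%N.
Proof.
move=> i8; rewrite -{1}loc_n // t2E // loc_n //.
by case: i i8 => [|[|[|[|[|[|[|[|i]]]]]]]].
Qed.
Let e2 i : (i < 8)%N -> edge M2 (n i) =
  nth (inl r) [:: inl r; n 5; n 4; n 7; n 2; n 1; inl (edge D r); n 3] i.
Proof. exact: straddle_edge. Qed.

Let K (u : dart M2) := match u with inl _ => true | inr i => (i == 4 :> nat) || (i == 5 :> nat) end.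
Let Kn i : (i < 8)%N -> K (n i) = (i == 4)%N || (i == 5)%N.
Proof. by move=> i8; rewrite /K /= inordK. Qed.
Let f (u : dart M2) : dart C := match u with inl x => inl x | inr i => inr (i == 5 :> nat) end.
Let fn i : (i < 8)%N -> f (n i) = inr (i == 5)%N.
Proof. by move=> i8; rewrite /f /= inordK. Qed.
Let skip i j : (i < 8)%N -> (j < 8)%N -> ~~ K (n i) -> nth 0%N t2 i = j -> forall y,
  res K (edge M2 (n j)) y -> res K (n i) y.
Proof. by move=> i8 j8 nK ij y ry; apply: res_skip => //; rewrite t2_new // ij. Qed.

Let r0 : res K (n 0) (inl (edge D r)).
Proof.
apply: (skip (j := 3)); rewrite ?Kn ?e2 //=.
by apply: (skip (j := 6)); rewrite ?Kn ?e2 //=; apply: res_here.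
Qed.
Let r6 : res K (n 6) (inl r).
Proof.
apply: (skip (j := 7)); rewrite ?Kn ?e2 //=.
by apply: (skip (j := 0)); rewrite ?Kn ?e2 //=; apply: res_here.
Qed.
Let r1 : res K (n 1) (n 4).
Proof. by apply: (skip (j := 2)); rewrite ?Kn ?e2 //=; apply: res_here; rewrite Kn. Qed.
Let r2 : res K (n 2) (n 5).
Proof. by apply: (skip (j := 1)); rewrite ?Kn ?e2 //=; apply: res_here; rewrite Kn. Qed.

(** The half of the disk on the left of [r] is a bigon between [n 2] and [n 7]; removing it pulls
    the whole circle to the other side of the edge. *)
Lemma near_straddle : near 0 M C.
Proof.
have fa2 : face M (n 2) = n 7.
  by rewrite (faceE gM) straddle_edge //= !straddle_turn.
have fa7 : face M (n 7) = n 2.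
  by rewrite (faceE gM) straddle_edge //= !straddle_turn.
have c i : (i < 8)%N -> @crossing M (n i).
  by rewrite /crossing; case: i => [|[|[|[|[|[|[|[|i]]]]]]]] // _; rewrite !straddle_turn // straddle_new_eq.
have big : @bigon M (n 2).
  split; rewrite ?fa2 ?fa7 //.
  - by split; apply: c.
  - by rewrite (porbit_vertex gM) !inE !straddle_turn // !straddle_new_eq.
  - by rewrite straddle_edge // !straddle_over.
  - elim/straddle_case => [x|i i8]; rewrite straddle_region !straddle_key_new //=.
    case: i i8 => [|[|[|[|[|[|[|[|i]]]]]]]] // _ _; first exact: porbit_id.
    by rewrite -fa2; have := mem_porbit (face M) 1 (n 2); rewrite expg1.
have eM2 : delete_site (Bigon (n 2)) = M2.
  by rewrite /delete_site fa2 !straddle_turn.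
have gs : good (delete_site (Bigon (n 2))) by rewrite eM2.
apply: (near0_trans (near_site gM gs big)); rewrite eM2.
have gC := good_circ (edge D r) g.
apply: (@weak_iso M2 C g2 gC K xpredT f) => //.
- elim/straddle_case => [x|i i8]; first by rewrite t2_inl.
  rewrite t2_new // !Kn //; last by case: i i8 => [|[|[|[|[|[|[|[|i]]]]]]]].
  by case: i i8 => [|[|[|[|[|[|[|[|i]]]]]]]].
- elim/straddle_case => [x //|i i8]; rewrite /crossing.
  by case: i i8 => [|[|[|[|[|[|[|[|i]]]]]]]] // _; rewrite !t2_new // eqxx.
- elim/straddle_case => [x|i i8]; first by exists (inl x); apply: res_here.
  case: i i8 => [|[|[|[|[|[|[|[|i]]]]]]]] // _; try by eexists; eassumption.
  + by exists (inl r); apply: (skip (j := 0)); rewrite ?Kn ?e2 //=; apply: res_here.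
  + by exists (n 4); apply: res_here; rewrite Kn.
  + by exists (n 5); apply: res_here; rewrite Kn.
  + by exists (inl (edge D r)); apply: (skip (j := 6)); rewrite ?Kn ?e2 //=; apply: res_here.
- by move=> u; exists u; apply: res_here.
- elim/straddle_case => [x|i i8]; elim/straddle_case => [y|j j8] //; rewrite ?Kn ?fn //.
  + by move=> _ _ [->].
  + by move=> /orP[]/eqP-> /orP[]/eqP->.
- move=> [x|[]] _; first by exists (inl x).
    by exists (n 5); rewrite ?Kn ?fn.
  by exists (n 4); rewrite ?Kn ?fn.
- elim/straddle_case => [x _|i i8]; first by rewrite t2_inl circ_turn.
  by rewrite Kn // circ_turn => /orP[]/eqP->; rewrite t2_new // !fn.
- elim/straddle_case => [x|i i8] //; rewrite /crossing.
  by case: i i8 => [|[|[|[|[|[|[|[|i]]]]]]]] // _ _; rewrite !t2_new // eqxx.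
- pose F (u : dart D + bool) : dart D + bool :=
    match u with inl x => inl x | inr i => if i then inl (edge D r) else inr true end.
  have eR := key_rel_equiv g.
  have FK u : K u -> circ_key (edge D r) (f u) = F (straddle_key r u).
    elim/straddle_case: u => [x|i i8] //; rewrite Kn // => /orP[]/eqP->; rewrite fn //=;
    by rewrite -[RHS]/(F (straddle_key r (n _))) straddle_key_new.
  move=> u v /FK fu /FK fv; rewrite -[region C _ _]/(key_rel (circ_key _ _) (circ_key _ _)) fu fv.
  have E2 : region M2 = merge (region M1) (d 5) (d 7).
    exact: (smooth_table_region t1E ok2).
  have E1 : region M1 = merge (region M) (d 0) (d 2).
    exact: (smooth_table_region tE ok1).
  rewrite E2 E1; apply: (merge_hom (F := fun u => F (straddle_key r u)) eR).
    apply: (merge_hom (F := fun u => F (straddle_key r u)) eR).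
      move=> {u v fu fv} u v; rewrite straddle_region.
      by case: (straddle_key r u) (straddle_key r v) => [x|[]] [y|[]] //= _; apply: regxx.
    by rewrite -[d 0]/(n 0) -[d 2]/(n 2) !straddle_key_new //=; apply: regxx.
  by rewrite -[d 5]/(n 5) -[d 7]/(n 7) !straddle_key_new //=; apply: regxx.
elim/straddle_case => [x _|i i8].
  exists (inl (edge D x)); last by rewrite circ_edge; apply: res_here.
  rewrite -[edge M2 _]/(edge M (inl x)) straddle_edge_inl.
  case: eqP => [->|_] //; case: eqP => [->|_]; first by rewrite (edgeK g).
  exact: res_here.
rewrite Kn // => /orP[]/eqP->.
  have -> : edge M2 (n 4) = n 2 by rewrite e2.
  by exists (n 5) => //; rewrite !fn // circ_edge; apply: res_here.
have -> : edge M2 (n 5) = n 1 by rewrite e2.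
by exists (n 4) => //; rewrite !fn // circ_edge; apply: res_here.
Qed.
End NearStraddle.

Section Transport.
Variables (D : udiagram) (g : good D).

(** A half-turn of the picture: the list [s] exchanges the two crossings together with west and
    east, south and north. *)
Lemma straddle_edge_iso (r : dart D) : near 0 (straddle r g) (straddle (edge D r) g).
Proof.
have ii i : (i < 8)%N -> nat_of_ord (inord i : 'I_8) = i by exact: inordK.
pose s := [:: 6; 7; 4; 5; 2; 3; 0; 1]%N.
pose f (u : dart (straddle r g)) : dart (straddle (edge D r) g) :=
  match u with inl x => inl x | inr i => straddle_new (edge D r) g (nth 0 s i)%N end.
have fn i : (i < 8)%N -> f (straddle_new r g i) = straddle_new (edge D r) g (nth 0 s i)%N.
  by move=> i8; rewrite /f /= ii.
have s8 i : (nth 0 s i < 8)%N by case: i => [|[|[|[|[|[|[|[|i]]]]]]]] //=; rewrite nth_nil.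
have f_inj : injective f.
  move=> u v; elim/straddle_case: u => [x|i i8]; elim/straddle_case: v => [y|j j8].
  - by case=> ->.
  - by rewrite fn // => -[].
  - by rewrite fn // => -[].
  rewrite !fn // => /eqP; rewrite straddle_new_eq // => e; congr (straddle_new r g).
  move: e; case: i i8 => [|[|[|[|[|[|[|[|i]]]]]]]] // _;
    by case: j j8 => [|[|[|[|[|[|[|[|j]]]]]]]].
have gs := good_straddle r g; have gs' := good_straddle (edge D r) g.
apply: (near_iso gs gs' (f := f)); apply: isomorphism_hom => //.
- exact: injF_bij.
- elim/straddle_case => [x|i i8].
    rewrite [RHS]straddle_edge_inl straddle_edge_inl (edgeK g).
    case: (eqVneq x r) => [->|_]; first by rewrite eq_sym (negbTE (edge_neq g r)) fn.
    by case: ifP => _; rewrite ?fn.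
  rewrite fn // !straddle_edge // (edgeK g).
  case: i i8 => [|[|[|[|[|[|[|[|i]]]]]]]] // _; rewrite ?[nth _ _ _]/= ?fn //.
- elim/straddle_case => [x|i i8]; first by rewrite [RHS]straddle_turn_inl straddle_turn_inl.
  rewrite fn // !straddle_turn // fn //; last by case: i i8 => [|[|[|[|[|[|[|[|i]]]]]]]].
  by case: i i8 => [|[|[|[|[|[|[|[|i]]]]]]]].
- elim/straddle_case => [x|i i8] // _; rewrite fn // !straddle_over //.
  by case: i i8 => [|[|[|[|[|[|[|[|i]]]]]]]].
pose F (u : dart D + bool) : dart D + bool := match u with inl x => inl x | inr i => inr (~~ i) end.
have FK u : straddle_key (edge D r) (f u) = F (straddle_key r u).
  elim/straddle_case: u => [x|i i8] //; rewrite fn // !straddle_key_new // (edgeK g).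
  by case: i i8 => [|[|[|[|[|[|[|[|i]]]]]]]].
move=> u v; rewrite !straddle_region !FK.
by case: (straddle_key r u) (straddle_key r v) => [x|[]] [y|[]].
Qed.

(** An RII move puts the circle over an edge and another takes it off on the far side; connectedness
    of the sphere carries it from there to any region. *)
Lemma circ_transport (r r' : dart D) : near 0 (circ r g) (circ r' g).
Proof.
have across x : near 0 (circ x g) (circ (edge D x) g).
  apply: near0_trans (near_straddle g x); apply: near0_trans (near_sym (straddle_edge_iso x)).
  by have := near_straddle g (edge D x); rewrite (edgeK g) => /near_sym.
have same x y : region D x y -> near 0 (circ x g) (circ y g).
  move=> xy; apply: (near_iso (good_circ x g) (good_circ y g)
    (f := fun u : dart (circ x g) => (u : dart (circ y g)))).
  apply: isomorphism_hom; [exact: good_circ | exact: good_circ | by exists id | | | by [] |].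
  - by move=> u; rewrite [RHS]circ_edge; apply: circ_edge.
  - by move=> u; rewrite [RHS]circ_turn; apply: circ_turn.
  have K u : key_rel (@circ_key D x u) (@circ_key D y u).
    by case: u => [z|[]] //=; apply: regxx.
  move=> u v; rewrite -[region _ _ _]/(key_rel (circ_key x u) (circ_key x v)) => uv.
  have eR := key_rel_equiv g.
  exact: (eqrel_trans eR (eqrel_sym eR (K u)) (eqrel_trans eR uv (K v))).
pose P x := `[< near 0 (circ x g) (circ r' g) >].
have e : P r = P r'.
  apply: (good_connected g (P := P)) => [x|x y xy].
    apply/asboolP/asboolP => n; first exact: near0_trans (across x) n.
    exact: near0_trans (near_sym (across x)) n.
  apply/asboolP/asboolP => n; first exact: near0_trans (near_sym (same x y xy)) n.
  exact: near0_trans (same x y xy) n.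
by apply/asboolP; rewrite -/(P r) e; apply/asboolP/steps_nil.
Qed.
End Transport.

Lemma circ_refines D E (g : good D) (gE : good E) (f : dart D -> dart E) (r : dart D) :
  refines f -> near 0 (circ r g) (circ (f r) gE).
Proof.
move=> rf; pose F (u : dart (circ r g)) : dart (circ (f r) gE) :=
  match u with inl x => inl (f x) | inr i => inr i end.
have iF y : img F (inl y) = img f y.
  by apply/imgP/imgP=> [[[x|i] //= [<-]]|[x <-]]; [exists x | exists (inl x)].
have rF y z : res (img f) y z -> res (img F) (inl y) (inl z).
  elim=> {y z} [y|y z ny _ IH]; first by rewrite -iF; apply: res_here.
  by apply: res_skip; rewrite ?iF // circ_turn circ_edge.
have resF i : res (img F) (inr i) (inr i) by apply: res_here; apply/imgP; exists (inr i).
apply: (near_refines (f := F)); [exact: good_circ | exact: good_circ |].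
split.
- by move=> [x|i] [y|j] //= []; [move/(ref_inj rf)-> | move->].
- by move=> [x|i]; rewrite !circ_turn //= (ref_turn rf).
- by move=> [x|i] //; rewrite circ_crossing => /(ref_over rf).
- by move=> [x|[]] [y|[]] //=; rewrite (ref_region rf).
- by move=> [y|i]; rewrite ?iF circ_crossing //; apply: (ref_off rf).
- move=> [x|i]; rewrite !circ_edge /=; last exact: resF.
  exact/rF/(ref_edge rf).
- move=> [y|i]; last by exists (inr i).
  by have [x yx] := ref_res rf y; exists (inl x); apply: rF.
Qed.

Lemma circ_smooth D (g : good D) (a r : dart D) (gS : good (smooth a)) : crossing a ->
  @isomorphism (@smooth (circ r g) (inl a)) (@circ (smooth a) r gS) (fun u => u).
Proof.
move=> ca; have gC := good_circ r g.
have ca' : @crossing (circ r g) (inl a) by rewrite circ_crossing.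
have gS' := good_smooth gC ca'.
apply: (isomorphism_hom gS' (good_circ _ _)).
- by exists id.
- by move=> u; apply: etrans (@circ_edge D r g u) (esym (@circ_edge (smooth a) r gS u)).
- move=> u; apply: etrans (esym (@circ_turn (smooth a) r gS u)); rewrite (smooth_turn gC ca') !circ_turn.
  case: u => [x|i] //=; rewrite (smooth_turn g ca) !(inj_eq (@inl_inj _ _)).
  by do 2?case: ifP.
- by [].
have eR := key_rel_equiv gS.
apply: (merge_hom (F := @circ_key D r) eR).
- move=> u v; rewrite -[region _ _ _]/(key_rel (circ_key r u) (circ_key r v)).
  by case: (circ_key r u) (circ_key r v) => [x|i] [y|j] //=; apply: merge_sub.
- by rewrite !circ_turn /=; apply/merge_pair/region_equiv.
Qed.

Lemma circ_change D (g : good D) (a r : dart D) : crossing a ->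
  near 1 (circ r g) (@circ (change_crossing a) r (good_change a g)).
Proof.
move=> ca; have gC := good_circ r g.
have ca' : @crossing (circ r g) (inl a) by rewrite circ_crossing.
have gc := good_change a g; have gcC := @good_change (circ r g) (inl a) gC.
apply: (near_trans (j := 1) (k := 0) (near_change_crossing gC ca')).
have gCc := good_circ (r : dart (change_crossing a)) gc.
rewrite (Prop_irrelevance (good_change a g) gc).
apply: (@near_iso (@change_crossing (circ r g) (inl a)) (@circ (change_crossing a) r gc)
  (fun u => u) gcC gCc); split.
- by exists id.
- by move=> u; apply: etrans (@circ_edge D r g u) (esym (@circ_edge (change_crossing a) r gc u)).
- by move=> u; apply: etrans (@circ_turn D r g u) (esym (@circ_turn (change_crossing a) r gc u)).
- move=> [x|i]; last by rewrite -[crossing _]/(@crossing (circ r g) (inr i)) circ_crossing.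
  move=> _; rewrite /= (porbit_vertex gC) (porbit_vertex g) !inE !circ_turn /=.
  by rewrite !(inj_eq (@inl_inj _ _)).
by [].
Qed.

Section CircleSite.
Variables (D : udiagram) (g : good D) (r : dart D).
Local Notation C := (circ r g).
Let gC := good_circ r g.

Lemma circ_face x : face C (inl x) = inl (face D x).
Proof. by rewrite (faceE gC) circ_edge !circ_turn /= (faceE g). Qed.

Lemma circ_porbit_face a u : (u \in porbit (face C) (inl a)) =
  if u is inl x then x \in porbit (face D) a else false.
Proof.
have fi i : ((face C) ^+ i)%g (inl a) = inl ((face D ^+ i)%g a).
  by elim: i => [|i IH]; rewrite ?expg0 ?perm1 // !expgSr [LHS]permM IH circ_face -permM.
apply/porbitP/idP => [[i ->]|]; first by rewrite fi mem_porbit.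
by case: u => [x /porbitP[i ->]|//]; exists i; rewrite fi.
Qed.

Lemma circ_vertex x y : ((inl x : dart C) \in vertex (inl y : dart C)) = (x \in vertex y).
Proof. by rewrite !inE !circ_turn /= !(inj_eq (@inl_inj _ _)). Qed.

Lemma circ_disk a : ~~ region D a r -> disk_face a -> disk_face (inl a : dart C).
Proof.
move=> nar disk [x ax|[]]; rewrite circ_porbit_face; first exact: disk.
  by rewrite -[region _ _ _]/(region D a r) (negbTE nar).
by [].
Qed.

Lemma circ_monogon a : ~~ region D a r -> monogon a -> monogon (inl a : dart C).
Proof.
by move=> nar [ca fa disk]; split; rewrite ?circ_crossing_inl ?circ_face ?fa //; apply: circ_disk.
Qed.

Lemma circ_bigon a : ~~ region D a r -> bigon a -> bigon (inl a : dart C).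
Proof.
move=> nar [[ca cb] ba fb ov disk]; split; rewrite ?circ_face ?fb //.
- by split; rewrite circ_crossing_inl.
- by rewrite (porbit_vertex gC) circ_vertex -(porbit_vertex g).
- by rewrite circ_edge.
- exact: circ_disk.
Qed.

Lemma circ_triangle a : ~~ region D a r -> triangle a -> triangle (inl a : dart C).
Proof.
move=> nar [[ca cb cc] [ba cb' ac] fc ov disk]; split; rewrite ?circ_face ?fc //.
- by split; rewrite circ_crossing_inl.
- by rewrite !(porbit_vertex gC) !circ_vertex -!(porbit_vertex g).
- exact: circ_disk.
Qed.

Lemma circ_across x : across (inl x : dart C) = inl (across x).
Proof. by rewrite /across circ_crossing_inl !circ_turn; case: ifP. Qed.

Lemma circ_swap_ends a u : swap_ends (inl a : dart C) u =
  if u is inl x then inl (swap_ends a x) else u.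
Proof.
have tp x y (v : dart C) : tperm (inl x : dart C) (inl y) v = if v is inl z then inl (tperm x y z) else v.
  by case: v => [z|i]; rewrite !permE //= !(inj_eq (@inl_inj _ _)); do 2?case: ifP.
by rewrite /swap_ends circ_edge /= !circ_across permM !tp; case: u => [x|//]; rewrite permM.
Qed.

(** Since neither [r] nor [edge D r] bounds the triangle, [r] names the same region before and after
    the slide. *)
Lemma circ_slide a (gE : good (slide_triangle a)) :
    ~~ region D a r -> triangle a -> ~~ (r \in porbit (face D) a) ->
    ~~ (edge D r \in porbit (face D) a) ->
  @isomorphism (slide_triangle (inl a : dart C)) (@circ (slide_triangle a) r gE) (fun u => u).
Proof.
move=> nar tri nr ner.
set tC := (swap_ends (inl a : dart C) * swap_ends (face C (inl a)) * swap_ends (face C (face C (inl a))))%g.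
set tD := (swap_ends a * swap_ends (face D a) * swap_ends (face D (face D a)))%g.
have mul3 (T : finType) (p q s : {perm T}) z : (p * q * s)%g z = s (q (p z)) by rewrite !permM.
have tCE u : tC u = if u is inl x then inl (tD x) else u.
  by rewrite /tC /tD mul3 !circ_face !circ_swap_ends; case: u => [x|//]; rewrite mul3.
have tCV u : tC^-1%g u = if u is inl x then inl (tD^-1%g x) else u.
  by apply: (@perm_inj _ tC); rewrite permKV tCE; case: u => [x|//]; rewrite permKV.
split.
- by exists id.
- by move=> u; apply: etrans (@circ_edge D r g u) (esym (@circ_edge (slide_triangle a) r gE u)).
- move=> u; apply: etrans (esym (@circ_turn (slide_triangle a) r gE u)).
  rewrite -[turn (slide_triangle _) u]/((tC^-1 * (turn C * tC))%g u) 2!permM tCV circ_turn tCE.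
  case: u => [x|//]; congr inl; apply: esym.
  exact: etrans (permM tD^-1%g (turn D * tD)%g x) (permM (turn D) tD (tD^-1%g x)).
- move=> [x|i] _; last by rewrite -[RHS]/(over C (tC (inr i))) tCE.
  by rewrite -[RHS]/(over C (tC (inl x))) tCE.
pose oldC (u : dart C) := if u \in porbit (face C) (inl a) then across (face C (face C u))
      else if edge C u \in porbit (face C) (inl a) then edge C u else u.
pose oldD x := if x \in porbit (face D) a then across (face D (face D x))
      else if edge D x \in porbit (face D) a then edge D x else x.
have oldE u : oldC u = if u is inl x then inl (oldD x) else u.
  rewrite /oldC /oldD circ_edge !circ_porbit_face; case: u => [x|i] //=.
  by rewrite !circ_face circ_across; do 2?case: ifP.
have oldr : oldD r = r by rewrite /oldD (negbTE nr) (negbTE ner).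
move=> u v; rewrite -[RHS]/(region C (oldC u) (oldC v)) !oldE.
case: u v => [x|[]] [y|[]] //.
- exact: (congr1 (fun z => region D (oldD x) z) oldr).
- exact: (congr1 (fun z => region D z (oldD y)) oldr).
- exact: (congr1 (fun z => region D z z) oldr).
Qed.
End CircleSite.

Definition circ_sim k D E := forall (g : good D) (gE : good E) (r : dart D) (r' : dart E),
  near k (circ r g) (circ r' gE).

(** By transport it is enough to treat one position of the circle in each diagram, chosen away from
    the site. *)
Lemma circ_sim_intro k D E (g : good D) (gE : good E) (r : dart D) (r' : dart E) :
  near k (circ r g) (circ r' gE) -> circ_sim k D E.
Proof.
move=> n g' gE' s s'; rewrite (Prop_irrelevance g' g) (Prop_irrelevance gE' gE).
rewrite -[k]addn0; apply: near_trans (circ_transport gE r' s').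
by rewrite -[k]add0n; apply: near_trans (circ_transport g s r) n.
Qed.

Lemma circ_sim_sym k D E : circ_sim k D E -> circ_sim k E D.
Proof. by move=> h g gE r r'; apply: near_sym. Qed.

Lemma circ_sim_trans i j D E F : good E -> circ_sim i D E -> circ_sim j E F -> circ_sim (i + j) D F.
Proof.
move=> gE h1 h2 g gF r r'; have [s _] := good_inhabited gE.
exact: near_trans (h1 g gE r s) (h2 gE gF s r').
Qed.

Lemma refines_circ_sim D E (f : dart D -> dart E) : good D -> good E -> refines f -> circ_sim 0 D E.
Proof.
move=> g gE rf; have [r _] := good_inhabited g.
exact: circ_sim_intro (circ_refines g gE r rf).
Qed.

Lemma site_circ_sim D (s : site D) : good D -> good (delete_site s) -> site_axiom s ->
  circ_sim 0 D (delete_site s).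
Proof.
move=> g gs; case: s gs => a gs ax.
- have [ca fa disk] := ax; have ct : crossing (turn D a) by rewrite crossing_turn.
  (* The circle is placed on the left of [turn D a], on the other side of the loop from the
     vanishing face. *)
  have nr : ~~ region D a (turn D a).
    apply/negP => /disk/porbitP[i ei]; have := turn_neq g a; rewrite ei.
    by elim: i {ei} => [|i]; [rewrite expg0 perm1 eqxx | rewrite expgS permM fa].
  have gC := good_circ (turn D a) g.
  have iso := circ_smooth g (turn D a) gs ct.
  have gSC := good_iso iso (good_circ _ _).
  have gSC' : good (delete_site (Monogon (inl a : dart (circ (turn D a) g)))).
    by rewrite /delete_site circ_turn.
  apply: (circ_sim_intro (r := turn D a) (r' := turn D a) (g := g) (gE := gs)).
  apply: near0_trans (near_site gC gSC' (circ_monogon g nr ax)) _.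
  by rewrite /delete_site circ_turn; apply: near_iso iso; [exact: gSC | exact: good_circ].
- have [[ca cb ba fb ov] disk] := bigon_facts g ax.
  have nr : ~~ region D a (turn D a).
    apply/negP => /disk[e|e]; first by have := turn_neq g a; rewrite e eqxx.
    by move: ba; rewrite -e (vertex_turn g) inE eqxx.
  have ct : crossing (turn D a) by rewrite crossing_turn.
  have ctb : crossing (turn D (face D a)) by rewrite crossing_turn.
  have gC := good_circ (turn D a) g.
  have g1 : good (smooth (turn D a)) by apply: good_smooth.
  have iso1 := circ_smooth g (turn D a) g1 ct.
  have gSC := good_iso iso1 (good_circ _ _).
  have tba : turn D (face D a) \notin vertex (turn D a).
    by rewrite (vertex_turn g) vertex_sym // (vertex_turn g) vertex_sym.
  have c2 : @crossing (smooth (turn D a)) (turn D (face D a)) by rewrite crossing_smooth // ctb.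
  have iso2 := circ_smooth g1 (turn D a) gs c2.
  have c2C : @crossing (@smooth (circ (turn D a) g) (inl (turn D a))) (inl (turn D (face D a))).
    have := crossing_iso (inl (turn D (face D a)) : dart (@smooth (circ (turn D a) g) (inl (turn D a)))) iso1.
    by move=> <-; rewrite circ_crossing.
  have r1 := smooth_refines gSC (good_circ _ g1) c2C (iso_refines iso1).
  have gSC2 := good_smooth gSC c2C.
  have gb2 := good_iso iso2 (good_circ _ _).
  apply: (circ_sim_intro (r := turn D a) (r' := turn D a) (g := g) (gE := gs)).
  have gSC' : good (delete_site (Bigon (inl a : dart (circ (turn D a) g)))).
    by rewrite /delete_site circ_face !circ_turn.
  apply: near0_trans (near_site gC gSC' (circ_bigon g nr ax)) _.
  rewrite /delete_site circ_face !circ_turn.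
  apply: near0_trans (near_refines gSC2 gb2 r1) _.
  by apply: near_iso iso2; [exact: gb2 | exact: good_circ].
have [[ca cb cc] [ba cb' ac] fc ov disk] := ax.
(* A dart at a corner of the triangle such that neither end of its edge is a boundary dart of the
   triangle. *)
pose r := turn D (turn D a).
have orbit x : (x \in porbit (face D) a) -> [\/ x = a, x = face D a | x = face D (face D a)].
  case/porbitP=> i ->; elim: i => [|i IH]; first by rewrite expg0 perm1; constructor 1.
  rewrite expgSr permM; case: IH => ->; [constructor 2|constructor 3|constructor 1]; by rewrite ?fc.
rewrite !(porbit_vertex g) in ba cb' ac.
have va : r \in vertex a by rewrite !(vertex_turn g) inE eqxx.
have nr : ~~ (r \in porbit (face D) a).
  apply/negP => /orbit[] e.
  - by move: ca; rewrite /crossing -/r e eqxx.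
  - by move: ba; rewrite -e va.
  - by move: ac; rewrite -e vertex_sym // va.
have ner : ~~ (edge D r \in porbit (face D) a).
  have ft x : edge D x = turn D (face D x) by rewrite (faceE g) (turn4 g).
  apply/negP => /orbit h; have {h} : [\/ r = turn D (face D a), r = turn D (face D (face D a)) | r = turn D a].
    case: h => e; rewrite -[r](edgeK g) e ft ?fc; [constructor 1|constructor 2|constructor 3] => //.
  case=> e.
  - by move: ba; rewrite -(vertex_turn g) -e va.
  - by move: ac; rewrite vertex_sym // -(vertex_turn g) -e va.
  - by have := turn_neq g (turn D a); rewrite -/r e eqxx.
have nar : ~~ region D a r by apply: contra nr => /disk.
have gC := good_circ r g; have iso := circ_slide g gs nar ax nr ner.
have gS' := good_iso iso (good_circ _ _).
apply: (circ_sim_intro (r := r) (r' := r) (g := g) (gE := gs)).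
have n1 := near_site (s := Triangle (inl a : dart (circ r g))) gC gS' (circ_triangle g nar ax).
by apply: near0_trans n1 _; apply: near_iso iso; [exact: gS' | exact: good_circ].
Qed.

Lemma deform_circ_sim D E : u_deform1 D E -> circ_sim 0 D E.
Proof.
have iso D' E' : u_isotopy1 D' E' -> circ_sim 0 D' E'.
  move=> i; have [f rf] := isotopy_refines i; case: i => /goodP g /goodP gE _.
  exact: refines_circ_sim rf.
have del D' E' : u_delete1 D' E' -> circ_sim 0 D' E'.
  case=> /goodP g /goodP gE [s ax [f isof]]; have gs := good_iso isof gE.
  exact: circ_sim_trans gs (site_circ_sim g gs ax) (refines_circ_sim gs gE (iso_refines isof)).
by case=> [[]|[]]; [apply: iso | move/iso/circ_sim_sym | apply: del | move/del/circ_sim_sym].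
Qed.

Lemma near_circ_sim k D E : near k D E -> circ_sim k D E.
Proof.
elim=> {k D E} [D|k D E F _ IH EF|k D E F _ IH EF].
- by move=> g gE r r'; rewrite (Prop_irrelevance gE g); apply: circ_transport.
- have gE : good E by apply/goodP; case: EF => [[]|[]] [].
  by rewrite -[k]addn0; apply: circ_sim_trans gE IH (deform_circ_sim EF).
case: EF => /goodP gE /goodP gF [a ca [f iso]]; rewrite -addn1.
apply: (circ_sim_trans gE IH); rewrite -[1%N]addn0.
have gc := good_change a gE; apply: (circ_sim_trans gc).
  by have [r _] := good_inhabited gE; apply: circ_sim_intro (circ_change gE r ca).
exact: refines_circ_sim (iso_refines iso).
Qed.

Lemma circ_unknotting D (g : good D) (r : dart D) :
  unknotting_number (circ r g) = unknotting_number D.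
Proof.
have gC := good_circ r g; apply: unknotting_eq => k; last first.
  move=> /unlinkableP[F [gF cF DF]]; exists k => //; apply/unlinkableP.
  have [r' _] := good_inhabited gF; exists (circ r' gF); split; first exact: good_circ.
    by move=> u; rewrite circ_crossing; case: u => [x|] //; apply: cF.
  exact: (near_circ_sim DF).
(* Conversely, the added circle is deleted from an unlinking sequence, which cannot lengthen it. *)
pose A (u : dart (circ r g)) := if u is inl _ then false else true.
have sA : sublink A by split=> u; rewrite ?circ_edge ?circ_turn; case: u => [x|i].
have exA : exists x, ~~ A x by exists (inl r).
case/(unlinkable_del gC sA exA) => j jk uj; exists j => //.
suff n : near 0 D (del gC sA) by rewrite -[j]add0n; apply: near_unlinkable n uj.
have gd := good_del gC sA exA.
pose f (x : dart D) : dart (del gC sA) := Sub (inl x : dart (circ r g)) isT.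
have fbij : bijective f.
  exists (fun y : dart (del gC sA) => if val y is inl x then x else r) => // y; apply: val_inj.
  by case: y => [[x|i] //= Ay]; case/negP: Ay.
apply: (near_iso g gd (f := f)); apply: (isomorphism_hom g gd fbij).
- by move=> x; apply: val_inj; rewrite val_del_edge circ_edge.
- by move=> x; apply: val_inj; rewrite val_del_turn /del_turn_fun circ_turn.
- by [].
- by move=> x y xy; apply: del_region_sub.
Qed.

(** Of the two smoothings of a kink, one removes it; the other detaches its loop, a circle that
    bounds the monogon and lies in the region on the left of [turn D a]. *)
Lemma monogon_unknotting D (g : good D) (a : dart D) : monogon a ->
  unknotting_number (smooth a) = unknotting_number (smooth (turn D a)).
Proof.
case=> ca fa disk; have ct : crossing (turn D a) by rewrite crossing_turn.
have g1 := good_smooth g ct; have g0 := good_smooth g ca.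
rewrite -(circ_unknotting g1 (turn D a)); apply: near0_unknotting.
set S := smooth a; set C := circ _ _; have gC : good C by apply: good_circ.
have ea : edge D a = turn D a by rewrite -{2}fa (faceE g) (turn4 g).
have eta : edge D (turn D a) = a by rewrite -ea (edgeK g).
set b := turn D a in ea eta ct *; set c := turn D b; set d := turn D c.
have td : turn D d = a by exact: turn4.
have cab : c != a by move: ca; rewrite /crossing.
have neq : uniq [:: a; b; c; d] by exact: vertex_uniq.
have nab : (a == b) = false by move: neq; rewrite /= !inE !negb_or => /andP[/and3P[/negbTE]].
have nac : (a == c) = false by rewrite eq_sym (negbTE cab).
have nad : (a == d) = false by move: neq; rewrite /= !inE !negb_or => /andP[/and3P[_ _ /negbTE]].
have nbc : (b == c) = false by move: neq; rewrite /= !inE !negb_or => /and3P[_ /andP[/negbTE]].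
have nbd : (b == d) = false by move: neq; rewrite /= !inE !negb_or => /and3P[_ /andP[_ /negbTE]].
have ncd : (c == d) = false by move: neq; rewrite /= !inE => /and4P[_ _ /negbTE].
have ndb : (d == b) = false by rewrite eq_sym.
have nba : (b == a) = false by rewrite eq_sym.
have nca : (c == a) = false by rewrite eq_sym.
have nda : (d == a) = false by rewrite eq_sym.
have ndc : (d == c) = false by rewrite eq_sym.
(* The loop, with darts [a] and [b], becomes the added circle. The vertex of [c] and [d], where the
   main strand goes on, becomes the one that [smooth b] forms from [a] and [d]. *)
pose f (u : dart D) : dart C := if u == a then inr false else if u == b then inr true
  else if u == c then inl a else inl u.
have fa_ : f a = inr false by rewrite /f eqxx.
have fb_ : f b = inr true by rewrite /f eq_sym nab eqxx.
have fc_ : f c = inl a by rewrite /f eq_sym nac eq_sym nbc eqxx.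
have fo_ u : u != a -> u != b -> u != c -> f u = inl u.
  by rewrite /f => /negbTE-> /negbTE-> /negbTE->.
have fd_ : f d = inl d by rewrite fo_ // eq_sym ?nad ?nbd ?ncd.
have case4 (P : dart D -> Prop) : P a -> P b -> P c -> P d -> (forall x, x \notin vertex a -> P x) -> forall x, P x.
  move=> Pa Pb Pc Pd Po x; have [|/Po//] := boolP (x \in vertex a).
  by rewrite !inE => /or4P[]/eqP->.
have foff u : u \notin vertex a -> f u = inl u.
  by rewrite !inE !negb_or => /and4P[ua ub uc _]; apply: fo_.
have vba u : (u \in vertex b) = (u \in vertex a).
  by apply: vertex_eq; rewrite // (vertex_turn g) inE eqxx.
have Sa : turn S a = b by exact: smooth_turn0.
have Sb : turn S b = a by exact: smooth_turn1.
have Sc : turn S c = d by exact: smooth_turn2.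
have Sd : turn S d = c by exact: smooth_turn3.
have So u : u \notin vertex a -> turn S u = turn D u by exact: smooth_turn_off.
have Ea : turn (smooth b) a = d by rewrite -{1}td; exact: (smooth_turn3 g ct).
have Eb : turn (smooth b) b = c by exact: (smooth_turn0 g ct).
have Ec : turn (smooth b) c = b by exact: (smooth_turn1 g ct).
have Ed : turn (smooth b) d = a by rewrite -[in RHS]td; exact: (smooth_turn2 g ct).
have Eo u : u \notin vertex a -> turn (smooth b) u = turn D u.
  by move=> uo; apply: (smooth_turn_off g ct); rewrite vba.
have Ct (x : dart D) : turn C (inl x) = inl (turn (smooth b) x) by rewrite circ_turn.
have Ce (x : dart D) : edge C (inl x) = inl (edge D x) by rewrite circ_edge.
(* In [smooth b] the main strand still runs along the old loop and meets the 2-valent vertex of [b]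
   and [c], which is skipped. *)
pose L (u : dart C) := (u != inl b) && (u != inl c).
have Linl (x : dart D) : L (inl x) = (x != b) && (x != c) by rewrite /L !(inj_eq (@inl_inj _ _)).
have Lc : res L (inl c) (inl a).
  by apply: res_skip; rewrite ?Linl ?eqxx ?andbF // Ct Ec Ce eta; apply: res_here; rewrite Linl nab nac.
have Lb : res L (inl b) (inl (edge D c)).
  apply: res_skip; rewrite ?Linl ?eqxx // Ct Eb Ce; apply: res_here; rewrite Linl (edge_neq g) andbT.
  by rewrite (can2_eq (edgeK g) (edgeK g)) eta eq_sym nac.
have edge_off x : x != a -> x != b -> res L (inl (edge D x)) (f (edge D x)).
  move=> xa xb; have [->|ec] := eqVneq (edge D x) c; first by rewrite fc_.
  have ea' : edge D x != a by rewrite (can2_eq (edgeK g) (edgeK g)) ea.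
  have eb' : edge D x != b by rewrite (can2_eq (edgeK g) (edgeK g)) eta.
  by rewrite fo_ //; apply: res_here; rewrite Linl eb'.
apply: (@weak_iso S C g0 gC xpredT L f) => //.
- elim=> [x|i]; last by rewrite circ_turn.
  rewrite Ct !Linl; elim/case4: x => [||||x xo].
  + by rewrite Ea nab nac ndb ndc.
  + by rewrite Eb !eqxx andbF.
  + by rewrite Ec !eqxx andbF.
  + by rewrite Ed nab nac ndb ndc.
  rewrite Eo //; move: (xo); rewrite -(vertex_turn g) => txo.
  by move: xo txo; rewrite !inE !negb_or => /and4P[_ -> -> _] /and4P[_ -> -> _].
- move=> [x|i]; rewrite circ_crossing //.
  rewrite crossing_smooth // vba Linl => /andP[_].
  by rewrite !inE !negb_or => /and4P[_ -> -> _].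
- by move=> u; exists u; apply: res_here.
- move=> [x|i]; last by exists (inr i); apply: res_here.
  have [->|xb] := eqVneq x b; first by exists (inl (edge D c)).
  have [->|xc] := eqVneq x c; first by exists (inl a).
  by exists (inl x); apply: res_here; rewrite Linl xb.
- pose h (u : dart C) := match u with inr i => if i then b else a | inl x => if x == a then c else x end.
  have hf x : h (f x) = x.
    elim/case4: x => [||||x xo]; rewrite ?fa_ ?fb_ ?fc_ ?fd_ /h ?eqxx //; first by rewrite eq_sym nad.
    by rewrite foff //; move: xo; rewrite inE negb_or => /andP[/negbTE-> _].
  by move=> x y _ _ /(congr1 h); rewrite !hf.
- move=> x _; elim/case4: x => [||||x xo].
  + by rewrite fa_.
  + by rewrite fb_.
  + by rewrite fc_ Linl nab nac.
  + by rewrite fd_ Linl ndb ndc.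
  by rewrite foff // Linl; move: xo; rewrite !inE !negb_or => /and4P[_ -> -> _].
- move=> [x|[]]; [|by exists b|by exists a].
  rewrite Linl => /andP[xb xc]; have [->|xa] := eqVneq x a; first by exists c.
  by exists x => //; apply: fo_.
- move=> x _; elim/case4: x => [||||x xo].
  + by rewrite Sa fa_ fb_ circ_turn.
  + by rewrite Sb fa_ fb_ circ_turn.
  + by rewrite Sc fc_ fd_ Ct Ea.
  + by rewrite Sd fc_ fd_ Ct Ed.
  by rewrite So // !foff ?(vertex_turn g) // Ct Eo.
- by move=> x _; rewrite crossing_smooth // => /andP[_ xo]; rewrite foff.
- have eR := key_rel_equiv g1.
  pose F (x : dart D) : dart D + bool := if x == a then inr true else inl x.
  have dis x : region D a x -> x = a.
    by move/disk/porbitP=> [i ->]; elim: i => [|i IH]; rewrite ?expg0 ?perm1 // expgSr permM IH.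
  have FK x : @key_rel (smooth b) (F x) (@circ_key (smooth b) b (f x)).
    elim/case4: x => [||||x xo].
    + by rewrite /F eqxx fa_.
    + by rewrite /F nba fb_; apply: (regxx g1).
    + rewrite /F nca fc_ -[key_rel _ _]/(merge (region D) c (turn D d) c a) td.
      exact/merge_pair/region_equiv.
    + by rewrite /F nda fd_; apply: (regxx g1).
    rewrite foff // /F; move: xo; rewrite inE negb_or => /andP[/negbTE-> _]; exact: (regxx g1).
  move=> x y _ _ xy; apply: (eqrel_trans eR (eqrel_sym eR (FK x))).
  apply: (eqrel_trans eR _ (FK y)); move: x y xy; apply: (merge_hom (F := F) eR).
    move=> x y xy; rewrite /F; case: eqP => [xa|xa].
      by rewrite xa in xy; rewrite (dis _ xy) eqxx.
    case: eqP => [ya|_]; last exact: merge_sub.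
    by case: xa; apply: dis; rewrite -ya; apply: regS.
  rewrite /F nba nda; apply: merge_sub.
  have := region_corner g d; rewrite td ea => r; exact: r.
move=> x _; exists (edge D x); first exact: res_here.
have [->|xa] := eqVneq x a; first by rewrite ea fa_ fb_ circ_edge; apply: res_here.
have [->|xb] := eqVneq x b; first by rewrite eta fa_ fb_ circ_edge; apply: res_here.
have [->|xc] := eqVneq x c; last by rewrite fo_ // Ce; apply: edge_off.
rewrite fc_ Ce ea fo_ //.
- by rewrite (can2_eq (edgeK g) (edgeK g)) ea eq_sym nbc.
- by rewrite (can2_eq (edgeK g) (edgeK g)) eta eq_sym nac.
by rewrite (edge_neq g).
Qed.

(** * Sums over the crossings *)

Section OrientedFacts.
Variables (n : nat) (D : ldiagram n).
Hypothesis lD : link_diagram D.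

Lemma link_good : good D. Proof. by case: lD => /goodP. Qed.
Let g := link_good.

Lemma outgoing_edge d : outgoing (edge D d) = ~~ outgoing d.
Proof. by case: lD => _ o _ _; have [] := o d. Qed.

Lemma outgoing_turn2 d : crossing d -> outgoing (turn D (turn D d)) = ~~ outgoing d.
Proof. by case: lD => _ o _ _ cd; have [_] := o d; rewrite /across cd. Qed.

Lemma label_edge d : label (edge D d) = label d.
Proof.
case: lD => _ _ l _; apply/esym/eqP; rewrite l; apply: connect1; by rewrite /= eqxx.
Qed.

Lemma label_turn2 d : crossing d -> label (turn D (turn D d)) = label d.
Proof.
case: lD => _ _ l _ cd; apply/esym/eqP; rewrite l; apply: connect1.
by rewrite /= /across cd eqxx orbT.
Qed.

Lemma positive_turn d : crossing d -> positive (turn D d) = positive d.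
Proof.
move=> cd; rewrite /positive (over_turn g cd) (outgoing_turn2 cd).
by case: (over D d); case: (outgoing d); case: (outgoing _).
Qed.

Lemma entry_turn (S : 'M[int]_n) d : S^T = S -> crossing d -> entry S (turn D d) = entry S d.
Proof. by move=> sS cd; rewrite /entry label_turn2 // -[in LHS]sS mxE. Qed.

Lemma regular_smoothing_turn d : crossing d ->
  near 0 (regular_smoothing (turn D d)) (regular_smoothing d).
Proof.
move=> cd; rewrite /regular_smoothing outgoing_turn2 //.
case: (outgoing d) (outgoing (turn D d)) => [] []; try exact: steps_nil;
  apply/near_sym/(near_iso _ _ (smooth_turn2_iso g cd));
  by apply: (good_smooth g); rewrite ?crossing_turn.
Qed.

Lemma irregular_smoothing_turn d : crossing d ->
  near 0 (irregular_smoothing (turn D d)) (irregular_smoothing d).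
Proof.
move=> cd; rewrite /irregular_smoothing outgoing_turn2 //.
case: (outgoing d) (outgoing (turn D d)) => [] []; try exact: steps_nil;
  apply/near_sym/(near_iso _ _ (smooth_turn2_iso g cd));
  by apply: (good_smooth g); rewrite ?crossing_turn.
Qed.

(* Exactly one of the four darts at a crossing is over and outgoing. *)
Lemma vertex_sum (V : zmodType) (G : dart D -> V) a : crossing a ->
    (forall d, d \in vertex a -> G d = G a) ->
  \sum_(d in crossings D | d \in vertex a) G d = G a.
Proof.
move=> ca Ga; under eq_bigl do rewrite andbC.
rewrite big_mkcondr -big_uniq ?vertex_uniq //=.
have c1 : crossing (turn D a) by rewrite crossing_turn.
have c2 : crossing (turn D (turn D a)) by rewrite crossing_turn.
have c3 : crossing (turn D (turn D (turn D a))) by rewrite crossing_turn.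
rewrite !big_cons big_nil !inE !crossing_turn // ca (outgoing_turn2 c1) (outgoing_turn2 ca).
rewrite (over_turn g c2) (over_turn g c1) (over_turn g ca).
have G1 : G (turn D a) = G a by apply: Ga; rewrite !inE eqxx orbT.
have G2 : G (turn D (turn D a)) = G a by apply: Ga; rewrite !inE eqxx !orbT.
have G3 : G (turn D (turn D (turn D a))) = G a by apply: Ga; rewrite !inE eqxx !orbT.
by case: (over D a); case: (outgoing a); case: (outgoing (turn D a)); rewrite /= ?(addr0, add0r) ?G1 ?G2 ?G3.
Qed.
End OrientedFacts.

Section Sums.
Variables (n : nat) (L : ldiagram n) (S T : 'M[int]_n) (eps delta : int).
Hypotheses (sS : S^T = S) (sT : T^T = T) (hT : forall i j, T i j \in [:: -1; 0; 1]).
Implicit Types D E : ldiagram n.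

Definition smoothing_term D (d : dart D) : int :=
  if entry S d == 1 then u_dist (regular_smoothing d) L
  else if entry S d == -1 then u_dist (irregular_smoothing d) L else 0.

(** The contribution of a crossing together with its share of the correction, which is [2 * eps] or
    [- eps] according to whether the sign of the crossing is [delta] or not, for [delta] equal to 1
    or -1. *)
Definition iu_term D (d : dart D) : rat :=
  (entry T d * sign d * smoothing_term d)%:~R
  + eps%:~R * (1 / 2 + delta%:~R * (3 / 2) * (sign d)%:~R).

Lemma modified_iu_sum D :
  modified_iu eps delta L S T D = \sum_(d in crossings D) iu_term d.
Proof.
have iuE : iu L S T D = \sum_(d in crossings D) entry T d * sign d * smoothing_term d.
  rewrite /iu [X in X + _]big_mkcond [X in _ + X]big_mkcond -big_split [RHS]big_mkcond.
  apply: eq_bigr => d _; rewrite !inE /smoothing_term; case: (crossing d && _) => //=.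
  by case: (eqVneq (entry S d) 1) => [->|_] //=; [rewrite addr0 | case: ifP; rewrite ?mulr0 ?add0r].
rewrite /modified_iu iuE /correction /crossing_number /writhe big_split /= rmorph_sum; congr (_ + _).
rewrite -mulr_sumr big_split /= sumr_const mulr_natr; congr (_ * (_ + _)).
by rewrite rmorph_sum mulr_sumr.
Qed.

Lemma sign_norm D (d : dart D) : `|sign d| = 1. Proof. by rewrite /sign; case: ifP. Qed.

Lemma entry_norm D (d : dart D) : `|entry T d| <= 1.
Proof. by have := hT (label d) (label (turn D d)); rewrite !inE => /or3P[]/eqP; rewrite /entry => ->. Qed.

Lemma iu_term_turn D (d : dart D) : link_diagram D -> crossing d -> iu_term (turn D d) = iu_term d.
Proof.
move=> lD cd; rewrite /iu_term /smoothing_term /sign (positive_turn lD cd) !(entry_turn lD) //.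
rewrite /u_dist (near0_unknotting (regular_smoothing_turn lD cd)).
by rewrite (near0_unknotting (irregular_smoothing_turn lD cd)).
Qed.

Lemma iu_term_vertex D (a d : dart D) : link_diagram D -> crossing a -> d \in vertex a ->
  iu_term d = iu_term a.
Proof.
move=> lD ca; have g := link_good lD.
by rewrite !inE => /or4P[]/eqP->; rewrite ?iu_term_turn ?crossing_turn.
Qed.

(** Agreement of everything that determines the term of a crossing, except that each smoothing is
    only known up to [k] crossing changes. *)
Record same_crossing (k : nat) D E (d : dart D) (e : dart E) : Prop := SameCrossing {
  same_over : over E e = over D d;
  same_outgoing : outgoing e = outgoing d;
  same_outgoing_turn : outgoing (turn E e) = outgoing (turn D d);
  same_label : label e = label d;
  same_label_turn : label (turn E e) = label (turn D d);
  same_smooth : near k (smooth d) (smooth e);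
  same_smooth_turn : near k (smooth (turn D d)) (smooth (turn E e)) }.

(** Signs, entries and corrections coincide. The terms differ only through the unknotting numbers,
    whose difference is multiplied by a factor of absolute value at most 1. *)
Lemma iu_term_same k D E (d : dart D) (e : dart E) : same_crossing k d e ->
  `|iu_term e - iu_term d| <= k%:R.
Proof.
case=> so soo sot sl slt ns nst.
have se : sign e = sign d by rewrite /sign /positive so soo sot.
have eM (M : 'M[int]_n) : entry M e = entry M d by rewrite /entry sl slt.
rewrite /iu_term se !eM opprD addrACA subrr addr0 -rmorphB /= -mulrBr.
rewrite -intr_norm -[k%:R]/(k%:Z%:~R) ler_int normrM normrM sign_norm mulr1.
apply: le_trans (ler_piMl (normr_ge0 _) (entry_norm d)) _.
have le k' (X Y : udiagram) : near k' X Y -> `|u_dist Y L - u_dist X L| <= k'%:Z.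
  by move/near_sym/near_u_dist.
rewrite /smoothing_term !eM; case: ifP => _.
  by rewrite /regular_smoothing soo sot; case: ifP => _; apply: le.
case: ifP => _; last by rewrite subrr normr0.
by rewrite /irregular_smoothing soo sot; case: ifP => _; apply: le.
Qed.

Lemma iu_term_same0 D E (d : dart D) (e : dart E) : same_crossing 0 d e -> iu_term e = iu_term d.
Proof. by move/iu_term_same; rewrite normr_le0 subr_eq0 => /eqP. Qed.
End Sums.

Section SiteOff.
Variables (D : udiagram) (g : good D).

(** A smoothing does not enlarge a face that contains neither of the corners it merges, so the site
    remains a site after a smoothing elsewhere. *)
Lemma region_smooth_off (a x : dart D) (d : dart D) (P : dart D -> Prop) :
  (forall y, region D a y -> P y) -> ~ P (turn D d) -> ~ P (turn D (turn D (turn D d))) ->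
  region (smooth d) a x -> P x.
Proof.
move=> aP n1 n3; rewrite region_smoothE => /or3P[/aP//|/andP[/aP/n1]|/andP[/aP/n3]] //.
Qed.

(** The move is performed in the smoothed diagram instead, and the two smoothings commute. *)
Lemma monogon_smooth_off (a d : dart D) : monogon a -> crossing d -> d \notin vertex a ->
  near 0 (smooth d) (@smooth (smooth (turn D a)) d).
Proof.
move=> [ca fa disk] cd da; have gd := good_smooth g cd.
have ct : crossing (turn D a) by rewrite crossing_turn.
have ad : a \notin vertex d by rewrite vertex_sym.
have tad : turn D a \notin vertex d by rewrite (vertex_turn g).
have ea : edge D a = turn D a by rewrite -{2}fa (faceE g) (turn4 g).
have tS : turn (smooth d) a = turn D a by rewrite smooth_turn_off.
have fS : face (smooth d) a = a.
  rewrite (faceE gd) -[edge (smooth d) a]/(edge D a) ea !smooth_turn_off ?(vertex_turn g) //.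
  by rewrite -{2}fa (faceE g) ea.
have dis x : region D a x -> x = a.
  by move/disk/porbitP=> [i ->]; elim: i => [|i IH]; rewrite ?expg0 ?perm1 // expgSr permM IH.
have mono : @monogon (smooth d) a.
  split=> //; first by rewrite crossing_smooth // ca.
  move=> x rx; have -> : x = a; last exact: porbit_id.
  apply: (region_smooth_off dis _ _ rx) => e; move: ad; rewrite -e ?(vertex_turn g) inE eqxx //.
have iso := smoothC_iso g cd ct tad.
have cS : @crossing (smooth d) (turn D a) by rewrite crossing_smooth // ct.
have g1 := good_smooth gd cS.
have cd1 : @crossing (smooth (turn D a)) d by rewrite crossing_smooth // cd vertex_sym.
have g2 := good_smooth (good_smooth g ct) cd1.
have gs : good (delete_site (Monogon (a : dart (smooth d)))) by rewrite /delete_site tS.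
have n1 := near_site (s := Monogon (a : dart (smooth d))) gd gs mono.
by apply: near0_trans n1 _; rewrite /delete_site tS; apply: near_iso iso.
Qed.

Lemma bigon_smooth_off (a d : dart D) : bigon a -> crossing d -> d \notin vertex a ->
    d \notin vertex (face D a) ->
  near 0 (smooth d) (@smooth (@smooth (smooth (turn D a)) (turn D (face D a))) d).
Proof.
move=> big cd da db; have [[ca cb ba fb ov] dis] := bigon_facts g big.
set b := face D a in cb ba fb db dis *.
have gd := good_smooth g cd.
have ct : crossing (turn D a) by rewrite crossing_turn.
have ctb : crossing (turn D b) by rewrite crossing_turn.
have ad : a \notin vertex d by rewrite vertex_sym.
have bd : b \notin vertex d by rewrite vertex_sym.
have tad : turn D a \notin vertex d by rewrite (vertex_turn g).
have tbd : turn D b \notin vertex d by rewrite (vertex_turn g).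
have ea : edge D a = turn D b by rewrite /b (faceE g) (turn4 g).
have eb : edge D b = turn D a by rewrite -[in RHS]fb (faceE g b) (turn4 g).
have tS : turn (smooth d) a = turn D a by rewrite smooth_turn_off.
have tSb : turn (smooth d) b = turn D b by rewrite smooth_turn_off.
have fS : face (smooth d) a = b.
  rewrite (faceE gd) -[edge (smooth d) a]/(edge D a) ea !smooth_turn_off ?(vertex_turn g) //.
  exact: (turn4 g).
have fSb : face (smooth d) b = a.
  rewrite (faceE gd) -[edge (smooth d) b]/(edge D b) eb !smooth_turn_off ?(vertex_turn g) //.
  exact: (turn4 g).
have bigS : @bigon (smooth d) a.
  split; rewrite ?fS ?fSb //.
  - by rewrite !crossing_smooth // ca cb.
  - by rewrite (porbit_vertex gd) smooth_off_vertex // -(porbit_vertex g).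
  - move=> x rx; have [->|->] : x = a \/ x = b; [|exact: porbit_id|].
      apply: (region_smooth_off dis _ _ rx) => -[] e.
      + by move: ad; rewrite -e (vertex_turn g) inE eqxx.
      + by move: bd; rewrite -e (vertex_turn g) inE eqxx.
      + by move: ad; rewrite -e !(vertex_turn g) inE eqxx.
      + by move: bd; rewrite -e !(vertex_turn g) inE eqxx.
    by rewrite -fS; have := mem_porbit (face (smooth d)) 1 a; rewrite expg1.
have tba : turn D b \notin vertex (turn D a).
  by rewrite (vertex_turn g) vertex_sym // (vertex_turn g) vertex_sym.
have iso := smoothC_iso g cd ct tad.
have g1 := good_smooth g ct.
have cS : @crossing (smooth d) (turn D a) by rewrite crossing_smooth // ct.
have gda := good_smooth gd cS.
have cd1 : @crossing (smooth (turn D a)) d by rewrite crossing_smooth // cd vertex_sym.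
have gad := good_smooth g1 cd1.
have cb1 : @crossing (smooth (turn D a)) (turn D b) by rewrite crossing_smooth // ctb.
have cb2 : @crossing (@smooth (smooth d) (turn D a)) (turn D b).
  have tbS : turn D b \notin @vertex (smooth d) (turn D a).
    by rewrite smooth_off_vertex.
  by rewrite crossing_smooth // crossing_smooth // ctb tbd.
have r1 := smooth_refines gda gad cb2 (iso_refines iso).
have tbd1 : turn D b \notin @vertex (smooth (turn D a)) d.
  by rewrite smooth_off_vertex // vertex_sym.
have iso2 := smoothC_iso g1 cd1 cb1 tbd1.
have gs : good (delete_site (Bigon (a : dart (smooth d)))).
  by rewrite /delete_site tS fS tSb; exact: (good_smooth gda cb2).
have n1 := near_site (s := Bigon (a : dart (smooth d))) gd gs bigS.
apply: near0_trans n1 _; rewrite /delete_site tS fS tSb.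
have cb3 : @crossing (@smooth (smooth (turn D a)) d) (turn D b) by rewrite crossing_smooth // cb1.
have g3 := good_smooth gad cb3.
apply: near0_trans (near_refines (good_smooth gda cb2) g3 r1) _.
have cd2 : @crossing (@smooth (smooth (turn D a)) (turn D b)) d.
  by rewrite crossing_smooth // cd1 vertex_sym //; apply: good_smooth.
exact: near_iso g3 (good_smooth (good_smooth g1 cb1) cd2) iso2.
Qed.

Lemma triangle_cost_turn (a x : dart D) : triangle_cost a (turn D x) = triangle_cost a x.
Proof. by rewrite /triangle_cost !(vertex_turn g). Qed.

(* A function that is negated along edges and across crossings does not
   distinguish the darts exchanged by a slide. *)
Lemma slide_perm_invariant (X : Type) (h : dart D -> X) (nu : X -> X) (a x : dart D) :
  involutive nu -> (forall y, h (edge D y) = nu (h y)) -> (forall y, h (across y) = nu (h y)) ->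
  h (slide_perm a x) = h x.
Proof.
move=> nuK he ha; have tp u v y : h u = h v -> h (tperm u v y) = h y.
  by move=> uv; rewrite permE /=; case: eqP => [->//|_]; case: eqP => [->|].
have sw u y : h (swap_ends u y) = h y.
  by rewrite /swap_ends permM tp ?tp // ?ha ?he // nuK.
have mul3 (U : finType) (p q s : {perm U}) z : (p * q * s)%g z = s (q (p z)) by rewrite !permM.
by rewrite /slide_perm mul3 !sw.
Qed.
End SiteOff.

(** * Variation of the modified invariant under moves *)

Section MoveSums.
Variables (n : nat) (L : ldiagram n) (S T : 'M[int]_n) (eps delta : int).
Hypotheses (sS : S^T = S) (sT : T^T = T) (hT : forall i j, T i j \in [:: -1; 0; 1]).
Implicit Types D E : ldiagram n.
Local Notation term := (iu_term L S T eps delta).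
Local Notation M := (modified_iu eps delta L S T).

(** [X] selects the crossings of [D] that survive in [E]; they keep their outgoing over dart,
    through which they are counted. *)
Lemma transfer_sum (V : zmodType) D E (phi : dart D -> dart E) (X : pred (dart D)) (k : dart D -> nat)
    (G : dart E -> V) :
  injective phi -> (forall e, crossing e -> exists d, phi d = e) ->
  (forall d, crossing (phi d) = crossing d && X d) ->
  (forall d, crossing d -> X d -> same_crossing (k d) d (phi d)) ->
  \sum_(e in crossings E) G e = \sum_(d in crossings D | X d) G (phi d).
Proof.
move=> phi_inj onto cphi same.
have -> : crossings E = phi @: [set d in crossings D | X d].
  apply/setP=> e; apply/idP/imsetP => [|[d]]; rewrite !inE; last first.
    by case/andP=> /and3P[cd od ogd] Xd ->; rewrite cphi cd Xd (same_over (same d cd Xd)) od (same_outgoing (same d cd Xd)) ogd.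
  case/and3P=> ce oe oge; have [d de] := onto _ ce; exists d => //.
  move: ce oe oge; rewrite -de cphi => /andP[cd Xd].
  by rewrite !inE cd Xd (same_over (same d cd Xd)) (same_outgoing (same d cd Xd)) => -> ->.
rewrite big_imset /=; last by move=> x y _ _; apply: phi_inj.
by apply: eq_bigl => d; rewrite !inE.
Qed.

Lemma refines_same D E (f : dart D -> dart E) : link_diagram D -> link_diagram E ->
  refines f -> preserves_labels_off set0 f -> forall d, crossing d -> same_crossing 0 d (f d).
Proof.
move=> lD lE rf pl d cd; have g := link_good lD; have gE := link_good lE.
have ct : crossing (turn D d) by rewrite crossing_turn.
have [o1 l1] := pl d (negbT (in_set0 d)); have [o2 l2] := pl _ (negbT (in_set0 (turn D d))).
have sm x : crossing x -> near 0 (smooth x) (smooth (f x)).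
  move=> cx; apply: near_refines (smooth_refines g gE cx rf); first exact: good_smooth.
  by apply: good_smooth; rewrite ?ref_crossing.
by split; rewrite -?(ref_turn rf) ?(ref_over rf) //; apply: sm.
Qed.

Lemma isotopy1_sum D E : isotopy1 D E -> M E = M D.
Proof.
case=> lD lE [f iso pl].
have rf : refines f by case: iso => [/iso_refines|/(subdivides_refines (link_good lE))].
have same := refines_same lD lE rf pl.
rewrite !modified_iu_sum (transfer_sum (k := fun=> 0%N) (X := xpredT) (phi := f)).
- by apply: eq_big => [d|d]; [rewrite andbT | rewrite !inE => /andP[/andP[cd _] _]; apply/iu_term_same0/same].
- exact: ref_inj rf.
- by move=> e; apply: contraPP => ne; apply/negP/(ref_off rf); apply/negP => /imgP.
- by move=> d; rewrite ref_crossing ?andbT //; exact: link_good.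
- by move=> d cd _; apply: same.
Qed.

Lemma isotopic_sum D E : isotopic D E -> M E = M D.
Proof. by elim=> [x y /isotopy1_sum|//|x y _ ->|x y z _ e1 _ e2] //; rewrite e2. Qed.

Lemma isotopic_near D E : isotopic D E -> near 0 D E.
Proof.
elim=> [x y [lx ly [f iso _]]|x|x y _|x y z _ e1 _ e2].
- apply: near_deform; left; left; split; [by case: lx | by case: ly | by exists f].
- exact: steps_nil.
- exact: near_sym.
- exact: near0_trans e1 e2.
Qed.

Lemma deletes_near D (s : site D) E : deletes s E -> near 0 D E.
Proof.
case=> lD lE ax [f iso _]; apply: near_deform; right; left.
by split; [case: lD | case: lE | exists s => //; exists f].
Qed.

Lemma move_near m D E : move m D E -> near 0 D E.
Proof.
case=> D0 [E0 [/isotopic_near DD0 /isotopic_near EE0 h]].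
apply: near0_trans DD0 _; apply: near0_trans (near_sym EE0).
by case: h => -[s _ /deletes_near]; last move/near_sym.
Qed.

Lemma deform_near k D E : deform k D E -> near 0 D E.
Proof.
elim=> {k D E} [D|k D E F _ n1 /isotopic_near n2|k D E F _ n1 [m /move_near n2]].
- exact: steps_nil.
- exact: near0_trans n1 n2.
- exact: near0_trans n1 n2.
Qed.

Lemma deletes_good D E (s : site D) : deletes s E -> good (delete_site s).
Proof. by case=> _ lE _ [f iso _]; apply: good_iso iso (link_good lE). Qed.

Lemma monogon_sum D E (a : dart D) : deletes (Monogon a) E ->
    unknotting_number D = unknotting_number L ->
  M D = M E + eps%:~R * (1 / 2 + delta%:~R * (3 / 2) * (sign a)%:~R).
Proof.
move=> del uD; have [lD lE ax [f iso pl]] := del.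
have g := link_good lD; have gE := link_good lE; have gs := deletes_good del.
have [ca fa disk] := ax; have ct : crossing (turn D a) by rewrite crossing_turn.
have ea : edge D a = turn D a by rewrite -{2}fa (faceE g) (turn4 g).
have vta x : (x \in vertex (turn D a)) = (x \in vertex a).
  by apply: vertex_eq; rewrite // (vertex_turn g) inE eqxx.
have [bf fe ft fo fr] := iso; have rf := iso_refines iso.
have sm x : crossing x -> x \notin vertex a -> near 0 (smooth x) (smooth (f x)).
  move=> cx xa; have cx1 : @crossing (smooth (turn D a)) x by rewrite crossing_smooth // cx vta.
  have r1 := smooth_refines gs gE cx1 rf.
  apply: near0_trans (monogon_smooth_off g ax cx xa) (near_refines _ _ r1).
    exact: (good_smooth (good_smooth g ct) cx1).
  by apply: (good_smooth gE); rewrite (crossing_iso _ iso).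
have off x : x \notin vertex a -> outgoing (f x) = outgoing x /\ label (f x) = label x.
  move=> xa; apply: pl; rewrite !inE ea; move: xa; rewrite !inE !negb_or.
  by case/and4P=> -> ->.
have toff x : x \notin vertex a -> turn D x \notin vertex a by rewrite (vertex_turn g).
have tf x : x \notin vertex a -> turn E (f x) = f (turn D x).
  by move=> xa; rewrite -ft; congr f; apply: (smooth_turn_off g ct); rewrite vta.
have same d : crossing d -> d \notin vertex a -> same_crossing 0 d (f d).
  move=> cd da; have [o1 l1] := off _ da; have [o2 l2] := off _ (toff _ da).
  split; rewrite ?tf //; try (apply: sm; rewrite ?crossing_turn ?toff //).
  by apply: fo; rewrite -[crossing _]/(@crossing (smooth (turn D a)) d) crossing_smooth // cd vta.
rewrite !modified_iu_sum (bigID (fun d => d \in vertex a)) /= addrC.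
rewrite (vertex_sum lD) //; last by move=> d; apply: iu_term_vertex.
rewrite (transfer_sum (phi := f) (X := fun d => d \notin vertex a) (k := fun=> 0%N) (D := D)).
- congr (_ + _); first by apply: eq_bigr => d /andP[]; rewrite inE => /and3P[cd _ _] da; apply/esym/iu_term_same0/same.
  (* Both smoothings of the kink have the unknotting number of [L], whatever kind of smoothing is
     selected by the matrix [S]. *)
  rewrite /iu_term (_ : smoothing_term _ _ _ = 0) ?mulr0 ?add0r //.
  have uE : unknotting_number (smooth (turn D a)) = unknotting_number L.
    rewrite -uD; apply/esym/near0_unknotting; exact: near_site g gs ax.
  have u0 : u_dist (smooth a) L = 0 by rewrite /u_dist (monogon_unknotting g ax) uE subrr normr0.
  have u1 : u_dist (smooth (turn D a)) L = 0 by rewrite /u_dist uE subrr normr0.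
  rewrite /smoothing_term /regular_smoothing /irregular_smoothing.
  by do ?[case: ifP => _].
- exact: bij_inj bf.
- by move=> e _; have [f' _ f'K] := bf; exists (f' e).
- by move=> d; rewrite (crossing_iso _ iso); apply: etrans (crossing_smooth g ct d) _; rewrite vta.
- exact: same.
Qed.

Lemma bigon_sum D E (a : dart D) : deletes (Bigon a) E -> `|eps| = 1 ->
  `|M D - M E| <= 2.
Proof.
move=> del eps1; have [lD lE ax [f iso pl]] := del.
have g := link_good lD; have gE := link_good lE; have gs := deletes_good del.
have [[ca cb ba fb ov] dis] := bigon_facts g ax.
have ct : crossing (turn D a) by rewrite crossing_turn.
have ctb : crossing (turn D (face D a)) by rewrite crossing_turn.
have ea : edge D a = turn D (face D a) by rewrite (faceE g) (turn4 g).
have eb : edge D (face D a) = turn D a by rewrite -[in RHS]fb (faceE g (face D a)) (turn4 g).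
have vta x : (x \in vertex (turn D a)) = (x \in vertex a).
  by apply: vertex_eq; rewrite // (vertex_turn g) inE eqxx.
have vtb x : (x \in vertex (turn D (face D a))) = (x \in vertex (face D a)).
  by apply: vertex_eq; rewrite // (vertex_turn g) inE eqxx.
have g1 := good_smooth g ct.
have tba : turn D (face D a) \notin vertex (turn D a) by rewrite vta (vertex_turn g).
have c2 : @crossing (smooth (turn D a)) (turn D (face D a)) by rewrite crossing_smooth // ctb.
have v2 : @vertex (smooth (turn D a)) (turn D (face D a)) = vertex (turn D (face D a)).
  exact: smooth_off_vertex.
pose X (d : dart D) := (d \notin vertex a) && (d \notin vertex (face D a)).
have crs (d : dart D) : @crossing (delete_site (Bigon a)) d = crossing d && X d.
  apply: etrans (crossing_smooth g1 c2 d) _; rewrite v2 vtb crossing_smooth // vta /X.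
  exact: (esym (andbA _ _ _)).
have [bf fe ft fo fr] := iso; have rf := iso_refines iso.
have sm x : crossing x -> X x -> near 0 (smooth x) (smooth (f x)).
  move=> cx Xx; have cx1 : @crossing (delete_site (Bigon a)) x by rewrite crs cx.
  have r1 := smooth_refines gs gE cx1 rf; have /andP[xa xb] := Xx.
  apply: near0_trans (bigon_smooth_off g ax cx xa xb) (near_refines _ _ r1).
    exact: (good_smooth gs cx1).
  by apply: (good_smooth gE); rewrite (crossing_iso _ iso).
have off x : X x -> outgoing (f x) = outgoing x /\ label (f x) = label x.
  move=> /andP[xa xb]; apply: pl; rewrite !inE ea eb; move: xa xb; rewrite !inE !negb_or.
  by case/and4P=> -> -> _ _ /and4P[-> ->].
have toff x : X x -> X (turn D x) by rewrite /X !(vertex_turn g).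
have tf x : X x -> turn E (f x) = f (turn D x).
  move=> /andP[xa xb]; rewrite -ft; congr f.
  apply: etrans (smooth_turn_off g1 c2 _) _; rewrite ?v2 ?vtb //.
  by apply: (smooth_turn_off g ct); rewrite vta.
have same d : crossing d -> X d -> same_crossing 0 d (f d).
  move=> cd da; have [o1 l1] := off _ da; have [o2 l2] := off _ (toff _ da).
  split; rewrite ?tf //; try (apply: sm; rewrite ?crossing_turn ?toff //).
  by apply: fo; rewrite crs cd.
rewrite !modified_iu_sum (bigID (fun d => d \in vertex a)) /= (vertex_sum lD) //; last first.
  by move=> d; apply: iu_term_vertex.
rewrite (bigID (fun d => d \in vertex (face D a))) /=.
rewrite (eq_bigl (fun d => (d \in crossings D) && (d \in vertex (face D a)))); last first.
  move=> d; case: (boolP (d \in vertex (face D a))) => db; rewrite ?andbF //.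
  rewrite !andbT; have -> : d \notin vertex a; last by rewrite andbT.
  apply: contra ba => da; rewrite -(vertex_eq g da) vertex_sym //.
rewrite (vertex_sum lD) //; last by move=> d; apply: iu_term_vertex.
rewrite (transfer_sum (phi := f) (X := X) (k := fun=> 0%N) (D := D)); first last.
- exact: same.
- by move=> d; rewrite (crossing_iso _ iso); exact: crs.
- by move=> e _; have [f' _ f'K] := bf; exists (f' e).
- exact: bij_inj bf.
rewrite (eq_bigl (fun d => (d \in crossings D) && X d)); last by move=> d; rewrite -andbA.
rewrite [X in _ - X](eq_bigr (fun d => term d)); last first.
  by move=> d /andP[]; rewrite inE => /and3P[cd _ _] Xd; apply/iu_term_same0/same.
rewrite addrA addrK.
have ota : outgoing (turn D (face D a)) = ~~ outgoing a by rewrite -ea (outgoing_edge lD).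
have ob : outgoing (face D a) = ~~ outgoing (turn D a) by rewrite -eb (outgoing_edge lD) negbK.
have lta : label (turn D (face D a)) = label a by rewrite -ea (label_edge lD).
have lb : label (face D a) = label (turn D a) by rewrite -eb (label_edge lD).
have ovb : over D (face D a) = ~~ over D a.
  by rewrite ov ea (over_turn g cb) negbK.
have sb : sign (face D a) = - sign a.
  rewrite /sign /positive ovb ob ota.
  by case: (over D a); case: (outgoing a); case: (outgoing (turn D a)).
have eN (N : 'M[int]_n) : N^T = N -> entry N (face D a) = entry N a.
  by move=> sN; rewrite /entry lb lta -[in LHS]sN mxE.
have nopen : near 1 (smooth (turn D a)) (smooth (turn D (face D a))).
  exact: (bigon_open g ca cb ba fb dis ov).
have nclose : near 0 (smooth a) (smooth (face D a)) by exact: (bigon_close g ca cb ba fb dis).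
have le (x y : int) : `|x - y| <= 1 -> `|(entry T a * sign a * (x - y))%:~R : rat| <= 1.
  move=> xy; rewrite -intr_norm -[1]/(1%:~R) ler_int !normrM sign_norm mulr1.
  by apply: mulr_ile1; rewrite ?normr_ge0 // entry_norm.
(* The sides of the bigon carry their orientations from one crossing to the other, so smoothings of
   the same kind open the bigon at both crossings or close it at both. *)
have sm1 : `|smoothing_term L S a - smoothing_term L S (face D a)| <= 1.
  have lop : `|u_dist (smooth (turn D a)) L - u_dist (smooth (turn D (face D a))) L| <= 1.
    exact: near_u_dist nopen.
  have lcl : `|u_dist (smooth a) L - u_dist (smooth (face D a)) L| <= 1.
    by apply: le_trans (near_u_dist L nclose) _.
  rewrite /smoothing_term eN // /regular_smoothing /irregular_smoothing ob ota.
  by case: ifP => _; [|case: ifP => _; [|by rewrite subrr normr0]];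
    case: (outgoing a); case: (outgoing (turn D a)).
rewrite /iu_term sb eN //.
have e1 := le _ _ sm1; set x := smoothing_term _ _ a in e1 *; set y := smoothing_term _ _ _ in e1 *.
set A := eps%:~R; set B := delta%:~R; set s := sign a in e1 *; set t := entry T a in e1 *.
have -> : (t * s * x)%:~R + A * (1 / 2 + B * (3 / 2) * s%:~R)
    + ((t * - s * y)%:~R + A * (1 / 2 + B * (3 / 2) * (- s)%:~R)) = (t * s * (x - y))%:~R + A :> rat.
  by rewrite !(intrM, intrD, intrN, rmorphN) /=; field.
apply: le_trans (ler_normD _ _) _; rewrite -[2]/(1 + 1); apply: lerD => //.
by rewrite /A -intr_norm eps1.
Qed.

Lemma triangle_sum D E (a : dart D) : deletes (Triangle a) E -> `|M D - M E| <= 2.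
Proof.
move=> del; have [lD lE ax [f iso pl]] := del.
have g := link_good lD; have gE := link_good lE; have gs : good (slide_triangle a) := deletes_good del.
have [bf fe ft fo fr] := iso; have rf := iso_refines iso.
(* The slide permutation says which dart of the result plays the role of [d] at the corresponding
   crossing. *)
pose phi d := f (slide_perm a d).
have phi_inj : injective phi by move=> x y /(bij_inj bf)/perm_inj.
have [ca cb cc] : [/\ crossing a, crossing (face D a) & crossing (face D (face D a))] by case: ax.
have crs (d : dart D) : @crossing (slide_triangle a) (slide_perm a d) = crossing d.
  by rewrite /crossing !slide_turn (inj_eq (@perm_inj _ (slide_perm a))).
have out d : outgoing (phi d) = outgoing d.
  have [-> _] := pl (slide_perm a d) (negbT (in_set0 _)).
  apply: (slide_perm_invariant (nu := negb)); first exact: negbK.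
    exact: outgoing_edge.
  by move=> y; case: lD => _ o _ _; have [] := o y.
have lab d : label (phi d) = label d.
  have [_ ->] := pl (slide_perm a d) (negbT (in_set0 _)).
  apply: (slide_perm_invariant (nu := id)) => // y; first exact: label_edge.
  case: lD => _ _ l _; apply/esym/eqP; rewrite l; apply: connect1; by rewrite /= eqxx orbT.
have tphi d : turn E (phi d) = phi (turn D d) by rewrite -ft; congr f; apply: slide_turn.
have sm x : crossing x -> near (triangle_cost a x).*2 (smooth x) (smooth (phi x)).
  move=> cx; have cx1 : @crossing (slide_triangle a) (slide_perm a x) by rewrite crs.
  have r1 := smooth_refines gs gE cx1 rf.
  rewrite -[_.*2]addn0; apply: near_trans (slide_smooth g ax gs cx) (near_refines _ _ r1).
    exact: (good_smooth gs cx1).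
  by apply: (good_smooth gE); rewrite (crossing_iso _ iso).
have same d : crossing d -> same_crossing (triangle_cost a d).*2 d (phi d).
  move=> cd; split; rewrite ?tphi ?out ?lab //.
  - by rewrite /phi fo ?crs // slide_over.
  - exact: sm.
  - by have := sm (turn D d); rewrite crossing_turn // triangle_cost_turn //; apply.
rewrite !modified_iu_sum.
rewrite (transfer_sum (phi := phi) (X := xpredT) (k := fun d => (triangle_cost a d).*2) (D := D)); first last.
- by move=> d cd _; apply: same.
- by move=> d; rewrite andbT -(crs d); apply: (crossing_iso _ iso).
- move=> e _; have [f' _ f'K] := bf; exists ((slide_perm a)^-1%g (f' e)).
  by rewrite /phi permKV f'K.
- exact: phi_inj.
under [X in _ - X]eq_bigl => d do rewrite andbT.
rewrite -sumrB; apply: le_trans (ler_norm_sum _ _ _) _.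
(* The number of crossing changes allowed at a crossing bounds the variation of its term. *)
pose G d : rat := (triangle_cost a d).*2%:R.
apply: (@le_trans _ _ (\sum_(d in crossings D) G d)).
  apply: ler_sum => d; rewrite inE => /and3P[cd _ _]; rewrite distrC.
  exact: (iu_term_same L S eps delta hT (same d cd)).
have GT y : G (turn D y) = G y by rewrite /G triangle_cost_turn.
have GV c d : d \in vertex c -> G d = G c.
  by rewrite !inE => /or4P[]/eqP->; rewrite ?GT.
have [_ [ba cb' ac] _ ov _] := ax; rewrite !(porbit_vertex g) in ba cb' ac.
have dis (c e d : dart D) : c \notin vertex e -> d \in vertex c -> d \notin vertex e.
  by move=> ce dc; apply: contra ce => de; rewrite -(vertex_eq g de) vertex_sym.
have ca' : face D (face D a) \notin vertex a by rewrite vertex_sym.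
rewrite (bigID (fun d => d \in vertex a)) /= (vertex_sum lD ca (GV a)).
rewrite (bigID (fun d => d \in vertex (face D a))) /=.
rewrite (eq_bigl (fun d => (d \in crossings D) && (d \in vertex (face D a)))); last first.
  move=> d; case: (boolP (d \in vertex (face D a))) => db; rewrite ?andbF //.
  by rewrite !andbT (dis _ _ _ ba db) andbT.
rewrite (vertex_sum lD cb (GV _)).
rewrite (bigID (fun d => d \in vertex (face D (face D a)))) /=.
rewrite (eq_bigl (fun d => (d \in crossings D) && (d \in vertex (face D (face D a))))); last first.
  move=> d; case: (boolP (d \in vertex (face D (face D a)))) => db; rewrite ?andbF //.
  by rewrite !andbT (dis _ _ _ ca' db) (dis _ _ _ cb' db) !andbT.
rewrite (vertex_sum lD cc (GV _)) big1 ?addr0; last first.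
  by move=> d /andP[/andP[/andP[_ da] db] dc]; rewrite /G /triangle_cost (negbTE da) (negbTE db) (negbTE dc).
rewrite /G /triangle_cost inE eqxx /= (negbTE ba) (negbTE ca') (negbTE cb').
have -> : face D a \in vertex (face D a) by rewrite inE eqxx.
have -> : face D (face D a) \in vertex (face D (face D a)) by rewrite inE eqxx.
(* The three values of [over] are not all equal, so exactly one of the comparisons holds and the
   total is 2. *)
move: ov; case: (over D a); case: (over D (face D a)); case: (over D (face D (face D a))) => //= _;
  by rewrite ?addr0 ?add0r.
Qed.

Lemma RI_sum pos D E : diagram_of L D -> RI_creating pos D E ->
  M E = M D + eps%:~R * (1 / 2 + delta%:~R * (3 / 2) * (if pos then 1 else -1)).
Proof.
move=> [k /deform_near LD] [D0 [E0 [DD0 EE0 [a pa del]]]].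
have uE : unknotting_number E0 = unknotting_number L.
  apply/esym/near0_unknotting; apply: near0_trans LD _; apply: near0_trans (isotopic_near DD0) _.
  exact: near_sym (deletes_near del).
rewrite -(isotopic_sum EE0) (monogon_sum del uE) -(isotopic_sum DD0) /sign pa.
by case: pos {pa}.
Qed.

Lemma move_sum m D E : `|eps| = 1 -> `|delta| = 1 -> diagram_of L D -> move m D E ->
  `|M E - M D| <= 2.
Proof.
move=> eps1 delta1 [k /deform_near LD] mv; have DE := move_near mv.
case: mv => D0 [E0 [DD0 EE0 h]]; rewrite -(isotopic_sum DD0) -(isotopic_sum EE0).
have LD0 := near0_trans LD (isotopic_near DD0).
have LE0 := near0_trans (near0_trans LD DE) (isotopic_near EE0).
have one (X Y : ldiagram n) (s : site X) : deletes s Y -> near 0 L X -> `|M X - M Y| <= 2.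
  case: s => a del LX; [|exact: bigon_sum del eps1 | exact: triangle_sum del].
  rewrite (monogon_sum del (esym (near0_unknotting LX))) addrAC subrr add0r normrM -intr_norm eps1 mul1r.
  have : delta = 1 \/ delta = -1.
    by move/eqP: delta1; rewrite eqr_norml ler01 andbT => /orP[]/eqP->; [left | right].
  by rewrite /sign mulr1z mul1r; case: ifP => _ [] ->; rewrite ?intrN ler_norml; apply/andP; split; lra.
by case: h => -[s _ del]; [rewrite distrC|]; apply: one del _.
Qed.

Lemma deform_sum k D E : `|eps| = 1 -> `|delta| = 1 -> diagram_of L D -> deform k D E ->
  `|M D - M E| <= 2 * k%:R.
Proof.
(* [move_sum] concerns diagrams of [L], so this property is carried along the induction. *)
move=> eps1 delta1 LD; suff : deform k D E -> diagram_of L E /\ `|M D - M E| <= 2 * k%:R by move=> h /h[].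
move=> DE; elim: DE LD => {k D E} [D|k D E F DE IH EF|k D E F DE IH [m EF]] LD.
- by split=> //; rewrite subrr normr0 mulr0.
- have [LE le] := IH LD; split; last by rewrite (isotopic_sum EF).
  by have [j LEj] := LE; exists j; apply: steps_free LEj EF.
have [LE le] := IH LD; split; first by have [j LEj] := LE; exists j.+1; apply: steps_paid LEj _; exists m.
have := move_sum eps1 delta1 LE EF; rewrite distrC => le2.
rewrite -[k.+1]addn1 natrD mulrDr mulr1 -[M D](subrK (M E)) -addrA.
exact: le_trans (ler_normD _ _) (lerD le le2).
Qed.

Lemma modified_iu_eq0 D : regular_crossings S D :|: irregular_crossings S D = set0 ->
  correction delta D = 0 -> M D = 0.
Proof.
move/setP=> e c0; rewrite /modified_iu c0 mulr0 addr0 /iu !big1 ?addr0 // => d dS;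
  by have := e d; rewrite in_setU in_set0 dS ?orbT.
Qed.
End MoveSums.

Theorem corollary1p4 (n : nat) (hn : (1 <= n)%N)
    (L : ldiagram n) (hL : link_diagram L)
    (S T : 'M[int]_n)
    (hSsym : S^T = S) (hTsym : T^T = T)
    (hS : forall i j, S i j \in [:: -1; 0; 1])
    (hT : forall i j, T i j \in [:: -1; 0; 1])
    (hST : forall i j, T i j = 0 <-> S i j = 0)
    (eps : int) (heps : eps \in [:: 1; -1]) :
  (* (1) *)
  [/\ forall D E : ldiagram n, diagram_of L D -> RI_creating true D E ->
        modified_iu eps 1 L S T E = modified_iu eps 1 L S T D + 2 * eps%:~R
        /\ modified_iu eps (-1) L S T E
             = modified_iu eps (-1) L S T D - eps%:~R,
      forall D E : ldiagram n, diagram_of L D -> RI_creating false D E ->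
        modified_iu eps (-1) L S T E
          = modified_iu eps (-1) L S T D + 2 * eps%:~R
        /\ modified_iu eps 1 L S T E = modified_iu eps 1 L S T D - eps%:~R
    & forall (delta : int) (D E : ldiagram n),
        delta \in [:: 1; -1] -> diagram_of L D -> move RII D E \/ move RIII D E ->
        `|modified_iu eps delta L S T E - modified_iu eps delta L S T D| <= 2]
  /\
  (* (2) *)
  (forall (delta : int) (D1 D2 : ldiagram n) (k : nat),
     delta \in [:: 1; -1] -> diagram_of L D1 -> diagram_of L D2 ->
     deform k D1 D2 ->
     Num.ceil (`|modified_iu eps delta L S T D1
                 - modified_iu eps delta L S T D2| / 2) <= k%:Z
     /\ (regular_crossings S D2 :|: irregular_crossings S D2 = set0 ->
         correction delta D2 = 0 ->
         Num.ceil (`|modified_iu eps delta L S T D1| / 2) <= k%:Z)).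
Proof.
have normS (x : int) : x \in [:: 1; -1] -> `|x| = 1.
  by rewrite !inE => /orP[]/eqP->.
have eps1 := normS _ heps.
split; last first.
  move=> delta D1 D2 k /normS delta1 L1 L2 D12.
  have le := deform_sum hSsym hTsym hT eps1 delta1 L1 D12.
  have cl (x : rat) : x <= 2 * k%:R -> Num.ceil (x / 2) <= k%:Z.
    by rewrite mulrC => xk; rewrite ceil_le_int ler_pdivrMr.
  split=> [|e c0]; first exact: cl.
  by apply: cl; move: le; rewrite (modified_iu_eq0 L T eps e c0) subr0.
split=> [D E LD DE|D E LD DE|delta D E /normS delta1 LD DE].
(* The coefficients are 1/2 + 3/2 = 2 when the sign of the new crossing is [delta], and 1/2 - 3/2 =
   -1 when it is opposite. *)
- by rewrite !(RI_sum _ _ hSsym hTsym hT LD DE); split; congr (_ + _); field.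
- by rewrite !(RI_sum _ _ hSsym hTsym hT LD DE); split; congr (_ + _); field.
by case: DE => mv; apply: (move_sum hSsym hTsym hT eps1 delta1 LD mv).
Qed.
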